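(* Let $W$ be a finite real reflection group with (complexified) reflection representation $\mathfrak h$, and let $c$ be a constant function on the set of reflections of $W$. Suppose that $c>0$ is rational and that the denominator of $c$, when written as an irreducible fraction, is a cuspidal number of $W$. Then the representation $L_c(W,\mathfrak h,\mathbb C)$ is finite dimensional.
   Context: Let $S$ be the set of reflections of $W$ in $\mathfrak h$; for $s\in S$, $\alpha_s\in\mathfrak h^*$, $\alpha_s^\vee\in\mathfrak h$ span the $-1$-eigenspaces of $s$, with $(\alpha_s,\alpha_s^\vee)=2$. The rational Cherednik algebra $H_c(W,\mathfrak h)$ is the quotient of $\mathbb C[W]\ltimes T(\mathfrak h\oplus\mathfrak h^* )$ by $[x,x']=0$, $[y,y']=0$, $[y,x]=(y,x)-c\sum_{s\in S}(y,\alpha_s)(x,\alpha_s^\vee)s$ ($x,x'\in\mathfrak h^*$, $y,y'\in\mathfrak h$). The polynomial representation is $M_c(W,\mathfrak h,\mathbb C)=H_c(W,\mathfrak h)\otimes_{\mathbb C[W]\ltimes\mathbb C[\mathfrak h^*]}\mathbb C$, where $W$ acts trivially on $\mathbb C$ and $\mathfrak h$ by $0$; $L_c(W,\mathfrak h,\mathbb C)$ is its unique irreducible quotient. A parabolic subgroup of $W$ is the stabilizer of a point of $\mathfrak h$. For a parabolic subgroup $W'\subset W$ (including $W'=W$), $\mathrm{Div}(W',\mathfrak h)$ is the set of all positive divisors of the degrees of the homogeneous generators of the polynomial algebra $\mathbb C[\mathfrak h]^{W'}$. A positive integer $d$ is a cuspidal number of $W$ if $d\in\mathrm{Div}(W,\mathfrak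 h)$ but $d\notin\mathrm{Div}(W',\mathfrak h)$ for every proper parabolic subgroup $W'\subset W$. *)

(* Defs.v *)
From HB Require Import structures.
From mathcomp Require Import all_boot all_order all_algebra.
From mathcomp Require Import all_fingroup all_character.
From mathcomp Require Import boolp reals.
From mathcomp Require Import complex.
From mathcomp Require Import mpoly.
From mathcomp Require monalg.

Set Implicit Arguments.
Unset Strict Implicit.
Unset Printing Implicit Defensive.

Import GRing.Theory.

Local Open Scope ring_scope.
Local Open Scope quotient_scope.

(* The library only has quotients of commutative rings by decidable proper
   ideals.  Here a quotient is by the subgroup generated by a Prop-valued set,
   made decidable by classical logic. *)

Inductive zspan (V : zmodType) (E : V -> Prop) : V -> Prop :=
| zspan_gen v of E v : zspan E v
| zspan_0 : zspan E 0
| zspan_sub u v of zspan E u & zspan E v : zspan E (u - v).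

Section ZmodQuotient.
Variables (V : zmodType) (E : V -> Prop).

Definition zspan_pred : {pred V} := fun v => `[< zspan E v >].

Lemma zspan_pred_closed : zmod_closed zspan_pred.
Proof.
split; first by apply/asboolP/zspan_0.
by move=> u v /asboolP Eu /asboolP Ev; apply/asboolP/zspan_sub.
Qed.

HB.instance Definition _ := GRing.isZmodClosed.Build V zspan_pred
  zspan_pred_closed.

Definition zmod_quot : Type := Quotient.quot zspan_pred.
HB.instance Definition _ := GRing.Zmodule.on zmod_quot.

End ZmodQuotient.

HB.lock Definition zmod_proj (V : zmodType) (E : V -> Prop) (v : V) :
  zmod_quot E := \pi_(Quotient.quot (zspan_pred E)) v.

Section ZmodProj.
Variables (V : zmodType) (E : V -> Prop).
Local Notation zspan_pred := (zspan_pred E).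
Local Notation zmod_quot := (zmod_quot E).
Local Notation zmod_proj := (@zmod_proj V E).

Lemma zmod_proj_is_zmod_morphism : zmod_morphism zmod_proj.
Proof. by rewrite unlock; exact: (raddfB \pi_(Quotient.quot zspan_pred)). Qed.

HB.instance Definition _ := GRing.isZmodMorphism.Build V zmod_quot zmod_proj
  zmod_proj_is_zmod_morphism.

Lemma zmod_projP u v : zmod_proj u = zmod_proj v <-> zspan E (u - v).
Proof.
rewrite unlock; split=> [uv | uv]; last by apply/eqmodP/asboolP.
by apply/asboolP; move/eqmodP: uv.
Qed.

Lemma zmod_proj_repr (q : zmod_quot) :
  zmod_proj (generic_quotient.repr (q : Quotient.quot zspan_pred)) = q.
Proof. rewrite unlock; exact: reprK. Qed.

Lemma zmod_projW (P : zmod_quot -> Prop) :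
  (forall v, P (zmod_proj v)) -> forall q, P q.
Proof. by move=> Pv q; rewrite -[q]zmod_proj_repr. Qed.

End ZmodProj.

Lemma zspan_mono (V U : zmodType) (E : V -> Prop) (E' : U -> Prop)
    (f : V -> U) : zmod_morphism f ->
  (forall v, E v -> E' (f v)) -> forall v, zspan E v -> zspan E' (f v).
Proof.
move=> fB fE v; elim=> [{}v Ev||u w _ Eu _ Ew].
- exact/zspan_gen/fE.
- rewrite -(subrr 0) fB subrr; exact: zspan_0.
- rewrite fB; exact: zspan_sub.
Qed.

(* R / (E), for the two-sided ideal (E) of R generated by E *)
Section RingQuotient.
Variables (R : pzRingType) (E : R -> Prop).

Definition ideal_gen (z : R) : Prop :=
  exists a e b, E e /\ z = a * e * b.

Definition ring_quot : Type := zmod_quot ideal_gen.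
HB.instance Definition _ := GRing.Zmodule.on ring_quot.

Definition ring_proj : R -> ring_quot := @zmod_proj R ideal_gen.
HB.instance Definition _ := GRing.Additive.on ring_proj.

Let rp (q : ring_quot) : R := generic_quotient.repr (q : Quotient.quot (zspan_pred ideal_gen)).

Let rpK q : ring_proj (rp q) = q. Proof. exact: zmod_proj_repr. Qed.

Definition ring_quot_mul (p q : ring_quot) : ring_quot :=
  ring_proj (rp p * rp q).

Lemma ring_proj_mul a b :
  ring_proj (a * b) = ring_quot_mul (ring_proj a) (ring_proj b).
Proof.
have Ha : zspan ideal_gen (rp (ring_proj a) - a).
  by apply/zmod_projP; rewrite -/(ring_proj _) rpK.
have Hb : zspan ideal_gen (rp (ring_proj b) - b).
  by apply/zmod_projP; rewrite -/(ring_proj _) rpK.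
apply/esym/zmod_projP.
set a' := rp _ in Ha *; set b' := rp _ in Hb *.
have -> : a' * b' - a * b = (a' - a) * b' - (- (a * (b' - b))).
  by rewrite opprK mulrBl mulrBr addrA subrK.
have HA : zspan ideal_gen ((a' - a) * b').
  apply: (zspan_mono (f := fun z => z * b') _ _ Ha) => [u v|v [x [e [y [Ee ->]]]]].
    exact: mulrBl.
  by exists x, e, (y * b'); split => //=; rewrite !mulrA.
have HB : zspan ideal_gen (a * (b' - b)).
  apply: (zspan_mono (f := fun z => a * z) _ _ Hb) => [u v|v [x [e [y [Ee ->]]]]].
    exact: mulrBr.
  by exists (a * x), e, y; split => //=; rewrite !mulrA.
apply: zspan_sub => //; rewrite -[- _]sub0r.
by apply: zspan_sub => //; apply: zspan_0.
Qed.

Let W := @zmod_projW R ideal_gen.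

Lemma ring_quot_mulA : associative ring_quot_mul.
Proof.
elim/W=> a; elim/W=> b; elim/W=> c.
by rewrite -!/(ring_proj _) -!ring_proj_mul mulrA.
Qed.

Lemma ring_quot_mul1q : left_id (ring_proj 1) ring_quot_mul.
Proof. by elim/W=> a; rewrite -!/(ring_proj _) -!ring_proj_mul mul1r. Qed.

Lemma ring_quot_mulq1 : right_id (ring_proj 1) ring_quot_mul.
Proof. by elim/W=> a; rewrite -!/(ring_proj _) -!ring_proj_mul mulr1. Qed.

Lemma ring_quot_mulDl : left_distributive ring_quot_mul +%R.
Proof.
elim/W=> a; elim/W=> b; elim/W=> c.
by rewrite -!/(ring_proj _) -raddfD -!ring_proj_mul mulrDl raddfD.
Qed.

Lemma ring_quot_mulDr : right_distributive ring_quot_mul +%R.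
Proof.
elim/W=> a; elim/W=> b; elim/W=> c.
by rewrite -!/(ring_proj _) -raddfD -!ring_proj_mul mulrDr raddfD.
Qed.

HB.instance Definition _ := GRing.Zmodule_isPzRing.Build ring_quot
  ring_quot_mulA ring_quot_mul1q ring_quot_mulq1
  ring_quot_mulDl ring_quot_mulDr.

Lemma ring_proj_is_monoid_morphism : monoid_morphism ring_proj.
Proof. by split=> // a b; rewrite ring_proj_mul. Qed.

HB.instance Definition _ := GRing.isMonoidMorphism.Build R ring_quot ring_proj
  ring_proj_is_monoid_morphism.

End RingQuotient.

(* V / <E>, for the submodule <E> of V generated by E *)
Section ModQuotient.
Variables (R : pzRingType) (V : lmodType R) (E : V -> Prop).

Definition submod_gen (z : V) : Prop := exists a e, E e /\ z = a *: e.

Definition mod_quot : Type := zmod_quot submod_gen.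
HB.instance Definition _ := GRing.Zmodule.on mod_quot.

Definition mod_proj : V -> mod_quot := @zmod_proj V submod_gen.
HB.instance Definition _ := GRing.Additive.on mod_proj.

Let rp (q : mod_quot) : V := generic_quotient.repr (q : Quotient.quot (zspan_pred submod_gen)).

Let rpK q : mod_proj (rp q) = q. Proof. exact: zmod_proj_repr. Qed.

Definition mod_quot_scale (a : R) (q : mod_quot) : mod_quot :=
  mod_proj (a *: rp q).

Lemma mod_proj_scale a v :
  mod_proj (a *: v) = mod_quot_scale a (mod_proj v).
Proof.
have Hv : zspan submod_gen (rp (mod_proj v) - v).
  by apply/zmod_projP; rewrite -/(mod_proj _) rpK.
apply/esym/zmod_projP; rewrite -scalerBr.
apply: (zspan_mono (f := fun z => a *: z) _ _ Hv) => [u w|_ [x [e [Ee ->]]]].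
  exact: scalerBr.
by exists (a * x), e; split => //=; rewrite scalerA.
Qed.

Let W := @zmod_projW V submod_gen.

Lemma mod_quot_scaleA a b v :
  mod_quot_scale a (mod_quot_scale b v) = mod_quot_scale (a * b) v.
Proof.
by elim/W: v => v; rewrite -!/(mod_proj _) -!mod_proj_scale scalerA.
Qed.

Lemma mod_quot_scale1 : left_id 1 mod_quot_scale.
Proof. by elim/W=> v; rewrite -!/(mod_proj _) -!mod_proj_scale scale1r. Qed.

Lemma mod_quot_scaleDr : right_distributive mod_quot_scale +%R.
Proof.
move=> a; elim/W=> u; elim/W=> v.
by rewrite -!/(mod_proj _) -raddfD -!mod_proj_scale scalerDr raddfD.
Qed.

Lemma mod_quot_scaleDl v :
  {morph mod_quot_scale^~ v : a b / a + b}.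
Proof.
move=> a b; elim/W: v => v.
by rewrite -!/(mod_proj _) -!mod_proj_scale scalerDl raddfD.
Qed.

HB.instance Definition _ := GRing.Zmodule_isLmodule.Build R mod_quot
  mod_quot_scaleA mod_quot_scale1 mod_quot_scaleDr mod_quot_scaleDl.

Lemma mod_proj_is_scalable : scalable mod_proj.
Proof. by move=> a v; rewrite mod_proj_scale. Qed.

HB.instance Definition _ := GRing.isScalable.Build R V mod_quot _ mod_proj
  mod_proj_is_scalable.

End ModQuotient.

(* The free K-algebra on a set I.  A module, because importing monalg redefines
   the {mpoly _[_]} notation; gen and const are locked because unifying them
   with a numeral would unfold the monoid algebra. *)
Module FreeAlg.
Import monalg.

Definition alg (K : comNzRingType) (I : choiceType) : lalgType K :=
  {malg K[{fmonom I}]}.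

HB.lock Definition gen (K : comNzRingType) (I : choiceType) (u : I) : alg K I :=
  << fmu u >>.

HB.lock Definition const (K : comNzRingType) (I : choiceType) (a : K) :
  alg K I := << a *g mone >>.

Lemma const_is_zmod_morphism (K : comNzRingType) (I : choiceType) :
  zmod_morphism (@const K I).
Proof. by rewrite unlock => a b; rewrite raddfB. Qed.

Lemma const_is_monoid_morphism (K : comNzRingType) (I : choiceType) :
  monoid_morphism (@const K I).
Proof. by rewrite unlock; split=> [|a b]; rewrite ?rmorph1 ?rmorphM. Qed.

HB.instance Definition _ (K : comNzRingType) (I : choiceType) :=
  GRing.isZmodMorphism.Build K (alg K I) (@const K I)
    (@const_is_zmod_morphism K I).
HB.instance Definition _ (K : comNzRingType) (I : choiceType) :=
  GRing.isMonoidMorphism.Build K (alg K I) (@const K I)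
    (@const_is_monoid_morphism K I).

Definition scalar (K : comNzRingType) (I : choiceType) :
  {rmorphism K -> alg K I} := @const K I.

End FreeAlg.

Section Modules.
Variables (A : pzRingType).

Definition irreducible_module (L : lmodType A) : Prop :=
  (exists v : L, v <> 0) /\
  forall S : {pred L}, GRing.submod_closed S ->
    (forall v, v \in S -> v = 0) \/ (forall v, v \in S).

Definition irreducible_quotient (M L : lmodType A) : Prop :=
  irreducible_module L /\
  exists pi : {linear M -> L}, forall v, exists u, pi u = v.

(* [iota] makes A, hence every A-module, a vector space over K *)
Definition finite_dimensional_over (K : fieldType) (iota : {rmorphism K -> A})
    (L : lmodType A) : Prop :=
  exists m (e : 'I_m -> L), forall v,
    exists a : 'I_m -> K, v = \sum_(i < m) iota (a i) *: e i.

End Modules.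

(* W is a finite group [gT] with a real representation rho on R^n.  The space h
   is the complexification C^n, realised as column vectors, and h^* is the space
   of row vectors, so that the pairing is the matrix product. *)
Section ReflectionGroup.
Variables (R : realType) (gT : finGroupType) (n : nat).
Variable rho : mx_representation R [set: gT] n.

Local Notation C := R[i].
Local Notation h := 'cV[C]_n.
Local Notation hs := 'rV[C]_n.

Definition is_reflection (s : gT) : bool :=
  (rho s *m rho s == 1%:M) && (\rank (rho s - 1%:M)%R == 1%N).

(* A finite real reflection group in its reflection representation: the latter
   means that W is a group of matrices with no nonzero invariant vector, i.e.
   that R^n is spanned by the roots. *)
Definition real_reflection_group : Prop :=
  [/\ mx_faithful rho,
      <<[set s | is_reflection s]>>%g = [set: gT] &
      forall v : 'cV[R]_n, (forall g, rho g *m v = v) -> v = 0].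

Definition rhoC : mx_representation C [set: gT] n :=
  map_repr (real_complex R) rho.

Definition act_h (g : gT) (y : h) : h := rhoC g *m y.
Definition act_hs (g : gT) (x : hs) : hs := x *m rhoC g^-1%g.
Definition pairing (y : h) (x : hs) : C := (x *m y) 0 0.

(* The -1-eigenspaces of s are lines and the pairing is nonzero, so alpha s and
   alphav s span them. *)
Definition root_vectors (alpha : gT -> hs) (alphav : gT -> h) : Prop :=
  forall s, is_reflection s ->
    [/\ act_hs s (alpha s) = - alpha s,
        act_h s (alphav s) = - alphav s &
        pairing (alphav s) (alpha s) = 2].

Definition stab (v : h) : {set gT} := [set g | act_h g v == v].

Definition parabolic (P : {set gT}) : Prop := exists v : h, P = stab v.

Definition coords (y : h) : 'I_n -> C := fun i => y i 0.

Definition invariant (P : {set gT}) (p : {mpoly C[n]}) : Prop :=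
  forall g, g \in P -> forall y, p.@[coords (act_h g y)] = p.@[coords y].

(* f freely generates C[h]^P and f_i is homogeneous of degree deg i *)
Definition basic_invariants (P : {set gT}) (f : n.-tuple {mpoly C[n]})
    (deg : 'I_n -> nat) : Prop :=
  [/\ forall i, tnth f i \is (deg i).-homog,
      forall i, invariant P (tnth f i),
      forall p, invariant P p -> exists q : {mpoly C[n]}, p = q \mPo f &
      forall q : {mpoly C[n]}, q \mPo f = 0 -> q = 0].

Definition Div (P : {set gT}) (d : nat) : Prop :=
  (0 < d)%N /\
  exists f deg, basic_invariants P f deg /\ exists i : 'I_n, (d %| deg i)%N.

Definition cuspidal (d : nat) : Prop :=
  Div [set: gT] d /\
  forall P : {set gT}, parabolic P -> P \proper [set: gT] -> ~ Div P d.

(* C[W] |x T(h + h^* ) is presented by generators W, h^*, h.  The free algebra on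
   the underlying set of these is reduced modulo the group law, linearity, and
   the conjugation action of W; rel_wx and rel_wy are w x w^-1 = w.x and
   w y w^-1 = w.y. *)
Definition cgen := (gT + (hs + h))%type.
Local Notation free_alg := (FreeAlg.alg C cgen).

Definition fw (g : gT) : free_alg := FreeAlg.gen C (inl g : cgen).
Definition fx (x : hs) : free_alg := FreeAlg.gen C (inr (inl x) : cgen).
Definition fy (y : h) : free_alg := FreeAlg.gen C (inr (inr y) : cgen).

Inductive smash_rel : free_alg -> Prop :=
| rel_w1 : smash_rel (fw 1%g - 1)
| rel_wM g g' : smash_rel (fw g * fw g' - fw (g * g')%g)
| rel_xlin a x x' : smash_rel (fx (a *: x + x') - (a *: fx x + fx x'))
| rel_ylin a y y' : smash_rel (fy (a *: y + y') - (a *: fy y + fy y'))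
| rel_wx g x : smash_rel (fw g * fx x - fx (act_hs g x) * fw g)
| rel_wy g y : smash_rel (fw g * fy y - fy (act_h g y) * fw g).

Definition smash : pzRingType := ring_quot smash_rel.

Definition sproj : {rmorphism free_alg -> smash} := ring_proj smash_rel.

Definition sC (a : C) : smash := sproj (FreeAlg.scalar C cgen a).
Definition sw (g : gT) : smash := sproj (fw g).
Definition sx (x : hs) : smash := sproj (fx x).
Definition sy (y : h) : smash := sproj (fy y).

Section Cherednik.
Variables (c : C) (alpha : gT -> hs) (alphav : gT -> h).

Inductive cherednik_rel : smash -> Prop :=
| rel_xx x x' : cherednik_rel (sx x * sx x' - sx x' * sx x)
| rel_yy y y' : cherednik_rel (sy y * sy y' - sy y' * sy y)
| rel_yx y x : cherednik_rel
    (sy y * sx x - sx x * sy y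
     - (sC (pairing y x)
        - sC c * \sum_(s | is_reflection s)
            sC (pairing y (alpha s) * pairing (alphav s) x) * sw s)).

Definition cherednik : pzRingType := ring_quot cherednik_rel.

Definition cherednik_proj : {rmorphism smash -> cherednik} :=
  ring_proj cherednik_rel.

Definition cherednik_scalar : {rmorphism C -> cherednik} :=
  (cherednik_proj \o sproj \o FreeAlg.scalar C cgen).
Definition cw (g : gT) : cherednik := cherednik_proj (sw g).
Definition cy (y : h) : cherednik := cherednik_proj (sy y).

(* H (x)_B C, with B generated by W and h, is the quotient of H by the elements
   k b - k eps(b), where the character eps is 1 on W and 0 on h; it is enough to
   let b run over generators. *)
Inductive polyrep_rel : cherednik^o -> Prop :=
| rel_triv k g : polyrep_rel (k * cw g - k)
| rel_annih k y : polyrep_rel (k * cy y).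

Definition polyrep : lmodType cherednik := mod_quot polyrep_rel.

End Cherednik.

End ReflectionGroup.

(* Main.v *)
(* In the polynomial representation A = C[h] the vectors of h act by Dunkl
   operators D_y, and L_c = A / J where J is the largest proper ideal stable
   under W and all D_y.  For a > 0 the ideal J is studied through Gaussian
   pairings: with mu a W-invariant Gaussian functional, the functional
   phi(p) = mu (sum_w w p) against the weight prod_s alpha_s^(-2c), evaluated on
   the contour R^n + i eps v0, intertwines multiplication by x with D_y, so its
   radical is a stable ideal.  Positivity of Fourier coefficients gives
   phi(1) <> 0, and shifting c to c - m and letting eps tend to 0 yields, for
   zeta = exp(-2 pi i c) and the length polynomial P_G of a reflection group G,
     phi(delta^(2m) q) = const * P_G(zeta) * mu (|delta|^(2(m-c)) q)
   for invariant q.  Hence P_G(zeta) = 0 produces a nonzero proper stable ideal,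
   while P_G(zeta) <> 0 forces every proper stable ideal to vanish.  By
   Chevalley and Solomon, P_G(t) = prod_i (1 - t^(d_i)) / (1 - t), so for a
   cuspidal denominator the first case holds for W and the second for every
   proper parabolic subgroup.  If some alpha_s were not nilpotent modulo J,
   localising J at a maximal non-nilpotent product of roots would give a proper
   stable ideal of a proper parabolic subgroup, hence 0, although J is nonzero.
   So all roots, hence all coordinates, are nilpotent modulo J. *)
Require Import Defs.
From mathcomp Require Import all_boot all_order all_algebra.
From mathcomp Require Import all_fingroup all_character.
From mathcomp Require Import boolp reals complex.

Set Implicit Arguments.
Unset Strict Implicit.
Unset Printing Implicit Defensive.

Import GRing.Theory.

Local Open Scope ring_scope.

(** For large [c] the weight is not integrable across the root hyperplanes, which forces the shifted
    contour; the shift costs only a character in the Gaussian density. There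
    [alpha_s + i t = i (t - i alpha_s)], whose second factor stays in the right half plane, so real
    powers are principal. Symmetrising over W is forced because the contour depends on the chamber
    of [v0]. Positivity comes from the Gamma integral: [(t - i l)^(-s)] is a positive superposition
    of the characters [exp(i r l)], so its Gaussian Fourier coefficients stay bounded below,
    uniformly as [t] tends to 0. A limit for [eps] tending to 0 says nothing by itself about a fixed
    [eps]. It does here because a functional turning coordinates into Dunkl operators is determined
    by its value at 1: all the [phi_eps] are proportional, and [phi_eps(1)] stays away from 0. No
    measure theory enters: [mu] is an ultrafilter limit of averages over normalised random signs,
    and integration by parts is proved on these averages. *)

Notation mk_group := Group.

(** * Principal complex powers; derivatives of complex functions of a real variable *)

Module Cpow.
From mathcomp Require Import all_boot all_order all_algebra.
From mathcomp Require Import boolp reals complex.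
From mathcomp Require Import classical_sets functions set_interval filter topology normedtype sequences derive realfun exp trigo.
From mathcomp Require Import ring lra.
Set Implicit Arguments.
Unset Strict Implicit.
Unset Printing Implicit Defensive.
Import Order.TTheory GRing.Theory Num.Theory numFieldNormedType.Exports ComplexField.
Local Open Scope ring_scope.
Local Open Scope complex_scope.

Section Cpow.
Variable R : realType.
Notation C := R[i].
Local Notation Re := (@complex.Re R).
Local Notation Im := (@complex.Im R).
Notation normc := (@Normc.normc R).
Implicit Types (z w : C) (s t : R).

Lemma normcE2 z : normc z = Num.sqrt (Re z ^+ 2 + Im z ^+ 2).
Proof. by case: z. Qed.
Lemma normc_ge0 z : 0 <= normc z.
Proof. by rewrite normcE2 sqrtr_ge0. Qed.
Lemma Re_le_normc z : `|Re z| <= normc z.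
Proof. by rewrite normcE2 -sqrtr_sqr ler_wsqrtr // lerDl sqr_ge0. Qed.
Lemma Im_le_normc z : `|Im z| <= normc z.
Proof. by rewrite normcE2 -sqrtr_sqr ler_wsqrtr // lerDr sqr_ge0. Qed.
Lemma normcD z w : normc (z + w) <= normc z + normc w.
Proof. exact: le_normcD. Qed.
Lemma normcB z w : normc (z - w) <= normc z + normc w.
Proof. by apply: le_trans (normcD _ _) _; rewrite normcN. Qed.
Lemma normc_real t : normc t%:C = `|t|.
Proof. by rewrite normcE2 /= expr0n addr0 sqrtr_sqr. Qed.
Lemma normcM z w : normc (z * w) = normc z * normc w.
Proof. exact: Normc.normcM. Qed.
Lemma normcX z k : normc (z ^+ k) = normc z ^+ k.
Proof. by elim: k => [|k IH]; rewrite ?expr0 ?Normc.normc1 // !exprS normcM IH. Qed.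
Lemma sqr_normc2 z : normc z ^+ 2 = Re z ^+ 2 + Im z ^+ 2.
Proof. by rewrite normcE2 sqr_sqrtr // addr_ge0 ?sqr_ge0. Qed.
Lemma normc_eq0 z : (normc z == 0) = (z == 0).
Proof. by apply/eqP/eqP => [/Normc.eq0_normc|->] //; rewrite Normc.normc0. Qed.
Lemma normc_gt0 z : (0 < normc z) = (z != 0).
Proof. by rewrite lt_def normc_ge0 andbT normc_eq0. Qed.

Lemma rcD s t : (s + t)%:C = s%:C + t%:C. Proof. exact: rmorphD. Qed.
Lemma rcM s t : (s * t)%:C = s%:C * t%:C. Proof. exact: rmorphM. Qed.
Lemma rcN t : (- t)%:C = - t%:C. Proof. exact: rmorphN. Qed.

Definition cis t : C := cos t +i* sin t.
Lemma cisD s t : cis (s + t) = cis s * cis t.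
Proof. by rewrite /cis cosD sinD; apply/eqP; rewrite eq_complex /= eqxx /= addrC. Qed.
Lemma cis0 : cis 0 = 1. Proof. by rewrite /cis cos0 sin0. Qed.
Lemma normc_cis t : normc (cis t) = 1.
Proof. by rewrite normcE2 /= cos2Dsin2 sqrtr1. Qed.

(** The half-angle formula for the principal argument. It is smooth off the closed negative axis; on
    that axis the denominator vanishes and the value is 0. Derivatives of powers are only taken
    where [0 <= Re z]. *)
Definition arg z := 2 * atan (Im z / (Re z + normc z)).
Definition cpow z s : C := (normc z `^ s)%:C * cis (s * arg z).

Lemma normc_cpow z s : normc (cpow z s) = normc z `^ s.
Proof. by rewrite normcM normc_cis mulr1 normc_real ger0_norm ?powR_ge0. Qed.

Lemma cpowD z s t : z != 0 -> cpow z (s + t) = cpow z s * cpow z t.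
Proof.
move=> z0; rewrite /cpow powRD; last by rewrite normc_eq0 z0 implybT.
by rewrite mulrDl cisD rmorphM mulrACA.
Qed.

Lemma cpow0 z : cpow z 0 = 1.
Proof. by rewrite /cpow powRr0 mul0r cis0 mulr1. Qed.

Lemma cpow_neq0 z s : z != 0 -> cpow z s != 0.
Proof. by rewrite -normc_gt0 => z0; rewrite -normc_gt0 normc_cpow powR_gt0. Qed.

Lemma cos_atan2 t : cos (2 * atan t) = (1 - t ^+ 2) / (1 + t ^+ 2).
Proof.
have h : 1 + t ^+ 2 != 0 by rewrite gt_eqF // ltr_wpDr ?sqr_ge0.
rewrite mulr_natl cos_mulr2n cos_atan exprVn sqr_sqrtr ?addr_ge0 ?sqr_ge0 // mulr2n.
by field.
Qed.

Lemma sin_atan2 t : sin (2 * atan t) = 2 * t / (1 + t ^+ 2).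
Proof.
have h0 : 0 < 1 + t ^+ 2 by rewrite ltr_wpDr ?sqr_ge0.
have h : 1 + t ^+ 2 != 0 by rewrite gt_eqF.
have c0 : cos (atan t) != 0.
  by rewrite cos_atan invr_eq0 gt_eqF // sqrtr_gt0.
have -> : sin (2 * atan t) = 2 * tan (atan t) * cos (atan t) ^+ 2.
  by rewrite mulr_natl sin_mulr2n -mulr_natl /tan; field.
by rewrite atanK cos_atan exprVn sqr_sqrtr ?(ltW h0).
Qed.

Lemma rhp_pos z : z != 0 -> 0 <= Re z -> 0 < Re z + normc z.
Proof. by rewrite -normc_gt0 => z0 rz; rewrite ltr_wpDl. Qed.

(** With [tau = y / (x + r)] one has [1 + tau^2 = 2 r / (x + r)] and [1 - tau^2 = 2 x / (x + r)], so
    the double-angle formulas at [atan tau] return [x / r] and [y / r]. The half plane condition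
    keeps [x + r] nonzero. *)
Lemma cpow1 z : z != 0 -> 0 <= Re z -> cpow z 1 = z.
Proof.
move=> z0 rz; have p0 := rhp_pos z0 rz; have := sqr_normc2 z.
have n0 := z0; rewrite -normc_gt0 in n0.
rewrite /cpow powRr1 ?normc_ge0 // mul1r /cis /arg cos_atan2 sin_atan2.
move: p0 n0; move: (normc z) => r; case: z z0 rz => x y /= _ x0 p0 n0 E.
have E1 : 1 + (y / (x + r)) ^+ 2 = 2 * r / (x + r).
  have -> : 1 + (y / (x + r)) ^+ 2 = ((x + r) ^+ 2 + (r ^+ 2 - x ^+ 2)) / (x + r) ^+ 2.
    by rewrite E; field; rewrite gt_eqF.
  by field; rewrite gt_eqF.
have E2 : 1 - (y / (x + r)) ^+ 2 = 2 * x / (x + r).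
  have -> : 1 - (y / (x + r)) ^+ 2 = ((x + r) ^+ 2 - (r ^+ 2 - x ^+ 2)) / (x + r) ^+ 2.
    by rewrite E; field; rewrite gt_eqF.
  by field; rewrite gt_eqF.
rewrite E1 E2; apply/eqP; rewrite eq_complex /=; apply/andP; split; apply/eqP; field;
by rewrite ?gt_eqF.
Qed.

Lemma cpowS z s : z != 0 -> 0 <= Re z -> cpow z (s + 1) = z * cpow z s.
Proof. by move=> z0 rz; rewrite cpowD // cpow1 // mulrC. Qed.

Lemma cpow_pos t s : 0 < t -> cpow t%:C s = (t `^ s)%:C.
Proof.
move=> t0; rewrite /cpow /arg /= mul0r atan0 mulr0 mulr0 cis0 mulr1.
by rewrite expr0n addr0 sqrtr_sqr gtr0_norm.
Qed.

Lemma arg_scale t z : 0 < t -> arg (t%:C * z) = arg z.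
Proof.
move=> t0; rewrite /arg normcM normc_real gtr0_norm //.
case: z => x y /=; rewrite !mul0r subr0 addr0 -mulrDr.
by rewrite invfM mulrACA divff ?gt_eqF // mul1r.
Qed.

Lemma cpow_scale t z s : 0 < t -> cpow (t%:C * z) s = (t `^ s)%:C * cpow z s.
Proof.
move=> t0; rewrite /cpow arg_scale // normcM normc_real gtr0_norm //.
by rewrite powRM ?normc_ge0 ?(ltW t0) // rmorphM mulrA.
Qed.


(** Differentiation by components, so that everything reduces to real calculus in one variable. *)
Definition derC (f : R -> C) (f' : C) (t : R) :=
  is_derive t 1 (fun x => Re (f x)) (Re f') /\ is_derive t 1 (fun x => Im (f x)) (Im f').

Lemma derC_cst z t : derC (fun=> z) 0 t.
Proof. by split; exact: is_derive_cst. Qed.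

Lemma is_derive_add (f g : R -> R) t a b : is_derive t 1 f a -> is_derive t 1 g b ->
  is_derive t 1 (fun x => f x + g x) (a + b).
Proof. exact: is_deriveD. Qed.
Lemma is_derive_mul (f g : R -> R) t a b : is_derive t 1 f a -> is_derive t 1 g b ->
  is_derive t 1 (fun x => f x * g x) (a * g t + f t * b).
Proof.
move=> df dg; have := is_deriveM df dg; rewrite /GRing.scale /= addrC mulrC.
by rewrite [X in X + _]mulrC mulrC.
Qed.
Lemma is_derive_cmul k (f : R -> R) t a : is_derive t 1 f a ->
  is_derive t 1 (fun x => k * f x) (k * a).
Proof. exact: is_deriveZ. Qed.
Lemma is_derive_congr (f g : R -> R) t a b : is_derive t 1 f a ->
  f =1 g -> a = b -> is_derive t 1 g b.
Proof. by move=> h /funext <- <-. Qed.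

Lemma ReM z w : Re (z * w) = Re z * Re w - Im z * Im w.
Proof. by case: z w => [? ?] [? ?]. Qed.
Lemma ImM z w : Im (z * w) = Re z * Im w + Im z * Re w.
Proof. by case: z w => [? ?] [? ?]. Qed.
Lemma ReN z : Re (- z) = - Re z. Proof. by case: z. Qed.
Lemma ImN z : Im (- z) = - Im z. Proof. by case: z. Qed.
Lemma ReD z w : Re (z + w) = Re z + Re w. Proof. by case: z w => [? ?] [? ?]. Qed.
Lemma ImD z w : Im (z + w) = Im z + Im w. Proof. by case: z w => [? ?] [? ?]. Qed.

Lemma derCD f g f' g' t : derC f f' t -> derC g g' t ->
  derC (fun x => f x + g x) (f' + g') t.
Proof.
move=> [f1 f2] [g1 g2]; split.
- by apply: (is_derive_congr (is_derive_add f1 g1)) => [x|]; rewrite ReD.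
- by apply: (is_derive_congr (is_derive_add f2 g2)) => [x|]; rewrite ImD.
Qed.

Lemma derCM f g f' g' t : derC f f' t -> derC g g' t ->
  derC (fun x => f x * g x) (f' * g t + f t * g') t.
Proof.
move=> [f1 f2] [g1 g2]; split.
- apply: (is_derive_congr (is_derive_add (is_derive_mul f1 g1)
    (is_derive_cmul (-1) (is_derive_mul f2 g2)))) => [x|]; rewrite ?ReD ?ReM ?mulN1r //.
  by ring.
- apply: (is_derive_congr (is_derive_add (is_derive_mul f1 g2) (is_derive_mul f2 g1))) => [x|].
    by rewrite ImM.
  by rewrite ImD !ImM; ring.
Qed.

Lemma derC_affine z w t : derC (fun x => z + x%:C * w) w t.
Proof.
split.
- apply: (is_derive_congr (is_derive_add (is_derive_cst (Re z) t 1)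
    (is_derive_cmul (Re w) (is_derive_id t 1)))) => [x|]; last by rewrite add0r mulr1.
  by rewrite ReD ReM /= mul0r subr0 mulrC.
- apply: (is_derive_congr (is_derive_add (is_derive_cst (Im z) t 1)
    (is_derive_cmul (Im w) (is_derive_id t 1)))) => [x|]; last by rewrite add0r mulr1.
  by rewrite ImD ImM /= mul0r addr0 mulrC.
Qed.

Lemma derC_eq f f' g' t : derC f f' t -> f' = g' -> derC f g' t.
Proof. by move=> h <-. Qed.

Lemma is_derive_comp1 (f g : R -> R) x df dg :
  is_derive (g x) 1 f df -> is_derive x 1 g dg ->
  is_derive x 1 (fun y => f (g y)) (df * dg).
Proof. by move=> hf hg; exact: (is_derive1_comp hf hg). Qed.

(** The mean value theorem fails for complex values, so it is applied to the real and imaginary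
    parts; the factor 2 is a crude bound for [sqrt 2]. *)
Lemma MVTC (f f' : _) (B : R) :
  (forall t, 0 <= t <= 1 -> derC f (f' t) t) ->
  (forall t, 0 <= t <= 1 -> normc (f' t) <= B) ->
  normc (f 1 - f 0) <= 2 * B.
Proof.
move=> df bf.
have main (g g' : R -> R) : (forall t, 0 <= t <= 1 -> is_derive t 1 g (g' t)) ->
   (forall t, 0 <= t <= 1 -> `|g' t| <= B) -> `|g 1 - g 0| <= B.
  move=> dg bg.
  have [|||c + ->] := @MVT R g g' 0 1 => //.
  - by move=> x; rewrite in_itv => /andP[x0 x1]; apply: dg; rewrite !ltW.
  - apply: derivable_within_continuous => x; rewrite in_itv /= => x01.
    by have [] := dg x x01.
  - rewrite in_itv /= => /andP[c0 c1]; rewrite subr0 mulr1; apply: bg.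
    by rewrite !ltW.
have h1 := main _ _ (fun t ht => (df t ht).1) (fun t ht => le_trans (Re_le_normc _) (bf t ht)).
have h2 := main _ _ (fun t ht => (df t ht).2) (fun t ht => le_trans (Im_le_normc _) (bf t ht)).
have B0 : 0 <= B by exact: le_trans (normr_ge0 _) h1.
rewrite normcE2 -[leRHS]ger0_norm ?mulr_ge0 // -[leRHS]sqrtr_sqr ler_wsqrtr //.
rewrite !raddfB /=; move: h1 h2; rewrite !ler_norml => /andP[a1 a2] /andP[b1 b2].
set x := _ - _ in a1 a2 *; set y := _ - _ in b1 b2 *; nra.
Qed.

End Cpow.
End Cpow.

(** * Differentiating complex powers along lines *)

Module Cpow2.
From mathcomp Require Import all_boot all_order all_algebra.
From mathcomp Require Import boolp reals complex.
From mathcomp Require Import classical_sets functions set_interval filter topology normedtype sequences derive realfun exp trigo.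
From mathcomp Require Import ring lra.
Set Implicit Arguments.
Unset Strict Implicit.
Unset Printing Implicit Defensive.
Import Order.TTheory GRing.Theory Num.Theory numFieldNormedType.Exports ComplexField.
Local Open Scope ring_scope.
Local Open Scope complex_scope.
Import Cpow.
Section Cpow2.
Variable R : realType.
Notation C := R[i].
Local Notation Re := (@complex.Re R).
Local Notation Im := (@complex.Im R).
Notation normc := (@Normc.normc R).
Implicit Types (z w : C) (s t : R).

Lemma normc_powRE z s : normc z `^ s = (Re z ^+ 2 + Im z ^+ 2) `^ (s / 2).
Proof.
by rewrite normcE2 -powR12_sqrt ?addr_ge0 ?sqr_ge0 // -powRrM mulrC.
Qed.

(** Modulus and argument come from the real and imaginary parts of the logarithm. Along a line of
    direction [w] the logarithmic derivative at [u] is [w / u]: its real part governs [|u|^s], and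
    its imaginary part is the derivative of [arg] in the next lemma. *)
Lemma is_derive_normc_powR z w s t : z + t%:C * w != 0 ->
  is_derive t 1 (fun x => normc (z + x%:C * w) `^ s)
    (s * normc (z + t%:C * w) `^ s * Re (w / (z + t%:C * w))).
Proof.
move=> n0; set u := z + _ in n0 *.
have N0 : 0 < Re u ^+ 2 + Im u ^+ 2 by rewrite -sqr_normc2 exprn_gt0 // normc_gt0.
have [dx dy] := derC_affine z w t.
have dN : is_derive t 1 (fun x : R => Re (z + x%:C * w) ^+ 2 + Im (z + x%:C * w) ^+ 2)
     (2 * (Re u * Re w + Im u * Im w)).
  apply: (is_derive_congr (is_derive_add (is_derive_mul dx dx) (is_derive_mul dy dy))) => [x|].
    by rewrite !expr2.
  by rewrite -/u; ring.
have -> : (fun x => normc (z + x%:C * w) `^ s) =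
   (fun x => (Re (z + x%:C * w) ^+ 2 + Im (z + x%:C * w) ^+ 2) `^ (s / 2)).
  by apply/funext => x; rewrite normc_powRE.
have := @is_derive_comp1 R (fun y => y `^ (s / 2)) (fun x : R => Re (z + x%:C * w) ^+ 2 + Im (z + x%:C * w) ^+ 2) t _ _ (is_derive1_powR (s / 2) N0) dN.
rewrite normc_powRE -/u => h; apply: (is_derive_congr h) => //.
have -> : w / u = (Re w * Re u + Im w * Im u) / (Re u ^+ 2 + Im u ^+ 2)
  +i* ((Im w * Re u - Re w * Im u) / (Re u ^+ 2 + Im u ^+ 2)).
  case: (u) (w) N0 => [a b] [c d] /= N0; simpc.
  by apply/eqP; rewrite eq_complex /=; apply/andP; split; apply/eqP; field; rewrite gt_eqF.
rewrite /= powRB; last by apply/implyP => _; rewrite gt_eqF.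
rewrite powRr1 ?(ltW N0) //.
have := N0; set N := _ + _ => N0'; have : N != 0 by rewrite gt_eqF.
by set p := N `^ _ => ?; field.
Qed.

Lemma is_derive_arg z w t : z + t%:C * w != 0 -> 0 <= Re (z + t%:C * w) ->
  is_derive t 1 (fun x => arg (z + x%:C * w)) (Im (w / (z + t%:C * w))).
Proof.
move=> n0 re0; have := rhp_pos n0 re0; have := is_derive_normc_powR 1 n0.
set u := z + _ in n0 re0 * => dr0 p0.
have [] := derC_affine z w t.
pose f x := Re (z + x%:C * w); pose g x := Im (z + x%:C * w).
pose r x := normc (z + x%:C * w).
have dr : is_derive t 1 r (1 * normc u `^ 1 * Re (w / u)).
  have <- : (fun x => normc (z + x%:C * w) `^ 1) = r.
    by apply/funext => x; rewrite powRr1 // normc_ge0.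
  by [].
rewrite -/f -/g => df dg.
have fr0 : f t + r t != 0 by rewrite gt_eqF.
have dq := is_derive_mul dg (@is_deriveV R (fun x => f x + r x) t _ 1 fr0 (is_derive_add df dr)).
have := is_derive_cmul 2 (@is_derive_comp1 R atan (fun x => g x * (f x + r x)^-1) t _ _ (is_derive1_atan _) dq).
move=> h; apply: (is_derive_congr h) => // {h dq}.
have gE : g t = Im u by []. have fE : f t = Re u by []. have rE : r t = normc u by [].
rewrite /GRing.scale /= gE fE rE powRr1 ?normc_ge0 //.
have := sqr_normc2 u; have : 0 < normc u by rewrite normc_gt0.
move: p0 => {fr0 fE rE gE dr dr0 df dg re0}.
case: (u) (w) n0 => [x y] [c d] n0; simpc; rewrite /=.
move: (Num.sqrt _) => ρ; set N := x ^+ 2 + y ^+ 2 => p0 r0 E.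
have N0 : N != 0 by rewrite -E expf_neq0 // gt_eqF.
have xr0 : x + ρ != 0 by rewrite gt_eqF.
have E1 : 1 + (y * (x + ρ)^-1) ^+ 2 = 2 * ρ / (x + ρ).
  have -> : 1 + (y / (x + ρ)) ^+ 2 = ((x + ρ) ^+ 2 + (N - x ^+ 2)) / (x + ρ) ^+ 2.
    by rewrite /N; field.
  by rewrite -E; field.
rewrite E1.
have r0' : ρ != 0 by rewrite gt_eqF.
have yE : y ^+ 2 = ρ ^+ 2 - x ^+ 2 by rewrite E /N; ring.
apply/eqP; rewrite -subr_eq0; apply/eqP.
have -> : x / N = x / ρ ^+ 2 by rewrite E.
have -> : y / N = y / ρ ^+ 2 by rewrite E.
(* The two sides differ by a multiple of the relation [y^2 = rho^2 - x^2]; the second factor is the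
   quotient. *)
transitivity ((y ^+ 2 - (ρ ^+ 2 - x ^+ 2)) * (- d / (ρ ^+ 2 * (x + ρ)))).
  by field; rewrite r0' xr0.
by rewrite yE subrr mul0r.
Qed.

(** The real and imaginary parts of [w / u], found separately for modulus and argument, recombine
    into the complex quotient. *)
Lemma derC_cpow z w s t : z + t%:C * w != 0 -> 0 <= Re (z + t%:C * w) ->
  derC (fun x => cpow (z + x%:C * w) s)
       (s%:C * cpow (z + t%:C * w) (s - 1) * w) t.
Proof.
move=> n0 re0; have dr := is_derive_normc_powR s n0; have da := is_derive_arg n0 re0.
set u := z + _ in n0 re0 dr da *.
have dz : derC (fun x => ((normc (z + x%:C * w) `^ s)%:C)) ((s * normc u `^ s * Re (w / u))%:C) t.
  by split; [exact: dr|exact: is_derive_cst].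
have dsa : is_derive t 1 (fun x => s * arg (z + x%:C * w)) (s * Im (w / u)).
  exact: is_derive_cmul.
have dc : derC (fun x => cis (s * arg (z + x%:C * w)))
   (cis (s * arg u) * (0 +i* (s * Im (w / u)))) t.
  split.
    apply: (is_derive_congr (@is_derive_comp1 R cos (fun x => s * arg (z + x%:C * w)) t _ _ (is_derive_cos _) dsa)) => //.
    by rewrite ReM /= -/u; ring.
  apply: (is_derive_congr (@is_derive_comp1 R sin (fun x => s * arg (z + x%:C * w)) t _ _ (is_derive_sin _) dsa)) => //.
  by rewrite ImM /= -/u; ring.
apply: derC_eq (derCM dz dc) _; rewrite -/u.
have -> : cpow u (s - 1) = cpow u s / u.
  by apply: (mulfI n0); rewrite -cpowS // subrK mulrC divfK.
rewrite /cpow.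
have -> : s%:C * ((normc u `^ s)%:C * cis (s * arg u) / u) * w =
   (normc u `^ s)%:C * cis (s * arg u) * (s%:C * (w / u)).
  by set a := _%:C; set b := cis _; set c := _%:C; rewrite mulrA; ring.
move: (w / u) => v; set ν := normc u `^ s; set b := cis _.
have -> : (s * ν * Re v)%:C = ν%:C * (s%:C * (Re v)%:C) by rewrite !rmorphM /=; ring.
have -> : (0 +i* (s * Im v)) = s%:C * (0 +i* Im v).
  by apply/eqP; rewrite eq_complex /=; apply/andP; split; apply/eqP; ring.
transitivity (ν%:C * b * (s%:C * ((Re v)%:C + (0 +i* Im v)))); first by ring.
by congr (_ * (_ * _)); apply/eqP; rewrite eq_complex /=; apply/andP; split; apply/eqP; ring.
Qed.
End Cpow2.
End Cpow2.

(** * Limits of bounded sequences along an ultrafilter *)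

Module Ulim.
From mathcomp Require Import all_boot all_order all_algebra.
From mathcomp Require Import boolp reals complex.
From mathcomp Require Import classical_sets functions set_interval filter topology normedtype sequences derive realfun exp trigo.
From mathcomp Require Import ring lra.
Set Implicit Arguments.
Unset Strict Implicit.
Unset Printing Implicit Defensive.
Import Order.TTheory GRing.Theory Num.Theory numFieldNormedType.Exports ComplexField.
Local Open Scope classical_set_scope.
Local Open Scope ring_scope.
Local Open Scope complex_scope.
Import Cpow.
Section Ulim.
Variable R : realType.
Notation C := R[i].
Local Notation Re := (@complex.Re R).
Local Notation Im := (@complex.Im R).
Notation normc := (@Normc.normc R).

Lemma ultrafilter_exists : exists U : set_system nat,
  UltraFilter U /\ (\oo `<=` U)%classic.
Proof. exact: ultraFilterLemma. Qed.

Definition ufilter : set_system nat := proj1_sig (cid ultrafilter_exists).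
Lemma ufilter_ultra : UltraFilter ufilter.
Proof. by rewrite /ufilter; case: cid => U []. Qed.
Lemma ufilter_sub : (\oo `<=` ufilter)%classic.
Proof. by rewrite /ufilter; case: cid => U []. Qed.
#[local] Instance ufilter_proper : ProperFilter ufilter.
Proof. exact: (@ultra_proper _ _ ufilter_ultra). Qed.

Lemma ultra_fmap (T T' : Type) (f : T -> T') (F : set_system T) :
  UltraFilter F -> UltraFilter (f @ F).
Proof.
move=> FU; have FP := @ultra_proper _ _ FU; split; first exact: fmap_proper_filter.
move=> G GF sfFG; rewrite predeqE => A; split; last exact: sfFG.
move=> GA; have [//|FnA] := in_ultra_setVsetC (f @^-1` A) FU.
have : G (~` A) by apply: sfFG.
by move=> GnA; have := @filterI _ G _ _ _ GA GnA; rewrite setICr => /(_ _) h;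
  case: (@filter_not_empty _ G GF); exact: h.
Qed.

(** Every bounded sequence converges along the chosen ultrafilter, by compactness of a segment. The
    limit is thus linear and monotone on all bounded sequences and agrees with the ordinary limit
    when there is one, so averages can be passed to the limit before anything is known about their
    convergence. *)
Definition ulimR (s : nat -> R) : R := lim (s @ ufilter).

Lemma ulimR_cvg s B : (forall m, `|s m| <= B) -> s @ ufilter --> ulimR s.
Proof.
move=> sB; have := @segment_compact R (- B) B; rewrite compact_ultra.
move=> /(_ (s @ ufilter)%classic); case.
- by apply: ultra_fmap; exact: ufilter_ultra.
- apply: ufilter_sub; exists 0%N => // m _ /=.
  by rewrite in_itv /= -ler_norml.
- by move=> l [_ sl]; apply: (@cvgP _ _ l).
Qed.

Lemma ulimR_eq s l B : (forall m, `|s m| <= B) ->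
  (forall e, 0 < e -> \forall m \near \oo, `|s m - l| <= e) -> ulimR s = l.
Proof.
move=> sB h; apply: (@cvg_lim _ (@Rhausdorff R)).
apply/cvgrPdist_le => e e0; apply: ufilter_sub.
by apply: filterS (h e e0) => m; rewrite distrC.
Qed.

Lemma ulimR_ge0 s B : (forall m, `|s m| <= B) -> (forall m, 0 <= s m) -> 0 <= ulimR s.
Proof.
move=> sB s0; apply: (limr_ge (x := 0)); first exact: cvgP (ulimR_cvg sB).
by apply: nearW.
Qed.

Lemma ulimR_near_ge s B b : (forall m, `|s m| <= B) ->
  (\forall m \near \oo, b <= s m) -> b <= ulimR s.
Proof.
move=> sB s0; apply: (limr_ge (x := b)); first exact: cvgP (ulimR_cvg sB).
exact: ufilter_sub.
Qed.

Lemma ulimRD s t B B' : (forall m, `|s m| <= B) -> (forall m, `|t m| <= B') ->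
  ulimR (fun m => s m + t m) = ulimR s + ulimR t.
Proof.
move=> sB tB; apply: (@cvg_lim _ (@Rhausdorff R)).
exact: cvgD (ulimR_cvg sB) (ulimR_cvg tB).
Qed.

Lemma ulimRZ a s B : (forall m, `|s m| <= B) ->
  ulimR (fun m => a * s m) = a * ulimR s.
Proof.
move=> sB; apply: (@cvg_lim _ (@Rhausdorff R)).
exact: cvgM (@cvg_cst _ _ _ _ _) (ulimR_cvg sB).
Qed.

Lemma ulimR_le s B : (forall m, `|s m| <= B) -> `|ulimR s| <= B.
Proof.
move=> sB; rewrite ler_norml; apply/andP; split.
  apply: (limr_ge (x := - B)); first exact: cvgP (ulimR_cvg sB).
  by apply: nearW => m; have := sB m; rewrite ler_norml => /andP[].
apply: (limr_le (x := B)); first exact: cvgP (ulimR_cvg sB).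
by apply: nearW => m; have := sB m; rewrite ler_norml => /andP[].
Qed.

Definition ulim (s : nat -> C) : C := ulimR (fun m => Re (s m)) +i* ulimR (fun m => Im (s m)).
Definition bnd (s : nat -> C) := exists B, forall m, normc (s m) <= B.

Lemma bnd_Re s : bnd s -> exists B, forall m, `|Re (s m)| <= B.
Proof. by move=> [B h]; exists B => m; exact: le_trans (Re_le_normc _) (h m). Qed.
Lemma bnd_Im s : bnd s -> exists B, forall m, `|Im (s m)| <= B.
Proof. by move=> [B h]; exists B => m; exact: le_trans (Im_le_normc _) (h m). Qed.

Lemma eqC z w : Re z = Re w -> Im z = Im w -> z = w.
Proof. by case: z w => [? ?] [? ?] /= -> ->. Qed.

Lemma ulimD s t : bnd s -> bnd t -> ulim (fun m => s m + t m) = ulim s + ulim t.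
Proof.
move=> bs bt; have [? rs] := bnd_Re bs; have [? is_] := bnd_Im bs.
have [? rt] := bnd_Re bt; have [? it] := bnd_Im bt.
apply: eqC; rewrite ?ReD ?ImD /=.
  by rewrite -(ulimRD rs rt); congr ulimR; apply/funext => m; rewrite ReD.
by rewrite -(ulimRD is_ it); congr ulimR; apply/funext => m; rewrite ImD.
Qed.

Lemma ulimZ a s : bnd s -> ulim (fun m => a * s m) = a * ulim s.
Proof.
move=> bs; have [B rs] := bnd_Re bs; have [B' is_] := bnd_Im bs.
have rs' : forall m, `|Re a * Re (s m)| <= `|Re a| * B.
  by move=> m; rewrite normrM ler_wpM2l.
have is' : forall m, `|- Im a * Im (s m)| <= `|- Im a| * B'.
  by move=> m; rewrite normrM ler_wpM2l.
have rs2 : forall m, `|Re a * Im (s m)| <= `|Re a| * B'.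
  by move=> m; rewrite normrM ler_wpM2l.
have is2 : forall m, `|Im a * Re (s m)| <= `|Im a| * B.
  by move=> m; rewrite normrM ler_wpM2l.
apply: eqC; rewrite ?ReM ?ImM /=.
  rewrite -(ulimRZ _ rs) -mulNr -(ulimRZ (- Im a) is_) -(ulimRD rs' is').
  by congr ulimR; apply/funext => m; rewrite ReM mulNr.
rewrite -(ulimRZ _ rs) -(ulimRZ (Re a) is_) -(ulimRD rs2 is2).
by congr ulimR; apply/funext => m; rewrite ImM.
Qed.

Lemma normc_ReIm z B : `|Re z| <= B -> `|Im z| <= B -> normc z <= 2 * B.
Proof.
move=> h1 h2; have B0 : 0 <= B by exact: le_trans (normr_ge0 _) h1.
rewrite normcE2 -[leRHS]ger0_norm ?mulr_ge0 // -[leRHS]sqrtr_sqr ler_wsqrtr //.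
move: h1 h2; rewrite !ler_norml => /andP[a1 a2] /andP[b1 b2].
set x := Re z in a1 a2 *; set y := Im z in b1 b2 *; nra.
Qed.

Lemma ulim_le s B : (forall m, normc (s m) <= B) -> normc (ulim s) <= 2 * B.
Proof.
move=> sB; apply: normc_ReIm; apply: ulimR_le => m.
  exact: le_trans (Re_le_normc _) (sB m).
exact: le_trans (Im_le_normc _) (sB m).
Qed.

Lemma ulim_eq s l : bnd s ->
  (forall e, 0 < e -> \forall m \near \oo, normc (s m - l) <= e) -> ulim s = l.
Proof.
move=> bs h; have [B rs] := bnd_Re bs; have [B' is_] := bnd_Im bs.
apply: eqC => /=; [apply: (ulimR_eq rs) | apply: (ulimR_eq is_)] => e e0.
  by apply: filterS (h e e0) => m; apply: le_trans; rewrite -ReN -ReD; exact: Re_le_normc.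
by apply: filterS (h e e0) => m; apply: le_trans; rewrite -ImN -ImD; exact: Im_le_normc.
Qed.

Lemma ulim_near_ge0 s : bnd s -> (\forall m \near \oo, 0 <= s m) -> 0 <= ulim s.
Proof.
move=> bs s0; have [B rs] := bnd_Re bs; have [B' is_] := bnd_Im bs.
rewrite lecE /=; apply/andP; split; last first.
  by apply: (ulimR_near_ge rs); apply: filterS s0 => m; rewrite lecE => /andP[].
apply/eqP; apply: (@ulimR_eq _ _ B') => // e e0; apply: filterS s0 => m.
by rewrite lecE /= => /andP[/eqP -> _]; rewrite subr0 normr0 ltW.
Qed.
End Ulim.
End Ulim.

(** * Averages over normalised random signs and their exponential moments *)

Module Mu.
From mathcomp Require Import all_boot all_order all_algebra.
From mathcomp Require Import boolp reals complex.
From mathcomp Require Import classical_sets functions set_interval filter topology normedtype sequences derive realfun exp trigo.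
From mathcomp Require Import ring lra.
Set Implicit Arguments.
Unset Strict Implicit.
Unset Printing Implicit Defensive.
Import Order.TTheory GRing.Theory Num.Theory numFieldNormedType.Exports ComplexField.
Local Open Scope classical_set_scope.
Local Open Scope ring_scope.
Local Open Scope complex_scope.
Import Cpow Ulim.
Section Mu.
Variables (R : realType) (n : nat) (A : finType) (u : A -> 'cV[R]_n).
Notation C := R[i].
Local Notation Re := (@complex.Re R).
Local Notation Im := (@complex.Im R).
Notation normc := (@Normc.normc R).
Notation V := 'cV[R]_n.

Definition ev (l : 'rV[R]_n) (x : V) : R := (l *m x) 0 0.
Lemma evE l x : ev l x = \sum_i l 0 i * x i 0.
Proof. by rewrite /ev mxE. Qed.
Lemma evD l x y : ev l (x + y) = ev l x + ev l y.
Proof. by rewrite /ev mulmxDr mxE. Qed.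
Lemma evZ l a x : ev l (a *: x) = a * ev l x.
Proof. by rewrite /ev -scalemxAr mxE. Qed.
Lemma ev_sum l (I : Type) (r : seq I) (P : pred I) (F : I -> V) :
  ev l (\sum_(i <- r | P i) F i) = \sum_(i <- r | P i) ev l (F i).
Proof.
elim/big_rec2: _ => [|i y z _ <-]; last by rewrite evD.
by rewrite /ev mulmx0 mxE.
Qed.
Lemma evDl l l' x : ev (l + l') x = ev l x + ev l' x.
Proof. by rewrite /ev mulmxDl mxE. Qed.
Lemma evZl a l x : ev (a *: l) x = a * ev l x.
Proof. by rewrite /ev -scalemxAl mxE. Qed.

Definition l1 (x : V) : R := \sum_i `|x i 0|.
(** The l1 norm is chosen because [exp(k |x_i|) <= exp(k x_i) + exp(-k x_i)]: the weight is
    dominated by exponentials of linear forms, whose averages factor over the signs. *)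
Definition wt (k : nat) (x : V) : R := expR (k%:R * l1 x).
Lemma l1_ge0 x : 0 <= l1 x. Proof. exact: sumr_ge0. Qed.
Lemma wt_gt0 k x : 0 < wt k x. Proof. exact: expR_gt0. Qed.
Lemma wt_ge1 k x : 1 <= wt k x.
Proof. by rewrite -expR0 ler_expR mulr_ge0 ?l1_ge0. Qed.
Lemma wtD k k' x : wt (k + k') x = wt k x * wt k' x.
Proof. by rewrite /wt natrD mulrDl expRD. Qed.
Lemma wt_le k k' x : (k <= k')%N -> wt k x <= wt k' x.
Proof. by move=> kk; rewrite ler_expR ler_wpM2r ?l1_ge0 ?ler_nat. Qed.
Lemma l1D x y : l1 (x + y) <= l1 x + l1 y.
Proof. by rewrite -big_split; apply: ler_sum => i _; rewrite mxE ler_normD. Qed.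
Lemma l1Z a x : l1 (a *: x) = `|a| * l1 x.
Proof. by rewrite /l1 mulr_sumr; apply: eq_bigr => i _; rewrite mxE normrM. Qed.
Lemma ev_le_l1 l x : `|ev l x| <= (\sum_i `|l 0 i|) * l1 x.
Proof.
rewrite evE (le_trans (ler_norm_sum _ _ _)) // mulr_suml; apply: ler_sum => i _.
rewrite normrM ler_wpM2l // /l1 (bigD1 i) //= lerDl; exact: sumr_ge0.
Qed.

Definition grow (f : V -> C) := exists B k, 0 <= B /\ forall x, normc (f x) <= B * wt k x.

Lemma grow_cst z : grow (fun=> z).
Proof. by exists (normc z), 0%N; split=> [|x]; rewrite ?normc_ge0 // /wt mul0r expR0 mulr1. Qed.
Lemma growD f g : grow f -> grow g -> grow (fun x => f x + g x).
Proof.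
move=> [B [k [B0 h]]] [B' [k' [B0' h']]]; exists (B + B'), (k + k')%N.
split=> [|x]; first exact: addr_ge0.
apply: le_trans (normcD _ _) _; rewrite mulrDl; apply: lerD.
  by apply: le_trans (h x) _; rewrite ler_wpM2l // wt_le // leq_addr.
by apply: le_trans (h' x) _; rewrite ler_wpM2l // wt_le // leq_addl.
Qed.
Lemma growM f g : grow f -> grow g -> grow (fun x => f x * g x).
Proof.
move=> [B [k [B0 h]]] [B' [k' [B0' h']]]; exists (B * B'), (k + k')%N.
split=> [|x]; first exact: mulr_ge0.
by rewrite normcM wtD mulrACA; apply: ler_pM; rewrite ?normc_ge0.
Qed.
Lemma grow_sum (I : Type) (r : seq I) (P : pred I) (F : I -> V -> C) :
  (forall i, P i -> grow (F i)) -> grow (fun x => \sum_(i <- r | P i) F i x).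
Proof.
move=> h; elim: r => [|i r IH].
  by have := grow_cst 0; congr grow; apply/funext => x; rewrite big_nil.
have [Pi|Pi] := boolP (P i); last first.
  by move: IH; congr grow; apply/funext => x; rewrite big_cons (negPf Pi).
have := growD (h i Pi) IH; congr grow; apply/funext => x; by rewrite big_cons Pi.
Qed.
Lemma grow_ev l : grow (fun x => (ev l x)%:C).
Proof.
exists (\sum_i `|l 0 i|), 1%N; split=> [|x]; first exact: sumr_ge0.
rewrite normc_real; apply: le_trans (ev_le_l1 _ _) _.
rewrite ler_wpM2l ?sumr_ge0 // /wt mul1r; apply: le_trans (expR_ge1Dx _).
by rewrite lerDr.
Qed.

Definition samples m := {ffun A * 'I_m -> bool}.
Definition sg (b : bool) : R := (-1) ^+ b.
Definition hstep m : R := (Num.sqrt m%:R)^-1.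
(** A normalised random walk with [m] independent signs for each vector [u a]. It stands for the
    Gaussian with covariance [sum_a u_a u_a^T], its limit law by the central limit theorem. *)
Definition pt m (o : samples m) : V := hstep m *: \sum_p sg (o p) *: u p.1.
Definition avg (K : fieldType) m (f : V -> K) : K :=
  (#|{: samples m}|%:R)^-1 * \sum_(o : samples m) f (pt o).

Lemma hstep_gt0 m : 0 < hstep m.+1.
Proof. by rewrite invr_gt0 sqrtr_gt0. Qed.
Lemma sqr_hstep m : hstep m.+1 ^+ 2 = m.+1%:R^-1.
Proof. by rewrite exprVn sqr_sqrtr. Qed.

Lemma card_samples_neq0 (K : numFieldType) m : #|{: samples m}|%:R != 0 :> K.
Proof. by rewrite pnatr_eq0 -lt0n; apply/card_gt0P; exists [ffun=> true]. Qed.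

(** Independence of the signs: the average of a product over the pairs is a product of averages, and
    the [m] copies of each [a] contribute equal factors. *)
Lemma avg_prod (K : numFieldType) m (F : A -> bool -> K) :
  (#|{: samples m}|%:R)^-1 * (\sum_(o : samples m) \prod_p F p.1 (o p)) =
  \prod_a ((F a true + F a false) / 2) ^+ m.
Proof.
have -> : \sum_(o : samples m) \prod_p F p.1 (o p) =
   \prod_(p : A * 'I_m) \sum_(b : bool) F p.1 b.
  by rewrite (bigA_distr_bigA (fun p b => F p.1 b)).
have -> : #|{: samples m}|%:R = \prod_(p : A * 'I_m) 2 :> K.
  by rewrite card_ffun card_bool natrX prodr_const.
rewrite -prodfV -big_split /= -(pair_bigA _ (fun a _ => 2^-1 * \sum_b F a b)) /=.
apply: eq_bigr => a _; rewrite prodr_const card_ord; congr (_ ^+ _).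
by rewrite big_bool mulrC.
Qed.

Lemma ev_pt m l (o : samples m) : ev l (pt o) = \sum_p hstep m * (sg (o p) * ev l (u p.1)).
Proof. by rewrite evZ ev_sum mulr_sumr; apply: eq_bigr => p _; rewrite evZ. Qed.

(** The sharp exponent is [y^2 / 2]; the constant 2 already follows from [1 + x <= exp x]. For
    [0 <= y <= 1] the bounds [1 - y + y^2] and [1 + y + 3 y^2] for the two exponentials average to
    [1 + 2 y^2]. *)
Lemma cosh_le (y : R) : (expR y + expR (- y)) / 2 <= expR (2 * y ^+ 2).
Proof.
wlog y0 : y / 0 <= y.
  move=> h; have [|y0] := leP 0 y; first exact: h.
  have := h (- y); rewrite opprK sqrrN addrC; apply; lra.
have [y1|y1] := leP y 1; last first.
  have h1 : expR y <= expR (2 * y ^+ 2) by rewrite ler_expR; nra.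
  have h2 : expR (- y) <= expR (2 * y ^+ 2) by rewrite ler_expR; nra.
  lra.
have h1 : expR (- y) <= 1 - y + y ^+ 2.
  have := expR_ge1Dx y => e1; rewrite expRN.
  have p : 0 < 1 + y by lra.
  apply: (@le_trans _ _ (1 + y)^-1); first by rewrite lef_pV2 // posrE expR_gt0.
  rewrite -[leLHS]mul1r ler_pdivrMr //; nra.
have h2 : expR y <= 1 + y + 3 * y ^+ 2.
  have e1 := expR_ge1Dx (- (y / 2)).
  have p : 0 < 1 - y / 2 by lra.
  have -> : expR y = (expR (- (y / 2)) * expR (- (y / 2)))^-1.
    by rewrite -expRD -expRN; congr expR; field.
  apply: (@le_trans _ _ ((1 - y / 2) * (1 - y / 2))^-1).
    rewrite lef_pV2 ?posrE ?mulr_gt0 ?expR_gt0 // ler_pM // ltW //; lra.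
  rewrite -[leLHS]mul1r ler_pdivrMr ?mulr_gt0 //.
  have -> : (1 + y + 3 * y ^+ 2) * ((1 - y / 2) * (1 - y / 2)) =
    1 + y ^+ 2 / 4 * (9 - 11 * y + 3 * y ^+ 2) by field.
  rewrite lerDl mulr_ge0 ?divr_ge0 ?sqr_ge0 //.
  nra.
have := expR_ge1Dx (2 * y ^+ 2); lra.
Qed.

(** Each of the [m.+1] equal factors contributes an exponent proportional to [hstep^2 = 1 / m.+1],
    so the bound does not depend on [m]. *)
Lemma avg_exp_le m l : avg m.+1 (fun x => expR (ev l x)) <=
  expR (2 * \sum_a ev l (u a) ^+ 2).
Proof.
pose F a b := expR (hstep m.+1 * (sg b * ev l (u a))).
rewrite /avg; under eq_bigr => o _ do rewrite ev_pt expR_sum.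
rewrite (avg_prod _ F) mulr_sumr expR_sum; apply: ler_prod => a _.
have -> : 2 * ev l (u a) ^+ 2 = m.+1%:R * (2 * (hstep m.+1 * ev l (u a)) ^+ 2).
  by rewrite exprMn sqr_hstep; field; rewrite addrC natr1 pnatr_eq0.
rewrite expRM_natl exprn_ge0 ?divr_ge0 ?addr_ge0 ?expR_ge0 //=.
rewrite lerXn2r ?nnegrE ?divr_ge0 ?addr_ge0 ?expR_ge0 //.
have := cosh_le (hstep m.+1 * ev l (u a)).
by rewrite /F /sg !expr1 expr0 mul1r mulN1r mulrN addrC.
Qed.

End Mu.
End Mu.

(** * The Gaussian functional [mu] and functions with a first-order expansion *)

Module Mu2.
From mathcomp Require Import all_boot all_order all_algebra.
From mathcomp Require Import boolp reals complex.
From mathcomp Require Import classical_sets functions set_interval filter topology normedtype sequences derive realfun exp trigo.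
From mathcomp Require Import ring lra.
Set Implicit Arguments.
Unset Strict Implicit.
Unset Printing Implicit Defensive.
Import Order.TTheory GRing.Theory Num.Theory numFieldNormedType.Exports ComplexField.
Local Open Scope classical_set_scope.
Local Open Scope ring_scope.
Local Open Scope complex_scope.
Import Cpow Ulim Mu.
Section Mu2.
Variables (R : realType) (n : nat) (A : finType) (u : A -> 'cV[R]_n).
Notation C := R[i].
Local Notation Re := (@complex.Re R).
Local Notation Im := (@complex.Im R).
Notation normc := (@Normc.normc R).
Notation V := 'cV[R]_n.
Local Notation avg := (avg u).
Local Notation pt := (pt u).

Lemma avg_ler m (f g : V -> R) : (forall x, f x <= g x) -> avg m f <= avg m g.
Proof. by move=> fg; rewrite ler_wpM2l ?invr_ge0 ?ler0n //; apply: ler_sum. Qed.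

Lemma avg_addr (K : fieldType) m (f g : V -> K) :
  avg m (fun x => f x + g x) = avg m f + avg m g.
Proof. by rewrite /avg big_split mulrDr. Qed.

Lemma avg_mulr (K : fieldType) m a (f : V -> K) :
  avg m (fun x => a * f x) = a * avg m f.
Proof. by rewrite /avg -mulr_sumr mulrCA. Qed.

Lemma avg_sum (K : fieldType) m (I : Type) (r : seq I) (P : pred I) (F : I -> V -> K) :
  avg m (fun x => \sum_(i <- r | P i) F i x) = \sum_(i <- r | P i) avg m (F i).
Proof. by rewrite /avg exchange_big /= mulr_sumr. Qed.

Lemma normc_sum (I : Type) (r : seq I) (P : pred I) (F : I -> C) :
  normc (\sum_(i <- r | P i) F i) <= \sum_(i <- r | P i) normc (F i).
Proof.
elim/big_rec2: _ => [|i y z _ h]; first by rewrite Normc.normc0.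
by apply: le_trans (normcD _ _) _; rewrite lerD2l.
Qed.

Lemma normc_avg m (f : V -> C) : normc (avg m f) <= avg m (fun x => normc (f x)).
Proof.
rewrite normcM ler_pM ?normc_ge0 ?normc_sum //.
by rewrite -(rmorph_nat (real_complex R)) -fmorphV normc_real ger0_norm ?invr_ge0.
Qed.

(** A bound for the averages of [wt k] at all sample sizes: the sum, over the sign patterns, of the
    moment bounds for the linear forms that dominate [k l1]. *)
Definition wtmean k : R := \sum_(s : {ffun 'I_n -> bool})
   expR (2 * \sum_a ev (\row_i (k%:R * sg R (s i))) (u a) ^+ 2).

Lemma wtmean_ge0 k : 0 <= wtmean k.
Proof. by apply: sumr_ge0 => s _; exact: expR_ge0. Qed.

Lemma wt_le_sum k x : wt k x <=
  \sum_(s : {ffun 'I_n -> bool}) expR (ev (\row_i (k%:R * sg R (s i))) x).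
Proof.
have -> : wt k x = \prod_i expR (k%:R * `|x i 0|) by rewrite -expR_sum -mulr_sumr.
apply: (@le_trans _ _ (\prod_i \sum_(b : bool) expR (k%:R * sg R b * x i 0))).
  apply: ler_prod => i _; rewrite expR_ge0 big_bool /= /sg expr1 expr0 mulr1 mulrN1 mulNr.
  have [h|h] := leP 0 (x i 0); first by rewrite ger0_norm // lerDr expR_ge0.
  by rewrite ltr0_norm // mulrN lerDl expR_ge0.
rewrite bigA_distr_bigA; apply: ler_sum => s _; rewrite -expR_sum ler_expR evE.
by apply: ler_sum => i _; rewrite mxE.
Qed.

Lemma avg_wt_le k m : avg m.+1 (wt k) <= wtmean k.
Proof.
apply: le_trans (avg_ler _ (@wt_le_sum k)) _.
by rewrite avg_sum; apply: ler_sum => s _; exact: avg_exp_le.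
Qed.

(** The sizes start at [m.+1] because [hstep] at 0 inverts 0. *)
Definition mu (f : V -> C) : C := ulim (fun m => avg m.+1 f).

Lemma avg_bound (f : V -> C) B k m : (forall x, normc (f x) <= B * wt k x) ->
  normc (avg m.+1 f) <= B * wtmean k.
Proof.
move=> h; have B0 : 0 <= B.
  have := le_trans (normc_ge0 _) (h 0); rewrite pmulr_lge0 //; exact: wt_gt0.
apply: le_trans (normc_avg _ _) _; apply: le_trans (avg_ler _ h) _.
by rewrite avg_mulr ler_wpM2l // avg_wt_le.
Qed.

Lemma grow_bnd f : grow f -> bnd (fun m => avg m.+1 f).
Proof. by move=> [B [k [B0 h]]]; exists (B * wtmean k) => m; exact: avg_bound. Qed.

Lemma mu_bound (f : V -> C) B k : (forall x, normc (f x) <= B * wt k x) ->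
  normc (mu f) <= 2 * (B * wtmean k).
Proof. by move=> h; apply: ulim_le => m; exact: avg_bound. Qed.

Lemma muD f g : grow f -> grow g -> mu (fun x => f x + g x) = mu f + mu g.
Proof.
move=> gf gg; rewrite -(ulimD (grow_bnd gf) (grow_bnd gg)).
by congr ulim; apply/funext => m; exact: avg_addr.
Qed.

Lemma muZ a f : grow f -> mu (fun x => a * f x) = a * mu f.
Proof.
move=> gf; rewrite -(ulimZ a (grow_bnd gf)).
by congr ulim; apply/funext => m; exact: avg_mulr.
Qed.

Lemma eq_mu f g : f =1 g -> mu f = mu g.
Proof. by move=> /funext ->. Qed.

Lemma avg_cst m z : avg m (fun=> z : C) = z.
Proof.
by rewrite /avg sumr_const -[z *+ _]mulr_natl mulrA mulVf ?mul1r // card_samples_neq0.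
Qed.

Lemma mu_cst z : mu (fun=> z) = z.
Proof.
apply: ulim_eq => [|e e0]; first exact/grow_bnd/grow_cst.
by apply: nearW => m; rewrite avg_cst subrr Normc.normc0 ltW.
Qed.

Lemma mu_sum (I : Type) (r : seq I) (P : pred I) (F : I -> V -> C) :
  (forall i, P i -> grow (F i)) ->
  mu (fun x => \sum_(i <- r | P i) F i x) = \sum_(i <- r | P i) mu (F i).
Proof.
move=> h; elim: r => [|i r IH].
  rewrite big_nil; transitivity (mu (fun=> 0)); last exact: mu_cst.
  by apply: eq_mu => x; rewrite big_nil.
rewrite big_cons; case: ifP => Pi; last first.
  by rewrite -IH; apply: eq_mu => x; rewrite big_cons Pi.
rewrite -IH -muD; [|exact: h|exact: grow_sum].
by apply: eq_mu => x; rewrite big_cons Pi.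
Qed.

Lemma mu_ge0 f : grow f -> (forall x, 0 <= f x) -> 0 <= mu f.
Proof.
move=> gf f0; apply: ulim_near_ge0; first exact: grow_bnd.
apply: nearW => m; apply: mulr_ge0; first by rewrite invr_ge0 ler0n.
by apply: sumr_ge0.
Qed.

Lemma mu_le f g : grow f -> grow g -> (forall x, f x <= g x) -> mu f <= mu g.
Proof.
move=> gf gg fg; rewrite -subr_ge0 -mulN1r -(muZ _ gf) -muD //; last first.
  exact: (growM (grow_cst _ (-1)) gf).
apply: mu_ge0 => [|x]; first exact: (growD gg (growM (grow_cst _ (-1)) gf)).
by rewrite mulN1r subr_ge0.
Qed.

(** An error quadratic in [t], uniform up to an exponential weight, is what the discrete integration
    by parts can absorb: the steps have size about [m^(-1/2)] and there are of order [m] of them. *)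
Definition tame (f : V -> C) (df : A -> V -> C) :=
  [/\ grow f, forall a, grow (df a) &
   exists B k, 0 <= B /\ forall a x t, `|t| <= 1 ->
     normc (f (x + t *: u a) - f x - t%:C * df a x) <= B * t ^+ 2 * wt k x].

Lemma tame_grow f df : tame f df -> grow f. Proof. by case. Qed.
Lemma tame_dgrow f df a : tame f df -> grow (df a). Proof. by case. Qed.

Lemma wt_shift k : exists2 B, 0 <= B & forall a x t, `|t| <= 1 ->
  wt k (x + t *: u a) <= B * wt k x.
Proof.
exists (expR (k%:R * \sum_a l1 (u a))); first exact: expR_ge0.
move=> a x t t1; rewrite /wt -expRD ler_expR -mulrDr ler_wpM2l //.
apply: le_trans (l1D _ _) _; rewrite addrC lerD2r l1Z.
apply: (@le_trans _ _ (l1 (u a))); first by rewrite ler_piMl ?l1_ge0.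
by rewrite (bigD1 a) //= lerDl; apply: sumr_ge0 => ? _; exact: l1_ge0.
Qed.

Lemma tame_cst z : tame (fun=> z) (fun _ _ => 0).
Proof.
split=> [|a|]; try exact: grow_cst.
exists 0, 0%N; split=> // a x t _.
by rewrite mulr0 subr0 subrr Normc.normc0 !mul0r.
Qed.

Lemma tame_ev l : tame (fun x => (ev l x)%:C) (fun a _ => (ev l (u a))%:C).
Proof.
split=> [|a|]; [exact: grow_ev|exact: grow_cst|].
exists 0, 0%N; split=> // a x t _.
rewrite evD evZ rcD rcM.
rewrite (_ : _ + _ - _ - _ = 0) ?Normc.normc0 ?mul0r //; ring.
Qed.

Lemma tameD f df g dg : tame f df -> tame g dg ->
  tame (fun x => f x + g x) (fun a x => df a x + dg a x).
Proof.
move=> [f1 f2 [B [k [B0 h]]]] [g1 g2 [B' [k' [B'0 h']]]]; split => [|a|].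
- exact: growD.
- exact: growD.
exists (B + B'), (k + k')%N; split => [|a x t t1]; first exact: addr_ge0.
have -> : f (x + t *: u a) + g (x + t *: u a) - (f x + g x) - t%:C * (df a x + dg a x) =
  (f (x + t *: u a) - f x - t%:C * df a x) + (g (x + t *: u a) - g x - t%:C * dg a x).
  by ring.
apply: le_trans (normcD _ _) _; rewrite !mulrDl; apply: lerD.
  apply: le_trans (h _ _ _ t1) _; apply: ler_wpM2l; first by rewrite mulr_ge0 ?sqr_ge0.
  by rewrite wt_le // leq_addr.
apply: le_trans (h' _ _ _ t1) _; apply: ler_wpM2l; first by rewrite mulr_ge0 ?sqr_ge0.
by rewrite wt_le // leq_addl.
Qed.

Lemma normc_le1 (t : R) : `|t| <= 1 -> normc t%:C <= 1.
Proof. by rewrite normc_real. Qed.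

Lemma grow_bound2 (F : A -> V -> C) : (forall a, grow (F a)) ->
  exists B k, 0 <= B /\ forall a x, normc (F a x) <= B * wt k x.
Proof.
move=> /(_ _)/cid h; pose B a := proj1_sig (h a).
have hk a : exists k, 0 <= B a /\ forall x, normc (F a x) <= B a * wt k x.
  by rewrite /B; case: (h a).
pose k a := proj1_sig (cid (hk a)).
have hB a : 0 <= B a /\ forall x, normc (F a x) <= B a * wt (k a) x.
  by rewrite /k; case: (cid _).
exists (\sum_a B a), (\sum_a k a)%N; split => [|a x].
  by apply: sumr_ge0 => a _; case: (hB a).
apply: le_trans ((hB a).2 x) _; apply: ler_pM; [exact: (hB a).1|exact/ltW/wt_gt0| |].
  by rewrite (bigD1 a) //= lerDl; apply: sumr_ge0 => b _; case: (hB b).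
by apply: wt_le; rewrite (bigD1 a) //= leq_addr.
Qed.

Lemma tameM f df g dg : tame f df -> tame g dg ->
  tame (fun x => f x * g x) (fun a x => df a x * g x + f x * dg a x).
Proof.
move=> [f1 f2 [B [k [B0 h]]]] [g1 g2 [B' [k' [B'0 h']]]]; split => [|a|].
- exact: growM.
- by apply: growD; apply: growM.
have [F [kf [F0 hF]]] := f1; have [G [kg [G0 hG]]] := g1.
have [F' [kf' [F'0 hF']]] := grow_bound2 f2.
have [G' [kg' [G'0 hG']]] := grow_bound2 g2.
have [S S0 hS] := wt_shift kg.
exists (B * (G * S) + (F + F') * B' + F' * G'), (k + kg + (kf + kf' + k') + (kf' + kg'))%N.
split => [|a x t t1]; first by rewrite !addr_ge0 ?mulr_ge0 ?addr_ge0.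
set y := x + _.
(* The remainder is regrouped so that every term has one second-order factor: the error of [f], the
   error of [g], or [t^2]. *)
have -> : f y * g y - f x * g x - t%:C * (df a x * g x + f x * dg a x) =
  (f y - f x - t%:C * df a x) * g y + (f x + t%:C * df a x) * (g y - g x - t%:C * dg a x)
   + t%:C ^+ 2 * (df a x * dg a x) by ring.
have tt : 0 <= t ^+ 2 by exact: sqr_ge0.
have e1 : normc ((f y - f x - t%:C * df a x) * g y) <= B * (G * S) * t ^+ 2 * wt (k + kg) x.
  rewrite normcM wtD; apply: (@le_trans _ _ ((B * t ^+ 2 * wt k x) * (G * (S * wt kg x)))); last by nra.
  apply: ler_pM; rewrite ?normc_ge0 ?h //; apply: le_trans (hG _) _; rewrite ler_wpM2l //; exact: hS.
have e2 : normc ((f x + t%:C * df a x) * (g y - g x - t%:C * dg a x)) <=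
   (F + F') * B' * t ^+ 2 * wt (kf + kf' + k') x.
  rewrite normcM wtD.
  apply: (@le_trans _ _ (((F + F') * wt (kf + kf') x) * (B' * t ^+ 2 * wt k' x))); last by nra.
  apply: ler_pM; rewrite ?normc_ge0 ?h' //; apply: le_trans (normcD _ _) _; rewrite mulrDl.
  apply: lerD.
    by apply: le_trans (hF _) _; rewrite ler_wpM2l // wt_le // leq_addr.
  rewrite normcM; apply: (@le_trans _ _ (normc (df a x))).
    by rewrite ler_piMl ?normc_ge0 // normc_le1.
  by apply: le_trans (hF' _ _) _; rewrite ler_wpM2l // wt_le // leq_addl.
have e3 : normc (t%:C ^+ 2 * (df a x * dg a x)) <= F' * G' * t ^+ 2 * wt (kf' + kg') x.
  rewrite normcM normcX normc_real real_normK ?num_real // normcM wtD.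
  have : normc (df a x) * normc (dg a x) <= (F' * wt kf' x) * (G' * wt kg' x).
    by apply: ler_pM; rewrite ?normc_ge0.
  by nra.
set W := wt _ x.
apply: (@le_trans _ _ (B * (G * S) * t ^+ 2 * W + (F + F') * B' * t ^+ 2 * W + F' * G' * t ^+ 2 * W));
  last by rewrite -!mulrDl.
apply: le_trans (normcD _ _) _; apply: lerD; last first.
  apply: le_trans e3 _; apply: ler_wpM2l; first by rewrite mulr_ge0 // ?mulr_ge0 // ?mulr_ge0.
  by rewrite wt_le // leq_addl.
apply: le_trans (normcD _ _) _; apply: lerD.
  apply: le_trans e1 _; apply: ler_wpM2l; first by rewrite mulr_ge0 // ?mulr_ge0 // ?mulr_ge0.
  by rewrite wt_le // -addnA leq_addr.
apply: le_trans e2 _; apply: ler_wpM2l; first by rewrite mulr_ge0 // mulr_ge0 // addr_ge0.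
by apply: wt_le; exact: leq_trans (leq_addl _ _) (leq_addr _ _).
Qed.

Lemma eq_tame f g df dg : tame f df -> f =1 g -> (forall a, df a =1 dg a) -> tame g dg.
Proof.
move=> h /funext <- e; have <- : df = dg by apply/funext => a; apply/funext.
exact: h.
Qed.

End Mu2.
End Mu2.

(** * Integration by parts, invariance, and a lower bound for the Fourier transform of [mu] *)

Module Mu3.
From mathcomp Require Import all_boot all_order all_algebra.
From mathcomp Require Import boolp reals complex.
From mathcomp Require Import classical_sets functions set_interval filter topology normedtype sequences derive realfun exp trigo.
From mathcomp Require Import ring lra.
Set Implicit Arguments.
Unset Strict Implicit.
Unset Printing Implicit Defensive.
Import Order.TTheory GRing.Theory Num.Theory numFieldNormedType.Exports ComplexField.
Local Open Scope classical_set_scope.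
Local Open Scope ring_scope.
Local Open Scope complex_scope.
Import Cpow Ulim Mu Mu2.
Section Mu3.
Variables (R : realType) (n : nat) (A : finType) (u : A -> 'cV[R]_n).
Notation C := R[i].
Local Notation Re := (@complex.Re R).
Local Notation Im := (@complex.Im R).
Notation normc := (@Normc.normc R).
Notation V := 'cV[R]_n.
Local Notation avg := (avg u).
Local Notation pt := (pt u).
Local Notation mu := (mu u).
Local Notation tame := (tame u).

Definition flip m (p : A * 'I_m) (o : samples A m) : samples A m :=
  [ffun q => if q == p then ~~ o q else o q].

Lemma flipK m (p : A * 'I_m) : involutive (flip p).
Proof. by move=> o; apply/ffunP => q; rewrite !ffunE; case: eqP; rewrite ?negbK. Qed.

Lemma sgN b : sg R (~~ b) = - sg R b.
Proof. by case: b; rewrite /sg /= ?expr1 ?expr0 ?opprK. Qed.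
Lemma sg2 b : sg R b * sg R b = 1.
Proof. by case: b; rewrite /sg /= ?expr1 ?expr0 ?mulrNN mulr1. Qed.

Lemma pt_flip m (p : A * 'I_m) (o : samples A m) :
  pt (flip p o) = pt o + (- 2 * hstep R m * sg R (o p)) *: u p.1.
Proof.
rewrite /Mu.pt (bigD1 p) //= [in RHS](bigD1 p) //= ffunE eqxx sgN.
rewrite (eq_bigr (fun q : A * 'I_m => sg R (o q) *: u q.1)); last first.
  by move=> q /negPf qp; rewrite ffunE qp.
rewrite !scalerDr addrAC; congr (_ + _); rewrite !scalerA -scalerDl; congr (_ *: _); ring.
Qed.

(** Pairing each sample with the one where the sign [p] is flipped turns a sign-weighted sum into
    half a sum of finite differences in the direction [u p.1]. *)
Lemma avg_sign_flip m (p : A * 'I_m) (f : V -> C) :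
  \sum_(o : samples A m) (sg R (o p))%:C * f (pt o) =
  \sum_(o : samples A m) 2^-1 * ((sg R (o p))%:C *
     (f (pt o) - f (pt o + (- 2 * hstep R m * sg R (o p)) *: u p.1))).
Proof.
have e : \sum_(o : samples A m) (sg R (o p))%:C * f (pt o) =
    - \sum_(o : samples A m) (sg R (o p))%:C * f (pt (flip p o)).
  rewrite (reindex_inj (inv_inj (flipK p))) /= -sumrN.
  apply: eq_bigr => o _; by rewrite ffunE eqxx sgN rcN mulNr.
rewrite -mulr_sumr.
under [X in _ = _ * X]eq_bigr => o _ do rewrite -pt_flip mulrBr.
by rewrite sumrB -e; field.
Qed.

Lemma sqrt_archi (e : R) : 0 < e -> \forall m \near \oo, hstep R m.+1 <= e.
Proof.
move=> e0; near=> m.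
have : e^-1 ^+ 2 <= m.+1%:R.
  near: m; exists (Num.bound (e^-1 ^+ 2)) => // k /= hk.
  apply: ltW; apply: lt_le_trans (archi_boundP _) _; first exact: sqr_ge0.
  by rewrite ler_nat ltnW.
move=> h; rewrite /hstep -[e]invrK lef_pV2 ?posrE ?sqrtr_gt0 ?invr_gt0 //.
by apply: le_trans (ler_wsqrtr h); rewrite sqrtr_sqr ger0_norm // invr_ge0 ltW.
Unshelve. all: by end_near. Qed.

Lemma ulim_sub_small (s t : nat -> C) B : bnd s -> bnd t -> 0 <= B ->
  (\forall m \near \oo, normc (s m - t m) <= B * hstep R m.+1) -> ulim s = ulim t.
Proof.
move=> bs bt B0 h; have bt' : bnd (fun m => -1 * t m).
  by case: bt => b hb; exists b => m; rewrite mulN1r normcN.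
apply/eqP; rewrite -subr_eq0 -mulN1r -ulimZ // -ulimD //; apply/eqP.
apply: ulim_eq => [|e e0].
  case: bs bt' => b hb [b' hb']; exists (b + b') => m.
  by apply: le_trans (normcD _ _) _; exact: lerD.
have B1 : 0 < B + 1 by rewrite ltr_wpDl.
have h2 := sqrt_archi (divr_gt0 e0 B1).
near=> m; rewrite subr0 mulN1r; apply: (@le_trans _ _ (B * hstep R m.+1)); first by near: m.
have : hstep R m.+1 <= e / (B + 1) by near: m.
move=> hm; apply: (@le_trans _ _ ((B + 1) * (e / (B + 1)))).
  by apply: ler_pM => //; [exact/ltW/hstep_gt0|rewrite lerDl].
by rewrite mulrC divfK ?gt_eqF.
Unshelve. all: by end_near. Qed.

Lemma avg_evM m l (f : V -> C) :
  avg m.+1 (fun x => (ev l x)%:C * f x) =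
  \sum_(p : A * 'I_m.+1) (hstep R m.+1 * ev l (u p.1))%:C *
   ((#|{: samples A m.+1}|%:R)^-1 *
     \sum_(o : samples A m.+1) (sg R (o p))%:C * f (pt o)).
Proof.
rewrite /Mu.avg; under eq_bigr => o _.
  rewrite ev_pt rmorph_sum /= mulr_suml.
  over.
rewrite exchange_big /= mulr_sumr; apply: eq_bigr => p _.
rewrite mulrCA; congr (_ * _); rewrite mulr_sumr; apply: eq_bigr => o _.
by rewrite !rcM; ring.
Qed.

Lemma sum_pair (W : zmodType) (I J : finType) (G : I * J -> W) :
  \sum_p G p = \sum_i \sum_j G (i, j).
Proof. by rewrite pair_bigA; apply: eq_bigr => -[]. Qed.

(** Gaussian integration by parts. Expanding [l] in signs and flipping one of them gives differences
    of step [-2 hstep s]; their first-order part is the derivative, and the error per sign is of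
    order [hstep^2]. Each of the [m.+1] signs carries a further factor [hstep], so the total error
    is of order [hstep]. *)
Theorem ibp f df l : tame f df ->
  mu (fun x => (ev l x)%:C * f x) = \sum_a (ev l (u a))%:C * mu (df a).
Proof.
move=> tf; have [gf gdf [B [k [B0 h]]]] := tf.
have -> : \sum_a (ev l (u a))%:C * mu (df a) =
  mu (fun x => \sum_a (ev l (u a))%:C * df a x).
  rewrite mu_sum => [|a _]; last exact: growM (grow_cst _ _) (gdf a).
  by apply: eq_bigr => a _; rewrite muZ.
set D := \sum_a `|ev l (u a)| * (2 * B * wtmean u k).
have D0 : 0 <= D.
  by apply: sumr_ge0 => a _; rewrite !mulr_ge0 ?wtmean_ge0.
apply: (ulim_sub_small (B := D)) => //.
- exact/grow_bnd/(growM (grow_ev _) gf).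
- by apply/grow_bnd/grow_sum => a _; exact: growM (grow_cst _ _) (gdf a).
(* A flip moves the point by [2 hstep] along [u a], and [tame] only controls parameters of absolute
   value at most 1. *)
have h2 : 0 < 2^-1 :> R by rewrite invr_gt0.
have := sqrt_archi h2; apply: filterS => m hm.
have hp := hstep_gt0 R m; set η := hstep R m.+1 in hm hp *.
have E2 : η ^+ 2 * m.+1%:R = 1 by rewrite sqr_hstep mulVf // pnatr_eq0.
rewrite avg_evM sum_pair.
rewrite avg_sum -sumrB; apply: le_trans (normc_sum _ _ _) _.
rewrite /D mulr_suml; apply: ler_sum => a _.
have -> : avg m.+1 (fun x => (ev l (u a))%:C * df a x) =
   \sum_(i < m.+1) (η * ev l (u a))%:C * (η%:C * avg m.+1 (df a)).
  rewrite avg_mulr sumr_const card_ord -[_ *+ m.+1]mulr_natl.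
  rewrite -(rmorph_nat (real_complex R)) /=.
  transitivity ((η ^+ 2 * m.+1%:R)%:C * ((ev l (u a))%:C * avg m.+1 (df a))).
    by rewrite E2 mul1r.
  by rewrite !rcM; ring.
rewrite -sumrB; apply: le_trans (normc_sum _ _ _) _.
apply: (@le_trans _ _ (\sum_(i < m.+1) (η * `|ev l (u a)|) * (2 * B * η ^+ 2 * wtmean u k))); last first.
  rewrite sumr_const card_ord -[_ *+ m.+1]mulr_natl.
  set w := wtmean u k; set e := `|_|.
  have -> : m.+1%:R * (η * e * (2 * B * η ^+ 2 * w)) = (η ^+ 2 * m.+1%:R) * (e * (2 * B * w) * η).
    by ring.
  by rewrite E2 mul1r.
apply: ler_sum => i _; rewrite -mulrBr normcM normc_real normrM gtr0_norm //.
rewrite ler_wpM2l ?mulr_ge0 ?(ltW hp) // avg_sign_flip /= -avg_mulr.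
rewrite /Mu.avg -mulrBr -sumrB.
set c := _^-1 : C.
apply: (@le_trans _ _ (avg m.+1 (fun x => 2 * B * η ^+ 2 * wt k x))); last first.
  by rewrite avg_mulr ler_wpM2l ?avg_wt_le // !mulr_ge0 // ltW.
rewrite normcM /Mu.avg.
have -> : normc c = #|{: samples A m.+1}|%:R^-1.
  rewrite /c -(rmorph_nat (real_complex R)) -fmorphV normc_real ger0_norm //.
  by rewrite invr_ge0 ler0n.
rewrite ler_wpM2l ?invr_ge0 ?ler0n //.
apply: le_trans (normc_sum _ _ _) _; apply: ler_sum => o _.
set s := sg R (o (a, i)); set x := pt o.
have s2 : s * s = 1 by exact: sg2.
have s1 : `|s| = 1 by rewrite /s /sg; case: (o _); rewrite ?expr1 ?normrN ?normr1.
set t := - 2 * η * s.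
have t1 : `|t| <= 1.
  rewrite /t !normrM s1 mulr1 normrN (ger0_norm (ltW hp)) ger0_norm //.
  by rewrite -ler_pdivlMl // mulr1.
have := h a x t t1.
have t2 : t ^+ 2 = 4 * η ^+ 2 by rewrite /t !exprMn expr2 [s ^+ 2]expr2 s2; ring.
rewrite t2.
have -> : 2^-1 * (s%:C * (f x - f (x + t *: u a))) - η%:C * df a x =
   - (2^-1 * s%:C) * (f (x + t *: u a) - f x - t%:C * df a x).
  have -> : η%:C = 2^-1 * s%:C * - t%:C.
    have -> : t%:C = - (2 * η%:C * s%:C).
      by rewrite /t !rcM rcN (rmorph_nat (real_complex R)); ring.
    have : s%:C * s%:C = 1 by rewrite -rcM s2.
    move: (s%:C) (η%:C) => S H SS; rewrite opprK.
    by transitivity (H * (S * S)); [rewrite SS mulr1|field].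
  by ring.
move=> hh; rewrite normcM normcN normcM normc_real s1 mulr1.
have -> : normc (2^-1) = 2^-1.
  by rewrite -(rmorph_nat (real_complex R)) -fmorphV normc_real ger0_norm // invr_ge0.
move: hh; set q := normc _; set w := wt k x => hh.
have -> : 2 * B * η ^+ 2 * w = 2^-1 * (B * (4 * η ^+ 2) * w) by field.
by apply: ler_wpM2l => //; rewrite invr_ge0.
Qed.

(** A matrix that permutes the vectors [u a] permutes the sample points, so each finite average is
    already invariant. *)
Lemma mu_invariant (M : 'M[R]_n) (s : A -> A) f : injective s ->
  (forall a, M *m u a = u (s a)) -> mu (fun x => f (M *m x)) = mu f.
Proof.
move=> si Ms; congr ulim; apply/funext => m; rewrite /Mu.avg; congr (_ * _).
pose h (p : A * 'I_m.+1) := (s p.1, p.2).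
have hi : injective h by move=> [a i] [b j] [/si -> ->].
pose g (o : samples A m.+1) : samples A m.+1 := [ffun p => o (h p)].
have gi : injective g.
  move=> o o' /ffunP e; apply/ffunP => p; have [h' hK h'K] := injF_bij hi.
  by have := e (h' p); rewrite !ffunE h'K.
rewrite (reindex_inj gi) /=; apply: eq_bigr => o _; congr f.
rewrite /Mu.pt -scalemxAr mulmx_sumr [in RHS](reindex_inj hi) /=; congr (_ *: _).
by apply: eq_bigr => p _; rewrite ffunE -scalemxAr Ms.
Qed.

Lemma sin_le_abs (t : R) : 0 <= t -> `|sin t| <= t.
Proof.
rewrite le_eqVlt => /orP[/eqP <-|t0]; first by rewrite sin0 normr0.
have [||c _] := @MVT R sin cos 0 t => //.
- by apply: derivable_within_continuous => x _; have [] := is_derive_sin x.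
rewrite sin0 !subr0 => ->; rewrite normrM (gtr0_norm t0) ler_piMl ?(ltW t0) //.
by rewrite ler_norml cos_geN1 cos_le1.
Qed.

(** From [1 - cos y = 2 sin(y/2)^2] and [|sin x| <= |x|]. *)
Lemma cos_ge (y : R) : 1 - y ^+ 2 / 2 <= cos y.
Proof.
wlog y0 : y / 0 <= y.
  move=> h; have [|y0] := leP 0 y; first exact: h.
  by have := h (- y); rewrite sqrrN cosN; apply; lra.
have := @sin_le_abs (y / 2); rewrite divr_ge0 // => /(_ isT).
have -> : cos y = 1 - 2 * sin (y / 2) ^+ 2.
  have {1}-> : y = (y / 2) *+ 2 by rewrite mulr2n; field.
  by rewrite cos_mulr2n cos2sin2 mulr2n; ring.
rewrite ler_norml => /andP[h1 h2]; nra.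
Qed.

Lemma avg_cis m l : avg m.+1 (fun x => cis (ev l x)) =
  (\prod_a cos (hstep R m.+1 * ev l (u a)) ^+ m.+1)%:C.
Proof.
pose F a b := cis (hstep R m.+1 * (sg R b * ev l (u a))).
have cis_sum (I : Type) (r : seq I) (G : I -> R) :
   cis (\sum_(i <- r) G i) = \prod_(i <- r) cis (G i).
  by elim: r => [|i r IH]; rewrite ?big_nil ?cis0 // !big_cons cisD IH.
rewrite /Mu.avg; under [X in _ * X = _]eq_bigr => o _ do rewrite ev_pt cis_sum.
rewrite (avg_prod _ F) rmorph_prod; apply: eq_bigr => a _.
rewrite rmorphXn /=; congr (_ ^+ _); rewrite /F /sg expr1 expr0 mul1r mulN1r mulrN.
set y := hstep R m.+1 * ev l (u a); rewrite /cis cosN sinN.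
apply: (mulIf (x := 2)); first by rewrite pnatr_eq0.
rewrite divfK ?pnatr_eq0 // -(rmorph_nat (real_complex R)) -rcM.
by apply: eqC => /=; ring.
Qed.

(** The average of the character is a product of powers [cos(y)^m.+1] with [y = hstep * l(u_a)].
    Once [|y| <= 1] one has [cos y >= 1 - y^2/2 >= exp(-y^2)], and these powers multiply up to the
    bound. The exact limit has exponent half as large; positivity is the point. *)
Lemma mu_cis_ge l : (expR (- \sum_a ev l (u a) ^+ 2))%:C <= mu (fun x => cis (ev l x)).
Proof.
have gc : grow (fun x : V => cis (ev l x)).
  exists 1, 0%N; split=> // x; rewrite normc_cis mul1r; exact: wt_ge1.
rewrite -subr_ge0 -[- _%:C](@mu_cst _ _ _ u) addrC -muD //; last exact: grow_cst.
apply: ulim_near_ge0; first by apply/grow_bnd/growD => //; exact: grow_cst.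
have h a : \forall m \near \oo, `|hstep R m.+1 * ev l (u a)| <= 1.
  have e0 : 0 < (`|ev l (u a)| + 1)^-1 by rewrite invr_gt0 ltr_wpDl.
  have := sqrt_archi e0; apply: filterS => m hm.
  rewrite normrM gtr0_norm ?hstep_gt0 //.
  apply: (@le_trans _ _ ((`|ev l (u a)| + 1)^-1 * (`|ev l (u a)| + 1))).
    by apply: ler_pM => //; [exact/ltW/hstep_gt0|rewrite lerDl].
  by rewrite mulVf // gt_eqF // ltr_wpDl.
have H : \forall m \near \oo, forall a, `|hstep R m.+1 * ev l (u a)| <= 1.
  have := @filter_forall _ _ _ \oo _ h; apply.
apply: filterS H => m hm; rewrite avg_addr avg_cst avg_cis -rcN -rcD ler0c addrC subr_ge0.
rewrite -sumrN expR_sum; apply: ler_prod => a _; rewrite expR_ge0 /=.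
set y := hstep R m.+1 * _; have y1 : y ^+ 2 <= 1.
  by rewrite -[y ^+ 2]real_normK ?num_real // expr_le1 // hm.
have -> : - ev l (u a) ^+ 2 = m.+1%:R * (- y ^+ 2).
  by rewrite /y exprMn sqr_hstep; field; rewrite addrC natr1 pnatr_eq0.
rewrite expRM_natl lerXn2r ?nnegrE ?expR_ge0 //.
  apply: le_trans _ (cos_ge y); move: y1; move: (y ^+ 2) => q ?; lra.
apply: le_trans _ (cos_ge y); rewrite expRN -[leLHS]mul1r ler_pdivrMr ?expR_gt0 //.
have := expR_ge1Dx (y ^+ 2); move: (expR _) (sqr_ge0 y) y1; move: (y ^+ 2) => q E q0 q1 h1.
by nra.
Qed.

End Mu3.
End Mu3.

(** * First-order expansions of powers and characters *)

Module Tame.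
From mathcomp Require Import all_boot all_order all_algebra.
From mathcomp Require Import boolp reals complex.
From mathcomp Require Import classical_sets functions set_interval filter topology normedtype sequences derive realfun exp trigo.
From mathcomp Require Import ring lra.
Set Implicit Arguments.
Unset Strict Implicit.
Unset Printing Implicit Defensive.
Import Order.TTheory GRing.Theory Num.Theory numFieldNormedType.Exports ComplexField.
Local Open Scope classical_set_scope.
Local Open Scope ring_scope.
Local Open Scope complex_scope.
Import Cpow Cpow2 Ulim Mu Mu2 Mu3.
Section Tame.
Variables (R : realType) (n : nat) (A : finType) (u : A -> 'cV[R]_n).
Notation C := R[i].
Local Notation Re := (@complex.Re R).
Local Notation Im := (@complex.Im R).
Notation normc := (@Normc.normc R).
Notation V := 'cV[R]_n.
Local Notation tame := (tame u).

(** The mean value inequality is applied to the derivative and then to the remainder; each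
    application costs a factor 2. *)
Lemma taylor1 (f f1 f2 : R -> C) B t :
  (forall x, derC f (f1 x) x) -> (forall x, derC f1 (f2 x) x) ->
  (forall x, `|x| <= 1 -> normc (f2 x) <= B) -> `|t| <= 1 ->
  normc (f t - f 0 - t%:C * f1 0) <= 4 * B * t ^+ 2.
Proof.
move=> d1 d2 b2 t1.
have B0 : 0 <= B by apply: le_trans (normc_ge0 _) (b2 0 _); rewrite normr0.
have step x : `|x| <= 1 -> normc (f1 x - f1 0) <= 2 * (B * `|x|).
  move=> x1; have := @MVTC R (fun h => f1 (h * x)) (fun h => f2 (h * x) * x%:C) (B * `|x|).
  rewrite mul1r mul0r; apply => [h _|h /andP[h0 h1]].
    have [r i] := d2 (h * x).
    have dl : is_derive h 1 (fun h => h * x) x.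
      by apply: (is_derive_congr (is_derive_cmul x (is_derive_id h 1))) => [y|];
        rewrite ?mulr1 // mulrC.
    split.
      apply: (is_derive_congr (@is_derive_comp1 R (fun y => Re (f1 y)) (fun h => h * x) h _ _ r dl)) => //.
      by rewrite ReM /= mulr0 subr0.
    apply: (is_derive_congr (@is_derive_comp1 R (fun y => Im (f1 y)) (fun h => h * x) h _ _ i dl)) => //.
    by rewrite ImM /= mulr0 add0r.
  rewrite normcM normc_real ler_wpM2r // b2 // normrM (ger0_norm h0).
  by apply: le_trans x1; rewrite ler_piMl.
have := @MVTC R (fun h => f (h * t) + h%:C * - (t%:C * f1 0))
   (fun h => f1 (h * t) * t%:C + - (t%:C * f1 0)) (2 * (B * `|t|) * `|t|).
have -> : f (1 * t) + 1%:C * - (t%:C * f1 0) - (f (0 * t) + 0%:C * - (t%:C * f1 0)) =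
  f t - f 0 - t%:C * f1 0.
  by rewrite mul1r mul0r rmorph1 rmorph0 mul0r mul1r addr0 addrAC.
have -> : 4 * B * t ^+ 2 = 2 * (2 * (B * `|t|) * `|t|).
  by rewrite -[t ^+ 2]real_normK ?num_real //; ring.
apply => [h _|h /andP[h0 h1]].
  have [r i] := d1 (h * t).
  have dl : is_derive h 1 (fun h => h * t) t.
    by apply: (is_derive_congr (is_derive_cmul t (is_derive_id h 1))) => [y|];
      rewrite ?mulr1 // mulrC.
  apply: derCD.
    split.
      apply: (is_derive_congr (@is_derive_comp1 R (fun y => Re (f y)) (fun h => h * t) h _ _ r dl)) => //.
      by rewrite ReM /= mulr0 subr0.
    apply: (is_derive_congr (@is_derive_comp1 R (fun y => Im (f y)) (fun h => h * t) h _ _ i dl)) => //.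
    by rewrite ImM /= mulr0 add0r.
  have := derC_affine 0 (- (t%:C * f1 0)) h.
  by congr derC; apply/funext => y; rewrite add0r.
have ht : `|h * t| <= `|t| by rewrite normrM (ger0_norm h0) ler_piMl.
have -> : f1 (h * t) * t%:C + - (t%:C * f1 0) = (f1 (h * t) - f1 0) * t%:C by ring.
rewrite normcM normc_real ler_wpM2r //; apply: le_trans (step _ (le_trans ht t1)) _.
by rewrite !ler_wpM2l.
Qed.

Lemma ev_wt (c : R) l : exists k, forall x : V, expR (c * `|ev l x|) <= wt k x.
Proof.
exists (Num.bound (`|c| * \sum_i `|l 0 i|)) => x; rewrite ler_expR.
apply: (@le_trans _ _ ((`|c| * \sum_i `|l 0 i|) * l1 x)).
  rewrite -mulrA; apply: (@le_trans _ _ (`|c| * `|ev l x|)).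
    by rewrite ler_wpM2r // ler_norm.
  by rewrite ler_wpM2l // ev_le_l1.
rewrite ler_wpM2r ?l1_ge0 //; apply: ltW; apply: archi_boundP.
by rewrite mulr_ge0 // sumr_ge0.
Qed.

(** This is [t - i l(x)], in the right half plane for [t > 0]. It is [-i] times the value of [l] at
    a point of the shifted contour, so its principal powers stand for powers of the roots there. *)
Definition wl (t : R) l (x : V) : C := t +i* (- ev l x).

Lemma normc_wl_ge t l x : 0 <= t -> t <= normc (wl t l x).
Proof. by move=> t0; have := Re_le_normc (wl t l x); rewrite /= ger0_norm. Qed.

Lemma normc_wl_le t l x : 0 <= t -> normc (wl t l x) <= (1 + t) * expR `|ev l x|.
Proof.
move=> t0; apply: (@le_trans _ _ (t + `|ev l x|)).
  have -> : wl t l x = t%:C + (0 +i* (- ev l x)).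
    by apply: eqC => /=; ring.
  apply: le_trans (normcD _ _) _; rewrite normc_real ger0_norm // lerD2l.
  by rewrite normcE2 /= expr0n add0r sqrtr_sqr normrN.
have := expR_ge1Dx `|ev l x|; have := normr_ge0 (ev l x).
by move: (expR _) => E; nra.
Qed.

(** For [s >= 0] the upper bound on [r] decides, for [s < 0] the lower bound [t]; adding both
    constants gives one estimate for all exponents. *)
Lemma powR_bound (r t y s : R) : 0 < t -> t <= r -> r <= (1 + t) * expR y -> 0 <= y ->
  r `^ s <= (t `^ s + (1 + t) `^ s) * expR (`|s| * y).
Proof.
move=> t0 tr rb y0; have r0 : 0 < r by exact: lt_le_trans tr.
have e1 : 1 <= expR (`|s| * y) by rewrite -expR0 ler_expR mulr_ge0.
have [s0|s0] := leP 0 s.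
  apply: (@le_trans _ _ (((1 + t) * expR y) `^ s)).
    by apply: ge0_ler_powR => //; rewrite nnegrE ltW // mulr_gt0 ?expR_gt0 // addr_gt0.
  rewrite powRM ?expR_ge0 ?addr_ge0 ?(ltW t0) // -expRM mulrC (ger0_norm s0) [s * y]mulrC.
  by rewrite mulrC ler_wpM2r ?expR_ge0 // lerDr powR_ge0.
apply: (@le_trans _ _ (t `^ s)).
  rewrite -[s]opprK (powRN r) (powRN t) lef_pV2 ?posrE ?powR_gt0 //.
  by apply: ge0_ler_powR; rewrite ?nnegrE ?oppr_ge0 ?(ltW s0) ?(ltW t0) ?(ltW r0).
apply: (@le_trans _ _ (t `^ s * 1)); first by rewrite mulr1.
by apply: ler_pM => //; [exact: powR_ge0|rewrite lerDl powR_ge0].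
Qed.

Lemma cpow_wl_bound t l s : 0 < t -> exists k, forall x : V,
  normc (cpow (wl t l x) s) <= (t `^ s + (1 + t) `^ s) * wt k x.
Proof.
move=> t0; have [k hk] := ev_wt `|s| l; exists k => x; rewrite normc_cpow.
apply: le_trans (powR_bound s t0 _ (normc_wl_le _ _ (ltW t0)) (normr_ge0 _)) _.
  exact/normc_wl_ge/ltW.
by rewrite ler_wpM2l ?addr_ge0 ?powR_ge0.
Qed.

Lemma grow_cpow t l s : 0 < t -> grow (fun x : V => cpow (wl t l x) s).
Proof.
move=> t0; have [k hk] := cpow_wl_bound l s t0.
by exists (t `^ s + (1 + t) `^ s), k; split; rewrite ?addr_ge0 ?powR_ge0.
Qed.

Lemma wl_line t l (x : V) a r : wl t l (x + r *: u a) = wl t l x + r%:C * (0 +i* (- ev l (u a))).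
Proof. by apply: eqC => /=; rewrite ?evD ?evZ; ring. Qed.

(** Along every line the real part of [wl] stays equal to [t], so the power never meets the cut, and
    its second derivative is again a power, controlled by [cpow_wl_bound]. *)
Lemma tame_cpow t l s : 0 < t ->
  tame (fun x => cpow (wl t l x) s)
       (fun a x => (s%:C * (0 +i* (- ev l (u a)))) * cpow (wl t l x) (s - 1)).
Proof.
move=> t0; split=> [|a|]; first exact: grow_cpow.
  by apply: (growM (grow_cst _ _)); exact: grow_cpow.
have [k hk] := cpow_wl_bound l (s - 1 - 1) t0.
have [S S0 hS] := wt_shift u k.
set c := t `^ _ + _ in hk.
have c0 : 0 <= c by rewrite addr_ge0 ?powR_ge0.
pose b a := normc (s%:C * (0 +i* (- ev l (u a))) * ((s - 1)%:C * (0 +i* (- ev l (u a))))).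
have b0 a : 0 <= b a by exact: normc_ge0.
exists (4 * ((\sum_a b a) * (c * S))), k; split => [|a x r r1].
  by rewrite !mulr_ge0 // sumr_ge0.
set z := wl t l x; set w := 0 +i* (- ev l (u a)).
have ok y : z + y%:C * w != 0 /\ 0 <= Re (z + y%:C * w).
  have e : Re (z + y%:C * w) = t by rewrite ReD ReM /= mulr0 mul0r subrr addr0.
  split; last by rewrite e ltW.
  by apply/eqP => e0; move: e; rewrite e0 /= => e; rewrite -e ltxx in t0.
pose f1 y := (s%:C * w) * cpow (z + y%:C * w) (s - 1).
pose f2 y := (s%:C * w) * ((s - 1)%:C * w * cpow (z + y%:C * w) (s - 1 - 1)).
have := @taylor1 (fun y => cpow (z + y%:C * w) s) f1 f2 (b a * (c * (S * wt k x))) r.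
rewrite /f1 rmorph0 mul0r addr0 -wl_line -/z => H.
apply: le_trans (H _ _ _ r1) _.
- move=> y; have [o1 o2] := ok y; apply: derC_eq (derC_cpow s o1 o2) _.
  by rewrite mulrAC.
- move=> y; have [o1 o2] := ok y.
  apply: derC_eq (derCM (derC_cst _ _) (derC_cpow (s - 1) o1 o2)) _.
  by rewrite mul0r add0r /f2; ring.
- move=> y y1; rewrite /f2 mulrA normcM -/w -/(b a) ler_wpM2l //.
  rewrite /z /w -wl_line; apply: le_trans (hk _) _; rewrite ler_wpM2l //; exact: hS.
have ba : b a <= \sum_a b a by rewrite (bigD1 a) //= lerDl sumr_ge0.
have := wt_gt0 k x; have := sqr_ge0 r.
move: (wt k x) (r ^+ 2) => W q q0 W0.
have -> : 4 * (b a * (c * (S * W))) * q = b a * (4 * (c * (S * W)) * q) by ring.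
have -> : 4 * ((\sum_a b a) * (c * S)) * q * W = (\sum_a b a) * (4 * (c * (S * W)) * q) by ring.
by rewrite ler_wpM2r // !mulr_ge0 // ltW.
Qed.

Lemma derC_cis (l t : R) : derC (fun y : R => cis (l * y)) ((0 +i* l) * cis (l * t)) t.
Proof.
have dl : is_derive t 1 (fun y => l * y) l.
  by apply: (is_derive_congr (is_derive_cmul l (is_derive_id t 1))); rewrite ?mulr1.
split.
  apply: (is_derive_congr (@is_derive_comp1 R cos (fun y => l * y) t _ _ (is_derive_cos _) dl)) => //.
  by rewrite ReM /=; ring.
apply: (is_derive_congr (@is_derive_comp1 R sin (fun y => l * y) t _ _ (is_derive_sin _) dl)) => //.
by rewrite ImM /=; ring.
Qed.

Lemma grow_cis l : grow (fun x : V => cis (ev l x)).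
Proof. by exists 1, 0%N; split=> // x; rewrite normc_cis mul1r; exact: wt_ge1. Qed.

Lemma tame_cis l : tame (fun x => cis (ev l x))
  (fun a x => (0 +i* ev l (u a)) * cis (ev l x)).
Proof.
split=> [|a|]; first exact: grow_cis.
  exact: (growM (grow_cst _ _) (grow_cis _)).
pose b a := normc ((0 +i* ev l (u a)) * (0 +i* ev l (u a))).
have b0 a : 0 <= b a by exact: normc_ge0.
exists (4 * \sum_a b a), 0%N; split => [|a x r r1]; first by rewrite mulr_ge0 // sumr_ge0.
have -> : wt 0 x = 1 by rewrite /wt mul0r expR0.
set i := 0 +i* _; set l' := ev l (u a).
have := @taylor1 (fun y => cis (ev l x) * cis (l' * y)) (fun y => cis (ev l x) * (i * cis (l' * y)))
   (fun y => cis (ev l x) * (i * (i * cis (l' * y)))) (b a) r.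
rewrite mulr0 cis0 !mulr1 -cisD evD evZ [r * _]mulrC [_ * i]mulrC => H.
apply: le_trans (H _ _ _ r1) _.
- move=> y; apply: derC_eq (derCM (derC_cst _ _) (derC_cis l' y)) _.
  by rewrite mul0r add0r.
- move=> y; apply: derC_eq (derCM (derC_cst _ _) (derCM (derC_cst _ _) (derC_cis l' y))) _.
  by rewrite mul0r !add0r mul0r add0r.
- by move=> y _; rewrite normcM normc_cis mul1r mulrA normcM normc_cis mulr1.
rewrite ler_wpM2r ?sqr_ge0 // ler_wpM2l //.
by rewrite (bigD1 a) //= lerDl sumr_ge0.
Qed.

End Tame.
End Tame.

(** * The binomial series of [(1 - z)^(-s)], with positive coefficients *)

Module PosSeries.
From mathcomp Require Import all_boot all_order all_algebra.
From mathcomp Require Import boolp reals complex.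
From mathcomp Require Import classical_sets functions set_interval filter topology normedtype sequences derive realfun exp trigo.
From mathcomp Require Import ring lra.
Set Implicit Arguments.
Unset Strict Implicit.
Unset Printing Implicit Defensive.
Import Order.TTheory GRing.Theory Num.Theory numFieldNormedType.Exports ComplexField.
Local Open Scope classical_set_scope.
Local Open Scope ring_scope.
Local Open Scope complex_scope.
Import Cpow Cpow2 Ulim Mu Mu2 Mu3 Tame.
Section Binomial.
Variables (R : realType) (s : R).
Hypothesis s01 : 0 < s < 1.
Notation C := R[i].
Local Notation Re := (@complex.Re R).
Local Notation Im := (@complex.Im R).
Notation normc := (@Normc.normc R).

(** The coefficient of [z^k] in [(1 - z)^(-s)], that is [s (s + 1) ... (s + k - 1) / k!]. *)
Definition bcoef k : R := \prod_(j < k) ((s + j%:R) / j.+1%:R).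
Lemma bcoefS k : bcoef k.+1 = bcoef k * ((s + k%:R) / k.+1%:R).
Proof. by rewrite /bcoef big_ord_recr. Qed.
Lemma bcoef_gt0 k : 0 < bcoef k.
Proof.
have /andP[s0 _] := s01.
by apply: prodr_gt0 => j _; rewrite divr_gt0 // ltr_wpDr.
Qed.
Lemma bcoef_le1 k : bcoef k <= 1.
Proof.
have /andP[s0 s1] := s01.
elim: k => [|k IH]; first by rewrite /bcoef big_ord0.
rewrite bcoefS mulr_ile1 ?(ltW (bcoef_gt0 _)) ?divr_ge0 ?addr_ge0 ?(ltW s0) //.
by rewrite ler_pdivrMr // mul1r -natr1 addrC lerD2l ltW.
Qed.

(** Write [q = exp L] and [E = q^s]. The tangent inequalities of the exponential at [(1 - s) L] and
    at [- s L], taken with weights [s] and [1 - s], cancel the terms in [L] and leave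
    [E <= s q + 1 - s]. *)
Lemma bernoulli_powR (q : R) : 0 < q -> q `^ s <= 1 + s * (q - 1).
Proof.
move=> q0; have /andP[s0 s1] := s01; rewrite /powR gt_eqF //; set L := ln q.
have qE : q = expR L by rewrite lnK.
have h1 := expR_ge1Dx ((1 - s) * L); have h2 := expR_ge1Dx (- (s * L)).
have e1 : expR ((1 - s) * L) = q / expR (s * L) by rewrite qE -expRB; congr expR; ring.
have e2 : expR (- (s * L)) = (expR (s * L))^-1 by rewrite expRN.
have := expR_gt0 (s * L); move: h1 h2; rewrite e1 e2; move: (expR (s * L)) => E h1 h2 E0.
have {}h1 : (1 + (1 - s) * L) * E <= q by rewrite -ler_pdivlMr.
have {}h2 : (1 + - (s * L)) * E <= 1 by rewrite -ler_pdivlMr // div1r.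
have : s * ((1 + (1 - s) * L) * E) + (1 - s) * ((1 + - (s * L)) * E) <= s * q + (1 - s) * 1.
  by apply: lerD; apply: ler_wpM2l => //; lra.
have -> : s * ((1 + (1 - s) * L) * E) + (1 - s) * ((1 + - (s * L)) * E) = E by ring.
by have -> : s * q + (1 - s) * 1 = 1 + s * (q - 1) by ring.
Qed.

(** The ratio of consecutive coefficients dominates that of the power law, by Bernoulli's inequality
    at [q = (k + 2) / (k + 1)]. The power law is what keeps a positive mass in the Riemann sums that
    follow. *)
Lemma bcoef_ge k : s * k.+1%:R `^ (s - 1) <= bcoef k.+1.
Proof.
have /andP[s0 s1] := s01.
elim: k => [|k IH]; first by rewrite powR1 mulr1 /bcoef big_ord1 addr0 divr1.
rewrite bcoefS; have k1 : 0 < k.+1%:R :> R by [].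
have k2 : 0 < k.+2%:R :> R by [].
have d : 0 <= (s + k.+1%:R) / k.+2%:R by apply: divr_ge0; [apply: addr_ge0; [exact: ltW|]|].
apply: le_trans (ler_wpM2r d IH).
have pB (j : nat) : j.+1%:R `^ (s - 1) = j.+1%:R `^ s / j.+1%:R :> R.
  by rewrite powRB ?powRr1 //; apply/implyP => _; rewrite pnatr_eq0.
rewrite !pB -!mulrA ler_wpM2l ?(ltW s0) //.
have -> : k.+1%:R `^ s * (k.+1%:R^-1 * ((s + k.+1%:R) / k.+2%:R)) =
   k.+1%:R `^ s * ((s + k.+1%:R) / k.+1%:R) / k.+2%:R.
  by rewrite !mulrA; congr (_ / _); rewrite mulrAC.
rewrite ler_wpM2r ?invr_ge0 //.
have := bernoulli_powR (divr_gt0 k2 k1).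
have -> : 1 + s * (k.+2%:R / k.+1%:R - 1) = (s + k.+1%:R) / k.+1%:R.
  by rewrite -[k.+2%:R]natr1; field; rewrite addrC natr1 pnatr_eq0.
move=> h; apply: le_trans (ler_wpM2l (powR_ge0 _ _) h).
by rewrite powRM ?invr_ge0 // mulrC -powR_inv1 // -powRrM mulN1r powRN -mulrA mulVf ?mulr1 // gt_eqF // powR_gt0.
Qed.

Definition bsum K (z : C) : C := \sum_(k < K.+1) (bcoef k)%:C * z ^+ k.
Definition bsum' K (z : C) : C := \sum_(k < K.+1) (bcoef k)%:C * (k%:R * z ^+ k.-1).

(** The full series satisfies [(1 - z) F' = s F]; for the truncated one everything telescopes except
    the last term. *)
Lemma bsum_ode K z :
  (1 - z) * bsum' K z - s%:C * bsum K z = - ((s + K%:R) * bcoef K)%:C * z ^+ K.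
Proof.
elim: K => [|K IH].
  rewrite /bsum /bsum' !big_ord1 /= expr0 mul0r !mulr0 sub0r addr0 !mulr1 /bcoef big_ord0 mulr1.
  by rewrite mulr1.
rewrite /bsum /bsum' big_ord_recr /= [X in _ - _ * X]big_ord_recr /= -/(bsum K z) -/(bsum' K z).
have e : ((s + K%:R) * bcoef K)%:C = K.+1%:R * (bcoef K.+1)%:C.
  rewrite -(rmorph_nat (real_complex R)) -rcM bcoefS; congr (_%:C).
  by field; rewrite addrC natr1 pnatr_eq0.
rewrite e in IH; rewrite !mulrDr opprD addrACA IH rcM rcD (rmorph_nat (real_complex R)) exprS.
by ring.
Qed.

Lemma derC_powline (z : C) k t :
  derC (fun h => (h%:C * z) ^+ k) (k%:R * (t%:C * z) ^+ k.-1 * z) t.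
Proof.
elim: k => [|k IH].
  by apply: derC_eq (derC_cst 1 t) _; rewrite mul0r mul0r.
have d1 : derC (fun h => h%:C * z) z t.
  by have := derC_affine 0 z t; congr derC; apply/funext => h; rewrite add0r.
have := derCM d1 IH; have -> : (fun h => h%:C * z * (h%:C * z) ^+ k) = (fun h => (h%:C * z) ^+ k.+1).
  by apply/funext => h; rewrite exprS.
move=> h; apply: derC_eq h _; case: k {IH} => [|k] /=.
  by rewrite expr0 mulr1 mul0r mul0r mulr0 addr0 mulr1 mul1r.
rewrite -[k.+2%:R]natr1 exprS; ring.
Qed.

Lemma derC_sum (I : Type) (r : seq I) (F : I -> R -> C) F' t :
  (forall i, derC (F i) (F' i) t) ->
  derC (fun h => \sum_(i <- r) F i h) (\sum_(i <- r) F' i) t.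
Proof.
move=> d; elim: r => [|i r IH].
  have := derC_cst 0 t; rewrite big_nil; congr derC; apply/funext => h; by rewrite big_nil.
have := derCD (d i) IH; rewrite big_cons; congr derC.
by apply/funext => h; rewrite big_cons.
Qed.

Lemma derC_bsum K z t : derC (fun h => bsum K (h%:C * z)) (bsum' K (t%:C * z) * z) t.
Proof.
have := @derC_sum _ (index_enum 'I_K.+1) (fun k h => (bcoef k)%:C * (h%:C * z) ^+ k) _ t
  (fun k => derCM (derC_cst (bcoef k)%:C t) (derC_powline z k t)).
move=> h; apply: derC_eq h _.
by rewrite /bsum' mulr_suml; apply: eq_bigr => k _; rewrite mul0r add0r; ring.
Qed.

(** Differentiate [S(h z) (1 - h z)^s] in [h]: the differential equation leaves only the truncation
    term, of size about [(1 + K) r^K], and at [h = 0] the product is 1. The power is principal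
    because [1 - h z] has real part at least [1 - r]. *)
Lemma bsum_trunc K (z : C) (r : R) : normc z <= r -> r < 1 ->
  normc (bsum K z * cpow (1 - z) s - 1) <=
  2 * ((1 - r) `^ (s - 1) * ((1 + K%:R) * r ^+ K)).
Proof.
have /andP[s0 s1] := s01; move=> zr r1.
have r0 : 0 <= r by exact: le_trans (normc_ge0 _) zr.
pose f h := bsum K (h%:C * z) * cpow (1 + h%:C * - z) s.
have f1 : f 1 = bsum K z * cpow (1 - z) s by rewrite /f rmorph1 !mul1r.
have f0 : f 0 = 1.
  rewrite /f rmorph0 !mul0r addr0 /bsum big_ord_recl /= expr0 mulr1.
  rewrite big1 => [|i _]; last by rewrite expr0n mulr0.
  rewrite -(rmorph1 (real_complex R)) cpow_pos // powR1 /bcoef big_ord0 addr0.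
  by rewrite !rmorph1 mulr1.
rewrite -f1 -f0.
pose f' h := z * cpow (1 + h%:C * - z) (s - 1) * (- ((s + K%:R) * bcoef K)%:C * (h%:C * z) ^+ K).
have nz h : 0 <= h <= 1 -> normc (h%:C * z) <= r.
  move=> /andP[h0 h1]; rewrite normcM normc_real ger0_norm //.
  by apply: le_trans zr; rewrite ler_piMl ?normc_ge0.
have re h : 0 <= h <= 1 -> 1 - r <= Re (1 + h%:C * - z).
  move=> h01; have := Re_le_normc (h%:C * z); have := nz h h01.
  rewrite mulrN ReD ReN /= ler_norml; set q := Re _; set m := normc _ => ? /andP[? ?]; lra.
have ok h : 0 <= h <= 1 -> 1 + h%:C * - z != 0 /\ 0 <= Re (1 + h%:C * - z).
  move=> h01; have := re h h01 => e; split; last by apply: le_trans e; rewrite subr_ge0 ltW.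
  by apply/eqP => e0; move: e; rewrite e0 /= subr_le0 leNgt r1.
apply: (MVTC (f' := f')) => h h01; have [o1 o2] := ok h h01.
  apply: derC_eq (derCM (derC_bsum K z h) (derC_cpow s o1 o2)) _.
  rewrite /f'; set c1 := cpow _ (s - 1).
  have -> : cpow (1 + h%:C * - z) s = (1 - h%:C * z) * c1.
    by rewrite /c1 -mulrN -cpowS // subrK.
  have := bsum_ode K (h%:C * z); set X := bsum' _ _; set Y := bsum _ _ => <-; ring.
rewrite /f'; set q := (s + K%:R) * bcoef K.
have n1 : normc (1 + h%:C * - z) `^ (s - 1) <= (1 - r) `^ (s - 1).
  have e : 1 - r <= normc (1 + h%:C * - z).
    by apply: le_trans (re h h01) _; apply: le_trans (Re_le_normc _); rewrite ler_norm.
  have p : 0 < 1 - r by rewrite subr_gt0.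
  rewrite -[s - 1]opprK 2!(powRN _ (- (s - 1))) lef_pV2 ?posrE ?powR_gt0 //; last first.
    exact: lt_le_trans e.
  apply: ge0_ler_powR; rewrite ?nnegrE ?(ltW p) ?normc_ge0 //; lra.
have q0 : 0 <= q by rewrite mulr_ge0 ?addr_ge0 ?(ltW s0) ?(ltW (bcoef_gt0 _)).
have q1 : q <= 1 + K%:R.
  rewrite -[leRHS]mulr1; apply: ler_pM; rewrite ?bcoef_le1 ?(ltW (bcoef_gt0 _)) ?addr_ge0 ?(ltW s0) //.
  by rewrite lerD2r ltW.
rewrite (normcM _ (_ * _)) (normcM z) (normcM (- _)) normc_cpow normcN normc_real ger0_norm // normcX -mulrA.
apply: (@le_trans _ _ (1 * ((1 - r) `^ (s - 1) * ((1 + K%:R) * r ^+ K)))); last by rewrite mul1r.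
have nK : 0 <= normc (h%:C * z) ^+ K by rewrite exprn_ge0 ?normc_ge0.
have qK : 0 <= q * normc (h%:C * z) ^+ K by exact: mulr_ge0.
apply: ler_pM; [exact: normc_ge0|by rewrite mulr_ge0 // powR_ge0|exact: le_trans zr (ltW r1)|].
apply: ler_pM => //; first exact: powR_ge0.
apply: ler_pM => //.
by rewrite lerXn2r ?nnegrE ?normc_ge0 // nz.
Qed.

Lemma powR_le_neg (a b p : R) : 0 < a -> a <= b -> 0 <= p -> b `^ (- p) <= a `^ (- p).
Proof.
move=> a0 ab p0; have b0 : 0 < b by exact: lt_le_trans ab.
rewrite !powRN lef_pV2 ?posrE ?powR_gt0 //.
by apply: ge0_ler_powR; rewrite ?nnegrE ?(ltW a0) ?(ltW b0).
Qed.

End Binomial.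
End PosSeries.

(** * Discretised Gamma integrals and the positivity of their Fourier coefficients *)

Module Pos2.
From mathcomp Require Import all_boot all_order all_algebra.
From mathcomp Require Import boolp reals complex.
From mathcomp Require Import classical_sets functions set_interval filter topology normedtype sequences derive realfun exp trigo.
From mathcomp Require Import ring lra.
Set Implicit Arguments.
Unset Strict Implicit.
Unset Printing Implicit Defensive.
Import Order.TTheory GRing.Theory Num.Theory numFieldNormedType.Exports ComplexField.
Local Open Scope classical_set_scope.
Local Open Scope ring_scope.
Local Open Scope complex_scope.
Import Cpow Cpow2 Ulim Mu Mu2 Mu3 Tame PosSeries.
Section Pos2.
Variables (R : realType) (n : nat) (A : finType) (u : A -> 'cV[R]_n) (s : R).
Hypothesis s01 : 0 < s < 1.
Notation C := R[i].
Local Notation Re := (@complex.Re R).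
Local Notation Im := (@complex.Im R).
Notation normc := (@Normc.normc R).
Notation V := 'cV[R]_n.
Local Notation mu := (mu u).
Local Notation bcoef := (bcoef s).
Local Notation bsum := (bsum s).

(** An inequality in the complex order also asserts equal imaginary parts, so both components are
    passed to the limit. *)
Lemma le_limC (a : nat -> C) (b l : C) (d : nat -> R) :
  (forall e, 0 < e -> exists K0, forall K, (K0 <= K)%N -> d K <= e) ->
  (forall K, normc (a K - l) <= d K) -> (exists K0, forall K, (K0 <= K)%N -> b <= a K) -> b <= l.
Proof.
move=> dl al [K0 ba].
have H e : 0 < e -> `|Im l - Im b| <= e /\ Re b <= Re l + e.
  move=> e0; have [K1 hK1] := dl e e0; pose K := maxn K0 K1.
  have h1 := le_trans (al K) (hK1 K (leq_maxr _ _)).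
  have := ba K (leq_maxl _ _); rewrite lecE => /andP[/eqP eI h2].
  have h3 := le_trans (Im_le_normc _) h1; have h4 := le_trans (Re_le_normc _) h1.
  split; first by move: h3; rewrite ImD ImN eI distrC.
  move: h4; rewrite ReD ReN ler_norml => /andP[_ h4]; lra.
rewrite lecE; apply/andP; split; last by apply/ler_addgt0Pr => e /H[].
rewrite -subr_eq0 -normr_le0; apply/ler_addgt0Pr => e /H[]; by rewrite add0r.
Qed.

Lemma geom_small (y D : R) : 0 < y -> 0 <= D ->
  forall e, 0 < e -> exists K0, forall K, (K0 <= K)%N -> D * ((1 + K%:R) * expR (- y) ^+ K) <= e.
Proof.
move=> y0 D0 e e0; exists (Num.bound (D * 4 / y ^+ 2 / e)).+1 => K hK.
have K1 : 1 <= K%:R :> R by rewrite ler1n (leq_trans _ hK).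
have hK' : D * 4 / y ^+ 2 / e <= K%:R.
  apply: ltW; apply: lt_le_trans (archi_boundP _) _; last by rewrite ler_nat ltnW.
  by rewrite !mulr_ge0 ?invr_ge0 ?sqr_ge0 // ltW.
have K0 : 0 < K%:R :> R by exact: lt_le_trans K1.
have y2 : 0 < y ^+ 2 by rewrite exprn_gt0.
have e1 : expR (- y) ^+ K <= 2 / (K%:R * y) ^+ 2.
  rewrite -expRM_natl mulrN expRN -[2 / _]invrK lef_pV2 ?posrE ?expR_gt0 ?invr_gt0 ?divr_gt0 ?exprn_gt0 ?mulr_gt0 //.
  have := @expR_ge1Dxn R (K%:R * y) 1; rewrite mulr_ge0 ?(ltW y0) // => /(_ isT).
  have -> : 2`!%:R = 2 :> R by [].
  move=> h; rewrite invf_div; apply: le_trans h.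
  by rewrite lerDr.
apply: (@le_trans _ _ (D * ((K%:R + K%:R) * (2 / (K%:R * y) ^+ 2)))).
  rewrite ler_wpM2l //; apply: ler_pM; rewrite ?addr_ge0 ?exprn_ge0 ?expR_ge0 // ?lerD2r //.
have -> : D * ((K%:R + K%:R) * (2 / (K%:R * y) ^+ 2)) = D * 4 / y ^+ 2 / K%:R.
  by field; rewrite !gt_eqF.
by rewrite ler_pdivrMr // (mulrC e) -ler_pdivrMr.
Qed.

Definition enorm (l : 'rV[R]_n) : R := \sum_i `|l 0 i|.
Lemma enorm_ge0 l : 0 <= enorm l. Proof. exact: sumr_ge0. Qed.
Lemma enormD l l' : enorm (l + l') <= enorm l + enorm l'.
Proof. by rewrite -big_split; apply: ler_sum => i _; rewrite mxE ler_normD. Qed.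
Lemma enormZ a l : enorm (a *: l) = `|a| * enorm l.
Proof. by rewrite /enorm mulr_sumr; apply: eq_bigr => i _; rewrite mxE normrM. Qed.

Definition zM (t : R) M l (x : V) : C :=
  (expR (- (t / M.+1%:R)))%:C * cis (ev (M.+1%:R^-1 *: l) x).
(** With [N = M.+1] the number [zM] is [exp(-(t - i l)/N)], so [FM] is [(N (1 - zM))^(-s)] and tends
    to [(t - i l)^(-s)]. Its binomial expansion is a Riemann sum for the Gamma integral of
    [r^(s-1) exp(-r (t - i l))]: a positive combination of the characters of frequency [(k/N) l]. *)
Definition FM (t : R) M l (x : V) : C :=
  (M.+1%:R `^ (- s))%:C * cpow (1 - zM t M l x) (- s).

Lemma cisX (y : R) k : cis y ^+ k = cis (k%:R * y).
Proof.
elim: k => [|k IH]; first by rewrite mul0r cis0.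
by rewrite exprS IH -cisD -nat1r mulrDl mul1r.
Qed.

Lemma zM_pow t M l x k : zM t M l x ^+ k =
  (expR (- (k%:R * (t / M.+1%:R))))%:C * cis (ev ((k%:R / M.+1%:R) *: l) x).
Proof.
rewrite exprMn cisX -rmorphXn /= -expRM_natl mulrN; congr (_ * cis _).
by rewrite !evZl mulrA.
Qed.

Lemma normc_zM t M l x : normc (zM t M l x) = expR (- (t / M.+1%:R)).
Proof. by rewrite normcM normc_cis mulr1 normc_real ger0_norm ?expR_ge0. Qed.

Lemma zM_rate (t : R) M : 0 < t -> expR (- (t / M.+1%:R)) < 1.
Proof. by move=> t0; rewrite expR_lt1 oppr_lt0 divr_gt0. Qed.

Lemma Re1BzM t M l x : 1 - expR (- (t / M.+1%:R)) <= Re (1 - zM t M l x).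
Proof.
have := Re_le_normc (zM t M l x); rewrite normc_zM ler_norml => /andP[_ h].
by rewrite ReD ReN /= lerD2l lerN2.
Qed.

Lemma normc1BzM t M l x : 1 - expR (- (t / M.+1%:R)) <= normc (1 - zM t M l x).
Proof. exact: le_trans (Re1BzM t M l x) (le_trans (ler_norm _) (Re_le_normc _)). Qed.

Lemma normc_cpow1BzM (t : R) M l x : 0 < t ->
  normc (cpow (1 - zM t M l x) (- s)) <= (1 - expR (- (t / M.+1%:R))) `^ (- s).
Proof.
move=> t0; have /andP[s0 _] := s01; rewrite normc_cpow powR_le_neg ?(ltW s0) //.
  by rewrite subr_gt0 zM_rate.
exact: normc1BzM.
Qed.

Lemma grow_zM t M l : grow (zM t M l).
Proof. exact: (growM (grow_cst _ _) (grow_cis _)). Qed.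

Lemma grow_bounded (f : V -> C) B : (forall x, normc (f x) <= B) -> grow f.
Proof.
move=> h; exists B, 0%N; split=> [|x]; first exact: le_trans (normc_ge0 _) (h 0).
by rewrite /wt mul0r expR0 mulr1.
Qed.

Lemma grow_FM (t : R) M l : 0 < t -> grow (FM t M l).
Proof.
by move=> t0; apply: growM (grow_cst _ _) (grow_bounded (fun x => normc_cpow1BzM M l x t0)).
Qed.

Lemma grow_bsum K t M l : grow (fun x => bsum K (zM t M l x)).
Proof.
apply: grow_sum => k _; apply: (growM (grow_cst _ _)).
elim: (k : nat) => [|j IH]; first exact: (grow_cst _ 1).
have := growM (grow_zM t M l) IH; congr grow; apply/funext => x; by rewrite exprS.
Qed.

Definition positive_type (G : V -> C) :=
  grow G /\ forall e, 0 <= mu (fun x => G x * cis (ev e x)).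
Definition lower_bound (G : V -> C) (r c : R) :=
  forall e, enorm e <= r -> c%:C <= mu (fun x => G x * cis (ev e x)).

Lemma mu_bsum (t : R) M l G e K : grow G ->
  mu (fun x => (M.+1%:R `^ (- s))%:C * bsum K (zM t M l x) * G x * cis (ev e x)) =
  \sum_(k < K.+1) (M.+1%:R `^ (- s) * (bcoef k * expR (- (k%:R * (t / M.+1%:R)))))%:C *
    mu (fun x => G x * cis (ev (e + (k%:R / M.+1%:R) *: l) x)).
Proof.
move=> gG.
have gGc e' : grow (fun x => G x * cis (ev e' x)) by exact: growM gG (grow_cis _).
transitivity (mu (fun x => \sum_(k < K.+1)
   (M.+1%:R `^ (- s) * (bcoef k * expR (- (k%:R * (t / M.+1%:R)))))%:C *
   (G x * cis (ev (e + (k%:R / M.+1%:R) *: l) x)))).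
  apply: eq_mu => x; rewrite mulr_sumr !mulr_suml; apply: eq_bigr => k _.
  by rewrite zM_pow evDl cisD !rcM; ring.
rewrite mu_sum => [|k _]; last exact: growM (grow_cst _ _) (gGc _).
by apply: eq_bigr => k _; rewrite muZ.
Qed.

(** For fixed [M] the series converges geometrically and uniformly in [x], since [|zM|] is a
    constant below 1; an estimate depending on [x] only through the growth of [G] can therefore be
    integrated. *)
Lemma mu_bsum_approx (t : R) M l G e : 0 < t -> grow G -> exists2 D, 0 <= D & forall K,
  normc (mu (fun x => (M.+1%:R `^ (- s))%:C * bsum K (zM t M l x) * G x * cis (ev e x)) -
         mu (fun x => FM t M l x * G x * cis (ev e x))) <=
  D * ((1 + K%:R) * expR (- (t / M.+1%:R)) ^+ K).
Proof.
move=> t0 gG; have [B [k [B0 hB]]] := gG.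
set r := expR _; set m := M.+1%:R `^ (- s).
have m0 : 0 <= m by exact: powR_ge0.
exists (2 * (m * (1 - r) `^ (- s) * 2 * (1 - r) `^ (s - 1) * B * wtmean u k)).
  by rewrite !mulr_ge0 ?powR_ge0 ?wtmean_ge0.
move=> K.
have g1 : grow (fun x => (M.+1%:R `^ (- s))%:C * bsum K (zM t M l x) * G x * cis (ev e x)).
  exact: (growM (growM (growM (grow_cst _ _) (grow_bsum K t M l)) gG) (grow_cis _)).
have g2 : grow (fun x => FM t M l x * G x * cis (ev e x)).
  exact: (growM (growM (grow_FM M l t0) gG) (grow_cis _)).
rewrite -[X in _ + X]mulN1r -(muZ _ _ g2) -muD //; last exact: (growM (grow_cst _ (-1)) g2).
have := @mu_bound R n A u (fun x => m%:C * bsum K (zM t M l x) * G x * cis (ev e x) +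
   -1 * (FM t M l x * G x * cis (ev e x)))
   (m * (1 - r) `^ (- s) * (2 * ((1 - r) `^ (s - 1) * ((1 + K%:R) * r ^+ K))) * B) k.
move=> H; apply: le_trans (H _) _; last first.
  rewrite le_eqVlt; apply/orP; left; apply/eqP; ring.
move=> x; set z := zM t M l x.
have z0 : 1 - z != 0.
  rewrite -normc_gt0; apply: lt_le_trans (normc1BzM t M l x).
  by rewrite subr_gt0 zM_rate.
have -> : m%:C * bsum K z * G x * cis (ev e x) + -1 * (FM t M l x * G x * cis (ev e x)) =
   m%:C * cpow (1 - z) (- s) * (bsum K z * cpow (1 - z) s - 1) * G x * cis (ev e x).
  have c1 : cpow (1 - z) (- s) * cpow (1 - z) s = 1 by rewrite -cpowD // addNr cpow0.
  rewrite /FM -/m -/z.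
  transitivity (m%:C * (bsum K z * (cpow (1 - z) (- s) * cpow (1 - z) s) - cpow (1 - z) (- s)) *
    G x * cis (ev e x)); last by move: (cpow _ _) (cpow _ _); move=> ? ?; ring.
  by rewrite c1; move: (cpow _ _); move=> ?; ring.
rewrite (normcM _ (cis _)) normc_cis mulr1 (normcM _ (G x)).
rewrite (normcM _ (_ - 1)) (normcM m%:C) normc_real (ger0_norm m0).
apply: (@le_trans _ _ ((m * (1 - r) `^ (- s) * (2 * ((1 - r) `^ (s - 1) * ((1 + K%:R) * r ^+ K)))) * (B * wt k x))); last by rewrite [leLHS]mulrA.
apply: ler_pM; rewrite ?mulr_ge0 ?normc_ge0 //.
apply: ler_pM; rewrite ?mulr_ge0 ?normc_ge0 //.
  by rewrite ler_wpM2l // normc_cpow1BzM.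
by apply: bsum_trunc => //; [rewrite normc_zM|exact: zM_rate].
Qed.

Lemma FM_limit (t : R) M l G e b : 0 < t -> grow G ->
  (exists K0, forall K, (K0 <= K)%N -> b <= mu (fun x =>
     (M.+1%:R `^ (- s))%:C * bsum K (zM t M l x) * G x * cis (ev e x))) ->
  b <= mu (fun x => FM t M l x * G x * cis (ev e x)).
Proof.
move=> t0 gG h; have [D D0 hD] := mu_bsum_approx M l e t0 gG.
apply: (le_limC (d := fun K => D * ((1 + K%:R) * expR (- (t / M.+1%:R)) ^+ K))) hD h.
by apply: geom_small => //; rewrite divr_gt0.
Qed.

(** Multiplying by a partial sum of the series shifts frequencies and takes positive combinations;
    the truncation error then tends to 0 for fixed [M]. *)
Lemma FM_positive_type (t : R) M l G : 0 < t -> positive_type G ->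
  positive_type (fun x => FM t M l x * G x).
Proof.
move=> t0 [gG pG]; split=> [|e]; first exact: growM (grow_FM M l t0) gG.
apply: FM_limit => //; exists 0%N => K _; rewrite mu_bsum //.
apply: sumr_ge0 => k _; rewrite mulr_ge0 // ler0c mulr_ge0 ?powR_ge0 //.
by rewrite mulr_ge0 ?expR_ge0 // ltW // bcoef_gt0.
Qed.

(** All terms are nonnegative, so it is enough to keep the [M.+1] indices from [M.+1] on. Their
    frequencies are at most [2 l], whence the loss [2 * enorm l] in the radius, and each contributes
    at least [c (s/2) exp(-2T) / M.+1]. The result depends on [T] but neither on [t] nor on [M]. *)
Lemma FM_lower_bound (t T : R) M l G r c : 0 < t <= T -> positive_type G -> 0 <= c ->
  lower_bound G (r + 2 * enorm l) c ->
  lower_bound (fun x => FM t M l x * G x) r (c * (s / 2) * expR (- (2 * T))).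
Proof.
move=> /andP[t0 tT] [gG pG] c0 lG e er; have /andP[s0 s1] := s01.
apply: FM_limit => //; exists (M.+1 + M.+1)%N => K hK; rewrite mu_bsum //.
set N := M.+1%:R : R; have N0 : 0 < N by [].
set w := fun k : nat => (N `^ (- s) * (bcoef k * expR (- (k%:R * (t / N)))))%:C *
    mu (fun x => G x * cis (ev (e + (k%:R / N) *: l) x)).
have w0 k : 0 <= w k.
  rewrite mulr_ge0 // ler0c mulr_ge0 ?powR_ge0 //.
  by rewrite mulr_ge0 ?expR_ge0 // ltW // bcoef_gt0.
have big k : (M < k <= M.+1 + M.+1)%N ->
    (c * (s / 2) * expR (- (2 * T)) / N)%:C <= w k.
  move=> /andP[k1 k2].
  have kN : k%:R / N <= 2.
    by rewrite ler_pdivrMr // /N -natrM ler_nat mul2n -addnn.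
  have kN0 : 0 <= k%:R / N by rewrite divr_ge0 ?ler0n // ltW.
  rewrite /w; apply: (@le_trans _ _ ((N `^ (- s) * (bcoef k * expR (- (k%:R * (t / N)))))%:C * c%:C)); last first.
    apply: ler_wpM2l; first by rewrite ler0c mulr_ge0 ?powR_ge0 // mulr_ge0 ?expR_ge0 // ltW // bcoef_gt0.
    apply: lG; apply: le_trans (enormD _ _) _; apply: lerD => //.
    by rewrite enormZ ger0_norm // ler_wpM2r ?enorm_ge0.
  rewrite -rcM lecR.
  have e1 : expR (- (2 * T)) <= expR (- (k%:R * (t / N))).
    rewrite ler_expR lerN2 mulrCA mulrC; apply: ler_pM => //; exact: ltW.
  (* For [k <= 2N] the coefficient is at least [s (2N)^(s-1)], and [2^(s-1) >= 1/2]. *)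
  have e2 : (s / 2) / N <= N `^ (- s) * bcoef k.
    case: k k1 k2 {kN kN0 e1} => // k k1 k2.
    apply: (@le_trans _ _ (N `^ (- s) * (s * k.+1%:R `^ (s - 1)))); last first.
      by rewrite ler_wpM2l ?powR_ge0 // bcoef_ge.
    have h : (2 * N) `^ (s - 1) <= k.+1%:R `^ (s - 1).
      rewrite -[s - 1]opprK; apply: powR_le_neg => //; last by lra.
      by rewrite /N -natrM ler_nat mul2n -addnn.
    apply: (@le_trans _ _ (N `^ (- s) * (s * (2 * N) `^ (s - 1)))); last first.
      by rewrite !ler_wpM2l ?powR_ge0 // ltW.
    rewrite powRM ?(ltW N0) //.
    have -> : N `^ (- s) * (s * (2 `^ (s - 1) * N `^ (s - 1))) = s * 2 `^ (s - 1) * (N `^ (- s) * N `^ (s - 1)).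
      by ring.
    rewrite -powRD; last by apply/implyP => _; rewrite gt_eqF.
    have -> : - s + (s - 1) = -1 by ring.
    rewrite powR_inv1 ?(ltW N0) // ler_wpM2r ?invr_ge0 ?(ltW N0) // ler_wpM2l ?(ltW s0) //.
    rewrite -[2^-1]powR_inv1 //; apply: ler_powR; [by rewrite ler1n|lra].
  have -> : c * (s / 2) * expR (- (2 * T)) / N = (s / 2 / N) * expR (- (2 * T)) * c by ring.
  rewrite ler_wpM2r // mulrA; apply: ler_pM => //; last exact: expR_ge0.
  by rewrite !mulr_ge0 ?invr_ge0 ?(ltW s0) ?(ltW N0).
rewrite -(big_mkord xpredT w).
rewrite (big_cat_nat (n := M.+1)) //=; last first.
  by apply: leq_trans (leqW hK); rewrite leq_addr.
rewrite [X in _ + X](big_cat_nat (n := (M.+1 + M.+1)%N)) //=; last 2 first.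
- by rewrite leq_addr.
- exact: leqW.
apply: (@le_trans _ _ (0 + (\sum_(M.+1 <= k < M.+1 + M.+1) w k + 0))); last first.
  by apply: lerD; [|apply: lerD => //]; apply: sumr_ge0.
rewrite add0r addr0.
apply: (@le_trans _ _ (\sum_(M.+1 <= k < M.+1 + M.+1) (c * (s / 2) * expR (- (2 * T)) / N)%:C)).
  rewrite big_const_nat addnK iter_addr_0 -[_%:C *+ _]mulr_natr -(rmorph_nat (real_complex R)) -rcM.
  by rewrite divfK ?gt_eqF.
rewrite big_nat_cond [X in _ <= X]big_nat_cond; apply: ler_sum => k /andP[/andP[k1 k2] _].
by apply: big; rewrite k1 ltnW.
Qed.

End Pos2.
End Pos2.

(** * Removing the discretisation: positivity for products of negative powers *)

Module Pos3.
From mathcomp Require Import all_boot all_order all_algebra.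
From mathcomp Require Import boolp reals complex.
From mathcomp Require Import classical_sets functions set_interval filter topology normedtype sequences derive realfun exp trigo.
From mathcomp Require Import ring lra.
Set Implicit Arguments.
Unset Strict Implicit.
Unset Printing Implicit Defensive.
Import Order.TTheory GRing.Theory Num.Theory numFieldNormedType.Exports ComplexField.
Local Open Scope classical_set_scope.
Local Open Scope ring_scope.
Local Open Scope complex_scope.
Import Cpow Cpow2 Ulim Mu Mu2 Mu3 Tame PosSeries Pos2.
Section Pos3.
Variables (R : realType) (n : nat) (A : finType) (u : A -> 'cV[R]_n) (s : R).
Hypothesis s01 : 0 < s < 1.
Notation C := R[i].
Local Notation Re := (@complex.Re R).
Local Notation Im := (@complex.Im R).
Notation normc := (@Normc.normc R).
Notation V := 'cV[R]_n.
Local Notation mu := (mu u).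
Local Notation FM := (FM s).

(** Since [mu] is an ultrafilter limit, exchanging it with another limit rests on weighted uniform
    bounds; the rate [1 / M.+1] passes directly to the values of [mu]. *)
Definition converges (g : nat -> V -> C) (h : V -> C) :=
  grow h /\ exists B k, 0 <= B /\ forall M x, normc (g M x - h x) <= B / M.+1%:R * wt k x.

Lemma converges_cst h : grow h -> converges (fun=> h) h.
Proof.
move=> gh; split=> //; exists 0, 0%N; split=> // M x.
by rewrite subrr Normc.normc0 !mul0r.
Qed.

Lemma convergesM g h g' h' : converges g h -> converges g' h' ->
  converges (fun M x => g M x * g' M x) (fun x => h x * h' x).
Proof.
move=> [gh [B [k [B0 c]]]] [gh' [B' [k' [B0' c']]]]; split; first exact: growM.
have [D [j [D0 hD]]] := gh; have [D' [j' [D0' hD']]] := gh'.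
exists (B * B' + B * D' + D * B'), (k + k' + (k + j' + (j + k')))%N.
split=> [|M x]; first by rewrite !addr_ge0 ?mulr_ge0.
have N1 : M.+1%:R^-1 <= 1 :> R by rewrite invf_le1 // ler1n.
have N0 : 0 < M.+1%:R^-1 :> R by rewrite invr_gt0.
move: (M.+1%:R^-1) N0 N1 (c M x) (c' M x) => N N0 N1 cx cx'.
have -> : g M x * g' M x - h x * h' x =
   (g M x - h x) * (g' M x - h' x) + (g M x - h x) * h' x + h x * (g' M x - h' x) by ring.
set W := wt _ x.
have W1 : wt k x * wt k' x <= W by rewrite -wtD wt_le // leq_addr.
have W2 : wt k x * wt j' x <= W.
  by rewrite -wtD wt_le //; apply: leq_trans (leq_addl _ _); exact: leq_addr.
have W3 : wt j x * wt k' x <= W.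
  by rewrite -wtD wt_le //; apply: leq_trans (leq_addl _ _); exact: leq_addl.
apply: (@le_trans _ _ (B * B' * N * W + B * D' * N * W + D * B' * N * W)); last first.
  by rewrite -!mulrDl.
have n0 := @normc_ge0 R; have w0 j0 := @wt_gt0 R n j0 x.
have hDx := hD x; have hDx' := hD' x.
apply: le_trans (normcD _ _) _; apply: lerD; last first.
  rewrite normcM; apply: (@le_trans _ _ ((D * wt j x) * (B' * N * wt k' x))).
    by apply: ler_pM.
  rewrite (_ : _ * _ = D * B' * N * (wt j x * wt k' x)); last by ring.
  by rewrite ler_wpM2l // !mulr_ge0 // ltW.
apply: le_trans (normcD _ _) _; apply: lerD; last first.
  rewrite normcM; apply: (@le_trans _ _ ((B * N * wt k x) * (D' * wt j' x))).
    by apply: ler_pM.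
  rewrite (_ : _ * _ = B * D' * N * (wt k x * wt j' x)); last by ring.
  by rewrite ler_wpM2l // !mulr_ge0 // ltW.
rewrite normcM; apply: (@le_trans _ _ ((B * N * wt k x) * (B' * N * wt k' x))).
  by apply: ler_pM.
apply: (@le_trans _ _ (B * B' * N * (wt k x * wt k' x) * 1)).
  rewrite (_ : _ * _ = B * B' * N * (wt k x * wt k' x) * N); last by ring.
  by rewrite ler_wpM2l // !mulr_ge0 // ltW.
by rewrite mulr1 ler_wpM2l // !mulr_ge0 // ltW.
Qed.

Lemma converges_mu_ge g h b : (forall M, grow (g M)) -> converges g h ->
  (forall M, b <= mu (g M)) -> b <= mu h.
Proof.
move=> gg [gh [B [k [B0 c]]]] hb; set D := 2 * (B * wtmean u k).
have D0 : 0 <= D by rewrite !mulr_ge0 ?wtmean_ge0.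
apply: (le_limC (a := fun M => mu (g M)) (d := fun K => D / K.+1%:R)).
- move=> e e0; exists (Num.bound (D / e)) => K hK.
  rewrite ler_pdivrMr // mulrC -ler_pdivrMr //.
  apply: ltW; apply: lt_le_trans (archi_boundP _) _; first by rewrite divr_ge0 // ltW.
  by rewrite ler_nat ltnW.
- move=> K; rewrite -[X in _ + X]mulN1r -(muZ _ _ gh) -muD //; last exact: (growM (grow_cst _ (-1)) gh).
  have := @mu_bound R n A u (fun x => g K x + -1 * h x) (B / K.+1%:R) k.
  move=> H; apply: le_trans (H _) _; last first.
    by rewrite /D le_eqVlt; apply/orP; left; apply/eqP; ring.
  by move=> x; rewrite mulN1r.
- by exists 0%N.
Qed.

Lemma derC_exp_cis (p q h : R) : derC (fun y : R => (expR (p * y))%:C * cis (q * y))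
  ((p +i* q) * ((expR (p * h))%:C * cis (q * h))) h.
Proof.
have dl : is_derive h 1 (fun y => p * y) p.
  by apply: (is_derive_congr (is_derive_cmul p (is_derive_id h 1))); rewrite ?mulr1.
have de : derC (fun y : R => (expR (p * y))%:C) ((expR (p * h) * p)%:C) h.
  split; last exact: is_derive_cst.
  exact: (@is_derive_comp1 R (@expR R) (fun y => p * y) h _ _ (is_derive_expR _) dl).
apply: derC_eq (derCM de (derC_cis q h)) _.
have -> : (p +i* q) = p%:C + (0 +i* q) by apply: eqC => /=; ring.
by rewrite rcM; ring.
Qed.

(** Put [a = N (1 - zM)] and [w = t - i l]. A second-order expansion of the exponential gives
    [|a - w| = O(|w|^2 / N)]. The segment from [w] to [a] stays in the half plane [Re >= sig], where
    the derivative of the power is bounded, so the mean value inequality applies. *)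
Lemma converges_FM (t : R) l : 0 < t ->
  converges (fun M x => FM t M l x) (fun x : V => cpow (wl t l x) (- s)).
Proof.
move=> t0; have /andP[s0 s1] := s01; split; first exact: grow_cpow.
have [k hk] := ev_wt 2 l.
(* A lower bound for [Re a] valid for every [N >= 1]: [N (1 - exp(-t/N)) >= t exp(-t/N) >= t
   exp(-t)]. *)
set sig := t * expR (- t).
have sig0 : 0 < sig by rewrite mulr_gt0 ?expR_gt0.
set c1 := s * sig `^ (- (s + 1)).
have c10 : 0 <= c1 by rewrite mulr_ge0 ?powR_ge0 // ltW.
exists (2 * (c1 * (4 * expR t * (1 + t) ^+ 2))), k; split.
  by do 3! apply: mulr_ge0 => //; [apply: mulr_ge0 => //; exact: expR_ge0|exact: sqr_ge0].
move=> M x; set N := M.+1%:R : R; have N0 : 0 < N by [].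
have N1 : 1 <= N by rewrite ler1n.
set z := zM t M l x; set w := wl t l x; set a := N%:C * (1 - z).
set y := ev l x.
have zE : z = (expR (- t / N * 1))%:C * cis (y / N * 1).
  by rewrite /z /zM evZl !mulr1 mulNr mulrC -/y mulrC [in RHS](mulrC y).
have wE : (- t / N +i* (y / N)) = - (N^-1%:C * w).
  by apply: eqC => /=; rewrite -/y; ring.
have w2 : normc w ^+ 2 <= (1 + t) ^+ 2 * wt k x.
  apply: (@le_trans _ _ (((1 + t) * expR `|y|) ^+ 2)).
    rewrite lerXn2r ?nnegrE ?normc_ge0 ?mulr_ge0 ?expR_ge0 ?addr_ge0 ?(ltW t0) //.
    by apply: normc_wl_le; exact: ltW.
  by rewrite exprMn ler_wpM2l ?sqr_ge0 // -expRM_natl hk.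
have aw : normc (a - w) <= 4 * expR t * normc w ^+ 2 / N.
  pose f (h : R) := (expR (- t / N * h))%:C * cis (y / N * h).
  pose i := - t / N +i* (y / N).
  have := @taylor1 R f (fun h => i * f h) (fun h => i * (i * f h)) ((normc w / N) ^+ 2 * expR t) 1.
  have f0 : f 0 = 1 by rewrite /f !mulr0 expR0 cis0 mulr1.
  have f1 : f 1 = z by rewrite zE.
  rewrite f0 f1 mulr1 expr1n rmorph1 mul1r mulr1 normr1 => H.
  have {}H : normc (z - 1 - i) <= 4 * ((normc w / N) ^+ 2 * expR t).
    apply: H => // [h|h|h h1].
    - exact: derC_exp_cis.
    - apply: derC_eq (derCM (derC_cst _ _) (derC_exp_cis _ _ _)) _.
      by rewrite mul0r add0r.
    rewrite mulrA normcM; apply: ler_pM; rewrite ?normc_ge0 //.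
      rewrite -expr2 normcX /i wE normcN normcM normc_real ger0_norm ?invr_ge0 ?(ltW N0) //.
      by rewrite mulrC.
    rewrite /f normcM normc_cis mulr1 normc_real ger0_norm ?expR_ge0 // ler_expR.
    apply: (@le_trans _ _ (`|t| * 1)); last by rewrite mulr1 gtr0_norm.
    apply: le_trans (ler_norm _) _; rewrite normrM; apply: ler_pM => //.
    rewrite normrM normrN ler_piMr // normrV ?unitfE ?gt_eqF // invf_le1 ?normr_gt0 ?gt_eqF //.
    by rewrite gtr0_norm.
  have -> : a - w = - N%:C * (z - 1 - i).
    have nv : N%:C * (N^-1%:C * w) = w by rewrite mulrA -rcM divff ?gt_eqF // mul1r.
    transitivity (N%:C * (1 - z) - N%:C * (N^-1%:C * w)); first by rewrite nv.
    by rewrite /i wE; move: (N^-1%:C * w) => v; ring.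
  rewrite normcM normcN normc_real gtr0_norm //.
  apply: le_trans (ler_wpM2l (ltW N0) H) _.
  have : N != 0 by rewrite gt_eqF.
  move: (N) (expR t) (normc w) => N' e' w' nN.
  by rewrite le_eqVlt; apply/orP; left; apply/eqP; field.
have FE : FM t M l x = cpow a (- s) by rewrite /a cpow_scale.
have sigt : sig <= t by rewrite /sig ler_piMr ?(ltW t0) // expR_le1 oppr_le0 ltW.
have Rea : sig <= Re a.
  have -> : Re a = N * Re (1 - z) by rewrite /a ReM -[Im N%:C]/0 mul0r subr0.
  apply: (@le_trans _ _ (N * (1 - expR (- (t / N))))); last first.
    by rewrite ler_wpM2l ?(ltW N0) // Re1BzM.
  have h1 := expR_ge1Dx (t / N); have h2 := expR_gt0 (t / N).
  have e1 : (t / N) * expR (- (t / N)) <= 1 - expR (- (t / N)).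
    have : (1 + t / N) / expR (t / N) <= 1 by rewrite ler_pdivrMr // mul1r.
    by rewrite expRN mulrDl mul1r lerBrDl.
  apply: (@le_trans _ _ (N * ((t / N) * expR (- (t / N))))); last by rewrite ler_wpM2l ?(ltW N0).
  have -> : N * ((t / N) * expR (- (t / N))) = t * expR (- (t / N)).
    by rewrite mulrA [N * _]mulrC divfK ?gt_eqF.
  by rewrite ler_wpM2l ?(ltW t0) // ler_expR lerN2 ler_pdivrMr // ler_peMr // ltW.
have ok h : 0 <= h <= 1 -> sig <= Re (w + h%:C * (a - w)).
  move=> /andP[h0 h1]; rewrite ReD ReM ReD ReN -[Im h%:C]/0 mul0r subr0 -[Re h%:C]/h -[Re w]/t.
  have -> : t + h * (Re a - t) = (1 - h) * t + h * Re a by ring.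
  apply: (@le_trans _ _ ((1 - h) * sig + h * sig)); first by rewrite -mulrDl subrK mul1r.
  by apply: lerD; rewrite ler_wpM2l // subr_ge0.
have ok2 h : 0 <= h <= 1 -> w + h%:C * (a - w) != 0 /\ 0 <= Re (w + h%:C * (a - w)).
  move=> h01; have := ok h h01 => e; split; last exact: le_trans (ltW sig0) e.
  by apply/eqP => e0; move: e; rewrite e0 /= leNgt sig0.
have := @MVTC R (fun h => cpow (w + h%:C * (a - w)) (- s))
  (fun h => (- s)%:C * cpow (w + h%:C * (a - w)) (- s - 1) * (a - w)) (c1 * normc (a - w)).
rewrite rmorph1 rmorph0 mul0r addr0 mul1r (addrC w (a - w)) subrK -FE => H.
apply: le_trans (H _ _) _ => [h h01|h h01|].
- by have [o1 o2] := ok2 h h01; exact: derC_cpow.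
- rewrite (normcM _ (a - w)) ler_wpM2r ?normc_ge0 // (normcM (- s)%:C) normc_cpow.
  rewrite normc_real normrN gtr0_norm // /c1 ler_wpM2l ?(ltW s0) //.
  have -> : - s - 1 = - (s + 1) by ring.
  apply: powR_le_neg => //; last by rewrite addr_ge0 // ltW.
  exact: le_trans (ok h h01) (le_trans (ler_norm _) (Re_le_normc _)).
apply: (@le_trans _ _ (2 * (c1 * (4 * expR t * ((1 + t) ^+ 2 * wt k x) / N)))).
  do 2! apply: ler_wpM2l => //; apply: le_trans aw _.
  by rewrite ler_wpM2r ?invr_ge0 ?(ltW N0) // ler_wpM2l // mulr_ge0 ?expR_ge0.
by rewrite le_eqVlt; apply/orP; left; apply/eqP; ring.
Qed.

Lemma mu_cis_lower (r : R) : exists2 c, 0 < c & lower_bound u (fun=> 1) r c.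
Proof.
exists (expR (- \sum_a (r * l1 (u a)) ^+ 2)); first exact: expR_gt0.
move=> e er; have -> : mu (fun x => 1 * cis (ev e x)) = mu (fun x => cis (ev e x)).
  by apply: eq_mu => x; rewrite mul1r.
apply: le_trans (mu_cis_ge u e).
rewrite lecR ler_expR lerN2; apply: ler_sum => a _.
rewrite -[leLHS]real_normK ?num_real //.
have h : `|ev e (u a)| <= r * l1 (u a).
  by apply: le_trans (ev_le_l1 _ _) _; rewrite ler_wpM2r ?l1_ge0.
by rewrite lerXn2r ?nnegrE // (le_trans _ h).
Qed.

(** The constant is chosen before [t], so it survives when the shifts tend to 0. Each factor
    enlarges the frequency range by [2 * enorm l], hence the induction on the list keeps the radius
    free. It is run on the discretised factors, and the limit is taken once at the end. *)
Theorem cpow_prod_positive (ls : seq 'rV[R]_n) (T r : R) : exists2 c, 0 < c &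
  forall (t : 'rV[R]_n -> R) e, (forall l, l \in ls -> 0 < t l <= T) -> enorm e <= r ->
   c%:C <= mu (fun x => (\prod_(l <- ls) cpow (wl (t l) l x) (- s)) * cis (ev e x)).
Proof.
have H : exists2 c, 0 < c & forall (t : 'rV[R]_n -> R) M, (forall l, l \in ls -> 0 < t l <= T) ->
   positive_type u (fun x => \prod_(l <- ls) FM (t l) M l x) /\
   lower_bound u (fun x => \prod_(l <- ls) FM (t l) M l x) r c.
  elim: ls r => [|l ls IH] r.
    have [c c0 hc] := mu_cis_lower r; exists c => // t M _.
    have -> : (fun x : V => \prod_(l <- [::]) FM (t l) M l x) = fun=> 1.
      by apply/funext => x; rewrite big_nil.
    split=> //; split=> [|e]; first exact: grow_cst.
    have [c' c'0 hc'] := mu_cis_lower (enorm e).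
    by apply: le_trans (hc' e (lexx _)); rewrite ler0c ltW.
  have [c c0 hc] := IH (r + 2 * enorm l).
  have /andP[s0 _] := s01.
  exists (c * (s / 2) * expR (- (2 * T))); first by rewrite !mulr_gt0 ?expR_gt0 ?invr_gt0.
  move=> t M ht.
  have [|pt lb] := hc t M; first by move=> l' l'ls; apply: ht; rewrite inE l'ls orbT.
  have -> : (fun x : V => \prod_(l <- l :: ls) FM (t l) M l x) =
     fun x => FM (t l) M l x * \prod_(l <- ls) FM (t l) M l x.
    by apply/funext => x; rewrite big_cons.
  have htl := ht l (mem_head _ _).
  split; first by apply: FM_positive_type => //; case/andP: htl.
  by apply: FM_lower_bound => //; exact: ltW.
have [c c0 hc] := H; exists c => // t e ht er.
have cv : converges (fun M x => \prod_(l <- ls) FM (t l) M l x)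
     (fun x => \prod_(l <- ls) cpow (wl (t l) l x) (- s)).
  elim: ls ht {H hc} => [|l ls IH] ht.
    have := converges_cst (@grow_cst R n 1).
    congr converges; first by apply/funext => M; apply/funext => x; rewrite big_nil.
    by apply/funext => x; rewrite big_nil.
  have /andP[t0 _] := ht l (mem_head _ _).
  have ht' l' : l' \in ls -> 0 < t l' <= T by move=> h; apply: ht; rewrite inE h orbT.
  have h := convergesM (converges_FM l t0) (IH ht').
  move: h; congr converges; first by apply/funext => M; apply/funext => x; rewrite big_cons.
  by apply/funext => x; rewrite big_cons.
apply: (converges_mu_ge _ (convergesM cv (converges_cst (grow_cis e)))).
  by move=> M; have [[gg _] _] := hc t M ht; exact: growM gg (grow_cis _).
by move=> M; have [_ lb] := hc t M ht; exact: lb.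
Qed.

End Pos3.
End Pos3.

(** * The weight on the shifted contour and integration by parts against it *)

Module Weight.
From mathcomp Require Import all_boot all_order all_algebra.
From mathcomp Require Import boolp reals complex.
From mathcomp Require Import classical_sets functions set_interval filter topology normedtype sequences derive realfun exp trigo.
From mathcomp Require Import ring lra.
Set Implicit Arguments.
Unset Strict Implicit.
Unset Printing Implicit Defensive.
Import Order.TTheory GRing.Theory Num.Theory numFieldNormedType.Exports ComplexField.
Local Open Scope classical_set_scope.
Local Open Scope ring_scope.
Local Open Scope complex_scope.
Import Cpow Cpow2 Ulim Mu Mu2 Mu3 Tame PosSeries Pos2 Pos3.
Section Weight.
Variables (R : realType) (n : nat) (A : finType) (u : A -> 'cV[R]_n).
Notation C := R[i].
Local Notation Re := (@complex.Re R).
Local Notation Im := (@complex.Im R).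
Notation normc := (@Normc.normc R).
Notation V := 'cV[R]_n.
Local Notation mu := (mu u).

(** Here [L] is the logarithmic derivative, so that products of factors become sums. *)
Definition ltame (f : V -> C) (L : A -> V -> C) := tame u f (fun a x => L a x * f x).

Lemma ltameM f L g K : ltame f L -> ltame g K ->
  ltame (fun x => f x * g x) (fun a x => L a x + K a x).
Proof.
by move=> hf hg; apply: (eq_tame (tameM hf hg)) => // a x; ring.
Qed.

Lemma ltame1 : ltame (fun=> 1) (fun _ _ => 0).
Proof. by apply: (eq_tame (tame_cst _ 1)) => // a x; rewrite mul0r. Qed.

Lemma ltame_prod (I : Type) (r : seq I) (f : I -> V -> C) L :
  (forall i, ltame (f i) (L i)) ->
  ltame (fun x => \prod_(i <- r) f i x) (fun a x => \sum_(i <- r) L i a x).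
Proof.
move=> h; elim: r => [|i r IH].
  by apply: (eq_tame ltame1) => [x|a x]; rewrite !big_nil ?mulr1.
by apply: (eq_tame (ltameM (h i) IH)) => [x|a x]; rewrite !big_cons.
Qed.

Definition lz (t : R) l (x : V) : C := ev l x +i* t.

Lemma lz_wl t l x : lz t l x = 'i%C * wl t l x.
Proof. by apply: eqC => /=; ring. Qed.

Lemma lz_neq0 t l (x : V) : t != 0 -> lz t l x != 0.
Proof. by move=> t0; apply/eqP => /(congr1 Im) /= e; rewrite e eqxx in t0. Qed.

Lemma wl_neq0 t l (x : V) : t != 0 -> wl t l x != 0.
Proof. by move=> t0; apply/eqP => /(congr1 Re) /= e; rewrite e eqxx in t0. Qed.

(** The constant [i] between [wl] and [lz] drops out of a logarithmic derivative, which leaves a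
    simple pole along the root. *)
Lemma ltame_cpow t l s : 0 < t ->
  ltame (fun x => cpow (wl t l x) s) (fun a x => s%:C * (ev l (u a))%:C / lz t l x).
Proof.
move=> t0; apply: (eq_tame (tame_cpow u l s t0)) => // a x.
have w0 := @wl_neq0 t l x (lt0r_neq0 t0).
have -> : cpow (wl t l x) s = wl t l x * cpow (wl t l x) (s - 1).
  by rewrite -cpowS ?subrK // ltW.
rewrite lz_wl invfM; set w := wl t l x in w0 *; set c := cpow _ _.
have i2 : 'i%C^-1 = - 'i%C :> C.
  by apply: (mulfI (x := 'i%C)); rewrite ?mulrN -?expr2 ?sqr_i ?opprK ?divff // eq_complex /= oner_eq0 andbF.
rewrite i2; have -> : (0 +i* (- ev l (u a))) = - ('i%C * (ev l (u a))%:C).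
  by apply: eqC => /=; ring.
move: (ev l _)%:C => e; field. exact: w0.
Qed.

Lemma ltame_cis l : ltame (fun x => cis (ev l x)) (fun a _ => 0 +i* ev l (u a)).
Proof. exact: tame_cis. Qed.

Lemma tame_lz t l : tame u (lz t l) (fun a _ => (ev l (u a))%:C).
Proof.
apply: (eq_tame (tameD (tame_ev u l) (tame_cst u (0 +i* t)))) => [x|a x].
  by apply: eqC => /=; ring.
by rewrite addr0.
Qed.

Lemma grow_lzV t l : 0 < t -> grow (fun x : V => (lz t l x)^-1).
Proof.
move=> t0; apply: (grow_bounded (B := t^-1)) => x.
rewrite Normc.normcV lef_pV2 ?posrE ?normc_gt0 ?lz_neq0 ?lt0r_neq0 //.
by have := Im_le_normc (lz t l x); rewrite /= gtr0_norm.
Qed.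

(** The squared power gives the exponent [-2c]. The character comes from the contour: replacing [x]
    by [x + i v] in the Gaussian density multiplies it, up to a constant, by [exp(-i <v, x>)], and
    [lam] is the covector dual to [v]. *)
Definition weight (I : Type) (r : seq I) (c : R) (t : I -> R) (l : I -> 'rV[R]_n) (lam : 'rV[R]_n)
  (x : V) : C := (\prod_(i <- r) cpow (wl (t i) (l i) x) (- c) ^+ 2) * cis (ev (- lam) x).

Section IBP.
Variables (I : Type) (r : seq I) (c : R) (t : I -> R) (l : I -> 'rV[R]_n) (lam : 'rV[R]_n).
Hypothesis t0 : forall i, 0 < t i.
Local Notation weight := (weight r c t l lam).

Lemma ltame_weight : ltame weight (fun a x =>
  (\sum_(i <- r) - (2 * c)%:C * (ev (l i) (u a))%:C / lz (t i) (l i) x) - 'i%C * (ev lam (u a))%:C).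
Proof.
have h i := ltameM (ltame_cpow (l i) (- c) (t0 i)) (ltame_cpow (l i) (- c) (t0 i)).
apply: (eq_tame (ltameM (ltame_prod r h) (ltame_cis (- lam)))) => [x|a x].
  by rewrite /Weight.weight /=; congr (_ * _); apply: eq_bigr => i _; rewrite expr2.
congr (_ * _).
congr (_ + _); first by apply: eq_bigr => i _; rewrite !rcN rcM (rmorph_nat (real_complex R)); ring.
have -> : ev (- lam) (u a) = - ev lam (u a) by rewrite /ev mulNmx mxE.
by apply: eqC => /=; ring.
Qed.

Lemma grow_weight : grow weight.
Proof. by have [] := ltame_weight. Qed.

(** Integration by parts yields derivatives of [f], poles from the powers, and a multiple of [i lam]
    from the character. The duality of [v] and [lam] makes the last one cancel the imaginary part of
    [lz]. *)
Theorem weight_ibp f df m (v : V) : tame u f df -> v = \sum_a ev lam (u a) *: u a ->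
  mu (fun x => lz (ev m v) m x * f x * weight x) =
  \sum_a (ev m (u a))%:C * mu (fun x => df a x * weight x) -
  \sum_(i <- r) (2 * c)%:C * (\sum_a ev m (u a) * ev (l i) (u a))%:C *
     mu (fun x => (lz (t i) (l i) x)^-1 * f x * weight x).
Proof.
move=> tf vE; have tw := ltame_weight.
have gf := tame_grow tf; have gw := grow_weight.
have gdf a := tame_dgrow a tf.
have gfw : grow (fun x => f x * weight x) by exact: growM.
have gI i : grow (fun x => (lz (t i) (l i) x)^-1 * f x * weight x).
  exact: growM (growM (grow_lzV _ (t0 i)) gf) gw.
have gdw a : grow (fun x => df a x * weight x) by exact: growM.
have -> : mu (fun x => lz (ev m v) m x * f x * weight x) =
   mu (fun x => (ev m x)%:C * (f x * weight x)) + 'i%C * (ev m v)%:C * mu (fun x => f x * weight x).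
  rewrite -(muZ u _ gfw) -muD; [|exact: growM (grow_ev _) gfw|exact: growM (grow_cst _ _) gfw].
  apply: eq_mu => x; have -> : lz (ev m v) m x = (ev m x)%:C + 'i%C * (ev m v)%:C.
    by apply: eqC => /=; ring.
  by ring.
rewrite (ibp m (tameM tf tw)).
have e a : mu (fun x => df a x * weight x +
    f x * (((\sum_(i <- r) - (2 * c)%:C * (ev (l i) (u a))%:C / lz (t i) (l i) x) - 'i%C * (ev lam (u a))%:C) * weight x)) =
  mu (fun x => df a x * weight x) +
   ((\sum_(i <- r) - (2 * c)%:C * (ev (l i) (u a))%:C * mu (fun x => (lz (t i) (l i) x)^-1 * f x * weight x))
    + - ('i%C * (ev lam (u a))%:C) * mu (fun x => f x * weight x)).
  have gs i : grow (fun x => - (2 * c)%:C * (ev (l i) (u a))%:C * ((lz (t i) (l i) x)^-1 * f x * weight x)).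
    exact: growM (grow_cst _ _) (gI i).
  rewrite -(muZ u _ gfw).
  under [X in _ = _ + (X + _)]eq_bigr => i _ do rewrite -(muZ u _ (gI i)).
  rewrite -(mu_sum u r (fun i _ => gs i)).
  have gS := grow_sum r (fun i (_ : true) => gs i).
  have gc : grow (fun x => - ('i%C * (ev lam (u a))%:C) * (f x * weight x)).
    exact: growM (grow_cst _ _) gfw.
  rewrite -(muD u gS gc) -(muD u (gdw a) (growD gS gc)).
  apply: eq_mu => x; congr (_ + _).
  have E (s y F w : C) : F * ((s - y) * w) = s * (F * w) + - y * (F * w) by ring.
  rewrite E mulr_suml; congr (_ + _).
  by apply: eq_bigr => i _; ring.
under eq_bigr => a _ do rewrite e !mulrDr.
rewrite !big_split /= -!addrA; congr (_ + _).
(* What must cancel: the imaginary shift of the linear form against the derivative of the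
   character. *)
rewrite [X in _ + X = _](_ : _ = 0) ?addr0.
  under eq_bigr => a _ do rewrite mulr_sumr.
  rewrite exchange_big /= -sumrN; apply: eq_bigr => i _.
  rewrite rmorph_sum /= mulr_sumr mulr_suml -sumrN; apply: eq_bigr => a _.
  by rewrite rcM; ring.
rewrite [X in (X)%:C](_ : ev m v = \sum_a ev lam (u a) * ev m (u a)); last first.
  by rewrite vE ev_sum; apply: eq_bigr => a _; rewrite evZ.
rewrite rmorph_sum /= mulr_sumr mulr_suml -big_split big1 //= => a _.
by rewrite rcM; ring.
Qed.
End IBP.

(** Integral powers of the squared factors lower [c]; a negative parameter makes the weight regular
    up to the real space. *)
Lemma weight_shift (I : Type) (r : seq I) c t (l : I -> 'rV[R]_n) lam k x : (forall i, 0 < t i) ->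
  (\prod_(i <- r) (wl (t i) (l i) x) ^+ 2) ^+ k * weight r c t l lam x =
  weight r (c - k%:R) t l lam x.
Proof.
move=> t0; rewrite /weight mulrA; congr (_ * _).
elim: r => [|i r IH]; first by rewrite !big_nil expr1n mulr1.
rewrite !big_cons -IH exprMn mulrACA; congr (_ * _).
rewrite -exprM mulnC exprM -exprMn; congr (_ ^+ 2).
have w0 := @wl_neq0 (t i) (l i) x (lt0r_neq0 (t0 i)).
have -> : - (c - k%:R) = - c + k%:R by ring.
elim: k {IH} => [|k IH]; first by rewrite expr0 mul1r addr0.
by rewrite exprS -mulrA IH -[k.+1%:R]natr1 addrA cpowS //; apply: ltW; exact: t0.
Qed.

End Weight.
End Weight.

(** * Letting the contour shift tend to zero *)

Module Bd.
From mathcomp Require Import all_boot all_order all_algebra.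
From mathcomp Require Import boolp reals complex.
From mathcomp Require Import classical_sets functions set_interval filter topology normedtype sequences derive realfun exp trigo.
From mathcomp Require Import ring lra.
Set Implicit Arguments.
Unset Strict Implicit.
Unset Printing Implicit Defensive.
Import Order.TTheory GRing.Theory Num.Theory numFieldNormedType.Exports ComplexField.
Local Open Scope classical_set_scope.
Local Open Scope ring_scope.
Local Open Scope complex_scope.
Import Cpow Cpow2 Ulim Mu Mu2 Mu3 Tame PosSeries Pos2 Pos3 Weight.
Section Bd.
Variables (R : realType) (n : nat) (A : finType) (u : A -> 'cV[R]_n).
Notation C := R[i].
Local Notation Re := (@complex.Re R).
Local Notation Im := (@complex.Im R).
Notation normc := (@Normc.normc R).
Notation V := 'cV[R]_n.
Local Notation mu := (mu u).

Lemma convergesD (g h g' h' : _) : @converges R n g h -> @converges R n g' h' ->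
  converges (fun M x => g M x + g' M x) (fun x => h x + h' x).
Proof.
move=> [gh [B [k [B0 c]]]] [gh' [B' [k' [B0' c']]]]; split; first exact: growD.
exists (B + B'), (k + k')%N; split=> [|M x]; first exact: addr_ge0.
have N0 : 0 <= M.+1%:R^-1 :> R by rewrite invr_ge0.
rewrite opprD addrACA; apply: le_trans (normcD _ _) _.
rewrite !mulrDl; apply: lerD.
  apply: le_trans (c M x) _; apply: ler_wpM2l; first exact: mulr_ge0.
  by rewrite wt_le // leq_addr.
apply: le_trans (c' M x) _; apply: ler_wpM2l; first exact: mulr_ge0.
by rewrite wt_le // leq_addl.
Qed.

Lemma converges_prod (I : Type) (r : seq I) (g : I -> nat -> V -> C) h :
  (forall i, converges (g i) (h i)) ->
  converges (fun M x => \prod_(i <- r) g i M x) (fun x => \prod_(i <- r) h i x).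
Proof.
move=> H; elim: r => [|i r IH].
  have -> : (fun M (x : V) => \prod_(i <- [::]) g i M x) = fun _ _ => 1.
    by apply/funext => M; apply/funext => x; rewrite big_nil.
  have -> : (fun x : V => \prod_(i <- [::]) h i x) = fun=> 1.
    by apply/funext => x; rewrite big_nil.
  by apply: converges_cst; exact: grow_cst.
have -> : (fun M (x : V) => \prod_(j <- i :: r) g j M x) = fun M x => g i M x * \prod_(j <- r) g j M x.
  by apply/funext => M; apply/funext => x; rewrite big_cons.
have -> : (fun x : V => \prod_(j <- i :: r) h j x) = fun x => h i x * \prod_(j <- r) h j x.
  by apply/funext => x; rewrite big_cons.
by apply: convergesM; [exact: H|exact: IH].
Qed.

Lemma converges_lim g h : (forall M, grow (g M)) -> converges g h ->
  exists2 D, 0 <= D & forall M, normc (mu (g M) - mu h) <= D / M.+1%:R.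
Proof.
move=> gg [gh [B [k [B0 c]]]]; exists (2 * (B * wtmean u k)).
  by rewrite !mulr_ge0 ?wtmean_ge0.
move=> K; rewrite -[X in _ + X]mulN1r -(muZ _ _ gh) -muD //; last exact: (growM (grow_cst _ (-1)) gh).
have H := @mu_bound R n A u (fun x => g K x + -1 * h x) (B / K.+1%:R) k.
apply: le_trans (H _) _; last first.
  by rewrite le_eqVlt; apply/orP; left; apply/eqP; ring.
by move=> x; rewrite mulN1r.
Qed.

Lemma archi_zero (y D : R) : 0 <= y -> (forall M, y <= D / M.+1%:R) -> y = 0.
Proof.
move=> y0 h; apply/eqP; case: eqVneq => // ny; exfalso.
have yp : 0 < y by rewrite lt_def ny.
have D0 : 0 <= D by have := h 0%N; rewrite divr1; exact: le_trans.
have := h (Num.bound (D / y)); rewrite ler_pdivlMr // mulrC -ler_pdivlMr //.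
apply/negP; rewrite -ltNge; apply: lt_le_trans (archi_boundP _) _; first by rewrite divr_ge0.
by rewrite ler_nat ltnW.
Qed.

Lemma normc_zero (z : C) : normc z = 0 -> z = 0.
Proof. by move/eqP; rewrite normc_eq0 => /eqP. Qed.

Lemma lim_zero g h : (forall M, grow (g M)) -> converges g h -> (forall M, mu (g M) = 0) -> mu h = 0.
Proof.
move=> gg ch g0; have [D _ hD] := converges_lim gg ch.
rewrite -[mu h]opprK; have -> : - mu h = 0; last by rewrite oppr0.
apply: normc_zero; apply: (archi_zero (D := D)); first exact: normc_ge0.
by move=> M; have := hD M; rewrite g0 sub0r.
Qed.

Lemma converges_lz t l : converges (fun M x => lz (M.+1%:R^-1 * t) l x) (fun x : V => (ev l x)%:C).
Proof.
split; first exact: grow_ev.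
exists `|t|, 0%N; split=> // M x.
have -> : lz (M.+1%:R^-1 * t) l x - (ev l x)%:C = 'i%C * (M.+1%:R^-1 * t)%:C.
  by apply: eqC => /=; ring.
rewrite normcM normc_real normrM ger0_norm ?invr_ge0 // mulrA mulrAC.
have -> : normc 'i%C = 1 by rewrite normcE2 /= expr0n add0r expr1n sqrtr1.
by rewrite mul1r /wt mul0r expR0 mulr1.
Qed.

Lemma converges_cis l : converges (fun M x => cis (ev (M.+1%:R^-1 *: l) x)) (fun _ : V => 1).
Proof.
split; first exact: grow_cst.
have [k hk] := @ev_wt R n 1 l.
exists 2, k; split=> // M x; rewrite evZl.
set y := M.+1%:R^-1 * ev l x.
have -> : cis y - 1 = cis (y * 1) - cis (y * 0) by rewrite mulr1 mulr0 cis0.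
have := MVTC (f := fun t => cis (y * t)) (f' := fun t => (0 +i* y) * cis (y * t)) (B := `|y|).
move=> /(_ (fun t _ => derC_cis y t)) H; apply: le_trans (H _) _.
  by move=> t _; rewrite normcM normc_cis mulr1 normcE2 /= expr0n add0r sqrtr_sqr.
rewrite /y normrM ger0_norm ?invr_ge0 // mulrA.
apply: ler_wpM2l; first by rewrite mulr_ge0 ?invr_ge0.
apply: le_trans (hk x); rewrite mul1r.
by have := expR_ge1Dx `|ev l x|; lra.
Qed.

Lemma cpow_wl0_bound l a : 1 <= a -> exists2 k, True & forall t T x, 0 <= t <= T ->
  normc (wl t l x : C) `^ (a - 1) <= (1 + T) `^ (a - 1) * wt k (x : V).
Proof.
move=> a1; have [k hk] := @ev_wt R n (a - 1) l; exists k => // t T x /andP[t0 tT].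
have a0 : 0 <= a - 1 by rewrite subr_ge0.
have T0 : 0 <= 1 + T by have := le_trans t0 tT; lra.
apply: (@le_trans _ _ (((1 + T) * expR `|ev l x|) `^ (a - 1))).
  apply: ge0_ler_powR => //; rewrite ?nnegrE ?normc_ge0 ?mulr_ge0 ?expR_ge0 //.
  apply: le_trans (normc_wl_le _ _ t0) _; apply: ler_wpM2r; first exact: expR_ge0.
  by rewrite lerD2l.
rewrite powRM ?expR_ge0 //; apply: ler_wpM2l; first exact: powR_ge0.
by apply: le_trans (hk x); rewrite -expRM mulrC.
Qed.

Lemma grow_cpow0 l a : 1 <= a -> grow (fun x : V => cpow (wl 0 l x) a).
Proof.
move=> a1; have [k _ hk] := cpow_wl0_bound l a1; have [k' hk'] := @ev_wt R n 1 l.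
exists 1, (k + k')%N; split=> // x; rewrite normc_cpow mul1r.
have h0 : 0 <= (0 : R) <= 0 by rewrite lexx.
have := hk 0 0 x h0; rewrite addr0 powR1 mul1r => h.
have [n0|n0] := eqVneq (normc (wl 0 l x)) 0.
  rewrite n0 powR0 ?ltW ?wt_gt0 //; apply/eqP => a0; move: a1; rewrite a0; lra.
have -> : normc (wl 0 l x) `^ a = normc (wl 0 l x) `^ (a - 1) * normc (wl 0 l x).
  rewrite -{3}[normc _]powRr1 ?normc_ge0 // -powRD ?subrK // n0 implybT //.
rewrite wtD; apply: ler_pM => //; rewrite ?powR_ge0 ?normc_ge0 //.
apply: le_trans (normc_wl_le _ _ (lexx 0)) _; rewrite addr0 mul1r.
by apply: le_trans (hk' x); rewrite mul1r.
Qed.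

(** The condition [1 <= a] keeps the derivative [a z^(a-1)] bounded near 0, so the rate is uniform
    up to the wall. On the wall [l(x) = 0] the path runs into 0, where powers are not
    differentiated, and the real power is estimated directly. *)
Lemma converges_cpow t0 l a : 0 < t0 -> 1 <= a ->
  converges (fun M x => cpow (wl (M.+1%:R^-1 * t0) l x) a) (fun x : V => cpow (wl 0 l x) a).
Proof.
move=> t00 a1; split; first exact: grow_cpow0.
have [k _ hk] := cpow_wl0_bound l a1.
exists (2 * (a * ((1 + t0) `^ (a - 1) * t0))), k; split=> [|M x].
  by rewrite !mulr_ge0 ?powR_ge0 ?(ltW t00) //; lra.
have N0 : 0 < M.+1%:R^-1 :> R by rewrite invr_gt0.
have N1 : M.+1%:R^-1 <= 1 :> R by rewrite invf_le1 // ler1n.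
move: (M.+1%:R^-1) N0 N1 => N N0 N1.
set w := (N * t0); have w0 : 0 < w by exact: mulr_gt0.
have wt0 : w <= t0 by rewrite /w; nra.
have wlE (y : R) : wl 0 l x + y%:C * w%:C = wl (y * w) l x.
  by apply: eqC => /=; ring.
have bnd y : 0 <= y <= 1 -> normc (wl (y * w) l x) `^ (a - 1) <= (1 + t0) `^ (a - 1) * wt k x.
  by move=> /andP[y0 y1]; apply: hk; apply/andP; split; nra.
have goalE : 2 * (a * ((1 + t0) `^ (a - 1) * t0)) * N * wt k x =
     2 * (a * ((1 + t0) `^ (a - 1) * wt k x) * w) by rewrite /w; ring.
rewrite goalE; have [e0|e0] := eqVneq (ev l x) 0.
  have -> : wl w l x = w%:C by rewrite /wl e0 oppr0.
  have -> : wl 0 l x = 0 by rewrite /wl e0 oppr0.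
  have an0 : a != 0 by apply/eqP; lra.
  rewrite cpow_pos // /(cpow 0) Normc.normc0 powR0 // mul0r subr0 normc_real ger0_norm ?powR_ge0 //.
  have := bnd 1; rewrite mul1r; have -> : wl w l x = w%:C by rewrite /wl e0 oppr0.
  rewrite normc_real ger0_norm ?(ltW w0) //; rewrite ler01 lexx => /(_ isT).
  have -> : w `^ a = w `^ (a - 1) * w.
    rewrite -{3}[w]powRr1 ?(ltW w0) // -powRD ?subrK // (gt_eqF w0) implybT //.
  have := powR_ge0 w (a - 1); have := powR_ge0 (1 + t0) (a - 1); have := wt_gt0 k x.
  move: (w `^ _) ((1 + t0) `^ _) (wt k x) => X Y Z Z0 Y0 X0 h.
  have h2 : X * w <= (Y * Z) * w by rewrite ler_wpM2r // ltW.
  apply: le_trans h2 _; have : 0 <= Y * Z * w by rewrite !mulr_ge0 // ltW.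
  by move: (Y * Z * w) (mulrA a (Y * Z) w) => G; nra.
have nz (y : R) : wl y l x != 0.
  by apply/eqP => -[_ /eqP]; rewrite oppr_eq0 (negbTE e0).
have := MVTC (f := fun y => cpow (wl 0 l x + y%:C * w%:C) a)
   (f' := fun y => a%:C * cpow (wl 0 l x + y%:C * w%:C) (a - 1) * w%:C)
   (B := a * ((1 + t0) `^ (a - 1) * wt k x) * w).
rewrite !wlE mul1r mul0r; apply=> y y01.
  apply: derC_cpow; rewrite wlE //=; case/andP: y01 => y0 _; by rewrite mulr_ge0 ?(ltW w0).
rewrite wlE normcM normcM !normc_real normc_cpow [`|w|]ger0_norm ?(ltW w0) // [`|a|]ger0_norm; last by lra.
apply: ler_wpM2r; first exact: ltW.
by apply: ler_wpM2l; [lra|exact: bnd].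
Qed.

(** On the real space [wl] is [-i l(x)], of argument [-pi/2] or [pi/2] according to the sign of
    [l(x)]. Relative to the positive side, the negative side acquires the factor [cis (2 a pi)]:
    this is the origin of [zeta]. *)
Lemma cpow_wl0 l a (x : V) : 1 <= a -> cpow (wl 0 l x) a ^+ 2 =
  ((`|ev l x| `^ a) ^+ 2)%:C * (cis (- (a * pi)) * (if ev l x < 0 then cis (2 * (a * pi)) else 1)).
Proof.
move=> a1; have nE : normc (wl 0 l x) = `|ev l x| by rewrite normcE2 /= expr0n add0r sqrrN sqrtr_sqr.
have an0 : a != 0 by apply/eqP; lra.
have pC (t : R) : t%:C ^+ 2 = (t ^+ 2)%:C by rewrite !expr2 rcM.
rewrite /cpow nE exprMn pC; case: (ltgtP (ev l x) 0) => e0; last first.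
- by rewrite e0 normr0 powR0 // expr0n mul0r mul0r.
- have -> : arg (wl 0 l x) = - (pi / 2).
    rewrite /arg nE /= add0r gtr0_norm // mulNr divff ?gt_eqF // atanN atan1.
    by field.
  by rewrite mulr1 [cis _ ^+ 2]expr2 -cisD; congr (_ * cis _); field.
have -> : arg (wl 0 l x) = pi / 2.
  rewrite /arg nE /= add0r ltr0_norm // divff ?oppr_eq0 ?lt_eqF // atan1.
  by field.
by rewrite [cis _ ^+ 2]expr2 -!cisD; congr (_ * cis _); field.
Qed.
End Bd.
End Bd.

(** * Linear substitutions, directional derivatives and divided differences of polynomials *)

Module PolyAct.
From HB Require Import structures.
From mathcomp Require Import boolp reals complex mpoly.
From mathcomp Require Import ring.
Set Implicit Arguments.
Unset Strict Implicit.
Unset Printing Implicit Defensive.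
Import Order.TTheory GRing.Theory Num.Theory ComplexField.
Local Open Scope ring_scope.
Section PolyAct.
Variables (F : numFieldType) (n : nat).
Notation A := {mpoly F[n]}.
Implicit Types (p q : A) (l m : 'rV[F]_n) (y e : 'cV[F]_n) (M N : 'M[F]_n).

Lemma mpoly_lin_ind (P : A -> Prop) : (forall a, P a%:MP) ->
  (forall p q, P p -> P q -> P (p + q)) -> (forall i p, P p -> P ('X_i * p)) -> forall p, P p.
Proof.
move=> PC PD PX; apply: mpolyind; first by rewrite -(mpolyC0 n).
move=> c m p _ _ Pp; apply: PD => //; rewrite -mul_mpolyC mpolyXE_id.
elim: (index_enum _) => [|i r IH]; first by rewrite big_nil mulr1.
rewrite big_cons mulrCA; elim: (m i) => [|k IHk]; first by rewrite mul1r.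
by rewrite exprS -mulrA; exact: PX.
Qed.

Lemma mpolyC_inj : injective (@mpolyC n F).
Proof. by move=> a b /(congr1 (mcoeff 0%MM)); rewrite !mcoeffC eqxx !mulr1. Qed.

Definition lin l : A := \sum_j l 0 j *: 'X_j.

Lemma lin_coef l j : (lin l)@_U_(j) = l 0 j.
Proof.
rewrite raddf_sum /= (bigD1 j) //= mcoeffZ mcoeffX eqxx mulr1 big1 ?addr0 // => i ij.
by rewrite mcoeffZ mcoeffX eq_mnm1 (negbTE ij) mulr0.
Qed.

Fact lin_is_linear : linear lin.
Proof.
move=> a l m; rewrite scaler_sumr -big_split /=; apply: eq_bigr => j _.
by rewrite !mxE scalerDl scalerA.
Qed.
HB.instance Definition _ := GRing.isLinear.Build F 'rV[F]_n A _ lin lin_is_linear.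

Lemma lin_inj : injective lin.
Proof. by move=> l m e; apply/rowP => j; rewrite -!lin_coef e. Qed.

Lemma lin_eq0 l : (lin l == 0) = (l == 0).
Proof. by rewrite -(inj_eq lin_inj) linear0. Qed.

Lemma lin_delta i : lin (delta_mx 0 i) = 'X_i.
Proof.
rewrite /lin (bigD1 i) //= !mxE !eqxx scale1r big1 ?addr0 // => j ji.
by rewrite !mxE (negbTE ji) scale0r.
Qed.

Lemma lin_homog l : lin l \is 1.-homog.
Proof. by apply: rpred_sum => j _; rewrite rpredZ // dhomogX /= mdeg1. Qed.

Definition lins M : n.-tuple A := [tuple lin (row i M) | i < n].
Local Notation act M := (comp_mpoly (lins M)).

Lemma actXU M i : act M 'X_i = lin (row i M).
Proof. by rewrite comp_mpolyXU -tnth_nth tnth_mktuple. Qed.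

Lemma act_lin M l : act M (lin l) = lin (l *m M).
Proof.
rewrite linear_sum /=; under eq_bigr do rewrite linearZ /= actXU -linearZ.
by rewrite -linear_sum mulmx_sum_row.
Qed.

(** The order is reversed because [act M] is composition with [M] on the right; the group action
    below therefore substitutes the inverse. *)
Lemma actK M N p : act N (act M p) = act (M *m N) p.
Proof.
move: p; apply: mpoly_lin_ind => [a|p q hp hq|i p hp]; first by rewrite !comp_mpolyC.
  by rewrite !raddfD /= hp hq.
by rewrite !rmorphM /= hp !actXU act_lin row_mul.
Qed.

Lemma act1 p : act 1%:M p = p.
Proof.
move: p; apply: mpoly_lin_ind => [a|p q hp hq|i p hp]; first by rewrite !comp_mpolyC.
  by rewrite !raddfD /= hp hq.
by rewrite !rmorphM /= hp !actXU row1 lin_delta.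
Qed.

Lemma meval_lin v l : (lin l).@[v] = \sum_j l 0 j * v j.
Proof. by rewrite raddf_sum /=; apply: eq_bigr => j _; rewrite mevalZ mevalXU. Qed.

Lemma meval_act M p y : (act M p).@[fun i => y i 0] = p.@[fun i => (M *m y) i 0].
Proof.
rewrite comp_mpoly_meval; apply: meval_eq => i.
by rewrite tnth_mktuple meval_lin mxE; apply: eq_bigr => j _; rewrite mxE.
Qed.

Lemma homog_prod (I : Type) (r : seq I) (P : pred I) (f : I -> A) (d : I -> nat) :
  (forall i, P i -> f i \is (d i).-homog) ->
  \prod_(i <- r | P i) f i \is (\sum_(i <- r | P i) d i)%N.-homog.
Proof. by move=> h; apply: (big_rec2 (fun p k => p \is k.-homog)) => [|i k p Pi]; [exact: dhomog1|move/(dhomogM (h i Pi))]. Qed.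

Lemma act_homog M d p : p \is d.-homog -> act M p \is d.-homog.
Proof.
move=> hp; rewrite [p]mpolyE raddf_sum /= big_seq; apply: rpred_sum => m mp.
rewrite linearZ /= rpredZ // comp_mpolyX; have /eqP <- : mdeg m == d by rewrite (dhomog_mf hp).
rewrite mdegE; apply: homog_prod => i _; rewrite tnth_mktuple -{2}[m i]mul1n.
exact/dhomogMn/lin_homog.
Qed.

Lemma msize_homog d p : p \is d.-homog -> (msize p <= d.+1)%N.
Proof.
move=> hp; rewrite msizeE big_seq; apply/bigmax_leqP_seq => m mp _.
by rewrite (dhomog_mf hp).
Qed.

Lemma msize_sum_le (I : Type) (r : seq I) (P : pred I) (f : I -> A) k :
  (forall i, P i -> (msize (f i) <= k)%N) -> (msize (\sum_(i <- r | P i) f i) <= k)%N.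
Proof.
move=> h; elim/big_rec: _ => [|i p Pi hp]; first by rewrite msize0.
by apply: (leq_trans (msizeD_le _ _)); rewrite geq_max h.
Qed.

Lemma msize_act M p k : (msize p <= k)%N -> (msize (act M p) <= k)%N.
Proof.
move=> pk; rewrite (pihomog_partitionE pk) raddf_sum /=; apply: msize_sum_le => i _.
exact: leq_trans (msize_homog (act_homog _ (pihomogP _ _ _))) _.
Qed.

Definition pd y p : A := \sum_i y i 0 *: p^`M(i).

Fact pd_is_linear y : linear (pd y).
Proof.
move=> a p q; rewrite scaler_sumr -big_split /=; apply: eq_bigr => i _.
by rewrite linearP scalerDr !scalerA mulrC.
Qed.
HB.instance Definition _ y := GRing.isLinear.Build F A A _ (pd y) (pd_is_linear y).

Lemma pdD y y' p : pd (y + y') p = pd y p + pd y' p.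
Proof. by rewrite -big_split; apply: eq_bigr => i _; rewrite mxE scalerDl. Qed.

Lemma pdZ a y p : pd (a *: y) p = a *: pd y p.
Proof. by rewrite scaler_sumr; apply: eq_bigr => i _; rewrite mxE scalerA. Qed.

Lemma pdM y p q : pd y (p * q) = pd y p * q + p * pd y q.
Proof.
rewrite mulr_suml mulr_sumr -big_split /=; apply: eq_bigr => i _.
by rewrite mderivM scalerDr scalerAl scalerAr.
Qed.

Lemma pdC y a : pd y a%:MP = 0.
Proof. by rewrite /pd big1 // => i _; rewrite mderivC scaler0. Qed.

Lemma pd_lin y l : pd y (lin l) = ((l *m y) 0 0)%:MP.
Proof.
rewrite linear_sum /= mxE raddf_sum /=; apply: eq_bigr => j _; rewrite linearZ /=.
rewrite /pd (bigD1 j) //= big1 ?addr0 => [|i ij].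
  rewrite mderivX mnm1E eqxx scale1r -(_ : 0 = U_(j) - U_(j))%MM; last first.
    by apply/mnmP => k; rewrite mnmBE subnn mnm0E.
  by rewrite mpolyX0 scalerA -alg_mpolyC.
by rewrite mderivX mnm1E eq_sym (negbTE ij) scale0r scaler0.
Qed.

Lemma pd_act y M p : pd y (act M p) = act M (pd (M *m y) p).
Proof.
move: p; apply: mpoly_lin_ind => [a|p q hp hq|i p hp].
- by rewrite comp_mpolyC !pdC raddf0.
- by rewrite !raddfD /= hp hq.
rewrite rmorphM /= !pdM hp raddfD /= !rmorphM /= -lin_delta act_lin !pd_lin.
by rewrite comp_mpolyC mulmxA.
Qed.

Lemma msize_pd y p k : (msize p <= k.+1)%N -> (msize (pd y p) <= k)%N.
Proof.
move=> pk; apply: msize_sum_le => i _; apply: leq_trans (msizeZ_le _ _) _.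
rewrite msizeE; apply/bigmax_leqP_seq => m; rewrite mcoeff_msupp mcoeff_mderiv => h _.
have : (m + U_(i))%MM \in msupp p by rewrite mcoeff_msupp; apply: contra_neq h => ->; rewrite mul0rn.
by move/msize_mdeg_lt; rewrite mdegD mdeg1 addn1 => /leq_trans/(_ pk).
Qed.

(** On a coordinate the difference is a multiple of [lin l], and [p q - r(p) r(q) = (p - r(p)) q +
    r(p) (q - r(q))] propagates divisibility. Allowing any rank one change [1 - e l] covers both
    reflections and projections onto root hyperplanes. *)
Lemma ddiff_ex e l p : exists q, p - act (1%:M - e *m l) p = lin l * q.
Proof.
move: p; apply: mpoly_lin_ind => [a|p q [p' hp] [q' hq]|i p [p' hp]].
- by exists 0; rewrite comp_mpolyC subrr mulr0.
- by exists (p' + q'); rewrite raddfD /= mulrDr -hp -hq opprD addrACA.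
exists ((e i 0) *: p + act (1%:M - e *m l) 'X_i * p').
rewrite rmorphM /=.
have -> : 'X_i * p - act (1%:M - e *m l) 'X_i * act (1%:M - e *m l) p =
  ('X_i - act (1%:M - e *m l) 'X_i) * p +  act (1%:M - e *m l) 'X_i * (p - act (1%:M - e *m l) p).
  by ring.
rewrite hp mulrDr mulrCA; congr (_ + _); rewrite -scalerAr scalerAl; congr (_ * _).
rewrite -{1 2}lin_delta act_lin mulmxBr mulmx1 raddfB /= opprB addrC subrK mulmxA -linearZ /=.
congr lin; rewrite -rowE; apply/rowP => j; rewrite !mxE big_ord1 mxE; by [].
Qed.

Definition ddiff e l p : A := sval (cid (ddiff_ex e l p)).

Lemma ddiffP e l p : p - act (1%:M - e *m l) p = lin l * ddiff e l p.
Proof. exact: svalP (cid (ddiff_ex e l p)). Qed.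

Section Ddiff.
Variables (e : 'cV[F]_n) (l : 'rV[F]_n).
Hypothesis l0 : l != 0.
Local Notation r := (act (1%:M - e *m l)).
Local Notation dd := (ddiff e l).

Lemma ddiff_uniq p q : p - r p = lin l * q -> dd p = q.
Proof. by rewrite ddiffP => /mulfI; apply; rewrite lin_eq0. Qed.

Lemma ddiffD p q : dd (p + q) = dd p + dd q.
Proof. by apply: ddiff_uniq; rewrite mulrDr -!ddiffP raddfD /= opprD addrACA. Qed.

Lemma ddiffZ a p : dd (a *: p) = a *: dd p.
Proof. by apply: ddiff_uniq; rewrite -scalerAr -ddiffP linearZ /= scalerBr. Qed.

Lemma ddiff_fix p : r p = p -> dd p = 0.
Proof. by move=> h; apply: ddiff_uniq; rewrite h subrr mulr0. Qed.

Lemma ddiffM p q : dd (p * q) = dd p * q + r p * dd q.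
Proof.
apply: ddiff_uniq; rewrite mulrDr mulrA -ddiffP mulrCA -ddiffP rmorphM /=; by ring.
Qed.

Lemma ddiff_lin m : dd (lin m) = ((m *m e) 0 0)%:MP.
Proof.
apply: ddiff_uniq; rewrite act_lin mulmxBr mulmx1 raddfB /= opprB addrC subrK mulmxA.
by rewrite mulrC mul_mpolyC -linearZ /= [X in X *m l]mx11_scalar mul_scalar_mx.
Qed.

Lemma msize_lin : msize (lin l) = 2%N.
Proof.
apply/eqP; rewrite eqn_leq msize_homog ?lin_homog //=.
have [j lj] : exists j, l 0 j != 0.
  by apply/existsP; apply: contraNT l0; rewrite negb_exists => /forallP h; apply/eqP/rowP => j; rewrite mxE; have := h j; rewrite negbK => /eqP.
have : U_(j)%MM \in msupp (lin l) by rewrite mcoeff_msupp lin_coef.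
by move/msize_mdeg_lt; rewrite mdeg1.
Qed.

Lemma msize_ddiff p k : (msize p <= k.+1)%N -> (msize (dd p) <= k)%N.
Proof.
move=> pk; have [->|nz] := eqVneq (dd p) 0; first by rewrite msize0.
have : (msize (lin l * dd p) <= k.+1)%N.
  rewrite -ddiffP; apply: leq_trans (msizeD_le _ _) _.
  by rewrite geq_max pk msizeN msize_act.
by rewrite msizeM ?lin_eq0 // msize_lin.
Qed.

End Ddiff.

Lemma lin_dvd e l p : act (1%:M - e *m l) p = 0 -> exists q, p = lin l * q.
Proof. by move=> h; exists (ddiff e l p); rewrite -ddiffP h subr0. Qed.

End PolyAct.
Notation act M := (comp_mpoly (lins M)).
End PolyAct.

(** * An invariant form and normalised roots *)

Module Root.
From HB Require Import structures.
From mathcomp Require Import boolp reals complex mpoly.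
From mathcomp Require Import ring.
Set Implicit Arguments.
Unset Strict Implicit.
Unset Printing Implicit Defensive.
Import Order.TTheory GRing.Theory Num.Theory ComplexField.
Local Open Scope ring_scope.
From mathcomp Require Import lra.
Require Import Defs.
Section Avoid.
Variables (R : realFieldType).
Lemma avoid_hyperplanes k (ls : seq 'rV[R]_k) : (forall l, l \in ls -> l != 0) ->
  exists v : 'cV[R]_k, forall l, l \in ls -> (l *m v) 0 0 != 0.
Proof.
elim: ls => [|l ls IH] h; first by exists 0.
have [|v hv] := IH; first by move=> m ml; apply: h; rewrite inE ml orbT.
have [i li] : exists i, l 0 i != 0.
  have := h l (mem_head _ _); case/rV0Pn=> i li; by exists i.
have [lv|lv] := eqVneq ((l *m v) 0 0) 0; last first.
  by exists v => m; rewrite inE => /predU1P[->//|]; exact: hv.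
pose w : 'cV[R]_k := delta_mx i 0.
pose bad := [seq `| (m *m v) 0 0 / (m *m w) 0 0 | | m <- ls].
(* Exceeds in absolute value every parameter at which a form that is nonzero on [w] vanishes at
   [v + t w]. *)
pose t := 1 + \sum_(b <- bad) b.
have t0 : 0 < t.
  apply: ltr_pwDl => //; rewrite big_map; apply: sumr_ge0 => m _; exact: normr_ge0.
have tb b : b \in bad -> b < t.
  move=> bb; rewrite /t (big_rem b) //=.
  have : 0 <= \sum_(y <- rem b bad) y.
    rewrite big_seq; apply: sumr_ge0 => y /mem_rem /mapP[m _ ->]; exact: normr_ge0.
  lra.
exists (v + t *: w) => m.
have E : (m *m (v + t *: w)) 0 0 = (m *m v) 0 0 + t * (m *m w) 0 0.
  by rewrite mulmxDr -scalemxAr !mxE.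
rewrite inE E => /predU1P[->|ml].
  rewrite lv add0r; apply: mulf_neq0; first exact: lt0r_neq0.
  by rewrite /w -colE mxE.
have [w0|w0] := eqVneq ((m *m w) 0 0) 0; first by rewrite w0 mulr0 addr0 hv.
apply/negP => /eqP e.
have := tb `| (m *m v) 0 0 / (m *m w) 0 0 | (map_f _ ml).
have -> : (m *m v) 0 0 / (m *m w) 0 0 = - t.
  by apply: (mulIf w0); rewrite divfK //; move: e; set a := (_ *m v) 0 0; set b := (_ *m w) 0 0 => e; lra.
by rewrite normrN gtr0_norm // ltxx.
Qed.
End Avoid.

Section Root.
Variables (R : realType) (gT : finGroupType) (n : nat).
Variable rho : mx_representation R [set: gT] n.
Hypothesis faith : mx_faithful rho.
Local Notation refl := (is_reflection rho).
Implicit Types (l m : 'rV[R]_n) (g w s t : gT).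

Lemma rhoM g h : rho (g * h)%g = rho g *m rho h.
Proof. by rewrite repr_mxM ?inE. Qed.
Lemma rho1 : rho 1%g = 1%:M. Proof. exact: repr_mx1. Qed.
Lemma rhoVK g : rho g^-1%g *m rho g = 1%:M.
Proof. by rewrite -rhoM mulVg rho1. Qed.
Lemma rhoKV g : rho g *m rho g^-1%g = 1%:M.
Proof. by rewrite -rhoM mulgV rho1. Qed.
Lemma rho_inj g h : rho g = rho h -> g = h.
Proof. by apply: (mx_faithful_inj faith); rewrite inE. Qed.

(** An invariant positive definite form on covectors, by averaging. It is also the covariance of the
    Gaussian whose directions are the columns of all the [rho g], which is how pairings of roots
    enter the analysis. *)
Definition gram : 'M[R]_n := \sum_g rho g *m (rho g)^T.
Definition sp l m : R := (l *m gram *m m^T) 0 0.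

Lemma gram_inv g : rho g *m gram *m (rho g)^T = gram.
Proof.
rewrite mulmx_sumr mulmx_suml (reindex_inj (mulgI g^-1%g)) /=.
by apply: eq_bigr => h _; rewrite !mulmxA -mulmxA -trmx_mul -!rhoM !mulKVg.
Qed.

Lemma spZl a l m : sp (a *: l) m = a * sp l m.
Proof. by rewrite /sp -!scalemxAl mxE. Qed.
Lemma spDl l l' m : sp (l + l') m = sp l m + sp l' m.
Proof. by rewrite /sp !mulmxDl mxE. Qed.
Lemma gram_sym : gram^T = gram.
Proof. by rewrite raddf_sum; apply: eq_bigr => g _; rewrite /= trmx_mul trmxK. Qed.
Lemma spC l m : sp l m = sp m l.
Proof.
have -> : sp l m = (l *m gram *m m^T)^T 0 0 by rewrite mxE.
by rewrite !trmx_mul trmxK gram_sym mulmxA.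
Qed.
Lemma spNl l m : sp (- l) m = - sp l m.
Proof. by rewrite -scaleN1r spZl mulN1r. Qed.
Lemma spNr l m : sp l (- m) = - sp l m.
Proof. by rewrite spC spNl spC. Qed.
Lemma spDr l m m' : sp l (m + m') = sp l m + sp l m'.
Proof. by rewrite spC spDl !(spC l). Qed.
Lemma spZr a l m : sp l (a *: m) = a * sp l m.
Proof. by rewrite spC spZl spC. Qed.
Lemma sp_rho g l m : sp (l *m rho g) (m *m rho g) = sp l m.
Proof. by rewrite /sp trmx_mul -!mulmxA [in RHS]mulmxA -[in RHS](gram_inv g) !mulmxA. Qed.

Lemma sp_sum l : sp l l = \sum_g \sum_j (l *m rho g) 0 j ^+ 2.
Proof.
rewrite /sp /gram mulmx_sumr mulmx_suml summxE; apply: eq_bigr => g _.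
by rewrite !mulmxA -mulmxA -trmx_mul mxE; apply: eq_bigr => j _; rewrite [_^T _ _]mxE expr2.
Qed.
Lemma sp_ge0 l : 0 <= sp l l.
Proof. by rewrite sp_sum; do 2! apply: sumr_ge0 => ? _; exact: sqr_ge0. Qed.
Lemma sp_eq0 l : (sp l l == 0) = (l == 0).
Proof.
apply/idP/eqP => [|->]; last by rewrite /sp !mul0mx mxE.
rewrite sp_sum psumr_eq0 => [|g _]; last by apply: sumr_ge0 => ? _; exact: sqr_ge0.
move=> /allP /(_ 1%g); rewrite mem_index_enum => /(_ isT) /=; rewrite rho1 mulmx1.
rewrite psumr_eq0 => [|j _]; last exact: sqr_ge0.
move=> /allP h; apply/rowP => j; have := h j; rewrite mem_index_enum => /(_ isT) /=.
by rewrite sqrf_eq0 mxE => /eqP.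
Qed.
Lemma sp_gt0 l : l != 0 -> 0 < sp l l.
Proof. by move=> l0; rewrite lt0r sp_eq0 l0 sp_ge0. Qed.

Lemma gram_unit : gram \in unitmx.
Proof.
rewrite -row_free_unit -kermx_eq0; apply/rowV0P => v /sub_kermxP vg.
by apply/eqP; rewrite -sp_eq0 /sp vg mul0mx mxE.
Qed.

Definition coroot l : 'cV[R]_n := gram *m l^T.
Lemma coroot_pair l m : (l *m coroot m) 0 0 = sp l m.
Proof. by rewrite /coroot mulmxA. Qed.

Lemma corootZ a l : coroot (a *: l) = a *: coroot l.
Proof. by rewrite /coroot linearZ /= -scalemxAr. Qed.

(** Rank one gives [1 - rho s = a l] with a covector [l] negated by [s]. Invariance of the form
    makes the column [a] proportional to the dual of [l], and scaling [l] to squared length 2 makes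
    the factor 1. *)
Lemma reflection_root s : refl s ->
  exists l, sp l l = 2 /\ rho s = 1%:M - coroot l *m l.
Proof.
case/andP=> /eqP ss /eqP rk.
pose N := 1%:M - rho s.
have rN : \rank N = 1%N by rewrite /N -opprB mxrank_opp.
have Ns : N *m rho s = - N by rewrite mulmxBl mul1mx ss opprB.
pose l := nz_row N.
have l0 : l != 0 by rewrite nz_row_eq0 -mxrank_eq0 rN.
have lN : (l <= N)%MS by exact: nz_row_sub.
have Nl : (N <= l)%MS.
  by rewrite -(geq_leqif (mxrank_leqif_sup lN)) rN rank_rV l0.
have ls : l *m rho s = - l.
  by have /submxP[D ->] := lN; rewrite -mulmxA Ns mulmxN.
have [a Na] : exists a : 'cV_n, N = a *m l by have /submxP[D ->] := Nl; exists D.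
have al : forall m, 2 * sp m l = sp l l * (m *m a) 0 0.
  move=> m; have := sp_rho s m l; rewrite ls spNr.
  have -> : m *m rho s = m - (m *m a) 0 0 *: l.
    rewrite -mul_scalar_mx -mx11_scalar -mulmxA -Na mulmxBr mulmx1; by rewrite opprB addrC subrK.
  by rewrite spDl spNl spZl; lra.
pose b := Num.sqrt (2 / sp l l).
have sl := sp_gt0 l0.
have b2 : b ^+ 2 = 2 / sp l l by rewrite sqr_sqrtr // divr_ge0 // ltW.
exists (b *: l); split.
  by rewrite spZl spZr mulrA -expr2 b2 divfK // gt_eqF.
have -> : rho s = 1%:M - N by rewrite /N opprB addrC subrK.
rewrite Na; congr (_ - _); rewrite corootZ -scalemxAr -scalemxAl scalerA -expr2 b2.
rewrite scalemxAl; congr (_ *m _); apply/colP => i.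
apply: (mulfI (lt0r_neq0 sl)); rewrite mxE mulrA [_ * (2 / _)]mulrC divfK ?gt_eqF //.
have := al (delta_mx 0 i); rewrite -coroot_pair -!rowE => h.
by transitivity (sp l l * (row i a) 0 0); [rewrite mxE | rewrite -h mxE].
Qed.

(** A point [v0] off all the root hyperplanes fixes the sign of each root; it represents the
    fundamental chamber from now on. *)
Lemma root_system : exists (al : gT -> 'rV[R]_n) (v0 : 'cV[R]_n), forall s, refl s ->
  [/\ rho s = 1%:M - coroot (al s) *m al s, sp (al s) (al s) = 2 & 0 < (al s *m v0) 0 0].
Proof.
pose b s := if pselect (refl s) is left h then sval (cid (reflection_root h)) else 0.
have hb s : refl s -> sp (b s) (b s) = 2 /\ rho s = 1%:M - coroot (b s) *m b s.
  by move=> hs; rewrite /b; case: pselect => // h; case: cid.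
have [v0 hv] : exists v : 'cV[R]_n, forall l, l \in [seq b s | s <- enum gT & refl s] -> (l *m v) 0 0 != 0.
  apply: avoid_hyperplanes => l /mapP[s]; rewrite mem_filter => /andP[hs _] ->.
  by rewrite -sp_eq0; case: (hb s hs) => -> _; rewrite pnatr_eq0.
exists (fun s => Num.sg ((b s *m v0) 0 0) *: b s), v0 => s hs.
have nz : (b s *m v0) 0 0 != 0.
  by apply: hv; apply/mapP; exists s => //; rewrite mem_filter hs mem_enum.
have sg2 : Num.sg ((b s *m v0) 0 0) * Num.sg ((b s *m v0) 0 0) = 1 by rewrite -expr2 sqr_sg nz.
have [h1 h2] := hb s hs; split.
- by rewrite h2 corootZ -scalemxAr -scalemxAl scalerA sg2 scale1r.
- by rewrite spZl spZr mulrA sg2 mul1r.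
by rewrite -scalemxAl mxE -normrEsg normr_gt0.
Qed.

End Root.
End Root.

(** * Chambers, simple reflections and lengths, relative to a subgroup *)

Module Cox.
From HB Require Import structures.
From mathcomp Require Import boolp reals complex mpoly.
From mathcomp Require Import ring.
Set Implicit Arguments.
Unset Strict Implicit.
Unset Printing Implicit Defensive.
Import Order.TTheory GRing.Theory Num.Theory ComplexField.
Local Open Scope ring_scope.
From mathcomp Require Import lra zify.
Require Import Defs.
Import Root.
Section Cox.
Variables (R : realType) (gT : finGroupType) (n : nat).
Variable rho : mx_representation R [set: gT] n.
Hypothesis faith : mx_faithful rho.
Variables (al : gT -> 'rV[R]_n) (v0 : 'cV[R]_n).
Local Notation refl := (is_reflection rho).
Local Notation gram := (gram rho).
Local Notation sp := (sp rho).
Local Notation coroot := (coroot rho).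
Hypothesis hal : forall s, refl s ->
  [/\ rho s = 1%:M - coroot (al s) *m al s, sp (al s) (al s) = 2 & 0 < (al s *m v0) 0 0].
Implicit Types (s t w g : gT) (x : 'cV[R]_n) (H : {group gT}).
Definition root s x : R := (al s *m x) 0 0.

Lemma rootD s x y : root s (x + y) = root s x + root s y.
Proof. by rewrite /root mulmxDr mxE. Qed.
Lemma rootZ s a x : root s (a *: x) = a * root s x.
Proof. by rewrite /root -scalemxAr mxE. Qed.
Lemma root_v0 s : refl s -> 0 < root s v0.
Proof. by case/hal. Qed.

Lemma refl_act s x : refl s -> rho s *m x = x - root s x *: coroot (al s).
Proof.
by case/hal=> -> _ _; rewrite mulmxBl mul1mx -mulmxA [al s *m x]mx11_scalar mul_mx_scalar.
Qed.

Lemma al_refl m s : refl s -> m *m rho s = m - sp m (al s) *: al s.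
Proof.
case/hal=> -> _ _; rewrite mulmxBr mulmx1 mulmxA; congr (_ - _).
by rewrite [m *m _]mx11_scalar coroot_pair mul_scalar_mx.
Qed.

Lemma al_self s : refl s -> al s *m rho s = - al s.
Proof.
by move=> hs; rewrite al_refl //; case: (hal hs) => _ -> _; rewrite scaler_nat mulr2n opprD addrA subrr add0r.
Qed.

Lemma root_self s x : refl s -> root s (rho s *m x) = - root s x.
Proof. by move=> hs; rewrite /root mulmxA al_self // mulNmx mxE. Qed.

Lemma root_refl t s x : refl s -> root t (rho s *m x) = root t x - sp (al t) (al s) * root s x.
Proof.
move=> hs; rewrite refl_act // -scaleNr rootD rootZ mulNr mulrC.
by rewrite [X in X * _]coroot_pair.
Qed.

Lemma al_neq0 s : refl s -> al s != 0.
Proof. by case/hal=> _ h _; rewrite -(sp_eq0 rho) h pnatr_eq0. Qed.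

Lemma reflK s : refl s -> (s * s = 1)%g.
Proof. by case/andP=> /eqP h _; apply: (rho_inj faith); rewrite rhoM h rho1. Qed.
Lemma reflV s : refl s -> (s^-1 = s)%g.
Proof. by move=> hs; apply/eqP; rewrite eq_invg_mul reflK. Qed.

Lemma refl_neg s m : refl s -> m *m rho s = - m -> sp m m = 2 -> m = al s \/ m = - al s.
Proof.
move=> hs; rewrite al_refl // => e mm; set k := sp m (al s) in e.
have m2 : m = (k / 2) *: al s.
  have : 2 *: m = k *: al s.
    by rewrite scaler_nat mulr2n -{1}[m]opprK -e opprB subrK.
  move=> h; rewrite mulrC -scalerA -h scalerA mulVf ?scale1r //; lra.
have : (k / 2) ^+ 2 = 1.
  move: mm; rewrite m2 spZl spZr; case: (hal hs) => _ -> _ h.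
  by rewrite expr2; move: h; set y := k / 2 => h; nra.
move/eqP; rewrite sqrf_eq1 => /orP[] /eqP h; rewrite m2 h.
  by left; rewrite scale1r.
by right; rewrite scaleN1r.
Qed.

Lemma refl_conj s w : refl s -> refl (s ^ w)%g.
Proof.
case/andP=> /eqP h1 /eqP h2; apply/andP; split.
  by rewrite -rhoM -conjMg conjgE !rhoM h1 mul1mx rhoVK.
have -> : rho (s ^ w)%g - 1%:M = rho w^-1%g *m (rho s - 1%:M) *m rho w.
  by rewrite mulmxBr mulmxBl mulmx1 rhoVK /conjg !rhoM mulmxA.
have U g : rho g \in unitmx by apply: repr_mx_unit; rewrite inE.
by rewrite mxrankMfree ?row_free_unit // eqmxMfull ?row_full_unit // h2.
Qed.

Lemma al_inj s t : refl s -> refl t -> al s = al t -> s = t.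
Proof.
move=> hs ht e; apply: (rho_inj faith).
by case: (hal hs) (hal ht) => -> _ _ [-> _ _]; rewrite e.
Qed.

Lemma sp_lt2 s t : refl s -> refl t -> s != t -> sp (al s) (al t) < 2.
Proof.
move=> hs ht st.
have : 0 < sp (al s - al t) (al s - al t).
  by apply: sp_gt0; rewrite subr_eq0; apply: contra_neq st; exact: al_inj.
rewrite spDl !spDr !spNl !spNr (spC _ (al t) (al s)).
by case: (hal hs) (hal ht) => _ -> _ [_ -> _]; lra.
Qed.

(** The image of a root is negated by the conjugate reflection and has squared length 2, so it is
    that reflection's root up to sign; the sign is read off at [v0]. *)
Lemma al_conj s w : refl s ->
  al s *m rho w = if 0 < root s (rho w *m v0) then al (s ^ w)%g else - al (s ^ w)%g.
Proof.
move=> hs; have hsw := refl_conj w hs.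
have := root_v0 hsw; rewrite /root mulmxA => p.
have [||->|->] := @refl_neg (s ^ w)%g (al s *m rho w) hsw.
- by rewrite /conjg !rhoM !mulmxA -[_ *m rho w *m _]mulmxA rhoKV mulmx1 al_self // mulNmx.
- by rewrite sp_rho; case: (hal hs).
- by rewrite p.
by rewrite mulNmx mxE oppr_gt0 ltNge ltW.
Qed.

Lemma root_neq0 s w : refl s -> root s (rho w *m v0) != 0.
Proof.
move=> hs; rewrite /root mulmxA al_conj //.
have := root_v0 (refl_conj w hs); rewrite /root.
case: ifP => _ h; first by rewrite gt_eqF.
by rewrite mulNmx [X in X != _]mxE oppr_eq0 gt_eqF.
Qed.

Lemma root_act s w x : refl s -> root s (rho w *m x) =
  if 0 < root s (rho w *m v0) then root (s ^ w)%g x else - root (s ^ w)%g x.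
Proof. by move=> hs; rewrite /root mulmxA al_conj //; case: ifP => _ //; rewrite mulNmx mxE. Qed.

(** Everything is relative to a subgroup [H], with the roots and base point of the whole group, so
    that parabolic subgroups are covered by the same lemmas. *)
Definition TH H s := refl s && (s \in H).
Definition neg H x := [set s | TH H s & root s x < 0].
Definition dom H x := forall s, TH H s -> 0 <= root s x.
(** A wall of the chamber of [v0] is recognised by its reflection crossing no other hyperplane of
    [H]. The set [neg] at [rho w *m v0] is the inversion set, and [ninv] below is the length. *)
Definition simple H s := TH H s && (neg H (rho s *m v0) == [set s]).
Definition ninv H w := #|neg H (rho w *m v0)|.

Lemma TH_conj H s w : w \in H -> TH H s -> TH H (s ^ w)%g.
Proof. by move=> wH /andP[hs sH]; rewrite /TH refl_conj // groupJ. Qed.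

Lemma domP H x : reflect (dom H x) (neg H x == set0).
Proof.
apply: (iffP eqP) => [h s hs|h]; last first.
  by apply/setP => s; rewrite !inE; apply/negP => /andP[/h]; rewrite leNgt => /negP.
by rewrite leNgt; apply/negP => sx; have : s \in neg H x by [rewrite inE hs]; rewrite h inE.
Qed.

Lemma simpleP H s t : simple H s -> TH H t -> t != s -> 0 < root t (rho s *m v0).
Proof.
case/andP=> _ /eqP h ht ts; rewrite lt_neqAle eq_sym root_neq0 /=; last by case/andP: ht.
rewrite leNgt; apply/negP => tn; have : t \in neg H (rho s *m v0) by rewrite inE ht.
by rewrite h inE (negbTE ts).
Qed.

Lemma simple_al H s t : simple H s -> TH H t -> t != s -> al t *m rho s = al (t ^ s)%g.
Proof. by move=> ss ht ts; rewrite al_conj ?(simpleP ss) //; case/andP: ht. Qed.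

Lemma simple_root H s t x : simple H s -> TH H t -> t != s -> root t (rho s *m x) = root (t ^ s)%g x.
Proof. by move=> ss ht ts; rewrite /root mulmxA (simple_al ss). Qed.

(** On the ray [v0 + r x] the first hyperplanes crossed minimise [r s]; among them take the least
    [root s v0]. If [s] made another root [t] negative, then [al t + al (t ^ s) = k al s] with
    [k < 2]. Both roots on the left vanish at the crossing point, so each is at least [root s v0] at
    [v0], and their sum exceeds [k * root s v0]. *)
Lemma neg_simple H x : neg H x != set0 -> exists2 s, simple H s & s \in neg H x.
Proof.
case/set0Pn=> i0 hi0; pose r s := root s v0 / - root s x.
have [m hm minm] : exists2 m, m \in neg H x & forall t, t \in neg H x -> r m <= r t.
  by case: (arg_minP r hi0) => m; exists m.
pose N' := [pred t | (t \in neg H x) && (r t == r m)].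
have [s /andP[sx /eqP rs] mins] : exists2 s, N' s & forall t, N' t -> root s v0 <= root t v0.
  have hm' : N' m by rewrite /= hm eqxx.
  by case: (arg_minP (fun s => root s v0) hm') => s; exists s.
exists s => //; move: (sx); rewrite inE => /andP[hs sneg].
have rfs : refl s by case/andP: hs.
have r0 : 0 < r s by rewrite divr_gt0 ?oppr_gt0 // root_v0.
have cross u : TH H u -> 0 <= root u v0 + r s * root u x.
  move=> hu; have u0 : 0 < root u v0 by apply: root_v0; case/andP: hu.
  have [ux|ux] := leP 0 (root u x); first by apply: addr_ge0; [exact: ltW|apply: mulr_ge0 => //; exact: ltW].
  have un : u \in neg H x by rewrite inE hu.
  have := minm u un; rewrite -rs /r ler_pdivlMr ?oppr_gt0 //; by set a := _ / _; lra.
have crosss : root s v0 + r s * root s x = 0.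
  by rewrite /r invrN mulrN mulNr divfK ?lt_eqF // subrr.
have crossed u : TH H u -> root u v0 + r s * root u x = 0 -> root s v0 <= root u v0.
  move=> hu e; have u0 : 0 < root u v0 by apply: root_v0; case/andP: hu.
  have ux : root u x < 0 by nra.
  apply: mins; rewrite /= inE hu ux /= -rs; apply/eqP; rewrite /r -/(r s).
  by apply: (mulIf (x := - root u x)); rewrite ?divfK ?oppr_eq0 ?lt_eqF //; lra.
rewrite /simple hs /=; apply/eqP/setP => t; rewrite !inE.
apply/andP/eqP => [[ht tneg]|->]; last first.
  by split=> //; rewrite root_self // oppr_lt0 root_v0.
apply/eqP; apply/negPn/negP => ts; have rft : refl t by case/andP: ht.
have sH : s \in H by case/andP: hs.
have ht' := TH_conj sH ht.
have E : al t + al (t ^ s)%g = sp (al t) (al s) *: al s.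
  have := al_conj s rft; rewrite ltNge ltW //= al_refl // => e.
  by rewrite -[al (t ^ s)%g]opprK -e opprB addrC subrK.
have Er y : root t y + root (t ^ s)%g y = sp (al t) (al s) * root s y.
  have := congr1 (fun z => (z *m y) 0 0) E; rewrite mulmxDl mxE /root => ->; by rewrite -scalemxAl mxE.
have k2 := sp_lt2 rft rfs ts.
have s0 := root_v0 rfs.
have c1 := cross t ht; have c2 := cross _ ht'.
have e1 := Er v0; have e2 := Er x.
have sum0 : (root t v0 + r s * root t x) + (root (t ^ s)%g v0 + r s * root (t ^ s)%g x) = 0.
  have -> : (root t v0 + r s * root t x) + (root (t ^ s)%g v0 + r s * root (t ^ s)%g x) =
    (root t v0 + root (t ^ s)%g v0) + r s * (root t x + root (t ^ s)%g x) by ring.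
  by rewrite e1 e2 -(mulr0 (sp (al t) (al s))) -crosss; ring.
have l1 : root s v0 <= root t v0 by apply: crossed => //; lra.
have l2 : root s v0 <= root (t ^ s)%g v0 by apply: crossed => //; lra.
nra.
Qed.

(** A simple reflection permutes the positive roots other than its own, so exactly one inversion
    disappears. *)
Lemma ninv_simple H s w : w \in H -> simple H s -> root s (rho w *m v0) < 0 -> (ninv H (s * w)).+1 = ninv H w.
Proof.
move=> wH ss sw; have /andP[hs _] := ss; have /andP[rs sH] := hs.
rewrite /ninv [in RHS](cardsD1 s) inE hs sw /= add1n; congr _.+1.
rewrite -(cardJg _ s); apply: eq_card => t; rewrite mem_conjg reflV // !inE.
have [->|ts] := eqVneq t s.
  rewrite conjgE reflK // mulg1 reflV // rhoM -mulmxA.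
  by rewrite root_self // oppr_lt0 ltNge ltW // andbF.
have tss : ((t ^ s) ^ s)%g = t by rewrite -{2}(reflV rs) conjgK.
have ts' : (t ^ s)%g != s.
  by apply: contra ts => /eqP e; apply/eqP; rewrite -tss e conjgE reflK // mulg1 reflV.
have E : TH H (t ^ s)%g -> root (t ^ s)%g (rho (s * w)%g *m v0) = root t (rho w *m v0).
  by move=> h; rewrite rhoM -mulmxA (simple_root _ ss) // tss.
rewrite /=; apply/andP/andP => -[h1 h2].
  by split; [rewrite -tss TH_conj | rewrite -E].
have h1' := TH_conj sH h1.
by split; rewrite ?E.
Qed.

Definition simples H := [set s | simple H s].

(** Among the [g] generated by simple reflections with [root t] positive at [g v0], take the least
    value. If the transported root [t'] is not simple, multiplying [g] by a simple [s] that pairs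
    positively with [t'] gives a smaller positive value. *)
Lemma TH_simples H t : TH H t -> t \in <<simples H>>%G.
Proof.
move=> ht; have rt : refl t by case/andP: ht.
pose P g := (g \in <<simples H>>%G) && (g \in H) && (0 < root t (rho g *m v0)).
have P1 : P 1%g by rewrite /P !group1 rho1 mul1mx root_v0.
case: (arg_minP (fun g => root t (rho g *m v0)) P1) => g /andP[/andP[gS gH] g0] ming.
have ht' := TH_conj gH ht; set t' := (t ^ g)%g in ht'.
have rt' : refl t' by case/andP: ht'.
(* At minus the coroot of [t'] the negative roots are those pairing positively with [t']. As [t'] is
   one of them, some simple root is too. *)
have [s ss] : exists2 s, simple H s & s \in neg H (- coroot (al t')).
  apply: neg_simple; apply/set0Pn; exists t'; rewrite inE ht' /root mulmxN mxE coroot_pair.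
  by case: (hal rt') => _ -> _; lra.
rewrite inE /root mulmxN mxE coroot_pair oppr_lt0 spC => /andP[hs st].
have rs : refl s by case/andP: hs.
have sH : s \in H by case/andP: hs.
have sS : s \in <<simples H>>%G by apply: mem_gen; rewrite inE.
have [e|ne] := eqVneq t' s.
  have -> : t = (s ^ g^-1)%g by rewrite -e conjgK.
  by rewrite groupJ // groupV.
have pos : 0 < root t' (rho s *m v0) by exact: simpleP ss _ _.
have Eg y : root t (rho g *m y) = root t' y by rewrite root_act // g0.
have := ming (g * s)%g; rewrite /P !groupM //= rhoM -mulmxA !Eg pos root_refl // => /(_ isT).
have := root_v0 rs; nra.
Qed.

(** The exchange condition. Passing a letter conjugates [t] and keeps its root positive unless the
    letter equals the current conjugate; that letter is then deleted. *)
Lemma simple_word H (r : seq gT) t : all (simple H) r -> TH H t ->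
  root t (rho (\prod_(s <- r) s)%g *m v0) < 0 ->
  exists r', [/\ (size r').+1 = size r, all (simple H) r' & (t * \prod_(s <- r) s = \prod_(s <- r') s)%g].
Proof.
elim: r t => [|s r IH] t /=.
  by move=> _ /andP[ht _]; rewrite big_nil rho1 mul1mx ltNge ltW // root_v0.
case/andP=> ss hr ht; have /andP[rt tH] := ht.
have /andP[hs _] := ss; have /andP[rs sH] := hs.
rewrite !big_cons rhoM -mulmxA; have [->|ts] := eqVneq t s.
  by move=> _; exists r; split=> //; rewrite mulgA reflK // mul1g.
rewrite (simple_root _ ss) // => /(IH _ hr (TH_conj sH ht))[r' [h1 h2 h3]].
exists (s :: r'); split=> /=; first by rewrite h1.
  by rewrite ss.
by rewrite big_cons -h3 conjgE reflV // !mulgA reflK // mul1g.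
Qed.

(** Without inversions, the root of the first letter is negative on the rest of the word, and the
    exchange condition shortens the word by two letters. *)
Lemma simple_word_free H (r : seq gT) : all (simple H) r -> ninv H (\prod_(s <- r) s) = 0%N -> (\prod_(s <- r) s = 1)%g.
Proof.
move: {2}(size r).+1 (ltnSn (size r)) => k; elim: k r => // k IH [|s r] //=.
  by move=> _ _ _; rewrite big_nil.
move=> rk /andP[ss hr] n0; have /andP[hs _] := ss; have /andP[rs sH] := hs.
have d : dom H (rho (\prod_(s <- (s :: r)) s)%g *m v0) by apply/domP; rewrite -cards_eq0; apply/eqP.
have := d s hs; rewrite big_cons rhoM -mulmxA root_self // oppr_ge0 le_eqVlt (negbTE (root_neq0 _ rs)) /=.
case/(simple_word hr hs)=> r' [h1 h2 h3].
rewrite h3; apply: IH => //; first by lia.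
by rewrite -h3; rewrite big_cons in n0.
Qed.

Definition refl_group H := H \subset <<[set s | TH H s]>>%g.

Lemma gen_simples H : refl_group H -> H \subset <<simples H>>%g.
Proof.
move=> h; apply: subset_trans h _; rewrite gen_subG; apply/subsetP => t; rewrite inE.
exact: TH_simples.
Qed.

Lemma ninv_free H w : refl_group H -> w \in H -> ninv H w = 0%N -> w = 1%g.
Proof.
move=> h /(subsetP (gen_simples h)) /gen_prodgP[k [c hc ->]] n0.
have E : (\prod_(i < k) c i = \prod_(s <- [seq c i | i <- index_enum 'I_k]) s)%g by rewrite big_map.
rewrite E; apply: (simple_word_free (H := H)); last by rewrite -E.
by apply/allP => s /mapP[i _ ->]; have := hc i; rewrite inE.
Qed.

(** A point of the orbit that maximises the covector dual to [v0] is dominant: reflecting in a root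
    negative at it would increase the value. *)
Lemma dom_ex H x : exists2 h, h \in H & dom H (rho h *m x).
Proof.
pose lam0 := v0^T *m invmx gram.
have lamE m : sp lam0 m = (m *m v0) 0 0.
  by rewrite /sp /lam0 mulmxKV ?gram_unit // -trmx_mul mxE.
case: (arg_maxP (fun h => (lam0 *m (rho h *m x)) 0 0) (group1 H)) => h hH maxh.
exists h => // s hs; have /andP[rs sH] := hs.
have := maxh (s * h)%g (groupM sH hH).
rewrite /= rhoM -mulmxA (refl_act _ rs) -scaleNr mulmxDr -scalemxAr mxE [X in _ + X]mxE coroot_pair lamE.
have := root_v0 rs; rewrite /root; set a := (_ *m v0) 0 0; set b := (al s *m _) 0 0; nra.
Qed.

(** Induction on the length of [h]. For a simple [s] inverted by [h], dominance of [x] and of [h x]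
    forces [root s] to vanish at [h x]; so [s] fixes that point and [s h] is shorter. *)
Lemma dom_fix H x h : refl_group H -> h \in H -> dom H x -> dom H (rho h *m x) ->
  rho h *m x = x /\ h \in <<[set s | simple H s & root s x == 0]>>%G.
Proof.
move=> rH; move: {2}(ninv H h).+1 (ltnSn (ninv H h)) => k.
elim: k h => // k IH h hk hH dx dhx.
have [n0|n0] := eqVneq (neg H (rho h *m v0)) set0.
  by rewrite (ninv_free rH hH) ?rho1 ?mul1mx ?group1 //; apply/eqP; rewrite cards_eq0 n0.
have [s ss] := neg_simple n0; rewrite inE => /andP[hs sneg].
have /andP[rs sH] := hs.
have sx0 : root s (rho h *m x) = 0.
  have := dhx s hs; have := dx _ (TH_conj hH hs).
  have sF : (0 < root s (rho h *m v0)) = false by apply/negbTE; rewrite -leNgt ltW.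
  by rewrite [root s (rho h *m x)]root_act // sF => h1 h2; apply/eqP; rewrite oppr_eq0 eq_le h1 -oppr_ge0 h2.
have fx : rho (s * h)%g *m x = rho h *m x by rewrite rhoM -mulmxA refl_act // sx0 scale0r subr0.
have nsh := ninv_simple hH ss sneg.
have [||e1 e2] := IH (s * h)%g _ (groupM sH hH) dx.
- by rewrite -nsh in hk.
- by rewrite fx.
split; first by rewrite -fx.
have -> : h = (s * (s * h))%g by rewrite mulgA reflK // mul1g.
by rewrite groupM // mem_gen // inE ss -e1 fx sx0 eqxx.
Qed.

(** Moving [x] to a dominant point by [k] reduces the claim to [dom_fix]; conjugating back turns
    simple reflections into reflections. *)
Lemma stab_gen H x h : refl_group H -> h \in H -> rho h *m x = x ->
  h \in <<[set s | TH H s & root s x == 0]>>%G.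
Proof.
move=> rH hH hx; have [k kH dk] := dom_ex H x.
have e : rho (h ^ k^-1)%g *m (rho k *m x) = rho k *m x.
  by rewrite mulmxA -rhoM conjgE invgK -!mulgA mulVg mulg1 rhoM -mulmxA hx.
have hk : (h ^ k^-1)%g \in H by rewrite groupJ // groupV.
have [|_ m] := dom_fix rH hk dk; first by rewrite e.
 have : h \in (<<[set s | simple H s & root s (rho k *m x) == 0]>> :^ k)%g.
  by rewrite mem_conjg.
rewrite /= -genJ; apply/subsetP/genS/subsetP => t /imsetP[s hs ->].
move: hs; rewrite !inE => /andP[/andP[hs _]].
have /andP[rs sH] := hs.
rewrite root_act // => sx; rewrite TH_conj //=.
by move: sx; case: ifP => // _; rewrite oppr_eq0.
Qed.

End Cox.
End Cox.

(** * Faces of the chamber and standard parabolic subgroups *)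

Module Cox2.
From HB Require Import structures.
From mathcomp Require Import boolp reals complex mpoly.
From mathcomp Require Import ring.
Set Implicit Arguments.
Unset Strict Implicit.
Unset Printing Implicit Defensive.
Import Order.TTheory GRing.Theory Num.Theory ComplexField.
Local Open Scope ring_scope.
From mathcomp Require Import lra zify.
Require Import Defs.
Import Root Cox.
(** Expand the product of [-1 + 1] over the elements of [Q]. *)
Lemma sum_subsets (T : finType) (F : comNzRingType) (Q : {set T}) (b : pred {set T}) :
  (forall J, b J = (J \subset Q)) ->
  \sum_(J | b J) (-1) ^+ #|J| = (Q == set0)%:R :> F.
Proof.
move=> hb; transitivity (\prod_i ((if i \in Q then -1 else 0) + 1) : F); last first.
  have [->|/set0Pn[i iQ]] := eqVneq Q set0; first by rewrite big1 // => i _; rewrite inE add0r.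
  by rewrite (bigD1 i) //= iQ addNr mul0r.
rewrite bigA_distr big_mkcond /=; apply: eq_bigr => J _; rewrite hb.
case: ifPn => [/subsetP JQ|/subsetPn[i iJ iQ]]; last first.
  by rewrite (bigD1 i) //= iJ (negbTE iQ) mul0r.
rewrite (bigID (mem J)) /= [X in _ * X]big1 ?mulr1 => [|i /negbTE -> //].
by rewrite (eq_bigr (fun=> -1)) ?prodr_const // => i iJ; rewrite iJ JQ.
Qed.

Section Cox2.
Variables (R : realType) (gT : finGroupType) (n : nat).
Variable rho : mx_representation R [set: gT] n.
Hypothesis faith : mx_faithful rho.
Variables (al : gT -> 'rV[R]_n) (v0 : 'cV[R]_n).
Local Notation refl := (is_reflection rho).
Local Notation gram := (gram rho).
Local Notation sp := (sp rho).
Local Notation coroot := (coroot rho).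
Hypothesis hal : forall s, refl s ->
  [/\ rho s = 1%:M - coroot (al s) *m al s, sp (al s) (al s) = 2 & 0 < (al s *m v0) 0 0].
Implicit Types (s t w g h : gT) (x : 'cV[R]_n) (H K : {group gT}) (J : {set gT}).
Local Notation root := (root al).
Local Notation TH := (TH rho).
Local Notation neg := (neg rho al).
Local Notation dom := (dom rho al).
Local Notation simple := (simple rho al v0).
Local Notation simples := (simples rho al v0).
Local Notation ninv := (ninv rho al v0).
Local Notation refl_group := (refl_group rho).

Definition fixer H x : {set gT} := [set h in H | rho h *m x == x].

Lemma card_dom K x : refl_group K ->
  exists2 k, k \in K & forall h, h \in K -> `[< dom K (rho h *m x) >] = (rho h *m x == rho k *m x).
Proof.
move=> rK; have [k kK dk] := dom_ex hal K x; exists k => // h hK.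
apply/asboolP/eqP => [d|-> //].
have := dom_fix faith hal rK (groupM hK (groupVr kK)) dk.
by rewrite mulmxA -rhoM mulgKV => /(_ d)[].
Qed.

(** All elements carrying [x] into the chamber reach the same point, so they form one coset of the
    fixer. *)
Lemma card_domE K x : refl_group K ->
  #|[set h in K | `[< dom K (rho h *m x) >]]| = #|fixer K x|.
Proof.
move=> rK; have [k kK hk] := card_dom x rK.
rewrite -(card_lcoset (fixer K x) k); apply: eq_card => h; rewrite mem_lcoset !inE.
rewrite groupMl ?groupV //; case hK: (h \in K) => //=; rewrite hk //.
apply/eqP/eqP => e; first by rewrite rhoM -mulmxA e mulmxA rhoVK mul1mx.
by rewrite -[in RHS]e mulmxA -rhoM mulKVg.
Qed.

Lemma fixer_regular K x : refl_group K -> (forall s, TH K s -> root s x != 0) -> #|fixer K x| = 1%N.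
Proof.
move=> rK reg; rewrite -(cards1 (1%g : gT)); apply: eq_card => h; rewrite !inE.
apply/andP/eqP => [[hK /eqP hx]|->]; last by rewrite group1 rho1 mul1mx.
have := stab_gen faith hal rK hK hx.
rewrite /= [X in <<X>>%g](_ : _ = set0) ?gen0; first by move/set1P.
by apply/setP => s; rewrite !inE; apply/negP => /andP[/reg/negbTE->].
Qed.

Section Parabolic.
Variable H : {group gT}.
Hypothesis rH : refl_group H.

Lemma TH_refl K t : TH K t -> refl t. Proof. by case/andP. Qed.

(** Let [a], [b] be the values of the two roots at [v0], and suppose the pairing [k] positive. Then
    [s ^ t] has a positive root and differs from [s], yet its root at [s v0] is [-a - k (b - k a)],
    which is negative. *)
Lemma simples_obtuse s t : simple H s -> simple H t -> s != t -> sp (al s) (al t) <= 0.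
Proof.
move=> ss st ne; have /andP[hs _] := ss; have /andP[ht _] := st.
have rs := TH_refl hs; have rt := TH_refl ht.
rewrite leNgt; apply/negP => k0; set k := sp _ _ in k0.
have p1 : 0 < root s (rho t *m v0) by apply: (simpleP hal st).
have p2 : 0 < root t (rho s *m v0) by apply: (simpleP hal ss) => //; rewrite eq_sym.
have tH : t \in H by case/andP: ht.
have ne' : (s ^ t)%g != s.
  apply/eqP => e; have := al_conj hal t rs; rewrite p1 e (al_refl hal) // -[X in _ = X]addr0.
  move/addrI/eqP; rewrite oppr_eq0 scaler_eq0 (negbTE (al_neq0 hal rt)) orbF -/k => /eqP k00.
  by rewrite k00 ltxx in k0.
have := simpleP hal ss (TH_conj tH hs) ne'.
have E y : root (s ^ t)%g y = root s (rho t *m y) by rewrite (root_act hal) // p1.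
rewrite E (root_refl hal) // (root_refl hal) //; move: p1 p2; rewrite !(root_refl hal) // -/k.
rewrite (spC _ (al t)) -/k; have := root_v0 hal rs; have := root_v0 hal rt.
case: (hal rs) => _ -> _; set a := root s v0; set b := root t v0; nra.
Qed.

(** Separating coefficients by sign writes a relation as [p = q]. Obtuseness gives [sp p q <= 0], so
    [p = 0]; evaluation at [v0], where all simple roots are positive, then kills each
    coefficient. *)
Lemma simples_indep (c : gT -> R) : \sum_(s in simples H) c s *: al s = 0 -> forall s, simple H s -> c s = 0.
Proof.
move=> h; pose p := \sum_(s in simples H | 0 < c s) c s *: al s.
pose q := \sum_(s in simples H | ~~ (0 < c s)) (- c s) *: al s.
have pq : p = q.
  move: h; rewrite (bigID (fun s => 0 < c s)) /= => /eqP; rewrite addr_eq0 => /eqP; rewrite -/p => ->.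
  by rewrite -sumrN; apply: eq_bigr => s _; rewrite scaleNr.
have spS (I : Type) (r : seq I) (P : pred I) (f : I -> 'rV[R]_n) m : sp (\sum_(i <- r | P i) f i) m = \sum_(i <- r | P i) sp (f i) m.
  elim/big_rec2: _ => [|i y1 y2 _ <-]; last by rewrite spDl.
  by rewrite -(scale0r (0 : 'rV_n)) spZl mul0r.
have pp : sp p p <= 0.
  rewrite [X in sp _ X]pq spS; apply: sumr_le0 => s /andP[hs cs].
  rewrite spZl spC spS; apply: mulr_ge0_le0; first exact: ltW.
  apply: sumr_le0 => t /andP[ht ct]; rewrite spZl; apply: mulr_ge0_le0.
    by rewrite oppr_ge0 leNgt.
  apply: simples_obtuse; [by rewrite inE in ht|by rewrite inE in hs|].
  by apply: contraNneq ct => ->.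
have p0 : p = 0 by apply/eqP; rewrite -(sp_eq0 rho) eq_le pp sp_ge0.
have rp : \sum_(s in simples H | 0 < c s) c s * root s v0 = 0.
  transitivity ((p *m v0) 0 0); last by rewrite p0 mul0mx mxE.
  by rewrite mulmx_suml summxE; apply: eq_bigr => s _; rewrite -scalemxAl mxE.
have rq : \sum_(s in simples H | ~~ (0 < c s)) (- c s) * root s v0 = 0.
  transitivity ((q *m v0) 0 0); last by rewrite -pq p0 mul0mx mxE.
  by rewrite mulmx_suml summxE; apply: eq_bigr => s _; rewrite -scalemxAl mxE.
have v0p s : s \in simples H -> 0 < root s v0.
  by rewrite inE => /andP[/TH_refl hs _]; exact: root_v0 hal _ hs.
move=> s ss; have hs : s \in simples H by rewrite inE.
case: (boolP (0 < c s)) => cs.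
  move/eqP: rp; rewrite psumr_eq0 => [/allP/(_ s (mem_index_enum s))|t /andP[/v0p t0 ct]]; last by rewrite mulr_ge0 // ltW.
  by rewrite hs cs /= mulf_eq0 (gt_eqF (v0p _ hs)) orbF => /eqP.
move/eqP: rq; rewrite psumr_eq0 => [/allP/(_ s (mem_index_enum s))|t /andP[/v0p t0 ct]]; last first.
  by apply: mulr_ge0; [rewrite oppr_ge0 leNgt|exact: ltW].
by rewrite hs cs /= mulf_eq0 (gt_eqF (v0p _ hs)) orbF oppr_eq0 => /eqP.
Qed.

(** Independence of the simple roots provides a right inverse of their matrix, hence points with
    prescribed values. This one is generic on the face of the chamber labelled by [J]. *)
Lemma face_point J : exists p : 'cV[R]_n, forall s, simple H s -> root s p = (s \notin J)%:R.
Proof.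
pose S := simples H; pose M : 'M[R]_(#|S|, n) := \matrix_i al (enum_val i).
have /row_freeP[B MB] : row_free M.
  rewrite -kermx_eq0; apply/rowV0P => v /sub_kermxP vM; apply/rowP => i; rewrite mxE.
  have hi : simple H (enum_val i) by have := enum_valP i; rewrite inE.
  pose c s := if s \in S =P true is ReflectT h then v 0 (enum_rank_in h s) else 0.
  have cE j : c (enum_val j) = v 0 j.
    by rewrite /c; case: eqP => [h|]; [rewrite enum_valK_in|rewrite enum_valP].
  rewrite -cE; apply: simples_indep hi; rewrite big_enum_val /=.
  by under eq_bigr do rewrite cE; rewrite -[RHS]vM mulmx_sum_row; apply: eq_bigr => j _; rewrite rowK.
exists (B *m \col_i ((enum_val i \notin J)%:R)) => s ss.
have hs : s \in S by rewrite inE.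
rewrite -(enum_rankK_in hs hs); set i := enum_rank_in hs s.
rewrite /Cox.root (_ : al (enum_val i) = row i M); last by rewrite rowK.
rewrite mulmxA -row_mul MB.
by rewrite row1 -rowE !mxE.
Qed.

Definition pt J := sval (cid (face_point J)).
Lemma ptP J s : simple H s -> root s (pt J) = (s \notin J)%:R.
Proof. exact: svalP (cid (face_point J)) s. Qed.

Lemma simple_dom x : (forall s, simple H s -> 0 <= root s x) -> dom H x.
Proof.
move=> h; apply/domP/negPn/negP => /(neg_simple faith hal)[s ss]; rewrite inE => /andP[_].
by rewrite ltNge h.
Qed.

Lemma pt_dom J : dom H (pt J).
Proof. by apply: simple_dom => s /ptP ->; rewrite ler0n. Qed.

Variable J : {set gT}.
Hypothesis JS : J \subset simples H.
Local Notation GJ := <<J>>%G.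

Lemma J_simple s : s \in J -> simple H s.
Proof. by move/(subsetP JS); rewrite inE. Qed.

Lemma GJ_fix w : (w \in GJ) = (w \in H) && (rho w *m pt J == pt J).
Proof.
apply/idP/andP => [wJ|[wH /eqP wp]].
  have gF : group_set (fixer H (pt J)).
    apply/group_setP; split=> [|a b]; first by rewrite inE group1 rho1 mul1mx eqxx.
    rewrite !inE => /andP[aH /eqP ha] /andP[bH /eqP hb].
    by rewrite groupM //= rhoM -mulmxA hb ha.
  suff : GJ \subset mk_group gF by move/subsetP/(_ w wJ); rewrite inE => /andP.
  rewrite gen_subG; apply/subsetP => s sJ; have ss := J_simple sJ.
  have /andP[hs _] := ss; have /andP[rs sH] := hs.
  by rewrite inE sH /= (refl_act hal) // ptP // sJ scale0r subr0.
have := dom_fix faith hal rH wH (pt_dom J); rewrite wp => /(_ (pt_dom J))[_].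
apply/subsetP/genS/subsetP => s; rewrite inE => /andP[ss]; rewrite ptP //.
by rewrite pnatr_eq0 eqb0 negbK.
Qed.

Lemma GJ_sub : GJ \subset H.
Proof. by apply/subsetP => w; rewrite GJ_fix => /andP[]. Qed.

Lemma TH_GJ t : TH GJ t = TH H t && (root t (pt J) == 0).
Proof.
rewrite /Cox.TH GJ_fix; case rt: (refl t) => //=; case: (t \in H) => //=.
rewrite (refl_act hal) // -subr_eq0 addrC addrA addNr add0r oppr_eq0 scaler_eq0 orbC.
case: eqP => [e|] //; have := al_neq0 hal rt; rewrite -(sp_eq0 rho).
by rewrite -(coroot_pair rho) e mulmx0 mxE eqxx.
Qed.

Lemma GJ_refl_group : refl_group GJ.
Proof.
rewrite /Cox.refl_group gen_subG; apply/subsetP => s sJ; apply: mem_gen; rewrite inE TH_GJ.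
by have ss := J_simple sJ; rewrite ptP // sJ eqxx andbT; case/andP: ss.
Qed.

(** The point is that a simple reflection of the subgroup generated by [J] is simple in [H]: it
    fixes [pt J], and the positive roots outside the subgroup are positive there. *)
Lemma J_dom x : dom GJ x <-> (forall s, s \in J -> 0 <= root s x).
Proof.
split=> [h s sJ|h].
  apply: h; rewrite TH_GJ ptP ?J_simple // sJ eqxx andbT.
  by case/andP: (J_simple sJ).
apply/domP/negPn/negP => /(neg_simple faith hal)[s ss]; rewrite inE => /andP[hs].
rewrite ltNge; apply/negP; rewrite negbK; apply: h.
have := hs; rewrite TH_GJ => /andP[hsH /eqP sp0].
suff ssH : simple H s by have := ptP J ssH; rewrite sp0; case: (s \in J) => // /eqP; rewrite eq_sym oner_eq0.
rewrite /Cox.simple hsH; apply/eqP/setP => t; rewrite !inE; apply/andP/eqP => [[ht tn]|->].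
  apply/eqP/negPn/negP => ts; have [tJ|tJ] := boolP (TH GJ t).
    by have := simpleP hal ss tJ ts; rewrite ltNge ltW.
  have tp : 0 < root t (pt J).
    rewrite lt_neqAle eq_sym pt_dom // andbT; apply: contra tJ => /eqP e.
    by rewrite TH_GJ ht e eqxx.
  have sH : s \in H by case/andP: hsH.
  have : root t (rho s *m pt J) = root t (pt J).
    by rewrite (refl_act hal) ?(TH_refl hs) // sp0 scale0r subr0.
  have nF : (0 < root t (rho s *m v0)) = false by apply/negbTE; rewrite -leNgt ltW.
  rewrite (root_act hal _ _ (TH_refl ht)) nF => e.
  have := pt_dom J (TH_conj sH ht); lra.
by split=> //; rewrite (root_self hal) ?(TH_refl hs) // oppr_lt0 (root_v0 hal) // (TH_refl hs).
Qed.

(** Inversions are split by membership in the parabolic subgroup. Inside, [w v0] is dominant, so the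
    signs are those at [h v0]. Outside, [h] fixes [pt J] and so permutes the positive roots that do
    not vanish there; the inversions are conjugates of those of [w]. *)
Lemma ninv_GJ h w : h \in GJ -> w \in H -> dom GJ (rho w *m v0) ->
  ninv H (h * w) = (ninv GJ h + ninv H w)%N.
Proof.
move=> hJ wH d; have hH : h \in H := subsetP GJ_sub _ hJ.
set x := rho w *m v0 in d *.
have hx : rho (h * w)%g *m v0 = rho h *m x by rewrite rhoM mulmxA.
rewrite /Cox.ninv hx -(cardsID [set t | TH GJ t]); congr (_ + _)%N.
  apply: eq_card => t; rewrite !inE; case tJ: (TH GJ t); last by rewrite andbF.
  have := tJ; rewrite TH_GJ => /andP[tH _]; rewrite tH andbT /=.
  rewrite [in LHS](root_act hal) ?(TH_refl tH) //.
  have p : 0 < root (t ^ h)%g x.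
    rewrite lt_neqAle eq_sym (d _ (TH_conj hJ tJ)) andbT; apply: (root_neq0 hal).
    exact: (refl_conj _ (TH_refl tH)).
  have rn := root_neq0 hal h (TH_refl tH); case: ifP => r0.
    by rewrite (lt_gtF p) (lt_gtF r0).
  by rewrite oppr_lt0 p lt_neqAle rn leNgt r0.
rewrite -(cardJg _ h); apply: eq_card => t; rewrite !inE.
rewrite -[t \in _]/(t \in _) mem_conjg !inE.
set u := (t ^ h^-1)%g; have tu : t = (u ^ h)%g by rewrite /u conjgKV.
case uH : (TH H u); last first.
  rewrite andbF; apply/esym/negP => /andP[h1 _]; move/negP: uH; apply.
  by rewrite /u TH_conj // groupV.
rewrite /= tu (TH_conj hH uH) /=.
have fixh : rho h *m pt J = pt J by move: hJ; rewrite GJ_fix => /andP[_ /eqP].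
case uJ: (TH GJ u) => /=.
  by apply/esym/negP => n1; have := d _ (TH_conj hJ uJ); rewrite leNgt n1.
have up : 0 < root u (pt J).
  rewrite lt_neqAle eq_sym pt_dom // andbT; apply: contraFneq uJ => e.
  by rewrite TH_GJ uH e eqxx.
rewrite (root_act hal) ?(TH_refl uH) //; case: ifP => // nu.
have := pt_dom J (TH_conj hH uH).
by move: up; rewrite -{1}fixh (root_act hal) ?(TH_refl uH) // nu; lra.
Qed.

End Parabolic.
End Cox2.
End Cox2.

(** * Length polynomials and Solomon's alternating formula for the sign character *)

Module Cox3.
From HB Require Import structures.
From mathcomp Require Import boolp reals complex mpoly.
From mathcomp Require Import ring.
Set Implicit Arguments.
Unset Strict Implicit.
Unset Printing Implicit Defensive.
Import Order.TTheory GRing.Theory Num.Theory ComplexField.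
Local Open Scope ring_scope.
From mathcomp Require Import lra zify.
Require Import Defs.
Import Root Cox.
Import Cox2.
Section Cox3.
Variables (R : realType) (gT : finGroupType) (n : nat).
Variable rho : mx_representation R [set: gT] n.
Hypothesis faith : mx_faithful rho.
Variables (al : gT -> 'rV[R]_n) (v0 : 'cV[R]_n).
Local Notation refl := (is_reflection rho).
Local Notation sp := (sp rho).
Local Notation coroot := (coroot rho).
Hypothesis hal : forall s, refl s ->
  [/\ rho s = 1%:M - coroot (al s) *m al s, sp (al s) (al s) = 2 & 0 < (al s *m v0) 0 0].
Implicit Types (s t w g h : gT) (x : 'cV[R]_n) (K : {group gT}) (J : {set gT}).
Local Notation root := (root al).
Local Notation TH := (TH rho).
Local Notation neg := (neg rho al).
Local Notation dom := (dom rho al).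
Local Notation simple := (simple rho al v0).
Local Notation simples := (simples rho al v0).
Local Notation ninv := (ninv rho al v0).
Local Notation refl_group := (refl_group rho).
Variable F : numFieldType.

Definition poincare K : {poly F} := \sum_(w in K) 'X^(ninv K w).

Variable H : {group gT}.
Hypothesis rH : refl_group H.
Local Notation pt := (pt hal H).
Local Notation GJ J := <<J>>%G.
Notation S := (simples H).

Lemma pt_dom0 J : dom H (pt J). Proof. exact: pt_dom. Qed.

(** Dominance selects the shortest element of each coset of the parabolic subgroup. *)
Definition coset_poly J : {poly F} :=
  \sum_(w in H | `[< dom (GJ J) (rho w *m v0) >]) 'X^(ninv H w).

Lemma regular_v0 K w t : TH K t -> root t (rho w *m v0) != 0.
Proof. by move/TH_refl => ht; exact: (root_neq0 hal). Qed.

Lemma sumV K (f : gT -> F) : \sum_(h in K) f (h^-1)%g = \sum_(h in K) f h.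
Proof. by rewrite [RHS](reindex_inj invg_inj); apply: eq_bigl => h; rewrite groupV. Qed.

Lemma poincare_factor J : J \subset S -> poincare H = poincare (GJ J) * coset_poly J.
Proof.
move=> JS; rewrite /poincare /coset_poly big_distrl /=.
have sub := subsetP (GJ_sub faith hal rH JS).
transitivity (\sum_(h in GJ J) \sum_(w in H | `[< dom (GJ J) (rho (h^-1 * w)%g *m v0) >]) 'X^(ninv H w) : {poly F}).
  rewrite (exchange_big_dep (mem H)) /= => [|i j _ /andP[]//]; apply: eq_bigr => w wH.
  rewrite -big_filter_cond /= big_const_seq.
  set k := count _ _.
  suff -> : k = 1%N by rewrite /= addr0.
  rewrite /k count_filter -sum1_count.
  transitivity (\sum_(h in GJ J | `[< dom (GJ J) (rho (h^-1 * w)%g *m v0) >]) 1)%N.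
    by rewrite [LHS]big_mkcond [RHS]big_mkcond; apply: eq_bigr => i _ /=; rewrite wH /= andbC.
  rewrite (reindex_inj invg_inj) /=.
  transitivity (\sum_(h in [set h in GJ J | `[< dom (GJ J) (rho h *m (rho w *m v0)) >]]) 1)%N.
    by apply: eq_bigl => h; rewrite !inE groupV invgK rhoM mulmxA.
  rewrite sum1_card (card_domE faith hal) ?(GJ_refl_group faith hal rH JS) //.
  apply: (fixer_regular faith hal); first exact: (GJ_refl_group faith hal rH JS).
  by move=> t; exact: regular_v0.
apply: eq_bigr => h hJ; rewrite mulr_sumr (reindex_inj (mulgI h)) /=.
have hH := sub _ hJ.
apply: eq_big => w; first by rewrite groupMl // mulKg.
by rewrite groupMl // mulKg => /andP[wH /asboolP d]; rewrite (ninv_GJ faith hal rH JS) // exprD.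
Qed.

Lemma alt_dom (x : 'cV[R]_n) :
  \sum_(J : {set gT} | (J \subset S) && `[< dom (GJ J) x >]) (-1) ^+ #|J| =
  [forall s, (s \in S) ==> (root s x < 0)]%:R :> F.
Proof.
rewrite (sum_subsets F (Q := [set s in S | 0 <= root s x])); last first.
  move=> J; apply/andP/subsetP => [[JS /asboolP d] s sJ|h].
    by rewrite inE (subsetP JS _ sJ); apply: (J_dom faith hal rH JS x).1.
  have JS : J \subset S by apply/subsetP => s /h; rewrite inE => /andP[].
  split=> //; apply/asboolP/(J_dom faith hal rH JS x) => s /h.
  by rewrite inE => /andP[].
congr ((nat_of_bool _)%:R); apply/eqP/forallP => [e s|h]; last first.
  apply/setP => s; rewrite [in LHS]inE [in RHS]inE; apply/negP => /andP[sS sx].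
  by have := h s; rewrite sS /= ltNge sx.
apply/implyP => sS; rewrite ltNge; apply/negP => sx.
by have : s \in [set s in S | 0 <= root s x]; [rewrite inE sS|rewrite e inE].
Qed.

Lemma all_neg_dom x : (forall t, TH H t -> root t x != 0) ->
  [forall s, (s \in S) ==> (root s x < 0)] = `[< dom H (- x) >].
Proof.
have rN t y : root t (- y) = - root t y by rewrite /Cox.root mulmxN mxE.
move=> reg; apply/forallP/asboolP => [h|d s]; last first.
  apply/implyP; rewrite inE => /andP[hs _]; have := d s hs; rewrite rN oppr_ge0.
  by rewrite lt_neqAle reg.
apply: (simple_dom faith hal) => s ss.
by rewrite rN oppr_ge0 ltW //; have := h s; rewrite inE ss.
Qed.

Lemma card_all_neg x : (forall t, TH H t -> root t x != 0) ->
  #|[set w in H | [forall s, (s \in S) ==> (root s (rho w *m x) < 0)]]| = 1%N.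
Proof.
move=> reg; have rN t y : root t (- y) = - root t y by rewrite /Cox.root mulmxN mxE.
transitivity #|fixer rho H (- x)|; last first.
  by apply: (fixer_regular faith hal) => // t ht; rewrite rN oppr_eq0 reg.
rewrite -(card_domE faith hal) //; apply: eq_card => w; rewrite !inE.
case wH: (w \in H) => //=; rewrite all_neg_dom ?mulmxN // => t ht.
have := reg _ (TH_conj wH ht); rewrite (root_act hal) ?(TH_refl ht) //.
by case: ifP => // _; rewrite oppr_eq0.
Qed.

(** Only the longest element survives the cancellation, being the unique one for which all simple
    roots are negative; every reflection of [H] is an inversion of it. *)
Lemma alt_coset_poly : \sum_(J : {set gT} | J \subset S) (-1) ^+ #|J| *: coset_poly J = 'X^#|[set t | TH H t]|.
Proof.
transitivity (\sum_(w in H) [forall s, (s \in S) ==> (root s (rho w *m v0) < 0)]%:R *: 'X^(ninv H w) : {poly F}).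
  under eq_bigr => J _ do rewrite /coset_poly scaler_sumr.
  rewrite (exchange_big_dep (mem H)) /=; last by move=> i j _ /andP[].
  apply: eq_bigr => w wH; rewrite -(alt_dom (rho w *m v0)) scaler_suml; apply: eq_bigl => J; by rewrite wH.
have reg t : TH H t -> root t v0 != 0 by move/TH_refl/(root_v0 hal)/lt0r_neq0.
have c1 := card_all_neg reg.
have /cards1P[w0 hw0] : #|[set w in H | [forall s, (s \in S) ==> (root s (rho w *m v0) < 0)]]| == 1%N by rewrite c1.
have := set11 w0; rewrite -hw0 inE => /andP[w0H w0n].
rewrite (bigD1 w0) //= w0n scale1r big1 ?addr0 => [|w /andP[wH ww0]]; last first.
  case: (boolP [forall s, (s \in S) ==> (root s (rho w *m v0) < 0)]) => [wn|_]; last by rewrite scale0r.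
  have : w \in [set w0] by rewrite -hw0 inE wH.
  by rewrite inE (negbTE ww0).
congr ('X^_); apply: eq_card => t; rewrite !inE andb_idr // => ht.
have regw u : TH H u -> root u (rho w0 *m v0) != 0 by exact: regular_v0.
move: w0n; rewrite all_neg_dom // => /asboolP/(_ t ht).
by rewrite /Cox.root mulmxN mxE oppr_ge0 lt_neqAle => ->; rewrite andbT; exact: regw.
Qed.

(** The alternating sum of the permutation characters on cosets of the standard parabolic
    subgroups. *)
Definition theta g : F := \sum_(J : {set gT} | J \subset S)
  (-1) ^+ #|J| * (#|GJ J|%:R^-1 * #|[set w in H | (g ^ w)%g \in GJ J]|%:R).

Definition alt_avg (chi : gT -> F) : F := \sum_(J : {set gT} | J \subset S)
  (-1) ^+ #|J| * (#|GJ J|%:R^-1 * \sum_(g in GJ J) chi g).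

Lemma card_sum (P : pred gT) : #|[set w | P w]|%:R = \sum_w (P w)%:R :> F.
Proof.
rewrite -sum1_card natr_sum big_mkcond /=; apply: eq_bigr => w _.
by rewrite inE; case: (P w).
Qed.

(** Frobenius reciprocity: pairing with an induced trivial character is averaging over the
    subgroup. *)
Lemma theta_sum (chi : gT -> F) : (forall g h, g \in H -> h \in H -> chi (g ^ h)%g = chi g) ->
  \sum_(g in H) theta g * chi g = #|H|%:R * alt_avg chi.
Proof.
move=> cf; under eq_bigr => g _ do rewrite /theta mulr_suml.
rewrite exchange_big /alt_avg mulr_sumr /=; apply: eq_bigr => J JS.
have sub := subsetP (GJ_sub faith hal rH JS).
rewrite mulrCA; under eq_bigr => g _ do rewrite -!mulrA.
transitivity ((-1) ^+ #|J| * (#|GJ J|%:R^-1 * \sum_(g in H) #|[set w in H | (g ^ w)%g \in GJ J]|%:R * chi g)).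
  by rewrite !mulr_sumr.
rewrite [#|H|%:R * _]mulrCA; congr (_ * (_ * _)).
under [LHS]eq_bigr => g _ do rewrite card_sum mulr_suml.
rewrite exchange_big /= (bigID (mem H)) /= [X in _ + X]big1 ?addr0; last first.
  by move=> w /negbTE wH; rewrite big1 // => g _; rewrite wH mul0r.
rewrite -sum1_card natr_sum mulr_suml; apply: eq_bigr => w wH; rewrite mul1r.
transitivity (\sum_(g in H) (g \in GJ J)%:R * chi g).
  rewrite [RHS](reindex_inj (conjg_inj w)) /=; apply: eq_big => g; first by rewrite (@groupJr _ H).
  by move=> gH; rewrite wH cf.
rewrite [RHS]big_mkcond [LHS]big_mkcond /=; apply: eq_bigr => g _.
case gJ: (g \in GJ J); first by rewrite (sub _ gJ) mul1r.
by rewrite mul0r if_same.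
Qed.

Lemma refl1 : refl 1%g = false.
Proof. by rewrite /is_reflection rho1 subrr mxrank0 andbF. Qed.

(** The sum on the left counts, over [w], the stabiliser of [w pt_K] in [GJ J]. By [card_domE] its
    order is also the number of [h] making [h w pt_K] dominant, and renaming [h w] as [w] gives the
    factor [#|GJ J|]. *)
Lemma fix_count (J K : {set gT}) : J \subset S -> K \subset S ->
  #|GJ J|%:R^-1 * \sum_(g in GJ J) #|[set w in H | (g ^ w)%g \in GJ K]|%:R =
  #|[set w in H | `[< dom (GJ J) (rho w *m pt K) >]]|%:R :> F.
Proof.
move=> JS KS; have sub := subsetP (GJ_sub faith hal rH JS).
have rJ := GJ_refl_group faith hal rH JS.
have nz : #|GJ J|%:R != 0 :> F by rewrite pnatr_eq0 -lt0n cardG_gt0.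
apply: (mulfI nz); rewrite mulrA divff // mul1r.
under eq_bigr => g _ do rewrite card_sum.
rewrite exchange_big /=.
transitivity (\sum_w (w \in H)%:R * #|[set h in GJ J | `[< dom (GJ J) (rho h *m (rho w *m pt K)) >]]|%:R : F).
  apply: eq_bigr => w _; rewrite (card_domE faith hal) //.
  case wH: (w \in H); last by rewrite mul0r big1.
  rewrite mul1r -sum1_card natr_sum [LHS]big_mkcond [RHS]big_mkcond /=; apply: eq_bigr => g _.
  rewrite inE; case gJ: (g \in GJ J) => //=.
  rewrite (GJ_fix faith hal rH KS) (@groupJr _ H) // (sub _ gJ) //= conjgE !rhoM.
  have -> : (rho w^-1%g *m (rho g *m rho w) *m pt K == pt K) = (rho g *m (rho w *m pt K) == rho w *m pt K).
    apply/eqP/eqP => [e|e]; last by rewrite -!mulmxA e mulmxA rhoVK mul1mx.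
    by rewrite -[in RHS]e !mulmxA rhoKV mul1mx.
  by case: (_ == _).
under eq_bigr => w _ do rewrite card_sum mulr_sumr.
rewrite exchange_big /= card_sum -sum1_card natr_sum mulr_suml [RHS]big_mkcond /=.
apply: eq_bigr => h _; case: ifPn => [hJ|hJ]; last first.
  by rewrite big1 // => w _; rewrite mulr0.
rewrite mul1r [RHS](reindex_inj (mulgI h)); apply: eq_bigr => w _.
by rewrite /= (groupMl _ (sub _ hJ)) rhoM -mulmxA -natrM mulnb.
Qed.

Lemma GJ0 : GJ set0 = 1%g :> {set gT}.
Proof. by rewrite /= gen0. Qed.

(** This is the norm of [theta]. Exchanging the two alternating sums leaves the [w] for which all
    simple roots are negative at [w pt_K]. A nonempty [K] puts [pt_K] on a wall, which excludes
    them, so only [K = set0] contributes, with a single [w]. *)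
Lemma alt_avg_theta : alt_avg theta = 1.
Proof.
rewrite /alt_avg.
transitivity (\sum_(K : {set gT} | K \subset S) (-1) ^+ #|K| * (#|GJ K|%:R^-1 *
   #|[set w in H | [forall s, (s \in S) ==> (root s (rho w *m pt K) < 0)]]|%:R) : F).
  have E J : J \subset S -> #|GJ J|%:R^-1 * \sum_(g in GJ J) theta g = \sum_(K : {set gT} | K \subset S)
      (-1) ^+ #|K| * (#|GJ K|%:R^-1 * #|[set w in H | `[< dom (GJ J) (rho w *m pt K) >]]|%:R).
    move=> JS; rewrite /theta exchange_big /= mulr_sumr; apply: eq_bigr => K KS.
    rewrite -(fix_count JS KS) !mulr_sumr; apply: eq_bigr => g _.
    by rewrite mulrCA; congr (_ * _); rewrite mulrCA.
  rewrite -/theta; under eq_bigr => J JS do rewrite E // mulr_sumr.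
  rewrite exchange_big /=; apply: eq_bigr => K KS.
  transitivity ((-1) ^+ #|K| * (#|GJ K|%:R^-1 * \sum_(J : {set gT} | J \subset S)
      (-1) ^+ #|J| * #|[set w in H | `[< dom (GJ J) (rho w *m pt K) >]]|%:R) : F).
    by rewrite !mulr_sumr; apply: eq_bigr => J _; rewrite mulrCA; congr (_ * _); rewrite mulrCA.
  congr (_ * (_ * _)).
  under eq_bigr => J JS do rewrite card_sum mulr_sumr.
  rewrite exchange_big /= card_sum; apply: eq_bigr => w _.
  case wH: (w \in H) => /=; last by rewrite big1 // => J _; rewrite mulr0.
  rewrite -(alt_dom (rho w *m pt K)) [RHS]big_mkcondr; apply: eq_bigr => J _.
  by case: `[< _ >]; rewrite ?mulr1 ?mulr0.
rewrite (bigD1 set0) ?sub0set //= big1 ?addr0 => [|K /andP[KS K0]]; last first.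
  suff -> : [set w in H | [forall s, (s \in S) ==> (root s (rho w *m pt K) < 0)]] = set0.
    by rewrite cards0 !mulr0.
  apply/setP => w; rewrite !inE; apply/negP => /andP[wH /forallP hn].
  have [s sK] := set0Pn _ K0; have ss := J_simple KS sK.
  have /andP[hs _] := ss; set y := rho w *m pt K in hn.
  have rN t z : root t (- z) = - root t z by rewrite /Cox.root mulmxN mxE.
  have dy : dom H (- y).
    apply: (simple_dom faith hal) => t st; rewrite rN oppr_ge0 ltW //.
    by have := hn t; rewrite inE st.
  have ht : TH H (s ^ w^-1)%g by rewrite TH_conj // groupV.
  have y0 : root (s ^ w^-1)%g y = 0.
    rewrite (root_act hal) ?(TH_refl ht) // conjgKV (ptP hal K ss) sK.
    by case: ifP; rewrite ?oppr0.
  have ty : rho (s ^ w^-1)%g *m (- y) = - y.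
    by rewrite (refl_act hal) ?(TH_refl ht) // rN y0 oppr0 scale0r subr0.
  have tH : (s ^ w^-1)%g \in H by case/andP: ht.
  have := dom_fix faith hal rH tH dy; rewrite ty => /(_ dy)[_].
  rewrite /= [X in <<X>>%g](_ : _ = set0) ?gen0.
    by move/set1P => e; have := TH_refl ht; rewrite e refl1.
  apply/setP => t; rewrite !inE; apply/negP => /andP[st]; rewrite rN oppr_eq0.
  by have := hn t; rewrite inE st /= => /lt_eqF ->.
rewrite cards0 expr0 mul1r GJ0 cards1 invr1 mul1r card_all_neg // => t ht.
apply/negP => t0; have : TH (GJ set0) t by rewrite (TH_GJ faith hal rH (sub0set _)) ht.
by case/andP => rt; rewrite GJ0 => /set1P e; rewrite e refl1 in rt.
Qed.

Section Solomon.
Variable sgn : gT -> F.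
Hypothesis sgnM : forall g h, g \in H -> h \in H -> sgn (g * h)%g = sgn g * sgn h.
Hypothesis sgn2 : forall g, g \in H -> sgn g ^+ 2 = 1.
Hypothesis sgnT : forall s, TH H s -> sgn s = -1.

Lemma sgn1 : sgn 1%g = 1.
Proof.
have := sgnM (group1 H) (group1 H); rewrite mulg1 => /esym/eqP.
have nz : sgn 1%g != 0 by apply/eqP => e; have := sgn2 (group1 H); rewrite e expr0n => /esym/eqP; rewrite oner_eq0.
by rewrite -{3}[sgn 1%g]mulr1 (inj_eq (mulfI nz)) => /eqP.
Qed.

Lemma alt_avg_sgn : alt_avg sgn = 1.
Proof.
rewrite /alt_avg (bigD1 set0) ?sub0set //= [X in _ + X]big1 ?addr0 => [|J /andP[JS J0]]; last first.
  have [s sJ] := set0Pn _ J0; have ss := J_simple JS sJ.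
  have /andP[hs _] := ss; have sub := subsetP (GJ_sub faith hal rH JS).
  have sG : s \in GJ J by apply: mem_gen.
  suff -> : \sum_(g in GJ J) sgn g = 0 by rewrite !mulr0.
  have e : \sum_(g in GJ J) sgn g = - \sum_(g in GJ J) sgn g.
    rewrite {1}(reindex_inj (mulgI s)) -sumrN; apply: eq_big => g /=; first by rewrite groupMl.
    by rewrite groupMl // => gJ; rewrite (sgnM (sub _ sG) (sub _ gJ)) sgnT // mulN1r.
  by apply/eqP; move/eqP: e; rewrite -subr_eq0 opprK -mulr2n mulrn_eq0.
rewrite cards0 expr0 mul1r GJ0 cards1 invr1 mul1r.
by rewrite (big_pred1 1%g) ?sgn1 // => g; rewrite inE.
Qed.

Lemma sgnJ g h : g \in H -> h \in H -> sgn (g ^ h)%g = sgn g.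
Proof.
move=> gH hH; rewrite conjgE !sgnM ?groupM ?groupV // mulrCA -sgnM ?groupV // mulVg sgn1.
by rewrite mulr1.
Qed.

Lemma thetaJ g h : h \in H -> theta (g ^ h)%g = theta g.
Proof.
move=> hH; apply: eq_bigr => J JS; congr (_ * (_ * _)).
rewrite !card_sum (reindex_inj (mulgI h^-1%g)); apply: eq_bigr => w _.
by rewrite groupMl ?groupV // -conjgM mulKVg.
Qed.

(** Both functions are real, and the squared norm of their difference is [1 - 2 + 1 = 0], from the
    two norms and the scalar product. *)
Lemma theta_sgn g : g \in H -> theta g = sgn g.
Proof.
have sr h : h \in H -> sgn h \is Num.real.
  move=> hH; have /eqP := sgn2 hH; rewrite sqrf_eq1 => /orP[]/eqP->; by rewrite ?rpredN rpred1.
have tr h : theta h \is Num.real.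
  apply: rpred_sum => J _; rewrite !rpredM ?rpredV ?rpred_nat // rpredX // rpredN rpred1 //.
have s0 : \sum_(h in H) (theta h - sgn h) ^+ 2 = 0.
  have -> : \sum_(h in H) (theta h - sgn h) ^+ 2 =
     \sum_(h in H) theta h * theta h - 2 * (\sum_(h in H) theta h * sgn h) + \sum_(h in H) 1.
    rewrite mulr_sumr -sumrB -big_split; apply: eq_bigr => h hH /=.
    transitivity (theta h * theta h - 2 * (theta h * sgn h) + sgn h ^+ 2); first by ring.
    by rewrite (sgn2 hH).
  rewrite !theta_sum => [|? ? *|? ? *]; [|exact: sgnJ|exact: thetaJ].
  by rewrite alt_avg_theta alt_avg_sgn sumr_const !mulr1 -[1 *+ _]/(_%:R); ring.
move=> gH; move/eqP: s0; rewrite psumr_eq0 => [/allP/(_ g (mem_index_enum g))|h hH].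
  by rewrite gH /= sqrf_eq0 subr_eq0 => /eqP.
by rewrite real_exprn_even_ge0 // rpredB // sr.
Qed.

Theorem alt_avgE chi : (forall g h, g \in H -> h \in H -> chi (g ^ h)%g = chi g) ->
  alt_avg chi = #|H|%:R^-1 * \sum_(g in H) sgn g * chi g.
Proof.
move=> cf; have nz : #|H|%:R != 0 :> F by rewrite pnatr_eq0 -lt0n cardG_gt0.
apply: (mulfI nz); rewrite -theta_sum // mulrA divff // mul1r.
by apply: eq_bigr => g gH; rewrite theta_sgn.
Qed.
End Solomon.

End Cox3.
End Cox3.

(** * The product of the roots and anti-invariant polynomials *)

Module Delta.
From HB Require Import structures.
From mathcomp Require Import boolp reals complex mpoly.
From mathcomp Require Import ring.
Set Implicit Arguments.
Unset Strict Implicit.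
Unset Printing Implicit Defensive.
Import Order.TTheory GRing.Theory Num.Theory ComplexField.
Local Open Scope ring_scope.
From mathcomp Require Import lra zify.
Require Import Defs.
Import PolyAct Root Cox Cox2 Cox3.
Section Delta.
Variables (R : realType) (gT : finGroupType) (n : nat).
Variable rho : mx_representation R [set: gT] n.
Hypothesis faith : mx_faithful rho.
Variables (al : gT -> 'rV[R]_n) (v0 : 'cV[R]_n).
Local Notation refl := (is_reflection rho).
Local Notation sp := (sp rho).
Local Notation coroot := (coroot rho).
Hypothesis hal : forall s, refl s ->
  [/\ rho s = 1%:M - coroot (al s) *m al s, sp (al s) (al s) = 2 & 0 < (al s *m v0) 0 0].
Implicit Types (s t w g h : gT) (K H : {group gT}).
Local Notation C := R[i].
Local Notation A := {mpoly C[n]}.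
Implicit Types p q : A.
Local Notation root := (root al).
Local Notation TH := (TH rho).
Local Notation refl_group := (refl_group rho).
Local Notation toC := (real_complex R).

Fact wact_key : unit. Proof. by []. Qed.
Definition wact g : A -> A := locked_with wact_key (fun p => act (map_mx toC (rho g^-1%g)) p).
Lemma wactE g p : wact g p = act (map_mx toC (rho g^-1%g)) p.
Proof. by rewrite /wact unlock. Qed.
Fact wact_is_linear g : linear (wact g).
Proof. by move=> a p q; rewrite !wactE linearP. Qed.
HB.instance Definition _ g := GRing.isLinear.Build C A A _ (wact g) (wact_is_linear g).
Fact wact_is_monoid g : monoid_morphism (wact g).
Proof. by split=> [|p q]; rewrite !wactE ?rmorph1 ?rmorphM. Qed.
HB.instance Definition _ g := GRing.isMonoidMorphism.Build A A (wact g) (wact_is_monoid g).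

Lemma wactM g h p : wact (g * h) p = wact g (wact h p).
Proof. by rewrite !wactE actK invMg rhoM map_mxM. Qed.
Lemma wact1 p : wact 1 p = p.
Proof. by rewrite wactE invg1 rho1 map_mx1 act1. Qed.
Lemma wactK g p : wact g^-1 (wact g p) = p.
Proof. by rewrite -wactM mulVg wact1. Qed.
Lemma wactVK g p : wact g (wact g^-1 p) = p.
Proof. by rewrite -wactM mulgV wact1. Qed.
Lemma wact_lin g l : wact g (lin l) = lin (l *m map_mx toC (rho g^-1%g)).
Proof. by rewrite wactE act_lin. Qed.
Lemma wact_homog g d p : p \is d.-homog -> wact g p \is d.-homog.
Proof. by rewrite wactE; exact: act_homog. Qed.
Lemma wact_inj g : injective (wact g).
Proof. exact: can_inj (wactK g). Qed.

Definition rowC s : 'rV[C]_n := map_mx toC (al s).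
Definition corC s : 'cV[C]_n := map_mx toC (coroot (al s)).
Definition alC s : A := lin (rowC s).

Lemma rowC_neq0 s : refl s -> rowC s != 0.
Proof. by move=> hs; rewrite map_mx_eq0 (al_neq0 hal). Qed.
Lemma alC_neq0 s : refl s -> alC s != 0.
Proof. by move=> hs; rewrite lin_eq0 rowC_neq0. Qed.

Lemma wact_refl s p : refl s -> wact s p = act (1%:M - corC s *m rowC s) p.
Proof.
move=> hs; rewrite wactE (reflV faith hs); congr (comp_mpoly (lins _) p).
by case: (hal hs) => -> _ _; rewrite map_mxB map_mx1 map_mxM.
Qed.

Definition nab s p : A := ddiff (corC s) (rowC s) p.
Lemma nabP s p : refl s -> p - wact s p = alC s * nab s p.
Proof. by move=> hs; rewrite (wact_refl p hs) ddiffP. Qed.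

Lemma rowC_corC s t : refl s -> (rowC t *m corC s) 0 0 = toC (sp (al t) (al s)).
Proof. by move=> hs; rewrite -map_mxM mxE coroot_pair. Qed.

Lemma wact_alC g s : refl s ->
  wact g (alC s) = if 0 < root s (rho g^-1%g *m v0) then alC (s ^ g^-1)%g else - alC (s ^ g^-1)%g.
Proof.
move=> hs; rewrite /alC wact_lin -map_mxM (al_conj hal _ hs).
by case: ifP => // _; rewrite map_mxN linearN.
Qed.

(** Restriction to the hyperplane of [s]: a root takes the value 2 on its coroot, so half of the
    rank one term gives the projection onto the hyperplane. *)
Definition res s p : A := act (1%:M - (2^-1 *: corC s) *m rowC s) p.

HB.instance Definition _ s := GRing.LRMorphism.copy (res s) (act (1%:M - (2^-1 *: corC s) *m rowC s)).

Lemma res_dvd s p : res s p = 0 -> exists q, p = alC s * q.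
Proof. exact: lin_dvd. Qed.

Lemma res_alC s t : refl s -> refl t -> t != s -> res s (alC t) != 0.
Proof.
move=> hs ht ts; rewrite /res act_lin lin_eq0; apply/eqP.
rewrite mulmxBr mulmx1 mulmxA -scalemxAr -scalemxAl [rowC t *m _]mx11_scalar rowC_corC //.
rewrite mul_scalar_mx scalerA => /eqP; rewrite subr_eq0 => /eqP e.
have {}e : al t = (2^-1 * sp (al t) (al s)) *: al s.
  apply/rowP => j; have := congr1 (fun l : 'rV[C]_n => l 0 j) e; rewrite !mxE.
  have -> : (2^-1 : C) = toC 2^-1 by rewrite fmorphV rmorph_nat.
  by rewrite -!rmorphM => /(@complexI R).
have h : sp (al t) (al t) = 2 by case: (hal ht).
have sse : sp (al s) (al s) = 2 by case: (hal hs).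
have ne := sp_lt2 faith hal ht hs ts.
move: h; rewrite {1}e spZl spC => h; have t0 := root_v0 hal ht; have s0 := root_v0 hal hs.
have : root t v0 = (2^-1 * sp (al t) (al s)) * root s v0 by rewrite /Cox.root e -scalemxAl mxE -e.
move: h ne; rewrite spC; set k := sp _ _; move=> h ne; nra.
Qed.

Lemma res_self s : refl s -> res s (alC s) = 0.
Proof.
move=> hs; apply/eqP; rewrite /res act_lin lin_eq0.
rewrite mulmxBr mulmx1 mulmxA -scalemxAr -scalemxAl [rowC s *m _]mx11_scalar rowC_corC //.
case: (hal hs) => _ -> _; rewrite rmorph_nat mul_scalar_mx scalerA mulVf ?scale1r ?subrr //.
by rewrite pnatr_eq0.
Qed.

Lemma anti_res s p : refl s -> wact s p = - p -> res s p = 0.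
Proof.
move=> hs e; have := nabP p hs; rewrite e opprK => /(congr1 (res s)).
rewrite rmorphM /= (res_self hs) mul0r raddfD /= -mulr2n -scaler_nat => /eqP.
by rewrite scaler_eq0 pnatr_eq0 => /eqP.
Qed.

Lemma res_prod_neq0 s (r : seq gT) : refl s -> all refl r -> s \notin r ->
  res s (\prod_(t <- r) alC t) != 0.
Proof.
move=> hs hr sr; rewrite rmorph_prod /= prodf_seq_neq0; apply/allP => t tr /=.
apply: (res_alC hs); first exact: (allP hr).
by apply: contraNneq sr => <-.
Qed.

(** Distinct roots are not proportional, so dividing by one of them keeps the vanishing on the other
    hyperplanes. *)
Lemma res_prod_dvd (r : seq gT) p : uniq r -> all refl r -> (forall s, s \in r -> res s p = 0) ->
  exists q, p = (\prod_(t <- r) alC t) * q.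
Proof.
elim: r => [|s r IH] /=; first by exists p; rewrite big_nil mul1r.
case/andP=> sr ur /andP[hs hr] h.
have [|q pq] := IH ur hr; first by move=> t tr; apply: h; rewrite inE tr orbT.
have /eqP : res s (\prod_(t <- r) alC t) * res s q = 0.
  by rewrite -(rmorphM (res s)) -pq; exact: h (mem_head _ _).
rewrite mulf_eq0 => /orP[e|/eqP/res_dvd[q' qE]].
  by have := res_prod_neq0 hs hr sr; rewrite e.
by exists q'; rewrite big_cons pq qE mulrCA mulrA.
Qed.

Definition roots H : seq gT := [seq s <- enum gT | TH H s].
Lemma mem_roots H s : (s \in roots H) = TH H s.
Proof. by rewrite mem_filter mem_enum andbT. Qed.
Lemma roots_refl H : all refl (roots H).
Proof. by apply/allP => s; rewrite mem_roots => /andP[]. Qed.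
Lemma roots_uniq H : uniq (roots H).
Proof. exact: filter_uniq (enum_uniq _). Qed.

Definition delta H : A := \prod_(s <- roots H) alC s.

Lemma deltaE H : delta H = \prod_(s | TH H s) alC s.
Proof. by rewrite /delta big_filter big_enum_cond; apply: eq_bigl. Qed.

Lemma delta_neq0 H : delta H != 0.
Proof.
rewrite prodf_seq_neq0; apply/allP => s sr /=.
by rewrite alC_neq0 //; exact: (allP (roots_refl H)).
Qed.

Definition sgn H g : C := \prod_(s | TH H s) (if 0 < root s (rho g^-1%g *m v0) then 1 else -1).

Lemma wact_delta H g : g \in H -> wact g (delta H) = sgn H g *: delta H.
Proof.
move=> gH; rewrite !deltaE rmorph_prod /=.
have -> : \prod_(s | TH H s) alC s = \prod_(s | TH H s) alC (s ^ g^-1)%g.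
  rewrite (reindex_inj (conjg_inj g^-1%g)); apply: eq_bigl => s.
  apply/idP/idP => [h|]; last by apply: TH_conj; rewrite groupV.
  by rewrite -[s](conjgKV g) TH_conj.
rewrite -mul_mpolyC rmorph_prod -big_split /=; apply: eq_bigr => s /TH_refl hs.
by rewrite wact_alC //; case: ifP => _; rewrite ?mul1r // rmorphN1 mulN1r.
Qed.

Lemma sgn_sqr H g : sgn H g ^+ 2 = 1.
Proof. by rewrite -prodrXl big1 // => s _; case: ifP => _; rewrite ?sqrrN expr1n. Qed.

Lemma sgnM H g h : g \in H -> h \in H -> sgn H (g * h)%g = sgn H g * sgn H h.
Proof.
move=> gH hH; have e := wactM g h (delta H).
rewrite !wact_delta ?groupM // linearZ /= wact_delta // scalerA [sgn H h * _]mulrC in e.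
by move/eqP: e; rewrite -subr_eq0 -scalerBl scaler_eq0 (negbTE (delta_neq0 H)) orbF subr_eq0 => /eqP.
Qed.

(** If the sign were 1, the product of the remaining roots would change sign under [s] and so vanish
    on its hyperplane, where no other root vanishes identically. *)
Lemma sgn_refl H s : TH H s -> sgn H s = -1.
Proof.
move=> hs; have /andP[rs sH] := hs; have /eqP := sgn_sqr H s.
rewrite sqrf_eq1 => /orP[/eqP e|/eqP //]; exfalso.
have := wact_delta sH; rewrite e scale1r /delta.
have sr : s \in roots H by rewrite mem_roots.
rewrite (big_rem s) //=; set d' := \prod_(t <- _) _ => E.
have ss : wact s (alC s) = - alC s.
  by rewrite /alC wact_lin -map_mxM (reflV faith rs) (al_self hal rs) map_mxN linearN.
have nd' : wact s d' = - d'.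
  apply: (mulfI (alC_neq0 rs)); rewrite mulrN -E (rmorphM (wact s)) /= ss mulNr opprK.
  by [].
have := anti_res rs nd'; apply/eqP; apply: res_prod_neq0 => //.
  by apply/allP => t /mem_rem; exact: (allP (roots_refl H)).
by rewrite mem_rem_uniq ?roots_uniq // inE eqxx.
Qed.

Lemma anti_dvd H p : (forall s, TH H s -> wact s p = - p) -> exists q, p = delta H * q.
Proof.
move=> h; apply: res_prod_dvd; rewrite ?roots_uniq ?roots_refl // => s; rewrite mem_roots => hs.
by apply: anti_res; [exact: TH_refl hs|exact: h].
Qed.

Definition inv H p := forall g, g \in H -> wact g p = p.

Definition avg H p : A := #|H|%:R^-1 *: \sum_(g in H) wact g p.
Definition avgs H p : A := #|H|%:R^-1 *: \sum_(g in H) sgn H g *: wact g p.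

Fact avg_linear H : linear (avg H).
Proof.
move=> a p q; rewrite /avg scalerA mulrC -scalerA -scalerDr; congr (_ *: _).
by rewrite scaler_sumr -big_split; apply: eq_bigr => g _ /=; rewrite linearP.
Qed.
HB.instance Definition _ H := GRing.isLinear.Build C A A _ (avg H) (avg_linear H).
Fact avgs_linear H : linear (avgs H).
Proof.
move=> a p q; rewrite /avgs scalerA mulrC -scalerA -scalerDr; congr (_ *: _).
rewrite scaler_sumr -big_split; apply: eq_bigr => g _ /=.
by rewrite linearP scalerDr !scalerA mulrC.
Qed.
HB.instance Definition _ H := GRing.isLinear.Build C A A _ (avgs H) (avgs_linear H).

Lemma cardC_neq0 H : #|H|%:R != 0 :> C.
Proof. by rewrite pnatr_eq0 -lt0n cardG_gt0. Qed.

Lemma avg_inv H p : inv H (avg H p).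
Proof.
move=> h hH; rewrite /avg linearZ /= (raddf_sum (wact h)) /=; congr (_ *: _).
rewrite [RHS](reindex_inj (mulgI h)); apply: eq_big => g; first by rewrite groupMl.
by rewrite wactM.
Qed.
Lemma avg_id H p : inv H p -> avg H p = p.
Proof.
move=> ip; rewrite /avg (eq_bigr (fun=> p)) // sumr_const -[p *+ _]scaler_nat scalerA.
by rewrite mulVf ?scale1r // cardC_neq0.
Qed.
Lemma avgM H p q : inv H q -> avg H (p * q) = avg H p * q.
Proof.
move=> iq; rewrite /avg -scalerAl mulr_suml; congr (_ *: _); apply: eq_bigr => g gH.
by rewrite rmorphM /= iq.
Qed.
Lemma avg_homog H d p : p \is d.-homog -> avg H p \is d.-homog.
Proof. by move=> hp; apply/rpredZ/rpred_sum => g _; apply: wact_homog. Qed.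
Lemma avgs_homog H d p : p \is d.-homog -> avgs H p \is d.-homog.
Proof. by move=> hp; apply/rpredZ/rpred_sum => g _; apply/rpredZ/wact_homog. Qed.

Lemma avgs_anti H p h : h \in H -> wact h (avgs H p) = sgn H h *: avgs H p.
Proof.
move=> hH; rewrite /avgs linearZ /= (raddf_sum (wact h)) /= scalerA mulrC -scalerA; congr (_ *: _).
rewrite scaler_sumr [RHS](reindex_inj (mulgI h)); apply: eq_big => g; first by rewrite groupMl.
move=> gH; rewrite linearZ /= -wactM scalerA sgnM // mulrA -expr2 sgn_sqr mul1r.
by [].
Qed.

Lemma avgs_delta H p : inv H p -> avgs H (delta H * p) = delta H * p.
Proof.
move=> ip; rewrite /avgs (eq_bigr (fun=> delta H * p)) => [|g gH].
  by rewrite sumr_const -[(_ * _) *+ _]scaler_nat scalerA mulVf ?scale1r // cardC_neq0.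
by rewrite rmorphM /= wact_delta // ip // -scalerAl scalerA -expr2 sgn_sqr scale1r.
Qed.

Lemma avgs_dvd H p : exists q, avgs H p = delta H * q /\ inv H q.
Proof.
have [s hs|q e] := @anti_dvd H (avgs H p).
  by rewrite avgs_anti ?sgn_refl ?scaleN1r //; case/andP: hs.
exists q; split=> // g gH; have := avgs_anti p gH; rewrite e rmorphM /= wact_delta //.
rewrite -scalerAl => /(scalerI _) E; apply: (mulfI (delta_neq0 H)); apply: E.
by apply/eqP => e0; have := sgn_sqr H g; rewrite e0 expr0n => /esym/eqP; rewrite oner_eq0.
Qed.

Lemma delta_homog H : delta H \is (size (roots H)).-homog.
Proof.
have := @homog_prod C n _ (roots H) xpredT alC (fun=> 1%N) (fun s _ => lin_homog (rowC s)).
by rewrite sum1_size.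
Qed.

Lemma size_roots H : size (roots H) = #|[set t | TH H t]|.
Proof. by rewrite /roots -sum1_size big_filter big_enum_cond -sum1_card; apply: eq_bigl => t; rewrite inE. Qed.

End Delta.
End Delta.

(** * Truncated Hilbert series and their relation to length polynomials *)

Module Hilb.
From HB Require Import structures.
From mathcomp Require Import boolp reals complex mpoly.
From mathcomp Require Import ring.
Set Implicit Arguments.
Unset Strict Implicit.
Unset Printing Implicit Defensive.
Import Order.TTheory GRing.Theory Num.Theory ComplexField.
Local Open Scope ring_scope.
From mathcomp Require Import lra zify.
Require Import Defs.
Import PolyAct Root Cox Cox2 Cox3 Delta.
Section Eqm.
Variable F : fieldType.
Implicit Types a p q : {poly F}.
(** Power series are represented by polynomials compared below an arbitrary degree [K]. *)
Definition eqm K p q := forall k, (k < K)%N -> p`_k = q`_k.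
Lemma eqm_refl K p : eqm K p p. Proof. by []. Qed.
Lemma eqm_sym K p q : eqm K p q -> eqm K q p. Proof. by move=> h k /h. Qed.
Lemma eqm_trans K q p r : eqm K p q -> eqm K q r -> eqm K p r.
Proof. by move=> h1 h2 k kK; rewrite h1 // h2. Qed.
Lemma eqmD K p q p' q' : eqm K p q -> eqm K p' q' -> eqm K (p + p') (q + q').
Proof. by move=> h1 h2 k kK; rewrite !coefD h1 // h2. Qed.
Lemma eqmM K p q p' q' : eqm K p q -> eqm K p' q' -> eqm K (p * p') (q * q').
Proof.
move=> h1 h2 k kK; rewrite !coefM; apply: eq_bigr => i _.
have := ltn_ord i; rewrite ltnS => ik; rewrite h1 ?h2 //; first by apply: leq_ltn_trans (leq_subr _ _) kK.
exact: leq_ltn_trans kK.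
Qed.
Lemma eqm_sum K (I : Type) (r : seq I) (P : pred I) (f g : I -> {poly F}) :
  (forall i, P i -> eqm K (f i) (g i)) -> eqm K (\sum_(i <- r | P i) f i) (\sum_(i <- r | P i) g i).
Proof. by move=> h; apply: (big_ind2 (fun p q => eqm K p q)) => // *; exact: eqmD. Qed.
Lemma eqm_cancel K a p : a`_0 != 0 -> eqm K (a * p) 0 -> eqm K p 0.
Proof.
move=> a0 h k; elim/ltn_ind: k => k IH kK; have := h k kK; rewrite coefM coef0.
rewrite big_ord_recl /= subn0 big1 ?addr0 => [/eqP|i _].
  by rewrite mulf_eq0 (negbTE a0) => /eqP.
rewrite IH ?coef0 ?mulr0 //; first by rewrite /bump /=; have := ltn_ord i; lia.
by rewrite /bump /=; lia.
Qed.
Lemma eqm_all p q : (forall K, eqm K p q) -> p = q.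
Proof. by move=> h; apply/polyP => k; exact: (h k.+1 k (ltnSn k)). Qed.
End Eqm.

Section Trace.
Variables (F : numFieldType) (K : nat).
Section One.
Variables (n : nat) (mf : measure n).
Hypothesis mf_ge : forall (m : 'X_{1..n}) i, (m i <= mf m)%N.
Notation A := {mpoly F[n]}.
Definition box := {ffun 'I_n -> 'I_K}.
Definition mm (u : box) : 'X_{1..n} := [multinom (u i : nat) | i < n].
Lemma mm_inj : injective mm.
Proof. by move=> u v /mnmP h; apply/ffunP => i; apply/val_inj; have := h i; rewrite !mnmE. Qed.
(** The trace on the part of degree [k], read on monomials with exponents below [K]; for [k < K]
    these are all the monomials of that degree. *)
Definition trk (T : A -> A) k := \sum_(u : box | mf (mm u) == k) (T 'X_[mm u])@_(mm u).
Lemma homog_box k (p : A) : (k < K)%N -> p \is k.-homog for mf ->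
  p = \sum_(u : box | mf (mm u) == k) p@_(mm u) *: 'X_[mm u].
Proof.
move=> kK hp; apply/mpolyP => m; rewrite raddf_sum /=.
have [e|ne] := eqVneq (mf m) k; last first.
  rewrite (dhomog_nemf_coeff hp ne) big1 // => u /eqP e; rewrite mcoeffZ mcoeffX.
  by case: eqP => [em|]; rewrite ?mulr0 //; rewrite -em e eqxx in ne.
have mK i : (m i < K)%N by apply: leq_ltn_trans (mf_ge m i) _; rewrite e.
pose u0 : box := [ffun i => Ordinal (mK i)].
have mu0 : mm u0 = m by apply/mnmP => i; rewrite mnmE ffunE.
rewrite (bigD1 u0) /= ?mu0 ?e // mcoeffZ mcoeffX eqxx mulr1 big1 ?addr0 // => u /andP[_ uu0].
by rewrite mcoeffZ mcoeffX -mu0 (inj_eq mm_inj) (negbTE uu0) mulr0.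
Qed.
End One.

Lemma linear_comb n1 n2 (f : {mpoly F[n1]} -> {mpoly F[n2]}) (I : Type) (r : seq I) (P : pred I) c v :
  linear f -> f (\sum_(i <- r | P i) c i *: v i) = \sum_(i <- r | P i) c i *: f (v i).
Proof.
move=> lf; have f0 : f 0 = 0 by have := lf (-1) 0 0; rewrite scaler0 addr0 scaleN1r addNr.
by elim/big_rec2: _ => // i x y _ <-; rewrite lf.
Qed.

Section Two.
Variables (n1 n2 : nat) (m1 : measure n1) (m2 : measure n2).
Hypotheses (h1 : forall (m : 'X_{1..n1}) i, (m i <= m1 m)%N) (h2 : forall (m : 'X_{1..n2}) i, (m i <= m2 m)%N).
Variables (T : {mpoly F[n2]} -> {mpoly F[n1]}) (U : {mpoly F[n1]} -> {mpoly F[n2]}).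
Hypotheses (lT : linear T) (lU : linear U).
(** The rule [tr(T U) = tr(U T)], for graded pieces that may lie in different polynomial rings; it
    transports dimensions without bases of the invariants. *)
Lemma trace_swap j k : (j < K)%N -> (k < K)%N ->
  (forall p, p \is j.-homog for m2 -> T p \is k.-homog for m1) ->
  (forall p, p \is k.-homog for m1 -> U p \is j.-homog for m2) ->
  trk m1 (T \o U) k = trk m2 (U \o T) j.
Proof.
move=> jK kK hT hU; rewrite /trk.
transitivity (\sum_(u : box n1 | m1 (mm u) == k) \sum_(v : box n2 | m2 (mm v) == j)
   (U 'X_[mm u])@_(mm v) * (T 'X_[mm v])@_(mm u)).
  apply: eq_bigr => u hu /=.
  rewrite {1}(homog_box h2 jK (hU 'X_[mm u] _)) ?dhomogX // linear_comb // raddf_sum /=.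
  by apply: eq_bigr => v _; rewrite mcoeffZ.
rewrite exchange_big /=; apply: eq_bigr => v hv.
rewrite {2}(homog_box h1 kK (hT 'X_[mm v] _)) ?dhomogX // linear_comb // raddf_sum /=.
by apply: eq_bigr => u _; rewrite mcoeffZ mulrC.
Qed.
End Two.
End Trace.

Lemma mdeg_ge n (m : 'X_{1..n}) i : (m i <= mdeg m)%N.
Proof. by rewrite mdegE (bigD1 i) //= leq_addr. Qed.

Section Weighted.
Variables (m : nat) (d : 'I_m -> nat).
Definition wdeg (u : 'X_{1..m}) : nat := (\sum_i d i * u i)%N.
Fact wdeg0 : wdeg 0%MM = 0%N.
Proof. by rewrite /wdeg big1 // => i _; rewrite mnm0E muln0. Qed.
Fact wdegD : {morph wdeg : u v / (u + v)%MM >-> (u + v)%N}.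
Proof. by move=> u v; rewrite /wdeg -big_split; apply: eq_bigr => i _; rewrite mnmDE mulnDr. Qed.
HB.instance Definition _ := isMeasure.Build m wdeg wdeg0 wdegD.
Lemma wdeg_ge (u : 'X_{1..m}) i : (forall i, 0 < d i)%N -> (u i <= wdeg u)%N.
Proof. by move=> d0; rewrite /wdeg (bigD1 i) //=; apply: leq_trans (leq_addr _ _); exact: leq_pmull. Qed.

Variable F : numFieldType.
Definition counts K : {poly F} := \sum_(u : box K m) 'X^(wdeg (mm u)).

(** Finite geometric series leave the factors [1 - X^(d_i K)], which are 1 below degree [K]. *)
Lemma counts_prod K : (forall i, 0 < d i)%N -> eqm K (counts K * \prod_i (1 - 'X^(d i))) 1.
Proof.
move=> d0; have -> : counts K * \prod_i (1 - 'X^(d i)) = \prod_i (1 - 'X^(d i * K)).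
  have -> : counts K = \prod_i \sum_(j < K) 'X^(d i * j).
    rewrite bigA_distr_bigA; apply: eq_bigr => u _.
    rewrite /wdeg -prodrXr; apply: eq_bigr => i _; by rewrite mnmE.
  rewrite -big_split /=; apply: eq_bigr => i _.
  rewrite mulrC exprM -[1 in RHS](expr1n _ K) subrXX; congr (_ * _).
  apply: eq_bigr => j _ /=.
  by rewrite expr1n mul1r exprM.
apply: (big_ind (fun p => eqm K p 1)) => // [p q hp hq|i _ k kK].
  by rewrite -[1]mulr1; exact: eqmM.
have lt : (k < d i * K)%N by apply: leq_trans kK _; rewrite leq_pmull.
by rewrite coefB coefXn (ltn_eqF lt) subr0.
Qed.

Lemma counts_coef K k : (counts K)`_k = (\sum_(u : box K m | wdeg (mm u) == k) 1).
Proof.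
rewrite /counts coef_sum [RHS]big_mkcond /=; apply: eq_bigr => u _.
by rewrite coefXn eq_sym; case: eqP.
Qed.
End Weighted.

Section HomogDiv.
Variables (n : nat) (F : numFieldType).
Implicit Types p q : {mpoly F[n]}.
Lemma pihomogM e b p q : p \is e.-homog -> pihomog mdeg (e + b) (p * q) = p * pihomog mdeg b q.
Proof.
move=> hp; rewrite [q in LHS](pihomog_partitionE (leqnn (msize q))) mulr_sumr raddf_sum /=.
have hd d := dhomogM hp (pihomogP mdeg d q).
under eq_bigr => d _.
  rewrite (_ : pihomog mdeg (e + b) _ = if val d == b then p * pihomog mdeg b q else 0); first over.
  case: eqP => [<-|ne]; first by rewrite pihomog_dE.
  by apply: pihomog_ne0 (hd d); rewrite eqn_add2l; apply/eqP.
have [lt|ge] := ltnP b (msize q).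
  rewrite (bigD1 (Ordinal lt)) //= eqxx big1 ?addr0 // => d; rewrite -val_eqE /= => /negbTE -> //.
rewrite big1 => [|d _]; last by rewrite ltn_eqF //; apply: leq_trans (ltn_ord d) ge.
rewrite pihomogE big_seq_cond big1 ?mulr0 // => u /andP[/msize_mdeg_lt h /eqP ue].
by move: (leq_trans h ge); rewrite ue ltnn.
Qed.

Lemma pihomogM_lt e k p q : p \is e.-homog -> (k < e)%N -> pihomog mdeg k (p * q) = 0.
Proof.
move=> hp ka; rewrite [q](pihomog_partitionE (leqnn (msize q))) mulr_sumr raddf_sum big1 //= => d _.
apply: pihomog_ne0 (dhomogM hp (pihomogP mdeg d q)); by rewrite gtn_eqF // ltn_addr.
Qed.

Lemma homog_div e b p q : p != 0 -> p \is e.-homog -> p * q \is (e + b).-homog -> q \is b.-homog.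
Proof.
move=> p0 hp /(@pihomog_dE _ _ mdeg); rewrite pihomogM // => /(mulfI p0) <-.
exact: pihomogP.
Qed.
End HomogDiv.

Section Hilbert.
Variables (R : realType) (gT : finGroupType) (n : nat).
Variable rho : mx_representation R [set: gT] n.
Hypothesis faith : mx_faithful rho.
Variables (al : gT -> 'rV[R]_n) (v0 : 'cV[R]_n).
Local Notation refl := (is_reflection rho).
Local Notation sp := (sp rho).
Local Notation coroot := (coroot rho).
Hypothesis hal : forall s, refl s ->
  [/\ rho s = 1%:M - coroot (al s) *m al s, sp (al s) (al s) = 2 & 0 < (al s *m v0) 0 0].
Local Notation C := R[i].
Local Notation A := {mpoly C[n]}.
Local Notation TH := (TH rho).
Local Notation wact := (wact rho).
Local Notation avg := (avg rho).
Local Notation avgs := (avgs rho al v0).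
Local Notation delta := (delta rho al).
Local Notation sgn := (sgn rho al v0).
Local Notation inv := (inv rho).
Local Notation N H := (#|[set t | TH H t]|).
Local Notation poincare := (@poincare R gT n rho al v0 C).
Local Notation coset_poly := (@coset_poly R gT n rho al v0 C).
Variable K : nat.
Local Notation trk := (@trk C K n mdeg).

Lemma trk_class g h k : (k < K)%N -> trk (wact (g ^ h)%g) k = trk (wact g) k.
Proof.
move=> kK; have hh g' p : p \is k.-homog -> wact g' p \is k.-homog by exact: wact_homog.
transitivity (trk (wact h^-1%g \o wact (g * h)%g) k).
  by apply: eq_bigr => u _; rewrite conjgE wactM.
rewrite (@trace_swap C K n n mdeg mdeg (@mdeg_ge n) (@mdeg_ge n) _ _ _ _ k k) //; try exact: linearP; try exact: hh.
by apply: eq_bigr => u _ /=; rewrite -wactM mulgK.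
Qed.

Lemma trk_avg (H : {group gT}) k : trk (avg H) k = #|H|%:R^-1 * \sum_(g in H) trk (wact g) k.
Proof.
rewrite /trk exchange_big mulr_sumr; apply: eq_bigr => u _.
by rewrite /avg mcoeffZ raddf_sum.
Qed.

Lemma avgs_div_ex (H : {group gT}) p : exists q, avgs H p = delta H * q /\ inv H q.
Proof. exact: (avgs_dvd faith hal). Qed.

(** Anti-invariants are [delta] times invariants, so their projector factors through division by
    [delta], which lowers the degree by the number of reflections. *)
Lemma trk_avgs (H : {group gT}) k : (k < K)%N ->
  trk (avgs H) k = if (N H <= k)%N then trk (avg H) (k - N H)%N else 0.
Proof.
move=> kK; have hd : delta H \is (N H).-homog by rewrite -size_roots; exact: delta_homog.
have d0 : delta H != 0 := delta_neq0 hal H.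
case: leqP => hk; last first.
  rewrite /trk big1 // => u /eqP hu; have [q [e _]] := avgs_div_ex H 'X_[mm u].
  have hh : avgs H 'X_[mm u] \is k.-homog by apply: avgs_homog; rewrite dhomogX /= hu.
  by rewrite -(pihomog_dE hh) e (pihomogM_lt _ hd hk) mcoeff0.
pose U p := sval (cid (avgs_div_ex H p)).
have UE p : avgs H p = delta H * U p by case: (svalP (cid (avgs_div_ex H p))).
have Ui p : inv H (U p) by case: (svalP (cid (avgs_div_ex H p))).
pose T q := delta H * avg H q.
have lT : linear T by move=> a p q; rewrite /T linearP /= mulrDr scalerAr.
have lU : linear U.
  by move=> a p q; apply: (mulfI d0); rewrite -UE linearP /= !UE mulrDr scalerAr.
have kj : (k = N H + (k - N H))%N by rewrite subnKC.
have jK : (k - N H < K)%N by apply: leq_ltn_trans (leq_subr _ _) kK.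
transitivity (trk (T \o U) k).
  by apply: eq_bigr => u _; rewrite /= /T (avg_id (Ui _)) UE.
rewrite (@trace_swap C K n n mdeg mdeg (@mdeg_ge n) (@mdeg_ge n) _ _ lT lU (k - N H)%N k) //.
- apply: eq_bigr => u _ /=; congr (_@_ _); apply: (mulfI d0); rewrite -UE /T.
  by apply: (avgs_delta hal); exact: avg_inv.
- by move=> p hp; rewrite kj /T; apply: dhomogM => //; exact: avg_homog.
- move=> p hp; apply: (homog_div d0 hd); rewrite -UE -kj; exact: avgs_homog.
Qed.

Definition hil (H : {group gT}) : {poly C} := \poly_(k < K) trk (avg H) k.
Definition hil1 : {poly C} := \poly_(k < K) trk id k.

Lemma hil_alt (H : {group gT}) : refl_group rho H ->
  eqm K (\sum_(J : {set gT} | J \subset simples rho al v0 H) (-1) ^+ #|J| *: hil <<J>>%G)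
    ('X^(N H) * hil H).
Proof.
move=> rH k kK; rewrite coef_sum coefXnM.
transitivity (alt_avg rho al v0 H (fun g => trk (wact g) k)).
  by apply: eq_bigr => J _; rewrite coefZ coef_poly kK trk_avg.
rewrite (alt_avgE faith hal rH (sgn := sgn H)); last first.
- by move=> g h _ _; exact: trk_class.
- by move=> s; exact: (sgn_refl faith hal).
- by move=> g _; exact: sgn_sqr.
- by move=> g h; exact: (sgnM hal).
transitivity (trk (avgs H) k).
  rewrite /trk; under [X in _ * X]eq_bigr => g _ do rewrite mulr_sumr.
  rewrite exchange_big mulr_sumr; apply: eq_bigr => u _.
  rewrite /avgs mcoeffZ raddf_sum; congr (_ * _); apply: eq_bigr => g _.
  by rewrite /= mcoeffZ.
rewrite trk_avgs // ltnNge; case: leqP => //= h.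
by rewrite coef_poly (leq_ltn_trans (leq_subr _ _) kK).
Qed.

Lemma poincare_neq0 (H : {group gT}) : poincare H != 0.
Proof.
apply/eqP => /(congr1 (fun p => p.[1])); rewrite /poincare horner_sum horner0.
rewrite (eq_bigr (fun=> 1)) => [|w _]; last by rewrite hornerXn expr1n.
by rewrite sumr_const => /eqP; rewrite pnatr_eq0 -[_ == _]negbK -lt0n cardG_gt0.
Qed.

(** Induction on the order of [H]. Solomon's identity for traces and the one for [coset_poly]
    evaluate the same alternating sum [Z]; the proper [J] are known by induction. What remains is
    [(X^N - e) (Q - hil1) = 0], and the first factor has an invertible constant term when [N > 0];
    for [N = 0] the group is trivial. *)
Theorem hil_poincare (H : {group gT}) : refl_group rho H -> eqm K (poincare H * hil H) hil1.
Proof.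
move: {2}(#|H|).+1 (ltnSn #|H|) => b; elim: b H => // b IH H Hb rH.
set S := simples rho al v0 H.
have [T0|TN] := posnP (N H).
  have H1 : H :=: 1%g.
    apply/trivgP; apply: subset_trans rH _; rewrite gen_subG; apply/subsetP => s hs.
    by move/eqP: T0; rewrite cards_eq0 => /eqP e; rewrite e inE in hs.
  have -> : poincare H = 1.
    rewrite /poincare H1 (big_pred1 1%g) => [|w]; last by rewrite inE.
    rewrite (_ : ninv _ _ _ _ _ = 0%N) //; apply/eqP; rewrite cards_eq0; apply/eqP/setP => t.
    by rewrite !inE; apply/negP => /andP[ht]; have : t \in [set t | TH H t] by [rewrite inE]; rewrite (cards0_eq T0) inE.
  move=> k kK; rewrite mul1r !coef_poly kK; apply: eq_bigr => u _; congr (_@_ _).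
  apply: avg_id => g; rewrite H1 => /set1P ->; exact: wact1.
pose e := ((-1) ^+ #|S| : C)%:P.
have GS : <<S>>%G = H.
  apply/val_inj/eqP; rewrite /= eqEsubset (gen_simples faith hal rH) andbT gen_subG.
  by apply/subsetP => s; rewrite inE => /andP[/andP[]].
have cS : coset_poly H S = 1.
  apply: (mulfI (poincare_neq0 H)); rewrite mulr1 [in RHS](poincare_factor faith hal C rH (subxx S)).
  by rewrite GS.
set Q := poincare H * hil H.
pose Z := \sum_(J : {set gT} | J \subset S) ((-1) ^+ #|J| : C) *: (poincare H * hil <<J>>%G).
have Z1 : eqm K Z ('X^(N H) * Q).
  have -> : Z = poincare H * \sum_(J : {set gT} | J \subset S) (-1) ^+ #|J| *: hil <<J>>%G.
    by rewrite mulr_sumr; apply: eq_bigr => J _; rewrite scalerAr.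
  by rewrite /Q mulrCA; apply: (eqmM (@eqm_refl _ K _)); exact: hil_alt.
have Z2 : eqm K Z (\sum_(J : {set gT} | (J \subset S) && (J != S)) ((-1) ^+ #|J| : C) *: (coset_poly H J * hil1) + e * Q).
  rewrite /Z (bigD1 S) //= addrC; apply: eqmD; last by rewrite GS mul_polyC.
  apply: eqm_sum => J /andP[JS JnS]; rewrite -!mul_polyC; apply: (eqmM (@eqm_refl _ K _)).
  rewrite (poincare_factor faith hal C rH JS) mulrAC mulrC; apply: (eqmM (@eqm_refl _ K _)).
  apply: IH; last exact: (GJ_refl_group faith hal rH JS).
  rewrite -ltnS; apply: leq_trans Hb; rewrite ltnS; apply: proper_card; rewrite properE (GJ_sub faith hal rH JS) /=.
  apply/subsetPn.
  have [s sS sJ] : exists2 s, s \in S & s \notin J.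
    by apply/subsetPn; apply: contra JnS => SJ; rewrite eqEsubset JS.
  have ss : simple rho al v0 H s by rewrite inE in sS.
  have /andP[hs _] := ss; exists s; first by case/andP: hs.
  apply/negP => sJ'; have : TH <<J>>%G s by rewrite /Cox.TH sJ' (TH_refl hs).
  by rewrite (TH_GJ faith hal rH JS) (ptP hal J ss) sJ oner_eq0 andbF.
have Z3 : \sum_(J : {set gT} | (J \subset S) && (J != S)) ((-1) ^+ #|J| : C) *: (coset_poly H J * hil1) = ('X^(N H) - e) * hil1.
  have aux := alt_coset_poly faith hal C rH; rewrite (bigD1 S) //= cS in aux.
  rewrite -aux -mul_polyC mulr1 -/e addrAC subrr add0r mulr_suml.
  by apply: eq_bigr => J _; rewrite scalerAl.
have E : eqm K (('X^(N H) - e) * (Q - hil1)) 0.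
  move=> k kK; have h1 := Z1 k kK; have h2 := Z2 k kK; rewrite Z3 in h2.
  have {h1 h2} := etrans (esym h1) h2; set P1 := 'X^_ - e.
  have -> : P1 * (Q - hil1) = 'X^(N H) * Q - (P1 * hil1 + e * Q).
    by rewrite mulrBr {1}/P1 mulrBl opprD addrA [RHS]addrAC.
  by rewrite coefB => ->; rewrite subrr coef0.
have a0 : ('X^(N H) - e)`_0 != 0.
  by rewrite coefB coefXn coefC (ltn_eqF TN) eqxx sub0r oppr_eq0 signr_eq0.
have := eqm_cancel a0 E => h k kK; have := h k kK.
by rewrite coefB coef0 => /eqP; rewrite subr_eq0 => /eqP.
Qed.

End Hilbert.
End Hilb.

(** * Degrees of free generators determine the length polynomial *)

Module Chev1.
From HB Require Import structures.
From mathcomp Require Import boolp reals complex mpoly.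
From mathcomp Require Import ring.
Set Implicit Arguments.
Unset Strict Implicit.
Unset Printing Implicit Defensive.
Import Order.TTheory GRing.Theory Num.Theory ComplexField.
Local Open Scope ring_scope.
From mathcomp Require Import lra zify.
Require Import Defs.
Import PolyAct Root Cox Cox2 Cox3 Delta Hilb.
Section Ext.
Variables (F : numFieldType) (n : nat).
Implicit Types p q : {mpoly F[n]}.

Definition lineX (y : 'I_n -> F) i p : {poly F} :=
  mmap (@polyC F) (fun j => (y j)%:P + (j == i)%:R * 'X) p.

Lemma lineX_eval y i p t : (lineX y i p).[t] = p.@[fun j => y j + (j == i)%:R * t].
Proof.
move: p; apply: mpoly_lin_ind => [a|p q hp hq|k p hp].
- by rewrite /lineX mmapC hornerC mevalC.
- by rewrite /lineX mmapD hornerD mevalD -hp -hq.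
rewrite /lineX rmorphM /= hornerM mevalM -hp mmapX mmap1U mevalXU hornerD hornerM hornerX hornerC.
by congr ((_ + _ * _) * _); case: (k == i); rewrite hornerC.
Qed.

Lemma lineX_deriv y i p : (lineX y i p)^`() = lineX y i p^`M(i).
Proof.
move: p; apply: mpoly_lin_ind => [a|p q hp hq|k p hp].
- by rewrite mderivC /lineX mmapC mmap0 derivC.
- by rewrite mderivD /lineX !mmapD derivD -/(lineX _ _ _) hp hq.
rewrite mderivM /lineX mmapD !rmorphM /= derivM -!/(lineX _ _ _) hp; congr (_ * _ + _).
rewrite /lineX mderivX mmapX mmap1U mnm1E derivD derivC add0r derivM derivX mulr1.
have -> : ((k == i)%:R : {poly F})^`() = 0 by case: (k == i); rewrite ?derivC // -polyC1 derivC.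
rewrite mul0r add0r mmapZ eq_sym; case: eqP => [->|_]; last by rewrite !mulr0n !mul0r.
by rewrite !mulr1n (_ : (U_(k) - U_(k))%MM = 0%MM) ?mpolyX0 ?rmorph1 ?mulr1 //; apply/mnmP => j; rewrite mnmBE subnn mnm0E.
Qed.

Lemma poly_eval0 (p : {poly F}) : (forall t, p.[t] = 0) -> p = 0.
Proof.
move=> h; apply/eqP/negPn/negP => p0.
have := max_poly_roots p0 (rs := [seq i%:R | i <- iota 0 (size p)]).
rewrite size_map size_iota ltnn => H; apply: notF; apply: H; last first.
  by rewrite map_inj_uniq ?iota_uniq // => i j /eqP; rewrite eqr_nat => /eqP.
by apply/allP => x _; apply/rootP; exact: h.
Qed.

Lemma mderiv0_const p : (forall i, p^`M(i) = 0) -> p = (p@_0%MM)%:MP.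
Proof.
move=> h; apply/mpolyP => m; rewrite mcoeffC; have [<-|ne] := eqVneq 0%MM m; first by rewrite mulr1.
have [i mi] : exists i, m i != 0%N.
  apply/existsP; apply: contraNT ne; rewrite negb_exists => /forallP hm; apply/eqP/mnmP => i.
  by rewrite mnm0E; have := hm i; rewrite negbK => /eqP.
have := congr1 (mcoeff (m - U_(i))%MM) (h i); rewrite mcoeff_mderiv mcoeff0 submK; last first.
  by rewrite lep1mP.
by move/eqP; rewrite mulrn_eq0 /= => /eqP ->; rewrite mulr0.
Qed.

(** Induction on the degree: the restriction to each coordinate line is zero, hence so is its
    derivative, and all partial derivatives vanish by induction. *)
Lemma meval_ext p : (forall v, p.@[v] = 0) -> p = 0.
Proof.
move: {2}(msize p).+1 (ltnSn (msize p)) => k; elim: k p => // k IH p pk h.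
have [//|p0] := eqVneq p 0.
have hd i : p^`M(i) = 0.
  apply: IH => [|y].
    have : (msize p <= (msize p).-1.+1)%N by rewrite leqSpred.
    have e : p^`M(i) = pd (delta_mx i 0) p.
      rewrite /pd (bigD1 i) //= mxE !eqxx scale1r big1 ?addr0 // => j ji.
      by rewrite mxE (negbTE ji) scale0r.
    move/(msize_pd (delta_mx i 0)); rewrite -e => h2; apply: leq_ltn_trans h2 _.
    have : msize p != 0%N by rewrite msize_poly_eq0.
    by move: pk; case: (msize p).
  have : lineX y i p = 0 by apply: poly_eval0 => t; rewrite lineX_eval h.
  move=> /(congr1 deriv); rewrite lineX_deriv linear0 => e.
  have := lineX_eval y i p^`M(i) 0; rewrite e horner0 => /esym; apply: etrans.
  by apply: meval_eq => j; rewrite mulr0 addr0.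
have e := mderiv0_const hd; have := h (fun=> 0); rewrite e mevalC => ->.
by rewrite mpolyC0.
Qed.
End Ext.

Lemma sum_pihomog (F : numFieldType) n (f : nat -> {mpoly F[n]}) N j : (forall i, f i \is i.-homog) ->
  \sum_(i < N) pihomog mdeg j (f i) = if (j < N)%N then f j else 0.
Proof.
move=> hf; case: ltnP => [lt|ge].
  rewrite (bigD1 (Ordinal lt)) //= (pihomog_dE (hf j)) big1 ?addr0 // => i ij.
  by apply: pihomog_ne0 (hf i).
rewrite big1 // => i _; apply: pihomog_ne0 (hf i).
by rewrite ltn_eqF //; apply: leq_trans (ltn_ord i) ge.
Qed.

Lemma pihomog_big (F : numFieldType) n (mf : measure n) (p : {mpoly F[n]}) k :
  (mmeasure mf p <= k)%N -> pihomog mf k p = 0.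
Proof.
move=> h; rewrite pihomogE big_seq_cond big1 // => u /andP[uq /eqP uj].
by have := mmeasure_mnm_lt mf uq; rewrite uj ltnNge h.
Qed.

Section Chev1.
Variables (R : realType) (gT : finGroupType) (n : nat).
Variable rho : mx_representation R [set: gT] n.
Hypothesis faith : mx_faithful rho.
Variables (al : gT -> 'rV[R]_n) (v0 : 'cV[R]_n).
Local Notation refl := (is_reflection rho).
Local Notation sp := (sp rho).
Local Notation coroot := (coroot rho).
Hypothesis hal : forall s, refl s ->
  [/\ rho s = 1%:M - coroot (al s) *m al s, sp (al s) (al s) = 2 & 0 < (al s *m v0) 0 0].
Local Notation C := R[i].
Local Notation A := {mpoly C[n]}.
Local Notation wact := (wact rho).
Local Notation avg := (avg rho).
Local Notation inv := (inv rho).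
Local Notation poincare := (@poincare R gT n rho al v0 C).

Lemma wactC g (a : C) : wact g a%:MP = a%:MP.
Proof. by rewrite wactE comp_mpolyC. Qed.

Lemma invariantE (P : {set gT}) (H : {group gT}) (p : A) : P = H -> invariant rho P p <-> inv H p.
Proof.
have E g y : (wact g p).@[coords y] = p.@[coords (act_h rho g^-1%g y)].
  by rewrite wactE /coords meval_act.
move=> ->; split=> h g gH; last first.
  by move=> y; rewrite -[g]invgK -E h ?groupV.
apply/eqP; rewrite -subr_eq0; apply/eqP; apply: meval_ext => v.
pose y : 'cV[C]_n := \col_i v i.
have vy : v =1 coords y by move=> i; rewrite /coords mxE.
by rewrite (meval_eq _ vy) mevalB E h ?groupV // subrr.
Qed.

(** The number [m] of generators is left open; that it equals [n] follows from the length
    polynomial. *)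
Definition free_gens (H : {group gT}) m (f : m.-tuple A) (d : 'I_m -> nat) :=
  [/\ forall i, tnth f i \is (d i).-homog, forall i, inv H (tnth f i),
     forall p, inv H p -> exists q, p = q \mPo f & forall q, q \mPo f = 0 -> q = 0].

Lemma comp_whomog m (f : m.-tuple A) (d : 'I_m -> nat) k (q : {mpoly C[m]}) :
  (forall i, tnth f i \is (d i).-homog) -> q \is k.-homog for (wdeg d) -> q \mPo f \is k.-homog.
Proof.
move=> hf hq; rewrite comp_mpolyEX big_seq; apply: rpred_sum => u uq; rewrite rpredZ // comp_mpolyX.
have <- : wdeg d u = k by exact: (dhomog_mf hq).
by apply: homog_prod => i _; exact: dhomogMn.
Qed.

Lemma comp_inv m (f : m.-tuple A) H (q : {mpoly C[m]}) : (forall i, inv H (tnth f i)) -> inv H (q \mPo f).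
Proof.
move=> hf g gH; move: q; apply: mpoly_lin_ind => [a|p q hp hq|i p hp].
- by rewrite (comp_mpolyC a f) wactC.
- rewrite (comp_mpolyD f p q); move: hp hq; move: (comp_mpoly f p) (comp_mpoly f q) => a b hp hq.
  by rewrite (raddfD (wact g)) /= hp hq.
have e : comp_mpoly f 'X_i = tnth f i by rewrite comp_mpolyXU -tnth_nth.
have E : comp_mpoly f ('X_i * p) = comp_mpoly f 'X_i * comp_mpoly f p := rmorphM (comp_mpoly f) _ _.
rewrite E e; move: hp; move: (comp_mpoly f p) => a hp.
by rewrite (rmorphM (wact g)) /= hp (hf i g gH).
Qed.

Section Gens.
Variables (H : {group gT}) (m : nat) (f : m.-tuple A) (d : 'I_m -> nat).
Hypothesis hf : free_gens H f d.

(** A generator of degree zero would be constant, which contradicts algebraic independence. *)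
Lemma gens_pos i : (0 < d i)%N.
Proof.
case: hf => h1 _ _ h4; rewrite lt0n; apply/eqP => d0.
have := h1 i; rewrite d0 => /msize_homog /msize1_polyC e.
have := h4 ('X_i - ((tnth f i)@_0%MM)%:MP); rewrite (raddfB (comp_mpoly f)) /= comp_mpolyXU -tnth_nth comp_mpolyC -e subrr.
move=> /(_ erefl) /(congr1 (mcoeff U_(i))); rewrite mcoeffB mcoeffX eqxx mcoeffC mcoeff0.
have -> : (U_(i)%MM == 0%MM :> 'X_{1..m}) = false.
  by apply/eqP => /(congr1 (fun u : 'X_{1..m} => u i)); rewrite mnm0E mnm1E eqxx.
by rewrite mulr0 subr0 => /eqP; rewrite oner_eq0.
Qed.

Lemma homog_comp_inj k (q : {mpoly C[m]}) : q \mPo f \is k.-homog -> q \is k.-homog for (wdeg d).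
Proof.
case: hf => h1 _ _ h4 hq.
have [h0|] := boolP (pihomog (wdeg d) k q == q); first by rewrite homog_piE.
move/eqP; case; apply/eqP; rewrite -subr_eq0; apply/eqP/h4.
set N := mmeasure (wdeg d) q.
have E : q \mPo f = \sum_(j < N) (pihomog (wdeg d) j q \mPo f).
  by rewrite {1}(pihomog_partitionE (leqnn N)) (raddf_sum (comp_mpoly f)).
have hj j : pihomog (wdeg d) j q \mPo f \is j.-homog by apply: comp_whomog => //; exact: pihomogP.
rewrite (raddfB (comp_mpoly f)) /=.
have Ek j : pihomog mdeg j (q \mPo f) = pihomog (wdeg d) j q \mPo f.
  rewrite E (raddf_sum (pihomog mdeg j)) /=.
  rewrite (sum_pihomog N j hj); case: ltnP => // ge.
  by rewrite (pihomog_big ge) (raddf0 (comp_mpoly f)).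
by rewrite -Ek (pihomog_dE hq) subrr.
Qed.

(** Writing invariants in the generators and substituting back are inverse graded maps. Swapping
    them turns the trace of the averaging projector into a count of weighted monomials. *)
Lemma hil_gens K : eqm K (hil rho K H) (counts d C K).
Proof.
case: hf => h1 h2 h3 h4 k kK; rewrite coef_poly kK counts_coef.
have ex p : exists q, avg H p = q \mPo f by apply: h3; exact: avg_inv.
pose U p := sval (cid (ex p)).
have UE p : avg H p = U p \mPo f by exact: svalP (cid (ex p)).
have inj (q q' : {mpoly C[m]}) : q \mPo f = q' \mPo f -> q = q'.
  by move=> e; apply/eqP; rewrite -subr_eq0; apply/eqP/h4; rewrite (raddfB (comp_mpoly f)) /= e subrr.
have lU : linear U.
  move=> a p q; apply: inj; rewrite -UE linearP /= !UE.
  by rewrite (linearP (comp_mpoly f)).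
transitivity (trk K mdeg (comp_mpoly f \o U) k); first by apply: eq_bigr => u _; rewrite /= UE.
rewrite (@trace_swap C K n m mdeg (wdeg d) (@mdeg_ge n) _ _ _ _ lU k k) //.
- apply: eq_bigr => u _ /=; rewrite (_ : U _ = 'X_[mm u]) ?mcoeffX ?eqxx //.
  by apply: inj; rewrite -UE; apply: avg_id; exact: comp_inv.
- by move=> u i; apply: wdeg_ge; exact: gens_pos.
- by move=> a p q; rewrite (linearP (comp_mpoly f)).
- by move=> p hp; exact: comp_whomog hp.
- by move=> p hp; apply: homog_comp_inj; rewrite -UE; exact: avg_homog.
Qed.

(** Three truncated identities combine: [P hil = hil1], [hil1 (1 - X)^n = 1] and
    [hil prod_i (1 - X^(d_i)) = 1]. *)
Theorem poincare_degrees : refl_group rho H ->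
  poincare H * (1 - 'X) ^+ n = \prod_i (1 - 'X^(d i)).
Proof.
move=> rH; apply: eqm_all => K.
have w1 (u : 'X_{1..n}) : wdeg (fun=> 1%N) u = mdeg u.
  by rewrite mdegE; apply: eq_bigr => i _; rewrite mul1n.
have e1 : eqm K (hil1 R n K * (1 - 'X) ^+ n) 1.
  have := @counts_prod n (fun=> 1%N) C K (fun _ => isT); rewrite prodr_const card_ord expr1.
  apply: eqm_trans; apply: eqmM (@eqm_refl _ K _) => k kK; rewrite coef_poly kK counts_coef.
  apply: eq_big => [u|u _]; first by rewrite w1.
  by rewrite mcoeffX eqxx.
have e2 : eqm K (hil rho K H * \prod_i (1 - 'X^(d i))) 1.
  apply: eqm_trans (counts_prod C (K := K) gens_pos).
  by apply: (eqmM _ (@eqm_refl _ K _)); exact: hil_gens.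
have e3 := @hil_poincare _ _ _ _ faith _ _ hal K H rH.
set P := poincare H in e3 *; set h := hil rho K H in e2 e3; set D := \prod_i _ in e2 *; set X := (1 - 'X) ^+ n in e1 *.
apply: (@eqm_trans _ K (P * X * (h * D))).
  by rewrite -[X in eqm _ X _]mulr1; apply: (eqmM (@eqm_refl _ K _)); exact: eqm_sym.
have -> : P * X * (h * D) = (P * h) * X * D by rewrite mulrACA mulrA.
rewrite -[X in eqm _ _ X]mul1r; apply: (eqmM _ (@eqm_refl _ K _)).
by apply: eqm_trans e1; apply: (eqmM _ (@eqm_refl _ K _)).
Qed.

(** Compare the orders of vanishing at 1 in [poincare_degrees]; the length polynomial takes the
    value [#|H|] there. *)
Lemma gens_card : refl_group rho H -> m = n.
Proof.
move=> rH; have E := poincare_degrees rH.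
pose S k : {poly C} := \sum_(i < k) 'X^i.
have SE k : 1 - 'X^k = (1 - 'X) * S k.
  rewrite -[1 - 'X^k]opprB subrX1 -mulNr opprB; congr (_ * _).
have S1 k : (S k).[1] = k%:R.
  rewrite /S horner_sum (eq_bigr (fun=> 1)) => [|i _]; last by rewrite hornerXn expr1n.
  by rewrite sumr_const card_ord.
have {E} E : poincare H * (1 - 'X) ^+ n = (1 - 'X) ^+ m * \prod_i S (d i).
  by rewrite E; under eq_bigr => i _ do rewrite SE; rewrite big_split /= prodr_const card_ord.
have X0 : (1 - 'X : {poly C}) != 0 by have := polyXsubC_eq0 (1 : C); rewrite polyC1 -opprB oppr_eq0 => ->.
have P1 : (poincare H).[1] != 0.
  rewrite /Cox3.poincare horner_sum (eq_bigr (fun=> 1)) => [|w _]; last by rewrite hornerXn expr1n.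
  by rewrite sumr_const cardC_neq0.
have D1 : (\prod_i S (d i)).[1] != 0.
  rewrite horner_prod prodf_seq_neq0; apply/allP => i _ /=; rewrite S1 pnatr_eq0 -lt0n.
  exact: gens_pos.
have [lt|lt|//] := ltngtP m n.
  have : poincare H * (1 - 'X) ^+ (n - m) = \prod_i S (d i).
    apply: (mulfI (expf_neq0 m X0)); rewrite -E mulrCA -exprD subnKC //; exact: ltnW.
  move=> /(congr1 (fun p => p.[1])); rewrite hornerM horner_exp !hornerE subrr expr0n subn_eq0 leqNgt lt mulr0.
  by move=> e; rewrite -e eqxx in D1.
have : poincare H = (1 - 'X) ^+ (m - n) * \prod_i S (d i).
  apply: (mulIf (expf_neq0 n X0)); rewrite E mulrAC -exprD subnK //; exact: ltnW.
move=> /(congr1 (fun p => p.[1])); rewrite hornerM horner_exp !hornerE subrr expr0n subn_eq0 leqNgt lt mul0r.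
by move=> e; rewrite e eqxx in P1.
Qed.
End Gens.
End Chev1.
End Chev1.

(** * Chevalley's theorem on the invariants of reflection groups *)

Module Chev2.
From HB Require Import structures.
From mathcomp Require Import boolp reals complex mpoly.
From mathcomp Require Import ring.
Set Implicit Arguments.
Unset Strict Implicit.
Unset Printing Implicit Defensive.
Import Order.TTheory GRing.Theory Num.Theory ComplexField.
Local Open Scope ring_scope.
From mathcomp Require Import lra zify.
Require Import Defs.
Import PolyAct Root Cox Cox2 Cox3 Delta Hilb Chev1.
Section Chev2.
Variables (R : realType) (gT : finGroupType) (n : nat).
Variable rho : mx_representation R [set: gT] n.
Hypothesis faith : mx_faithful rho.
Variables (al : gT -> 'rV[R]_n) (v0 : 'cV[R]_n).
Local Notation refl := (is_reflection rho).
Local Notation sp := (sp rho).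
Local Notation coroot := (coroot rho).
Hypothesis hal : forall s, refl s ->
  [/\ rho s = 1%:M - coroot (al s) *m al s, sp (al s) (al s) = 2 & 0 < (al s *m v0) 0 0].
Local Notation C := R[i].
Local Notation A := {mpoly C[n]}.
Implicit Types p q : A.
Local Notation wact := (wact rho).
Local Notation avg := (avg rho).
Local Notation inv := (inv rho).
Local Notation TH := (TH rho).
Local Notation nab := (nab rho al).
Variable H : {group gT}.
Hypothesis rH : refl_group rho H.

Lemma wact_pihomog g k p : pihomog mdeg k (wact g p) = wact g (pihomog mdeg k p).
Proof.
rewrite {1}(pihomog_partitionE (leqnn (msize p))) (raddf_sum (wact g)) (raddf_sum (pihomog mdeg k)) /=.
have hj j : wact g (pihomog mdeg j p) \is j.-homog by apply: wact_homog; exact: pihomogP.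
rewrite (sum_pihomog (msize p) k hj); case: ltnP => // ge.
by rewrite (pihomog_big ge) (raddf0 (wact g)).
Qed.

Lemma inv_pihomog k p : inv H p -> inv H (pihomog mdeg k p).
Proof. by move=> ip g gH; rewrite -wact_pihomog ip. Qed.

Lemma invD p q : inv H p -> inv H q -> inv H (p + q).
Proof. by move=> hp hq g gH; rewrite (raddfD (wact g)) /= hp ?hq. Qed.
Lemma invM p q : inv H p -> inv H q -> inv H (p * q).
Proof. by move=> hp hq g gH; rewrite (rmorphM (wact g)) /= hp ?hq. Qed.

Lemma coef0_homog0 p : pihomog mdeg 0 p = (p@_0%MM)%:MP.
Proof.
apply/mpolyP => m; rewrite mcoeffC.
have [<-|ne] := eqVneq 0%MM m.
  rewrite mulr1 pihomogE raddf_sum /=; have [h|h] := boolP (0%MM \in msupp p).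
    rewrite (big_rem 0%MM h) /= mdeg0 eqxx mcoeffZ mcoeffX eqxx mulr1 big_seq_cond big1 ?addr0 // => u.
    rewrite mem_rem_uniq ?msupp_uniq // inE => /andP[/andP[u0 _] _].
    by rewrite mcoeffZ mcoeffX (negbTE u0) mulr0.
  rewrite big_seq_cond big1 ?(memN_msupp_eq0 h) // => u /andP[up _].
  by rewrite mcoeffZ mcoeffX; case: eqP => [e|]; rewrite ?mulr0 //; rewrite -e up in h.
rewrite mulr0; apply: dhomog_nemf_coeff (pihomogP mdeg 0 p) _.
by apply: contra_neq ne => /eqP; rewrite mdeg_eq0 => /eqP.
Qed.

Inductive pos_ideal : A -> Prop :=
| pos_gen p q of inv H q & q@_0%MM = 0 : pos_ideal (p * q)
| pos_add p q of pos_ideal p & pos_ideal q : pos_ideal (p + q).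

Lemma pos0 : pos_ideal 0.
Proof. by rewrite -(mul0r 0); apply: pos_gen; rewrite ?mcoeff0 // => g _; rewrite (raddf0 (wact g)). Qed.
Lemma posM a p : pos_ideal p -> pos_ideal (a * p).
Proof.
elim=> [u q iq q0|u v _ hu _ hv]; first by rewrite mulrA; exact: pos_gen.
by rewrite mulrDr; exact: pos_add.
Qed.
Lemma pos_wact g p : g \in H -> pos_ideal p -> pos_ideal (wact g p).
Proof.
move=> gH; elim=> [u q iq q0|u v _ hu _ hv].
  by rewrite (rmorphM (wact g)) /= iq //; exact: pos_gen.
by rewrite (raddfD (wact g)) /=; exact: pos_add.
Qed.
Lemma pos_sum (I : Type) (r : seq I) (P : pred I) (f : I -> A) :
  (forall i, P i -> pos_ideal (f i)) -> pos_ideal (\sum_(i <- r | P i) f i).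
Proof. by move=> h; apply: (big_ind pos_ideal) => //; [exact: pos0|exact: pos_add]. Qed.

(** Elements moving [p] only within the ideal form a subgroup, so its generating reflections
    decide. *)
Lemma pos_avg p : (forall s, TH H s -> pos_ideal (p - wact s p)) -> pos_ideal (p - avg H p).
Proof.
move=> hs; pose D := [set g in H | `[< pos_ideal (p - wact g p) >]].
have gD : group_set D.
  apply/group_setP; split; first by rewrite inE group1 /=; apply/asboolP; rewrite wact1 subrr; exact: pos0.
  move=> g h; rewrite !inE => /andP[gH /asboolP hg] /andP[hH /asboolP hh]; rewrite groupM //=.
  apply/asboolP; rewrite wactM.
  have -> : p - wact g (wact h p) = (p - wact g p) + wact g (p - wact h p).
    have aux (a b c : A) : a - c = (a - b) + (b - c) by rewrite addrA subrK.
    have e1 : wact g (p - wact h p) = wact g p - wact g (wact h p) by exact: (raddfB (wact g)).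
    rewrite e1; exact: aux.
  by apply: pos_add => //; exact: pos_wact.
have all g : g \in H -> pos_ideal (p - wact g p).
  move=> gH; suff : g \in Group gD by rewrite inE => /andP[_ /asboolP].
  have := subsetP rH g gH; apply/subsetP; rewrite gen_subG; apply/subsetP => s; rewrite inE => ts.
  by rewrite inE; case/andP: (ts) => _ ->; apply/asboolP/hs.
have -> : p - avg H p = (#|H|%:R^-1)%:MP * \sum_(g in H) (p - wact g p).
  rewrite mul_mpolyC sumrB scalerBr -/(avg H p) sumr_const; congr (_ - _).
  by rewrite -[p *+ _]scaler_nat scalerA mulVf ?scale1r // cardC_neq0.
by apply/posM/pos_sum.
Qed.

(** Induction on the size of [P i0]. Divided differences annihilate the invariant [J i] and send
    relations to smaller ones, so [P i0] agrees with its average modulo the ideal. If that average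
    had a constant term, the component of degree [e i0] of the averaged relation would express
    [J i0] through the others. *)
Lemma chevalley_lemma (T : finType) (B : {set T}) (J : T -> A) (e : T -> nat) (i0 : T) (P : T -> A) :
  (forall i, inv H (J i)) -> (forall i, J i \is (e i).-homog) -> i0 \in B ->
  ~ (exists2 q : T -> A, forall i, inv H (q i) & J i0 = \sum_(i in B :\ i0) q i * J i) ->
  \sum_(i in B) P i * J i = 0 -> pos_ideal (P i0).
Proof.
move=> iJ hJ i0B no; move: {2}(msize (P i0)) (leqnn (msize (P i0))) => k.
elim: k P => [|k IH] P pk rel.
  by move: pk; rewrite leqn0 msize_poly_eq0 => /eqP ->; exact: pos0.
have step s : TH H s -> pos_ideal (P i0 - wact s (P i0)).
  case/andP=> rs sH; rewrite (nabP faith hal _ rs); apply: posM.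
  apply: (IH (fun i => nab s (P i))); first by apply: msize_ddiff => //; exact: rowC_neq0 hal _ rs.
  have l0 := rowC_neq0 hal rs.
  transitivity (nab s (\sum_(i in B) P i * J i)); last first.
    rewrite rel; apply: (ddiff_fix l0); exact: (raddf0 (comp_mpoly _)).
  elim/big_rec2: _ => [|i x y iB ->].
    by apply/esym; apply: (ddiff_fix l0); exact: (raddf0 (comp_mpoly _)).
  rewrite /Delta.nab (ddiffD _ l0) (ddiffM _ l0); congr (_ + _).
  rewrite [ddiff _ _ (J i)](ddiff_fix l0) ?mulr0 ?addr0 //.
  by rewrite -(wact_refl faith hal _ rs) iJ.
have dif := pos_avg step.
have -> : P i0 = (P i0 - avg H (P i0)) + avg H (P i0) by rewrite subrK.
apply: pos_add => //; rewrite -[avg H _]mul1r; apply: pos_gen; first exact: avg_inv.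
apply/eqP/negPn/negP => c0; apply: no; set c := _@_0%MM in c0.
have rel2 : \sum_(i in B) avg H (P i) * J i = 0.
  have := congr1 (avg H) rel; rewrite (raddf0 (avg H)) (raddf_sum (avg H)) /=.
  by move=> e1; rewrite -[RHS]e1; apply: eq_bigr => i _; rewrite avgM.
pose q i := - c^-1 *: (if (e i <= e i0)%N then pihomog mdeg (e i0 - e i) (avg H (P i)) else 0).
exists q => [i|].
  move=> g gH; rewrite /q linearZ /=; congr (_ *: _).
  case: ifP => _; last by rewrite (raddf0 (wact g)).
  by apply: inv_pihomog => //; exact: avg_inv.
have := congr1 (pihomog mdeg (e i0)) rel2; rewrite (raddf0 (pihomog mdeg _)) (raddf_sum (pihomog mdeg _)) /=.
have E i : pihomog mdeg (e i0) (avg H (P i) * J i) =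
   (if (e i <= e i0)%N then pihomog mdeg (e i0 - e i) (avg H (P i)) else 0) * J i.
  rewrite mulrC; case: leqP => h; last by rewrite mul0r (pihomogM_lt _ (hJ i) h).
  by rewrite -{1}(subnKC h) (pihomogM _ _ (hJ i)) mulrC.
rewrite (bigD1 i0) //= E leqnn subnn coef0_homog0 -/c mul_mpolyC => /eqP; rewrite addr_eq0 => /eqP e1.
apply: (scalerI c0); rewrite e1 scaler_sumr -sumrN; apply: eq_big => [i|i _].
  by rewrite !inE andbC.
by rewrite E /q -scalerAl scalerA mulrN divff // scaleN1r.
Qed.

Definition good m (f : 'I_m -> A) (d : 'I_m -> nat) :=
  [/\ forall i, inv H (f i), forall i, f i \is (d i).-homog, forall i, (0 < d i)%N &
   forall p, inv H p -> p@_0%MM = 0 -> exists c : 'I_m -> A, p = \sum_i c i * f i].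

Lemma avgZ a p : avg H (a *: p) = a *: avg H p.
Proof. by have := @avg_linear _ _ _ rho H a p 0; rewrite !addr0 (raddf0 (avg H)) addr0. Qed.

Lemma monomial_avg p : inv H p -> p = \sum_(u <- msupp p) p@_u *: avg H 'X_[u].
Proof.
move=> ip; rewrite -{1}(avg_id ip) {1}[p]mpolyE (raddf_sum (avg H)).
by apply: eq_bigr => u _; exact: avgZ.
Qed.

Section Finite.
(** Each variable is a root of [prod_g (T - g x_i)], whose lower coefficients are invariants of
    degree at most [#|H|]; so [x_i^#|H|] lies in the ideal they generate. A monomial of degree at
    least [K] contains such a power, which bounds the degrees of the generators. *)
Let K := (n * #|H|).+2.
Let T := {u : box K n | (0 < mdeg (mm u))%N && (mdeg (mm u) < K)%N}.
Let fT (u : T) : A := avg H 'X_[mm (val u)].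
Let gen p := exists c : T -> A, p = \sum_u c u * fT u.

Let genM a p : gen p -> gen (a * p).
Proof. by case=> c ->; exists (fun u => a * c u); rewrite mulr_sumr; apply: eq_bigr => u _; rewrite mulrA. Qed.
Let genD p q : gen p -> gen q -> gen (p + q).
Proof. by case=> c -> [c' ->]; exists (fun u => c u + c' u); rewrite -big_split; apply: eq_bigr => u _; rewrite mulrDl. Qed.
Let gen0 : gen 0.
Proof. by exists (fun=> 0); rewrite big1 // => u _; rewrite mul0r. Qed.
Let gen_sum (I : Type) (r : seq I) (P : pred I) (f : I -> A) : (forall i, P i -> gen (f i)) -> gen (\sum_(i <- r | P i) f i).
Proof. by move=> h; apply: (big_ind gen). Qed.

Let gen_low (u : 'X_{1..n}) : (0 < mdeg u)%N -> (mdeg u < K)%N -> gen (avg H 'X_[u]).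
Proof.
move=> u0 uK; have uiK i : (u i < K)%N by apply: leq_ltn_trans (mdeg_ge u i) uK.
pose b : box K n := [ffun i => Ordinal (uiK i)].
have mb : mm b = u by apply/mnmP => i; rewrite mnmE ffunE.
have hb : (0 < mdeg (mm b))%N && (mdeg (mm b) < K)%N by rewrite mb u0 uK.
exists (fun v => (v == Sub b hb)%:R).
rewrite (bigD1 (Sub b hb)) //= eqxx mul1r big1 ?addr0 => [|v /negbTE ->]; last by rewrite mul0r.
by rewrite /fT SubK mb.
Qed.

Let gen_homog k p : (0 < k)%N -> (k < K)%N -> inv H p -> p \is k.-homog -> gen p.
Proof.
move=> k0 kK ip hp; rewrite (monomial_avg ip) big_seq; apply: gen_sum => u up.
rewrite -mul_mpolyC; apply: genM; have e := dhomog_mf hp up.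
by apply: gen_low; rewrite e.
Qed.

Let gen_power i : gen ('X_i ^+ #|H|).
Proof.
pose E j : A := \sum_(B : {set gT} | (B \subset H) && (#|B| == j)) \prod_(g in B) wact g 'X_i.
have hX : ('X_i : A) \is 1.-homog by rewrite dhomogX /= mdeg1.
have iE j : inv H (E j).
  move=> h hH; rewrite (raddf_sum (wact h)) /= [RHS](reindex_inj (h := fun B : {set gT} => (h *: B)%g)); last first.
    by move=> B B' /(congr1 (fun X : {set gT} => (h^-1 *: X)%g)); rewrite -!lcosetM mulVg !lcoset1.
  apply: eq_big => [B|B _].
    rewrite card_lcoset; congr (_ && _); apply/idP/idP => /subsetP hB; apply/subsetP => g.
      by rewrite mem_lcoset => /hB; rewrite groupMl // groupV.
    by move=> gB; have := hB (h * g)%g; rewrite mem_lcoset mulKg groupMl //; exact.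
  rewrite (rmorph_prod (wact h)) /= [RHS](reindex_inj (mulgI h)) /=.
  by apply: eq_big => [g|g _]; rewrite ?mem_lcoset ?mulKg // wactM.
have hE j : E j \is j.-homog.
  apply: rpred_sum => B /andP[_ /eqP <-].
  have := @homog_prod C n _ (index_enum gT) (mem B) (fun g => wact g 'X_i) (fun=> 1%N) (fun g _ => wact_homog rho g hX).
  by rewrite sum1_card.
have gE j : (0 < j)%N -> (j <= #|H|)%N -> gen (E j).
  move=> j0 jH; apply: (gen_homog j0) (iE j) (hE j).
  have n0 : (0 < n)%N := leq_ltn_trans (leq0n _) (ltn_ord i).
  by rewrite /K ltnS; apply: (leq_trans jH); rewrite leqW // leq_pmull.
have : \prod_(g in H) ('X_i - wact g 'X_i) = 0 :> A.
  by rewrite (bigD1 1%g) //= wact1 subrr mul0r.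
have -> : \prod_(g in H) ('X_i - wact g 'X_i) = \sum_(j < #|H|.+1) (-1) ^+ j * E j * 'X_i ^+ (#|H| - j).
  transitivity (\prod_g ((if g \in H then - wact g 'X_i else 0) + (if g \in H then 'X_i else 1))).
    by rewrite [LHS]big_mkcond; apply: eq_bigr => g _; case: ifP => _; rewrite ?add0r // addrC.
  rewrite bigA_distr (bigID (fun B : {set gT} => B \subset H)) /= [X in _ + X]big1 ?addr0; last first.
    by move=> B /subsetPn[g gB gH]; rewrite (bigD1 g) //= gB (negbTE gH) mul0r.
  rewrite (partition_big (fun B : {set gT} => inord #|B| : 'I_#|H|.+1) xpredT) //=; apply: eq_bigr => j _.
  rewrite /E mulr_sumr mulr_suml; apply: eq_big => [B|B /andP[BH /eqP hj]].
    case BH: (B \subset H) => //=; have le : (#|B| <= #|H|)%N by exact: subset_leq_card.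
    by rewrite -val_eqE /= inordK.
  have jB : #|B| = j.
    by rewrite -hj inordK // ltnS subset_leq_card.
  rewrite (bigID (mem B)) /= -jB; congr (_ * _).
    rewrite -prodrN; apply: eq_bigr => g gB; by rewrite gB (subsetP BH).
  rewrite (eq_bigr (fun g => if g \in H then 'X_i else 1)) => [|g /negbTE -> //].
  rewrite -big_mkcondr /= prodr_const; congr (_ ^+ _).
  by rewrite -(cardsDS BH); apply: eq_card => g; rewrite !inE.
rewrite big_ord_recl expr0 mul1r subn0 => /eqP; rewrite addr_eq0 => /eqP.
have -> : E 0%N = 1.
  rewrite /E (big_pred1 set0) ?big_set0 // => B; rewrite cards_eq0 andb_idl // => /eqP ->; exact: sub0set.
rewrite mul1r => ->; rewrite -sumrN; apply: gen_sum => j _.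
rewrite mulrAC -mulNr; apply: genM; apply: gE; rewrite lift0 //; exact: ltn_ord.
Qed.

Let gen_high (v : 'X_{1..n}) : (K <= mdeg v)%N -> gen 'X_[v].
Proof.
move=> hv; have [i hi] : exists i, (#|H| <= v i)%N.
  apply/existsP; apply: contraTT hv; rewrite negb_exists => /forallP h; rewrite -ltnNge mdegE.
  apply: (@leq_ltn_trans (\sum_(i < n) #|H|)%N).
    by apply: leq_sum => i _; have := h i; rewrite -ltnNge => /ltnW.
  by rewrite sum_nat_const card_ord /K.
have le : (U_(i) *+ #|H| <= v)%MM.
  apply/mnm_lepP => j; rewrite mulmnE mnm1E; case: eqP => [<-|_]; by rewrite ?mul1n ?mul0n.
by rewrite -(submK le) mpolyXD -mpolyXn; apply: genM; exact: gen_power.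
Qed.

Lemma good_ex : exists m (f : 'I_m -> A) d, good f d.
Proof.
exists #|{: T}|, (fun i => fT (enum_val i)), (fun i => mdeg (mm (val (enum_val i)))); split=> [i|i|i|p ip p0].
- exact: avg_inv.
- by apply: avg_homog; rewrite dhomogX.
- by have /andP[] := valP (enum_val i).
suff [c ->] : gen p.
  exists (fun i => c (enum_val i)); by rewrite (reindex _ (onW_bij _ (@enum_val_bij _))).
rewrite {1}(monomial_avg ip) big_seq; apply: gen_sum => u up; rewrite -mul_mpolyC; apply: genM.
have u0 : (0 < mdeg u)%N.
  by rewrite lt0n mdeg_eq0; apply: contraTneq up => ->; rewrite mcoeff_msupp p0 eqxx.
have [lt|ge] := ltnP (mdeg u) K; first exact: gen_low.
rewrite [avg H _]mpolyE big_seq; apply: gen_sum => v vu; rewrite -mul_mpolyC; apply: genM.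
apply: gen_high; have hu : avg H 'X_[u] \is (mdeg u).-homog by apply: avg_homog; rewrite dhomogX.
by rewrite (dhomog_mf hu vu).
Qed.
End Finite.

Lemma good_min : exists m (f : 'I_m -> A) d, good f d /\
  forall i (c : 'I_m -> A), f i <> \sum_(j | j != i) c j * f j.
Proof.
have ex : exists m, `[< exists (f : 'I_m -> A) d, good f d >].
  by have [m [f [d g]]] := good_ex; exists m; apply/asboolP; exists f, d.
case: (ex_minnP ex) => m /asboolP[f [d gf]] mmin; exists m, f, d; split=> // i c e.
case: m f d gf mmin i c e => [|m] f d gf mmin; first by case.
move=> i c e; have : (m.+1 <= m)%N; last by rewrite ltnn.
apply: mmin; apply/asboolP; exists (f \o lift i), (d \o lift i).
case: gf => h1 h2 h3 h4; split=> [j|j|j|p ip p0]; [exact: h1|exact: h2|exact: h3|].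
have [b ->] := h4 p ip p0; exists (fun j => b (lift i j) + b i * c (lift i j)).
have eL (F : 'I_m.+1 -> A) : \sum_(j | j != i) F j = \sum_j F (lift i j).
  apply: (@addrI _ (F i)); transitivity (\sum_j F j); first by rewrite [RHS](bigD1 i).
  by rewrite (bigD1_ord i).
rewrite (bigD1 i) //= {1}e !eL mulr_sumr -big_split; apply: eq_bigr => j _ /=.
by rewrite mulrDl mulrA addrC.
Qed.

Lemma euler k p : p \is k.-homog -> \sum_i 'X_i * p^`M(i) = k%:R *: p.
Proof.
move=> hp; rewrite {2}[p]mpolyE scaler_sumr.
under eq_bigr => i _ do rewrite {1}[p]mpolyE (raddf_sum (mderiv i)) mulr_sumr.
rewrite exchange_big /= big_seq [RHS]big_seq; apply: eq_bigr => u up.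
have <- : mdeg u = k by exact: (dhomog_mf hp).
rewrite mdegE natr_sum scaler_suml; apply: eq_bigr => i _.
rewrite linearZ /= mderivX -scalerAr -scalerAr scalerA mulrC -scalerA.
have [u0|u0] := eqVneq (u i) 0%N; first by rewrite u0 !scale0r.
by congr (_ *: (_ *: _)); rewrite -mpolyXD addmC submK // lep1mP.
Qed.

Lemma chain_rule m (phi : {mpoly C[m]} -> A) (F : 'I_m -> A) (q : {mpoly C[m]}) i :
  (forall a, phi a%:MP = a%:MP) -> (forall u v, phi (u + v) = phi u + phi v) ->
  (forall u v, phi (u * v) = phi u * phi v) -> (forall k, phi 'X_k = F k) ->
  (phi q)^`M(i) = \sum_j phi q^`M(j) * (F j)^`M(i).
Proof.
move=> pC pD pM pX; move: q; apply: mpoly_lin_ind => [a|p q hp hq|k p hp].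
- rewrite pC mderivC big1 // => j _.
  by rewrite mderivC -(mpolyC0 m) pC mpolyC0 mul0r.
- under [RHS]eq_bigr => j _ do rewrite mderivD pD mulrDl.
  by rewrite big_split /= -hp -hq pD mderivD.
rewrite pM mderivM hp pX.
under [RHS]eq_bigr => j _ do rewrite mderivM pD !pM mulrDl pX.
rewrite big_split /=; congr (_ + _).
  rewrite (bigD1 k) //= [X in _ = _ + X]big1 ?addr0 => [|j jk].
    rewrite mderivX mnm1E eqxx scale1r (_ : (U_(k) - U_(k))%MM = 0%MM); last first.
      by apply/mnmP => j; rewrite mnmBE subnn mnm0E.
    by rewrite mpolyX0 -(mpolyC1 m) pC mpolyC1 mul1r mulrC.
  by rewrite mderivX mnm1E eq_sym (negbTE jk) scale0r -(mpolyC0 m) pC mpolyC0 !mul0r.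
by rewrite mulr_sumr; apply: eq_bigr => j _; rewrite mulrA.
Qed.

(** Surjectivity goes by degree, with averaged coefficients. For independence, differentiate a
    relation [q] of least weighted degree in each [x_i]: its partial derivatives at the generators,
    [h j], are not all zero, and [chevalley_lemma] puts combinations of the derivatives of the
    generators in the ideal of positive invariants. Euler's formula then expresses one generator by
    the others, against minimality. *)
Theorem chevalley : exists m (f : m.-tuple A) d, free_gens rho H f d.
Proof.
have [m [f0 [d [[h1 h2 h3 h4] hmin]]]] := good_min.
pose f := [tuple f0 i | i < m]; have fE i : tnth f i = f0 i by rewrite tnth_mktuple.
have [phi phiE] : exists phi : {mpoly C[m]} -> A, forall q : {mpoly C[m]}, phi q = q \mPo f by exists (comp_mpoly f).
have fX i : phi 'X_i = f0 i by rewrite phiE comp_mpolyXU -tnth_nth.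
have fC a : phi a%:MP = a%:MP by rewrite phiE comp_mpolyC.
have fD u v : phi (u + v) = phi u + phi v by rewrite !phiE; exact: comp_mpolyD.
have fM u v : phi (u * v) = phi u * phi v by rewrite !phiE; exact: (rmorphM (comp_mpoly f)).
have f00 : phi 0 = 0 by rewrite -(mpolyC0 m) fC mpolyC0.
have fS (I : Type) (r : seq I) (P : pred I) G : phi (\sum_(i <- r | P i) G i) = \sum_(i <- r | P i) phi (G i).
  by elim/big_rec2: _ => // i x y _ <-; rewrite fD.
have hf i : tnth f i \is (d i).-homog by rewrite fE.
have invf i : inv H (tnth f i) by rewrite fE.
have cst k p : p \is k.-homog -> k = 0%N -> p = (p@_0%MM)%:MP.
  by move=> hp k0; rewrite -[p in LHS](pihomog_dE hp) k0 coef0_homog0.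
have low k p : p \is k.-homog -> (0 < k)%N -> p@_0%MM = 0.
  by move=> hp k0; apply: (dhomog_nemf_coeff hp); rewrite /= mdeg0 ltn_eqF.
have part (u v : A) b k : v \is b.-homog -> pihomog mdeg k (u * v) =
    (if (b <= k)%N then pihomog mdeg (k - b) u else 0) * v.
  move=> hv; rewrite mulrC; case: leqP => h; last by rewrite mul0r (pihomogM_lt _ hv h).
  by rewrite -{1}(subnKC h) (pihomogM _ _ hv) mulrC.
have surj k p : p \is k.-homog -> inv H p -> exists q : {mpoly C[m]}, p = phi q.
  elim/ltn_ind: k p => k IH p hp ip; have [k0|k0] := posnP k.
    by exists (p@_0%MM)%:MP; rewrite fC; exact: cst hp k0.
  have [c pE] := h4 p ip (low k p hp k0).
  pose b i := avg H (if (d i <= k)%N then pihomog mdeg (k - d i) (c i) else 0).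
  have pE2 : p = \sum_i b i * f0 i.
    have e1 : p = avg H (pihomog mdeg k p) by rewrite (pihomog_dE hp) avg_id.
    rewrite {1}e1 {1}pE (raddf_sum (pihomog mdeg k)) (raddf_sum (avg H)).
    by apply: eq_bigr => i _ /=; rewrite (part _ _ _ _ (h2 i)) avgM.
  have ex i : exists q : {mpoly C[m]}, b i = phi q.
    rewrite /b; case: leqP => di; last by exists 0; rewrite f00 (raddf0 (avg H)).
    apply: (IH (k - d i)%N); first by rewrite ltn_subrL h3 k0.
      by apply: avg_homog; exact: pihomogP.
    exact: avg_inv.
  exists (\sum_i sval (cid (ex i)) * 'X_i); rewrite fS {1}pE2.
  by apply: eq_bigr => i _; rewrite fM fX -(svalP (cid (ex i))).
have surj' p : inv H p -> exists q : {mpoly C[m]}, p = phi q.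
  move=> ip; have ex (k : 'I_(msize p)) := surj k _ (pihomogP mdeg k p) (inv_pihomog _ ip).
  exists (\sum_k sval (cid (ex k))); rewrite fS {1}(pihomog_partitionE (leqnn (msize p))).
  by apply: eq_bigr => k _; rewrite -(svalP (cid (ex k))).
have posf p : pos_ideal p -> exists c : 'I_m -> A, p = \sum_i c i * f0 i.
  elim=> [u q iq q0|u v _ [c ->] _ [c' ->]].
    by have [c ->] := h4 q iq q0; exists (fun i => u * c i); rewrite mulr_sumr; apply: eq_bigr => i _; rewrite mulrA.
  by exists (fun i => c i + c' i); rewrite -big_split; apply: eq_bigr => i _; rewrite mulrDl.
have inj k (q : {mpoly C[m]}) : q \is k.-homog for (wdeg d) -> phi q = 0 -> q = 0.
  elim/ltn_ind: k q => k IH q hq q0.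
  pose h j := phi q^`M(j).
  have dq j : (d j <= k)%N -> q^`M(j) \is (k - d j).-homog for (wdeg d).
    move=> dk; apply/dhomogP => u; rewrite mcoeff_msupp mcoeff_mderiv => nz.
    have : (u + U_(j))%MM \in msupp q by rewrite mcoeff_msupp; apply: contra_neq nz => ->; rewrite mul0rn.
    move/(dhomog_mf hq); rewrite (mfD (s := wdeg d)) => <-.
    have e2 : wdeg d U_(j)%MM = d j.
      rewrite /wdeg (bigD1 j) //= mnm1E eqxx muln1 big1 ?addn0 // => i ij.
      by rewrite mnm1E eq_sym (negbTE ij) muln0.
    transitivity (wdeg d u + d j - d j)%N; first by rewrite addnK.
    by congr (_ + _ - _)%N; exact: esym e2.
  have dq0 j : (k < d j)%N -> q^`M(j) = 0.
    move=> dk; apply/mpolyP => u; rewrite mcoeff_mderiv mcoeff0.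
    have [nz|] := boolP ((u + U_(j))%MM \in msupp q); last by rewrite mcoeff_msupp negbK => /eqP ->; rewrite mul0rn.
    have e0 : wdeg d (u + U_(j))%MM = k := dhomog_mf hq nz.
    move: e0; rewrite /wdeg (bigD1 j) //= mnmDE mnm1E eqxx addn1 mulnS => e.
    by move: dk; rewrite -e -addnA ltnNge leq_addr.
  have hh j : h j \is (k - d j).-homog.
    rewrite /h; case: (leqP (d j) k) => dk; first by rewrite phiE; apply: comp_whomog hf (dq j dk).
    by rewrite dq0 // f00 rpred0.
  have ih j : inv H (h j) by rewrite /h phiE; exact: comp_inv.
  have [all0|] := boolP [forall j, h j == 0].
    have d0 j : q^`M(j) = 0.
      have [dk|dk] := leqP (d j) k; last exact: dq0.
      apply: (IH (k - d j)%N) (dq j dk) _; last exact/eqP/(forallP all0).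
      have := h3 j; lia.
    have e := mderiv0_const d0; move: q0; rewrite e fC => /(congr1 (mcoeff 0%MM)).
    by rewrite mcoeffC eqxx mulr1 mcoeff0 => ->; rewrite mpolyC0.
  rewrite negb_forall => /existsP[j0 hj0]; exfalso.
  (* A smallest set generating all the [h j] with invariant coefficients is used, so that none of
     its members is a combination of the others. *)
  pose spans (B : {set 'I_m}) := `[< forall j, exists2 V : 'I_m -> A, forall b, inv H (V b) & h j = \sum_(b in B) V b * h b >].
  have sT : spans setT.
    apply/asboolP => j; exists (fun b => (b == j)%:R).
      by move=> b g gH; case: (b == j); rewrite ?(rmorph1 (wact g)) ?(raddf0 (wact g)).
    rewrite (bigD1 j) ?inE //= eqxx mul1r big1 ?addr0 // => b /andP[_ /negbTE ->]; by rewrite mul0r.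
  case: (arg_minnP (fun B : {set 'I_m} => #|B|) sT) => B /asboolP sB minB.
  have [b0 b0B] : exists b, b \in B.
    apply/set0Pn; apply: contra hj0 => /eqP B0; have [V _ ->] := sB j0.
    by rewrite B0 big_set0.
  have no : ~ (exists2 c : 'I_m -> A, forall i, inv H (c i) & h b0 = \sum_(i in B :\ b0) c i * h i).
    case=> c ic hb; have : spans (B :\ b0).
      apply/asboolP => j; have [V iV ->] := sB j; exists (fun b => V b + V b0 * c b).
        by move=> b; apply: invD (iV b) (invM (iV b0) (ic b)).
      rewrite (bigD1 b0) //= {1}hb mulr_sumr [X in _ + X](eq_bigl (fun b => b \in B :\ b0)) => [|b]; last by rewrite !inE andbC.
      by rewrite -big_split; apply: eq_bigr => b _ /=; rewrite mulrDl mulrA addrC.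
    by move/minB; rewrite [X in (X <= _)%N](cardsD1 b0) b0B add1n ltnn.
  (* Members of the minimal set are represented by themselves, which gives the coefficient
     [V b0 b0 = 1]. *)
  pose V j b : A := if j \in B then (b == j)%:R else s2val (cid2 (sB j)) b.
  have VE j : h j = \sum_(b in B) V j b * h b.
    rewrite /V; case: (boolP (j \in B)) => jB; last exact: s2valP' (cid2 (sB j)).
    rewrite (bigD1 j) //= eqxx mul1r big1 ?addr0 // => b /andP[_ /negbTE ->]; by rewrite mul0r.
  have der i : pos_ideal (\sum_j V j b0 * (f0 j)^`M(i)).
    apply: (chevalley_lemma (J := h) (e := fun j => (k - d j)%N) (P := fun b => \sum_j V j b * (f0 j)^`M(i)) ih hh b0B no).
    have := chain_rule q i fC fD fM fX; rewrite q0 mderiv0 => /esym e; rewrite -[RHS]e.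
    under [RHS]eq_bigr => j _ do rewrite -/(h j) {1}VE mulr_suml.
    rewrite exchange_big /=; apply: eq_bigr => b _; rewrite mulr_suml; apply: eq_bigr => j _.
    by rewrite mulrAC.
  pose r i := sval (cid (posf _ (der i))).
  have rE i : \sum_j V j b0 * (f0 j)^`M(i) = \sum_l r i l * f0 l by exact: svalP (cid (posf _ (der i))).
  have E : \sum_j V j b0 * ((d j)%:R *: f0 j) = \sum_l (\sum_i 'X_i * r i l) * f0 l.
    transitivity (\sum_i 'X_i * \sum_j V j b0 * (f0 j)^`M(i)).
      under eq_bigr => j _ do rewrite -(euler (h2 j)) mulr_sumr.
      rewrite exchange_big /=; apply: eq_bigr => i _; rewrite mulr_sumr; apply: eq_bigr => j _.
      by rewrite mulrCA.
    under eq_bigr => i _ do rewrite rE mulr_sumr.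
    rewrite exchange_big /=; apply: eq_bigr => l _; rewrite mulr_suml; apply: eq_bigr => i _.
    by rewrite mulrA.
  pose pr (u : A) l := if (d l <= d b0)%N then pihomog mdeg (d b0 - d l) u else 0.
  (* In degree [d b0] the generator [f0 b0] keeps the coefficient [d b0] on the left, while on the
     right its coefficient has no constant term and drops out. *)
  have := congr1 (pihomog mdeg (d b0)) E; rewrite !(raddf_sum (pihomog mdeg (d b0))) /=.
  under eq_bigr => j _ do rewrite -scalerAr linearZ /= (part _ _ _ _ (h2 j)) -/(pr _ _).
  under [X in _ = X]eq_bigr => l _ do rewrite (part _ _ _ _ (h2 l)) -/(pr _ _).
  rewrite (bigD1 b0) //= [X in _ = X](bigD1 b0) //=.
  have -> : pr (V b0 b0) b0 = 1.
    by rewrite /pr leqnn subnn coef0_homog0 /V b0B eqxx mcoeffC eqxx mulr1.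
  have -> : pr (\sum_i 'X_i * r i b0) b0 = 0.
    rewrite /pr leqnn subnn (raddf_sum (pihomog mdeg 0)) big1 // => i _.
    by apply: (pihomogM_lt (e := 1)); rewrite // dhomogX /= mdeg1.
  rewrite mul1r mul0r add0r => /(canRL (addrK _)) e.
  have dn : (d b0)%:R != 0 :> C by rewrite pnatr_eq0 -lt0n.
  apply: (hmin b0 (fun l => (d b0)%:R^-1 *: (pr (\sum_i 'X_i * r i l) l - (d l)%:R *: pr (V l b0) l))).
  apply: (scalerI dn); rewrite e scaler_sumr -sumrB; apply: eq_bigr => l _.
  by rewrite -scalerAl scalerA mulfV // scale1r mulrBl -scalerAl.
exists m, f, d; split=> // [p ip|q]; first by have [q ->] := surj' p ip; exists q; rewrite phiE.
rewrite -phiE => q0.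
rewrite (pihomog_partitionE (leqnn (mmeasure (wdeg d) q))) big1 // => k _.
apply: (inj k); first exact: pihomogP.
have hj j : phi (pihomog (wdeg d) j q) \is j.-homog by rewrite phiE; apply: comp_whomog hf _; exact: pihomogP.
have := congr1 (pihomog mdeg k) q0; rewrite (raddf0 (pihomog mdeg k)).
have e1 : phi q = \sum_(j < mmeasure (wdeg d) q) phi (pihomog (wdeg d) j q).
  by rewrite -fS; congr phi; exact: pihomog_partitionE (leqnn _).
rewrite e1 (raddf_sum (pihomog mdeg k)) /=.
by rewrite (sum_pihomog _ k hj) ltn_ord.
Qed.
End Chev2.
End Chev2.

(** * Dunkl operators, stable ideals and intertwining functionals *)

Module Dunkl.
From HB Require Import structures.
From mathcomp Require Import boolp reals complex mpoly.
From mathcomp Require Import ring.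
Set Implicit Arguments.
Unset Strict Implicit.
Unset Printing Implicit Defensive.
Import Order.TTheory GRing.Theory Num.Theory ComplexField.
Local Open Scope ring_scope.
From mathcomp Require Import lra zify.
Require Import Defs.
Import PolyAct Root Cox Cox2 Cox3 Delta Hilb Chev1 Chev2.
Section Dunkl.
Variables (R : realType) (gT : finGroupType) (n : nat).
Variable rho : mx_representation R [set: gT] n.
Hypothesis faith : mx_faithful rho.
Variables (al : gT -> 'rV[R]_n) (v0 : 'cV[R]_n).
Local Notation refl := (is_reflection rho).
Local Notation sp := (sp rho).
Local Notation coroot := (coroot rho).
Hypothesis hal : forall s, refl s ->
  [/\ rho s = 1%:M - coroot (al s) *m al s, sp (al s) (al s) = 2 & 0 < (al s *m v0) 0 0].
Local Notation C := R[i].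
Local Notation A := {mpoly C[n]}.
Implicit Types p q : A.
Local Notation wact := (wact rho).
Local Notation avg := (avg rho).
Local Notation inv := (inv rho).
Local Notation TH := (TH rho).
Local Notation nab := (nab rho al).
Local Notation rowC := (rowC al).
Local Notation corC := (corC rho al).
Local Notation alC := (alC al).
Implicit Types (y : 'cV[C]_n) (l : 'rV[C]_n) (G : {group gT}).

Lemma wact_coef0 g p : (wact g p)@_0%MM = p@_0%MM.
Proof.
apply: (@mpolyC_inj C n); rewrite -!coef0_homog0 wact_pihomog coef0_homog0 wactC.
by [].
Qed.

Section Def.
Variables (G : {group gT}) (c : C).
Definition dunkl y p : A := pd y p - c *: \sum_(s | TH G s) (rowC s *m y) 0 0 *: nab s p.

Fact dunkl_linear y : linear (dunkl y).
Proof.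
move=> a p q; rewrite /dunkl linearP scalerBr scalerA mulrC -scalerA.
rewrite -addrA [X in _ + X](_ : _ = - (c *: (a *: \sum_(s | TH G s) (rowC s *m y) 0 0 *: nab s p)) +
   (pd y q - c *: \sum_(s | TH G s) (rowC s *m y) 0 0 *: nab s q)).
  by rewrite addrA.
rewrite addrCA; congr (_ + _); rewrite -opprD -scalerDr; congr (- (_ *: _)).
rewrite scaler_sumr -big_split; apply: eq_bigr => s /TH_refl rs /=.
by rewrite /Delta.nab (ddiffD _ (rowC_neq0 hal rs)) (ddiffZ _ (rowC_neq0 hal rs)) scalerDr !scalerA mulrC.
Qed.
HB.instance Definition _ y := GRing.isLinear.Build C A A _ (dunkl y) (dunkl_linear y).

Lemma dunklD y y' p : dunkl (y + y') p = dunkl y p + dunkl y' p.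
Proof.
rewrite /dunkl pdD; have -> : \sum_(s | TH G s) (rowC s *m (y + y')) 0 0 *: nab s p =
   \sum_(s | TH G s) (rowC s *m y) 0 0 *: nab s p + \sum_(s | TH G s) (rowC s *m y') 0 0 *: nab s p.
  by rewrite -big_split; apply: eq_bigr => s _; rewrite mulmxDr mxE scalerDl.
by rewrite scalerDr opprD addrACA.
Qed.
Lemma dunklZ a y p : dunkl (a *: y) p = a *: dunkl y p.
Proof.
rewrite /dunkl pdZ; have -> : \sum_(s | TH G s) (rowC s *m (a *: y)) 0 0 *: nab s p =
   a *: \sum_(s | TH G s) (rowC s *m y) 0 0 *: nab s p.
  by rewrite scaler_sumr; apply: eq_bigr => s _; rewrite -scalemxAr mxE scalerA.
by rewrite scalerBr !scalerA [c * a]mulrC.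
Qed.

(** The counterpart of the cross relation of the algebra; the last sum comes from the twisted term
    of the Leibniz rule for divided differences. *)
Lemma dunkl_lin y l p : dunkl y (lin l * p) = lin l * dunkl y p + (l *m y) 0 0 *: p -
  c *: \sum_(s | TH G s) ((rowC s *m y) 0 0 * (l *m corC s) 0 0) *: wact s p.
Proof.
rewrite /dunkl pdM pd_lin mul_mpolyC mulrBr -!addrA addrCA; congr (_ + _).
rewrite addrCA; congr (_ + _); rewrite -scalerAr -opprD -scalerDr; congr (- (_ *: _)).
rewrite mulr_sumr -big_split; apply: eq_bigr => s /TH_refl rs /=.
have l0 := rowC_neq0 hal rs; rewrite /Delta.nab mulrC (ddiffM _ l0) (ddiff_lin _ l0) scalerDr.
rewrite -(wact_refl faith hal _ rs) -scalerA; congr (_ + _ *: _); first by rewrite mulrC scalerAr.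
by rewrite mulrC mul_mpolyC.
Qed.

Lemma dunkl_inv y p : inv G p -> dunkl y p = pd y p.
Proof.
move=> ip; rewrite /dunkl big1 ?scaler0 ?subr0 // => s hs; have /andP[rs sG] := hs.
by rewrite /Delta.nab (ddiff_fix (rowC_neq0 hal rs)) ?scaler0 // -(wact_refl faith hal _ rs) ip.
Qed.

Lemma dunklC y a : dunkl y a%:MP = 0.
Proof. by rewrite dunkl_inv ?pdC // => g _; exact: wactC. Qed.

Lemma msize_dunkl y p k : (msize p <= k.+1)%N -> (msize (dunkl y p) <= k)%N.
Proof.
move=> pk; apply: leq_trans (msizeD_le _ _) _; rewrite geq_max msize_pd //= msizeN.
apply: leq_trans (msizeZ_le _ _) _; apply: msize_sum_le => s /TH_refl rs.
by apply: leq_trans (msizeZ_le _ _) _; apply: msize_ddiff => //; exact: (rowC_neq0 hal rs).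
Qed.

Record stable (K : A -> Prop) : Prop := Stable {
  stableD : forall p q, K p -> K q -> K (p + q);
  stableM : forall a p, K p -> K (a * p);
  stableW : forall g p, g \in G -> K p -> K (wact g p);
  stableY : forall y p, K p -> K (dunkl y p) }.

Lemma stable0 K p : stable K -> K p -> K 0.
Proof. by move=> h /(stableM h 0); rewrite mul0r. Qed.
Lemma stableZ K a p : stable K -> K p -> K (a *: p).
Proof. by move=> h /(stableM h a%:MP); rewrite mul_mpolyC. Qed.
Lemma stableB K p q : stable K -> K p -> K q -> K (p - q).
Proof. by move=> h hp hq; apply: (stableD h) => //; rewrite -scaleN1r; exact: stableZ. Qed.
Lemma stable_sum K (I : Type) (r : seq I) (P : pred I) (f : I -> A) q : stable K -> K q ->
  (forall i, P i -> K (f i)) -> K (\sum_(i <- r | P i) f i).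
Proof. by move=> h Kq hf; apply: (big_ind K) => //; [exact: (stable0 h Kq)|exact: (stableD h)]. Qed.
Lemma stable_avg K p : stable K -> K p -> K (avg G p).
Proof. by move=> h Kp; apply: stableZ => //; apply: (big_ind K) => [|a b Ka Kb|g gG]; [exact: (stable0 h Kp)|exact: (stableD h Ka Kb)|exact: (stableW h gG Kp)]. Qed.

Definition eul p : A := \sum_i 'X_i * p^`M(i).
Fact eul_linear : linear eul.
Proof.
move=> a p q; rewrite /eul scaler_sumr -big_split; apply: eq_bigr => i _ /=.
by rewrite linearP mulrDr -scalerAr.
Qed.
HB.instance Definition _ := GRing.isLinear.Build C A A _ eul eul_linear.
Lemma eulX u : eul 'X_[u] = (mdeg u)%:R *: 'X_[u].
Proof. by rewrite /eul (@euler R n (mdeg u)) // dhomogX. Qed.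
Lemma eul_coef p u : (eul p)@_u = (mdeg u)%:R * p@_u.
Proof.
have -> : (eul p)@_u = \sum_(v <- msupp p) (mdeg v)%:R * (p@_v * (v == u)%:R).
  rewrite {1}[p]mpolyE (raddf_sum eul) raddf_sum /=; apply: eq_bigr => v _.
  by rewrite linearZ /= eulX !mcoeffZ mcoeffX mulrCA.
have -> : p@_u = \sum_(v <- msupp p) p@_v * (v == u)%:R.
  by rewrite {1}[p]mpolyE raddf_sum; apply: eq_bigr => v _; rewrite /= mcoeffZ mcoeffX.
rewrite mulr_sumr; apply: eq_bigr => v _; case: eqP => [->|_] //.
by rewrite !mulr0.
Qed.

(** The part of degree [d] is multiplied by [prod_i (1 - d / i)] for [i] from 1 to [k], so once [k]
    reaches the degree only the constant term is left. *)
Fixpoint fseq p k : A := if k is k'.+1 then fseq p k' - k%:R^-1 *: eul (fseq p k') else p.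

Lemma fseq_coef p k u : (fseq p k)@_u = p@_u * \prod_(i < k) (1 - (mdeg u)%:R / i.+1%:R).
Proof.
elim: k => [|k IH]; first by rewrite big_ord0 mulr1.
rewrite big_ord_recr mulrA -IH /= mcoeffB mcoeffZ eul_coef mulrBr mulr1; congr (_ - _).
by rewrite mulrA mulrC [_^-1 * _]mulrC.
Qed.

Lemma fseq_end p : fseq p (msize p) = (p@_0%MM)%:MP.
Proof.
apply/mpolyP => u; rewrite fseq_coef mcoeffC; have [<-|ne] := eqVneq 0%MM u.
  by rewrite mulr1 big1 ?mulr1 // => i _; rewrite mdeg0 mul0r subr0.
rewrite mulr0; have [up|] := boolP (u \in msupp p); last by rewrite mcoeff_msupp negbK => /eqP ->; rewrite mul0r.
have h := msize_mdeg_lt up.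
have u0 : (0 < mdeg u)%N by rewrite lt0n mdeg_eq0 eq_sym.
have hi : ((mdeg u).-1 < msize p)%N by apply: leq_ltn_trans (leq_pred _) h.
rewrite (bigD1 (Ordinal hi)) //= prednK // divff ?subrr ?mul0r ?mulr0 //.
by rewrite pnatr_eq0 -lt0n.
Qed.

Lemma inv_eul p : inv G p -> inv G (eul p).
Proof.
move=> ip g gG; transitivity (eul (wact g p)); last by rewrite ip.
have pE := pihomog_partitionE (leqnn (msize p)).
have e k : wact g (eul (pihomog mdeg k p)) = eul (wact g (pihomog mdeg k p)).
  have h1 : eul (pihomog mdeg k p) = k%:R *: pihomog mdeg k p := euler (pihomogP mdeg k p).
  have h2 : eul (wact g (pihomog mdeg k p)) = k%:R *: wact g (pihomog mdeg k p).
    by apply: euler; apply: wact_homog; exact: pihomogP.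
  by rewrite h1 h2 linearZ.
transitivity (\sum_(k < msize p) wact g (eul (pihomog mdeg k p))).
  by rewrite {1}pE (raddf_sum eul) /= (raddf_sum (wact g)).
transitivity (eul (wact g (\sum_(k < msize p) pihomog mdeg k p))); last by rewrite -pE.
by rewrite (raddf_sum (wact g)) /= (raddf_sum eul) /=; apply: eq_bigr => k _; exact: e.
Qed.

Lemma eul_dunkl p : inv G p -> eul p = \sum_i 'X_i * dunkl (delta_mx i 0) p.
Proof.
move=> ip; apply: eq_bigr => i _; rewrite dunkl_inv //; congr (_ * _).
rewrite /pd (bigD1 i) //= mxE !eqxx scale1r big1 ?addr0 // => j ji.
by rewrite mxE (negbTE ji) scale0r.
Qed.

Lemma inv_fseq p k : inv G p -> inv G (fseq p k).
Proof.
move=> ip; elim: k => //= k IH g gG; rewrite (raddfB (wact g)) /= linearZ /= inv_eul // IH //.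
Qed.

Lemma stable_fseq K p k : stable K -> K p -> inv G p -> K (fseq p k).
Proof.
move=> h Kp ip; elim: k => //= k IH; apply: stableB => //; apply: stableZ => //.
rewrite eul_dunkl; last exact: inv_fseq.
apply: (big_ind K) => [|a b Ka Kb|i _]; [exact: (stable0 h IH)|exact: (stableD h Ka Kb)|].
by apply: (stableM h); exact: (stableY h).
Qed.

Lemma avg_coef0 p : (avg G p)@_0%MM = p@_0%MM.
Proof.
rewrite /Delta.avg mcoeffZ raddf_sum /= (eq_bigr (fun=> p@_0%MM)) => [|g _]; last exact: wact_coef0.
by rewrite sumr_const -[p@_0%MM *+ _]mulr_natr mulrCA mulVf ?mulr1 // cardC_neq0.
Qed.

(** After averaging to an invariant, Dunkl operators act as derivatives and the Euler operator is
    [sum_i x_i D_i], which preserves [K]; so [fseq] isolates the constant term inside [K]. *)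
Lemma stable_const K p : stable K -> ~ K 1 -> K p -> p@_0%MM = 0.
Proof.
move=> h K1 Kp; apply/eqP/negPn/negP => c0; apply: K1.
have := stable_fseq (msize (avg G p)) h (stable_avg h Kp) (avg_inv rho p).
rewrite fseq_end avg_coef0 => /(stableZ (p@_0%MM)^-1 h).
by rewrite -mul_mpolyC -mpolyCM mulVf // mpolyC1.
Qed.

Section Functional.
Variable L : A -> C.
Hypotheses (LD : forall p q, L (p + q) = L p + L q) (LZ : forall a p, L (a *: p) = a * L p).
Hypothesis LW : forall g p, g \in G -> L (wact g p) = L p.
Variable ly : 'rV[C]_n -> 'cV[C]_n.
Hypothesis Lly : forall l p, L (lin l * p) = L (dunkl (ly l) p).

Let L0 : L 0 = 0. Proof. by have := LZ 0 0; rewrite scale0r mul0r. Qed.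
Let LB p q : L (p - q) = L p - L q.
Proof. by rewrite LD -scaleN1r LZ mulN1r. Qed.
Let LS (I : Type) (r : seq I) (P : pred I) (f : I -> A) : L (\sum_(i <- r | P i) f i) = \sum_(i <- r | P i) L (f i).
Proof. by elim/big_rec2: _ => // i x y _ <-; rewrite LD. Qed.

(** Induction on the size. For an invariant, [L] turns [x_i D_i] into a product of two Dunkl
    operators, whose value lies in [K] and is smaller. Hence [fseq] does not change [L], and its
    last value is the constant term, which is zero in [K]. *)
Lemma functional_stable K p : stable K -> ~ K 1 -> K p -> L p = 0.
Proof.
move=> h K1; move: {2}(msize p) (leqnn (msize p)) => k.
elim: k p => [|k IH] p pk Kp; first by move: pk; rewrite leqn0 msize_poly_eq0 => /eqP ->.
have La : L p = L (avg G p).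
  rewrite /Delta.avg LZ LS (eq_bigr (fun=> L p)) => [|g gG]; last exact: LW.
  by rewrite sumr_const -[L p *+ _]mulr_natr mulrCA mulVf ?mulr1 // cardC_neq0.
rewrite La; set f := avg G p.
have Kf : K f := stable_avg h Kp; have invf : inv G f := avg_inv rho p.
have fk : (msize f <= k.+1)%N.
  apply: leq_trans (msizeZ_le _ _) _; apply: msize_sum_le => g _.
  by rewrite wactE; exact: msize_act.
have sz j : (msize (fseq f j) <= k.+1)%N.
  elim: j => //= j IHj; apply: leq_trans (msizeD_le _ _) _; rewrite geq_max IHj msizeN.
  apply: leq_trans (msizeZ_le _ _) _; rewrite msizeE; apply/bigmax_leqP_seq => u up _.
  have : u \in msupp (fseq f j).
    by move: up; rewrite !mcoeff_msupp eul_coef; apply: contra_neq => ->; rewrite mulr0.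
  by move/msize_mdeg_lt => h1; apply: leq_trans h1 IHj.
have step j : L (fseq f j) = L f.
  elim: j => //= j <-; rewrite LB LZ [X in _ * X](_ : _ = 0) ?mulr0 ?subr0 //.
  rewrite eul_dunkl; last exact: inv_fseq.
  rewrite LS big1 // => i _; rewrite -lin_delta Lly; apply: IH.
    by do 2! apply: msize_dunkl; apply: leq_trans (sz j) _.
  by do 2! apply: (stableY h); exact: stable_fseq.
by rewrite -(step (msize f)) fseq_end (stable_const h K1 Kf) mpolyC0 L0.
Qed.

Definition rad p := forall q, L (p * q) = 0.

Lemma nab_sym s q : refl s -> wact s (nab s q) = nab s q.
Proof.
move=> rs; have ss : wact s (wact s q) = q by rewrite -wactM (reflK faith rs) wact1.
have sa : wact s (alC s) = - alC s.
  by rewrite /Delta.alC wact_lin -map_mxM (reflV faith rs) (al_self hal rs) map_mxN linearN.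
apply: (mulfI (alC_neq0 hal rs)); rewrite -(nabP faith hal _ rs).
have := congr1 (wact s) (nabP faith hal q rs); rewrite (raddfB (wact s)) /= ss (rmorphM (wact s)) /= sa mulNr => e.
by rewrite -[RHS]opprB e opprK.
Qed.

(** A Leibniz rule under [L]: the twist in the product rule disappears because [nab s q] is fixed by
    [s] and [L] is invariant. *)
Lemma rad_dunkl_step l p q : L (dunkl (ly l) p * q) + L (p * dunkl (ly l) q) = L (lin l * (p * q)).
Proof.
rewrite Lly /dunkl pdM; set y := ly l.
have E : L (\sum_(s | TH G s) (rowC s *m y) 0 0 *: nab s (p * q)) =
    L ((\sum_(s | TH G s) (rowC s *m y) 0 0 *: nab s p) * q) + L (p * \sum_(s | TH G s) (rowC s *m y) 0 0 *: nab s q).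
  rewrite mulr_suml mulr_sumr !LS -big_split; apply: eq_bigr => s hs /=; have /andP[rs sG] := hs.
  have l0 := rowC_neq0 hal rs; rewrite /Delta.nab (ddiffM _ l0) -!/(Delta.nab _ _ _ _) -(wact_refl faith hal _ rs).
  rewrite -scalerAl -scalerAr !LZ LD mulrDr; congr (_ + _ * _).
  by rewrite -{1}(nab_sym q rs) -(rmorphM (wact s)) LW.
rewrite mulrBl mulrBr -scalerAl -scalerAr !LB !LZ LD E; ring.
Qed.

Lemma rad_stable : (forall y, exists l, ly l = y) -> stable rad.
Proof.
move=> lys; split.
- by move=> p q hp hq r; rewrite mulrDl LD hp hq addr0.
- by move=> a p hp q; rewrite mulrAC mulrC; exact: hp.
- by move=> g p gG hp q; rewrite -[q](wactVK rho g) -(rmorphM (wact g)) LW.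
move=> y p hp q; have [l <-] := lys y; have := rad_dunkl_step l p q.
by rewrite hp addr0 mulrCA hp.
Qed.

End Functional.

(** Trading a variable for a Dunkl operator lowers the degree, so the values are determined
    recursively by the one at 1. The cross-multiplied form makes no assumption that this value is
    nonzero. *)
Lemma functional_unique (L1 L2 : A -> C) (ly : 'rV[C]_n -> 'cV[C]_n) :
  (forall p q, L1 (p + q) = L1 p + L1 q) -> (forall a p, L1 (a *: p) = a * L1 p) ->
  (forall p q, L2 (p + q) = L2 p + L2 q) -> (forall a p, L2 (a *: p) = a * L2 p) ->
  (forall l p, L1 (lin l * p) = L1 (dunkl (ly l) p)) -> (forall l p, L2 (lin l * p) = L2 (dunkl (ly l) p)) ->
  forall p, L1 1 * L2 p = L2 1 * L1 p.
Proof.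
move=> D1 Z1 D2 Z2 h1 h2 p; move: {2}(msize p) (leqnn (msize p)) => k.
elim: k p => [|k IH] p pk.
  move: pk; rewrite leqn0 msize_poly_eq0 => /eqP ->; rewrite -(scale0r 0) Z1 Z2; ring.
have S (L : A -> C) : (forall p q, L (p + q) = L p + L q) -> (forall a p, L (a *: p) = a * L p) ->
    L p = \sum_(u <- msupp p) p@_u * L 'X_[u].
  move=> D Z; rewrite {1}[p]mpolyE.
  elim/big_rec2: _ => [|u x y _ <-]; first by rewrite -(scale0r 0) Z mul0r.
  by rewrite D Z.
rewrite (S L1 D1 Z1) (S L2 D2 Z2) !mulr_sumr !big_seq; apply: eq_bigr => u up.
rewrite mulrCA [RHS]mulrCA; congr (_ * _).
have [->|u0] := eqVneq u 0%MM; first by rewrite mpolyX0 mulrC.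
have [i ui] : exists i, u i != 0%N.
  apply/existsP; apply: contraNT u0; rewrite negb_exists => /forallP hm; apply/eqP/mnmP => i.
  by rewrite mnm0E; have := hm i; rewrite negbK => /eqP.
have -> : 'X_[u] = lin (delta_mx 0 i) * 'X_[u - U_(i)] :> A.
  by rewrite lin_delta -mpolyXD addmC submK // lep1mP.
rewrite h1 h2; apply: IH; apply: msize_dunkl; rewrite msizeX.
have := leq_trans (msize_mdeg_lt up) pk.
have e : mdeg u = (mdeg (u - U_(i))%MM).+1.
  by rewrite -{1}(@submK _ U_(i) u) ?lep1mP // mdegD mdeg1 addn1.
by rewrite e => /ltnW.
Qed.

End Def.
End Dunkl.
End Dunkl.

(** * From the rational Cherednik algebra to polynomials modulo an ideal *)

Module PartM.
From HB Require Import structures.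
From mathcomp Require Import boolp reals complex mpoly.
From mathcomp Require Import ring.
Set Implicit Arguments.
Unset Strict Implicit.
Unset Printing Implicit Defensive.
Import Order.TTheory GRing.Theory Num.Theory ComplexField.
Local Open Scope ring_scope.
From mathcomp Require Import lra zify.
Require Import Defs.
From mathcomp Require monalg.
From mathcomp Require finmap.
Import PolyAct Root Cox Cox2 Cox3 Delta Hilb Chev1 Chev2 Dunkl.
Lemma rel_comm (S T : pzRingType) (f : {rmorphism S -> T}) a b :
  f (a * b - b * a) = 0 -> f a * f b = f b * f a.
Proof. by rewrite rmorphB !rmorphM => /eqP; rewrite subr_eq0 => /eqP. Qed.

Lemma rel_cross (S T : pzRingType) (f : {rmorphism S -> T}) (I : finType) (Q : pred I) y x p k (F G : I -> S) :
  f (y * x - x * y - (p - k * \sum_(s | Q s) F s * G s)) = 0 ->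
  f y * f x = f x * f y + f p - f k * \sum_(s | Q s) f (F s) * f (G s).
Proof.
rewrite !(rmorphB, rmorphM) rmorph_sum => /eqP; rewrite subr_eq0 subr_eq => /eqP ->.
rewrite addrC addrA; congr (_ - _ * _); apply: eq_bigr => s _; exact: rmorphM.
Qed.

Lemma cross_eq (Q : pzRingType) (a b d k : Q) (I : finType) (P : pred I) (F F' G : I -> Q) :
  a = b + d - k * \sum_(s | P s) F s * G s -> (forall s, P s -> F s = F' s) ->
  a = b + d - k * \sum_(s | P s) F' s * G s.
Proof. by move=> -> e; congr (_ - _ * _); apply: eq_bigr => s /e ->. Qed.

Lemma prod_mnmS (Q : pzRingType) n (f : 'I_n -> Q) i (m : 'X_{1..n}) :
  (forall i j, f i * f j = f j * f i) ->
  \prod_(j < n) f j ^+ (U_(i) + m)%MM j = f i * \prod_(j < n) f j ^+ m j.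
Proof.
move=> fC; have : i \in index_enum 'I_n by exact: mem_index_enum.
elim: (index_enum _) (index_enum_uniq 'I_n) => //= j r IH /andP[jr ur].
rewrite inE !big_cons mnmDE mnm1E; have [ij _|ij /= ir] := eqVneq i j.
  rewrite -ij exprD expr1 -mulrA; congr (_ * (_ * _)); apply: eq_big_seq => k kr.
  rewrite mnmDE mnm1E; case: eqP => // e; by move: jr; rewrite -ij e kr.
rewrite add0n IH // !mulrA; congr (_ * _).
by apply: commr_sym; apply: commrX; exact: fC.
Qed.

Lemma irr_prop (B : pzRingType) (M : lmodType B) (Q : M -> Prop) : irreducible_module M ->
  Q 0 -> (forall a x y, Q x -> Q y -> Q (a *: x + y)) -> (forall w, Q w -> w = 0) \/ (forall w, Q w).
Proof.
move=> [_ h] q0 ql; case: (h (fun w => `[< Q w >])) => [|h1|h1].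
- split; first exact/asboolP.
  by move=> a x y /asboolP qx /asboolP qy; apply/asboolP; exact: ql.
- by left=> w qw; apply: h1; exact/asboolP.
by right=> w; apply/asboolP; exact: h1.
Qed.

Lemma comm_step (Q : pzRingType) (a b u : Q) : a * b = b * a -> a * u = u * a -> a * (b * u) = b * u * a.
Proof. by move=> e f; rewrite mulrA e -mulrA f mulrA. Qed.
Lemma half_sum (Q : numFieldType) (V : lmodType Q) (a : V) : 2^-1 *: (a + a) = a.
Proof.
rewrite -[a + a]/(a *+ 2) -[a *+ 2]scaler_nat scalerA mulVf ?scale1r //.
by rewrite pnatr_eq0.
Qed.
Lemma half_eq (Q : zmodType) (a b : Q) : a - b = - a -> b = a + a.
Proof. by move/eqP; rewrite subr_eq addrC -subr_eq opprK => /eqP ->. Qed.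
Lemma ring_rel (R : pzRingType) (E : R -> Prop) e : E e -> ring_proj E e = 0.
Proof.
move=> he; rewrite -(raddf0 (ring_proj E)); apply/zmod_projP; rewrite subr0; apply: zspan_gen.
by exists 1, e, 1; rewrite mul1r mulr1.
Qed.

Section Free.
Variables (K : comNzRingType) (I : choiceType).
Notation Fr := (FreeAlg.alg K I).
Import monalg.
Lemma malg_scaleU (a : K) (k : {fmonom I}) : a *: << k >> = << a *g k >> :> {malg K[{fmonom I}]}.
Proof. by apply/malgP => j; rewrite mcoeffZ !mcoeffU mulr_natr. Qed.

Lemma malg_consU (x : I) (s : seq I) : mmul (fmu x) (FMonom s) = FMonom (x :: s).
Proof. rewrite fmuE; exact: fmmulE. Qed.

Lemma free_scale (a : K) (u : Fr) : a *: u = FreeAlg.const I a * u.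
Proof. by rewrite FreeAlg.const.unlock; exact: esym (mul_malgC a u). Qed.

Lemma free_ind (Q : Fr -> Prop) : Q 0 -> (forall u w, Q u -> Q w -> Q (u + w)) ->
  (forall a u, Q u -> Q (FreeAlg.const I a * u)) -> (forall x u, Q u -> Q (FreeAlg.gen K x * u)) ->
  Q 1 -> forall u, Q u.
Proof.
move=> Q0 QD QC QG Q1 u; rewrite (monalgE u); apply: (big_ind Q) => // k _.
have -> : << monalg.mcoeff k u *g k >> = FreeAlg.const I (monalg.mcoeff k u) * << k >> :> Fr.
  by rewrite -free_scale; exact: (esym (malg_scaleU _ _)).
apply: QC; case: k => s; elim: s => [|x s IH].
  suff -> : << FMonom [::] >> = 1 :> Fr by [].
  by rewrite -fmoneE.
suff -> : << FMonom (x :: s) >> = FreeAlg.gen K x * << FMonom s >> :> Fr by exact: QG.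
rewrite FreeAlg.gen.unlock malgME !msuppU1 !finmap.big_seq_fset1 !mcoeffU1 !eqxx mulr1.
by rewrite malg_consU.
Qed.

Lemma free_const_comm (a : K) (u : Fr) : FreeAlg.const I a * u = u * FreeAlg.const I a.
Proof.
move: u; apply: free_ind => [|u w hu hw|b u hu|x u hu|].
- by rewrite mulr0 mul0r.
- by rewrite mulrDr mulrDl hu hw.
- have e : FreeAlg.const I a * FreeAlg.const I b = FreeAlg.const I b * FreeAlg.const I a :> Fr.
    transitivity (FreeAlg.const I (a * b)); first exact: (esym (rmorphM (FreeAlg.scalar K I) a b)).
    rewrite mulrC; exact: (rmorphM (FreeAlg.scalar K I) b a).
  exact: (comm_step e hu).
- have e : FreeAlg.const I a * FreeAlg.gen K x = FreeAlg.gen K x * FreeAlg.const I a :> Fr.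
    rewrite -free_scale FreeAlg.gen.unlock FreeAlg.const.unlock.
    have [->|a0] := eqVneq a 0; first by rewrite scale0r monalgU0 mulr0.
    rewrite malgME msuppU1 msuppU (negbTE a0) !finmap.big_seq_fset1 !mcoeffU !eqxx mulr1n mul1r mulm1.
    exact: malg_scaleU.
  exact: (comm_step e hu).
by rewrite mulr1 mul1r.
Qed.
End Free.
Section PartM.
Variables (R : realType) (gT : finGroupType) (n : nat).
Variable rho : mx_representation R [set: gT] n.
Hypothesis faith : mx_faithful rho.
Variables (al : gT -> 'rV[R]_n) (v0 : 'cV[R]_n).
Local Notation refl := (is_reflection rho).
Local Notation sp := (sp rho).
Local Notation coroot := (coroot rho).
Hypothesis hal : forall s, refl s ->
  [/\ rho s = 1%:M - coroot (al s) *m al s, sp (al s) (al s) = 2 & 0 < (al s *m v0) 0 0].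
Local Notation C := R[i].
Local Notation A := {mpoly C[n]}.
Implicit Types p q : A.
Local Notation wact := (wact rho).
Local Notation avg := (avg rho).
Local Notation inv := (inv rho).
Local Notation TH := (TH rho).
Local Notation nab := (nab rho al).
Local Notation rowC := (rowC al).
Local Notation corC := (corC rho al).
Variables (alpha : gT -> 'rV[C]_n) (alphav : gT -> 'cV[C]_n) (c : C).
Hypothesis halpha : root_vectors rho alpha alphav.
Notation Hc := (cherednik rho c alpha alphav).
Notation Fr := (FreeAlg.alg C (cgen R gT n)).
Notation dunkl := (dunkl rho al [set: gT]%G c).
Notation stable := (stable rho al [set: gT]%G c).

Lemma rhoC_refl s : refl s -> rhoC rho s = 1%:M - corC s *m rowC s :> 'M[C]_n.
Proof.
move=> hs; have -> : rhoC rho s = map_mx (real_complex R) (rho s) by [].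
case: (hal hs) => -> _ _.
by rewrite (map_mxB (real_complex R)) (map_mx1 (real_complex R)) (map_mxM (real_complex R)).
Qed.

(** The given root vectors are multiples [k] and [k'] of the normalised ones, and the pairing 2
    forces [k k' = 1]. The product in the cross relation is thus the same for both choices. *)
Lemma pair_rel s x y : refl s -> pairing y (alpha s) * pairing (alphav s) x =
  (rowC s *m y) 0 0 * (x *m corC s) 0 0.
Proof.
move=> hs; have [h1 h2 h3] := halpha hs.
have n2 : (2 : C) != 0 by rewrite pnatr_eq0.
have e1 : alpha s = (2^-1 * (alpha s *m corC s) 0 0) *: rowC s.
  have e : (alpha s *m corC s) 0 0 *: rowC s = alpha s + alpha s.
    apply: half_eq; rewrite -h1 /act_hs (reflV faith hs) rhoC_refl // mulmxBr mulmx1 mulmxA.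
    by rewrite -mul_scalar_mx -mx11_scalar.
  by rewrite -scalerA e half_sum.
have e2 : alphav s = (2^-1 * (rowC s *m alphav s) 0 0) *: corC s.
  have e : (rowC s *m alphav s) 0 0 *: corC s = alphav s + alphav s.
    apply: half_eq; rewrite -h2 /act_h rhoC_refl // mulmxBl mul1mx -mulmxA.
    by rewrite -mul_mx_scalar -mx11_scalar.
  by rewrite -scalerA e half_sum.
move: h3 e1 e2; set k := 2^-1 * _; set k' := 2^-1 * _ => h3 e1 e2.
have kk : k * k' = 1.
  move: h3; rewrite /pairing e1 e2 -scalemxAl -scalemxAr scalerA mxE rowC_corC //.
  by case: (hal hs) => _ -> _; rewrite rmorph_nat -[RHS]mul1r => /(mulIf n2).
rewrite /pairing e1 e2 -scalemxAl -scalemxAr !mxE.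
by rewrite mulrACA kk mul1r.
Qed.

Definition P (u : Fr) : Hc := cherednik_proj rho c alpha alphav (sproj rho u).
Lemma PD u w : P (u + w) = P u + P w. Proof. by rewrite /P !rmorphD. Qed.
Lemma PB u w : P (u - w) = P u - P w. Proof. by rewrite /P !rmorphB. Qed.
Lemma PM u w : P (u * w) = P u * P w. Proof. by rewrite /P !rmorphM. Qed.
Lemma P0 : P 0 = 0. Proof. by rewrite /P !rmorph0. Qed.
Lemma P1 : P 1 = 1. Proof. by rewrite /P !rmorph1. Qed.
Lemma P_surj a : exists u, P u = a.
Proof.
elim/zmod_projW: a => a; elim/zmod_projW: a => u; exists u; by [].
Qed.
Lemma P_eq u w : smash_rel rho (u - w) -> P u = P w.
Proof.
move=> h; apply/eqP; rewrite -subr_eq0 -PB /P.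
have -> : sproj rho (u - w) = 0 by exact: ring_rel.
by rewrite rmorph0.
Qed.

Definition iota (a : C) : Hc := P (FreeAlg.const (cgen R gT n) a).
Definition PW g : Hc := P (fw R n g).
Definition PX (x : 'rV[C]_n) : Hc := P (fx gT x).
Definition PY (y : 'cV[C]_n) : Hc := P (fy gT y).

Lemma iota_comm a h : iota a * h = h * iota a.
Proof. by have [u <-] := P_surj h; rewrite /iota -!PM free_const_comm. Qed.
Lemma iotaD a b : iota (a + b) = iota a + iota b.
Proof. by rewrite /iota -PD; congr (P _); exact: (rmorphD (FreeAlg.scalar C (cgen R gT n)) a b). Qed.
Lemma iotaM a b : iota (a * b) = iota a * iota b.
Proof. by rewrite /iota -PM; congr (P _); exact: (rmorphM (FreeAlg.scalar C (cgen R gT n)) a b). Qed.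
Lemma iota0 : iota 0 = 0. Proof. by rewrite -P0; congr (P _); exact: (rmorph0 (FreeAlg.scalar C (cgen R gT n))). Qed.
Lemma iota1 : iota 1 = 1. Proof. by rewrite -P1; congr (P _); exact: (rmorph1 (FreeAlg.scalar C (cgen R gT n))). Qed.
Lemma PWM g h : PW g * PW h = PW (g * h)%g.
Proof. by rewrite /PW -PM; apply: P_eq; exact: rel_wM. Qed.
Lemma PXlin a x x' : PX (a *: x + x') = iota a * PX x + PX x'.
Proof. by rewrite /PX /iota -PM -PD -free_scale; apply: P_eq; exact: rel_xlin. Qed.
Lemma PYlin a y y' : PY (a *: y + y') = iota a * PY y + PY y'.
Proof. by rewrite /PY /iota -PM -PD -free_scale; apply: P_eq; exact: rel_ylin. Qed.
Lemma PWX g x : PW g * PX x = PX (act_hs rho g x) * PW g.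
Proof. by rewrite /PW /PX -!PM; apply: P_eq; exact: rel_wx. Qed.
Lemma PXX x x' : PX x * PX x' = PX x' * PX x.
Proof. exact: (rel_comm (f := cherednik_proj rho c alpha alphav) (ring_rel (rel_xx rho c alpha alphav x x'))). Qed.
Lemma PYX0 y x : PY y * PX x = PX x * PY y + iota (pairing y x)
   - iota c * \sum_(s | refl s) iota (pairing y (alpha s) * pairing (alphav s) x) * PW s.
Proof. exact: (rel_cross (f := cherednik_proj rho c alpha alphav) (ring_rel (rel_yx rho c alpha alphav y x))). Qed.
Lemma PYX y x : PY y * PX x = PX x * PY y + iota (pairing y x)
   - iota c * \sum_(s | refl s) iota ((rowC s *m y) 0 0 * (x *m corC s) 0 0) * PW s.
Proof.
exact: (cross_eq (PYX0 y x) (fun s hs => congr1 iota (pair_rel x y hs))).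
Qed.
Lemma gen_ind (Q : Hc -> Prop) : Q 0 -> (forall u w, Q u -> Q w -> Q (u + w)) ->
  (forall a u, Q u -> Q (iota a * u)) -> (forall g u, Q u -> Q (PW g * u)) ->
  (forall l u, Q u -> Q (PX l * u)) -> (forall y u, Q u -> Q (PY y * u)) -> Q 1 -> forall u, Q u.
Proof.
move=> Q0 QD QC QW QX QY Q1 u; have [w <-] := P_surj u; move: w; apply: free_ind.
- by rewrite P0.
- by move=> u1 u2 h1 h2; rewrite PD; exact: QD.
- by move=> a u1 h1; rewrite PM; exact: QC.
- move=> x u1 h1; rewrite PM; case: x => [g|[l|y]]; [exact: QW|exact: QX|exact: QY].
by rewrite P1.
Qed.
End PartM.

(** * Modules generated by an invariant vector killed by [h], over an algebra with these
    relations *)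

Section PolyMod.
Variables (R : realType) (gT : finGroupType) (n : nat).
Variable rho : mx_representation R [set: gT] n.
Hypothesis faith : mx_faithful rho.
Variables (al : gT -> 'rV[R]_n) (v0 : 'cV[R]_n).
Local Notation refl := (is_reflection rho).
Local Notation sp := (sp rho).
Local Notation coroot := (coroot rho).
Hypothesis hal : forall s, refl s ->
  [/\ rho s = 1%:M - coroot (al s) *m al s, sp (al s) (al s) = 2 & 0 < (al s *m v0) 0 0].
Local Notation C := R[i].
Local Notation A := {mpoly C[n]}.
Implicit Types p q : A.
Local Notation wact := (wact rho).
Local Notation rowC := (rowC al).
Local Notation corC := (corC rho al).
Variables (c : C) (Hc : pzRingType) (iota : C -> Hc) (PW : gT -> Hc) (PX : 'rV[C]_n -> Hc) (PY : 'cV[C]_n -> Hc).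
Notation dunkl := (dunkl rho al [set: gT]%G c).
Notation stable := (stable rho al [set: gT]%G c).
Hypothesis iota_comm : forall a h, iota a * h = h * iota a.
Hypothesis iotaD : forall a b, iota (a + b) = iota a + iota b.
Hypothesis iotaM : forall a b, iota (a * b) = iota a * iota b.
Hypotheses (iota0 : iota 0 = 0) (iota1 : iota 1 = 1).
Hypothesis PXlin : forall a x x', PX (a *: x + x') = iota a * PX x + PX x'.
Hypothesis PWX : forall g x, PW g * PX x = PX (act_hs rho g x) * PW g.
Hypothesis PXX : forall x x', PX x * PX x' = PX x' * PX x.
Hypothesis PYX : forall y x, PY y * PX x = PX x * PY y + iota (pairing y x)
   - iota c * \sum_(s | refl s) iota ((rowC s *m y) 0 0 * (x *m corC s) 0 0) * PW s.
Hypothesis gen_ind : forall (Q : Hc -> Prop), Q 0 -> (forall u w, Q u -> Q w -> Q (u + w)) ->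
  (forall a u, Q u -> Q (iota a * u)) -> (forall g u, Q u -> Q (PW g * u)) ->
  (forall l u, Q u -> Q (PX l * u)) -> (forall y u, Q u -> Q (PY y * u)) -> Q 1 -> forall u, Q u.
Lemma iotaN a : iota (- a) = - iota a.
Proof. by apply/eqP; rewrite -addr_eq0 -iotaD addNr iota0. Qed.
Lemma PX0 : PX 0 = 0.
Proof. by have := PXlin (-1) 0 0; rewrite scaler0 addr0 iotaN iota1 mulN1r addNr. Qed.

Definition fi i : Hc := PX (delta_mx 0 i).
Definition mon (m : 'X_{1..n}) : Hc := \prod_(i < n) fi i ^+ m i.

Lemma monS i m : mon (U_(i) + m)%MM = fi i * mon m.
Proof.
by apply: prod_mnmS => j k; exact: PXX.
Qed.

Definition Phi (p : A) : Hc := \sum_(m <- msupp p) iota p@_m * mon m.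

Lemma PhiE (d : seq 'X_{1..n}) p : uniq d -> {subset msupp p <= d} -> Phi p = \sum_(m <- d) iota p@_m * mon m.
Proof.
move=> ud sd; rewrite [RHS](bigID (mem (msupp p))) /= [X in _ + X]big1 ?addr0; last first.
  by move=> m; rewrite mcoeff_msupp negbK => /eqP ->; rewrite iota0 mul0r.
rewrite -big_filter; apply: perm_big; apply: uniq_perm; rewrite ?msupp_uniq ?filter_uniq // => m.
by rewrite mem_filter; case mp: (m \in msupp p) => //=; rewrite sd.
Qed.

Lemma PhiD p q : Phi (p + q) = Phi p + Phi q.
Proof.
set d := undup (msupp p ++ msupp q ++ msupp (p + q)).
have ud : uniq d := undup_uniq _.
rewrite !(PhiE ud); try by move=> m h; rewrite mem_undup !mem_cat h ?orbT.
by rewrite -big_split; apply: eq_bigr => m _; rewrite mcoeffD iotaD mulrDl.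
Qed.

Lemma PhiX a m : Phi (a *: 'X_[m]) = iota a * mon m.
Proof.
rewrite (PhiE (d := [:: m])) ?big_seq1 ?mcoeffZ ?mcoeffX ?eqxx ?mulr1 // => u.
rewrite !inE mcoeff_msupp mcoeffZ mcoeffX [u == m]eq_sym; case: (m == u) => //.
by rewrite mulr0 eqxx.
Qed.

Lemma Phi0 : Phi 0 = 0.
Proof. by rewrite /Phi msupp0 big_nil. Qed.

Lemma mon0 : mon 0%MM = 1.
Proof. by rewrite /mon big1 // => i _; rewrite mnm0E expr0. Qed.

Lemma PhiC a : Phi a%:MP = iota a.
Proof. by rewrite -[a%:MP]mulr1 mul_mpolyC -mpolyX0 PhiX mon0 mulr1. Qed.

Lemma PhiXM i p : Phi ('X_i * p) = fi i * Phi p.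
Proof.
elim/mpolyind: p => [|a m p _ _ IH]; first by rewrite mulr0 Phi0 mulr0.
rewrite mulrDr !PhiD IH mulrDr; congr (_ + _).
by rewrite -scalerAr -mpolyXD !PhiX monS mulrA iota_comm mulrA.
Qed.

Lemma PhiZ a p : Phi (a *: p) = iota a * Phi p.
Proof.
elim/mpolyind: p => [|b m p _ _ IH]; first by rewrite scaler0 Phi0 mulr0.
by rewrite scalerDr !PhiD IH mulrDr scalerA !PhiX iotaM mulrA.
Qed.

Lemma PhiS (I : Type) (r : seq I) (Q : pred I) (f : I -> A) : Phi (\sum_(i <- r | Q i) f i) = \sum_(i <- r | Q i) Phi (f i).
Proof. by elim/big_rec2: _ => [|i x y _ <-]; rewrite ?Phi0 ?PhiD. Qed.

Lemma PXsum l : PX l = \sum_j iota (l 0 j) * fi j.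
Proof.
rewrite {1}(row_sum_delta l).
elim/big_rec2: _ => [|j x y _ <-]; first exact: PX0.
exact: PXlin.
Qed.

Lemma Phi_lin l p : Phi (lin l * p) = PX l * Phi p.
Proof.
rewrite PXsum /lin !mulr_suml PhiS; apply: eq_bigr => j _.
by rewrite -scalerAl PhiZ PhiXM mulrA.
Qed.

Lemma Phi_wact g p : PW g * Phi p = Phi (wact g p) * PW g.
Proof.
move: p; apply: mpoly_lin_ind => [a|p q hp hq|i p hp].
- by rewrite wactC !PhiC iota_comm.
- by rewrite (raddfD (wact g)) /= !PhiD mulrDr mulrDl hp hq.
rewrite (rmorphM (wact g)) /= -lin_delta wact_lin !Phi_lin mulrA PWX -mulrA hp mulrA.
by [].
Qed.

Variable L : lmodType Hc.
Variable v : L.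
Hypothesis vW : forall g, PW g *: v = v.
Hypothesis vY : forall y, PY y *: v = 0.
Definition ev p : L := Phi p *: v.

Lemma evD p q : ev (p + q) = ev p + ev q. Proof. by rewrite /ev PhiD scalerDl. Qed.
Lemma evZ a p : ev (a *: p) = iota a *: ev p. Proof. by rewrite /ev PhiZ scalerA. Qed.
Lemma ev_lin l p : ev (lin l * p) = PX l *: ev p. Proof. by rewrite /ev Phi_lin scalerA. Qed.
Lemma ev_wact g p : ev (wact g p) = PW g *: ev p.
Proof. by rewrite /ev scalerA Phi_wact -scalerA vW. Qed.
Lemma evB p q : ev (p - q) = ev p - ev q.
Proof. by rewrite -[- q]scaleN1r evD evZ iotaN iota1 scaleN1r. Qed.
Lemma evS (I : Type) (r : seq I) (Q : pred I) (f : I -> A) : ev (\sum_(i <- r | Q i) f i) = \sum_(i <- r | Q i) ev (f i).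
Proof. by rewrite /ev PhiS scaler_suml. Qed.

Lemma dunkl_add y p q : dunkl y (p + q) = dunkl y p + dunkl y q.
Proof.
have : dunkl y (1 *: p + q) = 1 *: dunkl y p + dunkl y q.
  by first [exact: (dunkl_linear faith hal [set: gT]%G c y 1 p q) | exact: (dunkl_linear hal [set: gT]%G c y 1 p q) | exact: (dunkl_linear faith [set: gT]%G c y 1 p q) | exact: dunkl_linear].
by rewrite !scale1r.
Qed.

(** Commuting [y] past the variables one at a time reproduces the recursion of the Dunkl operator,
    since [y] kills [v] and the group fixes it. *)
Lemma ev_dunkl y p : ev (dunkl y p) = PY y *: ev p.
Proof.
move: p; apply: mpoly_lin_ind => [a|p q hp hq|i p hp].
- by rewrite (dunklC faith hal) /ev Phi0 scale0r PhiC scalerA -iota_comm -scalerA vY scaler0.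
- rewrite dunkl_add; transitivity (ev (dunkl y p) + ev (dunkl y q)); first exact: evD.
  transitivity (PY y *: ev p + PY y *: ev q); first exact: (congr2 +%R hp hq).
  transitivity (PY y *: (ev p + ev q)); first exact: (esym (scalerDr _ _ _)).
  congr (_ *: _); exact: (esym (evD p q)).
rewrite -lin_delta (dunkl_lin faith hal) evB evD !evZ evS [ev (lin _ * p)]ev_lin [in RHS]scalerA PYX [RHS]scalerBl [X in _ = X - _]scalerDl ev_lin hp -!scalerA.
congr (_ + _ - _ *: _); rewrite scaler_suml; apply: eq_big => [s|s _].
  by rewrite /Cox.TH inE andbT.
by rewrite evZ ev_wact scalerA.
Qed.

Definition J p := ev p = 0.
Lemma J_stable : stable J.
Proof.
split.
- by move=> p q hp hq; rewrite /J evD hp hq addr0.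
- move=> a p hp; move: a; apply: mpoly_lin_ind => [b|a b ha hb|i a ha].
  + by rewrite mul_mpolyC /J evZ hp scaler0.
  + by rewrite mulrDl /J evD ha hb addr0.
  + by rewrite -mulrA -lin_delta /J ev_lin ha scaler0.
- by move=> g p _ hp; rewrite /J ev_wact hp scaler0.
by move=> y p hp; rewrite /J ev_dunkl hp scaler0.
Qed.

Hypothesis irrL : irreducible_module L.
Hypothesis v0' : v <> 0.

Lemma J_proper : ~ J 1.
Proof. by rewrite /J /ev -(mpolyC1 n) PhiC iota1 scale1r. Qed.

Lemma P_ev h p : exists q, h *: ev p = ev q.
Proof.
move: h p; apply: gen_ind => [p|u w hu hw p|a u hu p|g u hu p|l u hu p|y u hu p|p].
- by exists 0; rewrite scale0r /ev Phi0 scale0r.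
- have [q1 e1] := hu p; have [q2 e2] := hw p; exists (q1 + q2); by rewrite scalerDl evD e1 e2.
- have [q e] := hu p; exists (a *: q); by rewrite -scalerA e evZ.
- have [q e] := hu p; by exists (wact g q); rewrite -scalerA e ev_wact.
- have [q e] := hu p; by exists (lin l * q); rewrite -scalerA e ev_lin.
- have [q e] := hu p; by exists (dunkl y q); rewrite -scalerA e ev_dunkl.
by exists p; rewrite scale1r.
Qed.

Lemma ev_surj w : exists p, w = ev p.
Proof.
have [||h|h] := irr_prop (Q := fun w => exists p, w = ev p) irrL.
- by exists 0; rewrite /ev Phi0 scale0r.
- move=> a x y [p ->] [q ->]; have [r ->] := P_ev a p; by exists (r + q); rewrite evD.
- case: v0'; apply: h; exists 1.
  by rewrite /ev -(mpolyC1 n) PhiC iota1 scale1r.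
exact: h.
Qed.

(** The image of [K] under [ev] is a submodule, so it is zero or everything. In the second case
    [v = ev q] with [q] in [K], and [1 - q] lies in the kernel; by [stable_const] both [q] and
    [1 - q] would have constant term zero. *)
Lemma J_max K p : stable K -> ~ K 1 -> K p -> J p.
Proof.
move=> sK K1 Kp; apply: contrapT => Jp.
have [||h|h] := irr_prop (Q := fun w => exists2 q, K q & w = ev q) irrL.
- exists 0; first exact: (stable0 sK Kp).
  by rewrite /ev Phi0 scale0r.
- move=> a x y [q Kq ->] [r Kr ->].
  suff [q' Kq' ->] : exists2 q', K q' & a *: ev q = ev q' by exists (q' + r); [exact: (stableD sK)|rewrite evD].
  move: a q Kq; apply: gen_ind => [q Kq|u w hu hw q Kq|b u hu q Kq|g u hu q Kq|l u hu q Kq|z u hu q Kq|q Kq].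
  + by exists 0; [exact: (stable0 sK Kp)|rewrite scale0r /ev Phi0 scale0r].
  + have [q1 k1 e1] := hu q Kq; have [q2 k2 e2] := hw q Kq; exists (q1 + q2); first exact: (stableD sK).
    by rewrite scalerDl evD e1 e2.
  + have [q1 k1 e1] := hu q Kq; exists (b *: q1); first exact: (stableZ _ sK k1).
    by rewrite -scalerA e1 evZ.
  + have [q1 k1 e1] := hu q Kq; by exists (wact g q1); [apply: (stableW sK); rewrite ?inE|rewrite -scalerA e1 ev_wact].
  + have [q1 k1 e1] := hu q Kq; by exists (lin l * q1); [exact: (stableM sK)|rewrite -scalerA e1 ev_lin].
  + have [q1 k1 e1] := hu q Kq; by exists (dunkl z q1); [exact: (stableY sK)|rewrite -scalerA e1 ev_dunkl].
  by exists q => //; rewrite scale1r.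
- by apply: Jp; apply: h; exists p.
have [q Kq vq] := h v.
have q0 := stable_const faith hal sK K1 Kq.
have J1q : J (1 - q) by rewrite /J evB -vq /ev -(mpolyC1 n) PhiC iota1 scale1r subrr.
have := stable_const faith hal J_stable J_proper J1q.
by rewrite mcoeffB q0 subr0 mcoeff1 eqxx => /eqP; rewrite oner_eq0.
Qed.

(** Monomials with an exponent at least [N] lie in the ideal, so the finitely many others span. *)
Lemma finite_dim N : (forall i, J ('X_i ^+ N)) ->
  exists m (e : 'I_m -> L), forall v,
    exists a : 'I_m -> C, v = \sum_(i < m) iota (a i) *: e i.
Proof.
move=> hN; have Js := J_stable.
have ex p : exists a : box N n -> C, J (p - \sum_u a u *: 'X_[mm u]).
  elim/mpolyind: p => [|b m p _ _ [a ha]].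
    exists (fun=> 0); rewrite big1 ?subr0 => [|u _]; last by rewrite scale0r.
    by rewrite /J /ev Phi0 scale0r.
  have [a' ha'] : exists a' : box N n -> C, J (b *: 'X_[m] - \sum_u a' u *: 'X_[mm u]).
    have [/forallP h|] := boolP [forall i, (m i < N)%N].
      pose w : box N n := [ffun i => Ordinal (h i)].
      have mw : mm w = m by apply/mnmP => i; rewrite mnmE ffunE.
      exists (fun u => if u == w then b else 0).
      rewrite (bigD1 w) //= eqxx mw big1 ?addr0 ?subrr => [|u /negbTE ->]; last by rewrite scale0r.
      by rewrite /J /ev Phi0 scale0r.
    move=> hn; have [i Ni] : exists i, (N <= m i)%N.
      apply: contrapT => hi; move/negP: hn; apply; apply/forallP => i; rewrite ltnNge; apply/negP => le; by apply: hi; exists i.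
    exists (fun=> 0); rewrite big1 ?subr0 => [|u _]; last by rewrite scale0r.
    have le : (U_(i) *+ N <= m)%MM.
      by apply/mnm_lepP => j; rewrite mulmnE mnm1E; case: eqP => [<-|_]; rewrite ?mul1n ?mul0n.
    by rewrite -(submK le) mpolyXD -mpolyXn -mul_mpolyC; do 2! apply: (stableM Js).
  exists (fun u => a' u + a u).
  have -> : b *: 'X_[m] + p - \sum_u (a' u + a u) *: 'X_[mm u] =
    (b *: 'X_[m] - \sum_u a' u *: 'X_[mm u]) + (p - \sum_u a u *: 'X_[mm u]).
    under eq_bigr => u _ do rewrite scalerDl.
    by rewrite big_split /= opprD addrACA.
  exact: (stableD Js).
exists #|{: box N n}|, (fun i => ev 'X_[mm (enum_val i)]) => w.
have [p ->] := ev_surj w; have [a ha] := ex p; exists (fun i => a (enum_val i)).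
move/eqP: ha; rewrite evB subr_eq0 => /eqP ->.
rewrite evS (reindex _ (onW_bij _ (@enum_val_bij _))); apply: eq_bigr => i _.
by rewrite evZ.
Qed.

End PolyMod.

Section Quotient.
Variables (R : realType) (gT : finGroupType) (n : nat).
Variable rho : mx_representation R [set: gT] n.
Variables (alpha : gT -> 'rV[R[i]]_n) (alphav : gT -> 'cV[R[i]]_n) (c : R[i]).
Notation Hc := (cherednik rho c alpha alphav).
Variable L : lmodType Hc.
Hypothesis hL : irreducible_quotient (polyrep rho c alpha alphav) L.

(** The image of the class of 1 generates the quotient, hence is nonzero because the quotient is. *)
Lemma vacuum_ex : exists v : L, [/\ v <> 0, forall g, PW rho alpha alphav c g *: v = v & forall y, PY rho alpha alphav c y *: v = 0].
Proof.
case: hL => [[[w w0] _] [pi pis]].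
pose one : polyrep rho c alpha alphav := mod_proj (polyrep_rel (rho:=rho) (c:=c) (alpha:=alpha) (alphav:=alphav)) 1.
have rel0 e : polyrep_rel e -> mod_proj (polyrep_rel (rho:=rho) (c:=c) (alpha:=alpha) (alphav:=alphav)) e = 0.
  move=> he; rewrite -(raddf0 (mod_proj _)); apply/zmod_projP; rewrite subr0; apply: zspan_gen.
  by exists 1, e; rewrite scale1r.
have sc (h : Hc) : h *: one = mod_proj (polyrep_rel (rho:=rho) (c:=c) (alpha:=alpha) (alphav:=alphav)) h.
  by rewrite /one -linearZ; congr (mod_proj _ _); exact: mulr1.
exists (pi one); split.
- move=> v0; apply: w0; have [m <-] := pis w.
  elim/zmod_projW: m => h; rewrite -[zmod_proj _ _]/(mod_proj _ h) -sc linearZ /= v0 scaler0.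
  by [].
- move=> g; rewrite -linearZ; congr (pi _); apply/eqP; rewrite -subr_eq0 -[X in _ - X]scale1r -scalerBl sc; apply/eqP.
  by apply: rel0; have := @rel_triv R gT n rho c alpha alphav 1 g; rewrite mul1r.
move=> y; rewrite -linearZ sc rel0 ?linear0 //.
by have := @rel_annih R gT n rho c alpha alphav 1 y; rewrite mul1r.
Qed.
End Quotient.
End PartM.

(** * Polynomials under the Gaussian functional; positive definiteness *)

Module AB.
From HB Require Import structures.
From mathcomp Require Import boolp reals complex mpoly.
From mathcomp Require Import exp trigo.
From mathcomp Require Import ring lra.
Set Implicit Arguments.
Unset Strict Implicit.
Unset Printing Implicit Defensive.
Import Order.TTheory GRing.Theory Num.Theory ComplexField.
Local Open Scope ring_scope.
Local Open Scope complex_scope.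
Require Import Defs.
Import Cpow Cpow2 Ulim Mu Mu2 Mu3 Tame PosSeries Pos2 Pos3 Weight Bd.
Import PolyAct Root Cox Cox2 Cox3 Delta Hilb Chev1 Chev2 Dunkl.

Section PolyEval.
Variables (R : realType) (n : nat) (A : finType) (u : A -> 'cV[R]_n) (v0 : 'cV[R]_n).
Notation C := R[i].
Notation V := 'cV[R]_n.
Notation P := {mpoly C[n]}.
Notation toC := (real_complex R).
(** The coordinates of the contour point [x + i e v0]. *)
Definition zpt (e : R) (x : V) : 'I_n -> C := fun i => lz (e * v0 i 0) (delta_mx 0 i) x.

Lemma ev_delta i (x : V) : Mu.ev (delta_mx 0 i) x = x i 0.
Proof. by rewrite /Mu.ev -rowE mxE. Qed.

Lemma zpt_lin e (x : V) (l : 'rV[R]_n) : (lin (map_mx toC l)).@[zpt e x] = lz (e * Mu.ev l v0) l x.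
Proof.
rewrite meval_lin; apply: eqC => /=.
  rewrite raddf_sum evE; apply: eq_bigr => j _; rewrite mxE /= mul0r subr0.
  by rewrite ev_delta.
rewrite raddf_sum evE mulr_sumr; apply: eq_bigr => j _; rewrite mxE /= mul0r addr0.
by ring.
Qed.

Lemma tame_poly e (p : P) : tame u (fun x => p.@[zpt e x])
  (fun a x => (pd (map_mx toC (u a)) p).@[zpt e x]).
Proof.
move: p; apply: mpoly_lin_ind => [a|p q hp hq|i p hp].
- apply: (eq_tame (tame_cst u a)) => [x|b x]; first by rewrite mevalC.
  by rewrite pdC meval0.
- apply: (eq_tame (tameD hp hq)) => [x|b x]; first by rewrite mevalD.
  by rewrite -mevalD -(raddfD (pd _)).
apply: (eq_tame (tameM (tame_lz u (e * v0 i 0) (delta_mx 0 i)) hp)) => [x|b x].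
  by rewrite mevalM mevalXU.
rewrite pdM mevalD !mevalM mevalXU -lin_delta pd_lin mevalC; congr (_ * _ + _).
by rewrite -rowE !mxE ev_delta.
Qed.

Lemma grow_poly e (p : P) : grow (fun x : V => p.@[zpt e x]).
Proof. exact: tame_grow (tame_poly e p). Qed.

Lemma converges_poly (p : P) : converges (fun M x => p.@[zpt M.+1%:R^-1 x])
   (fun x : V => p.@[fun i => (x i 0)%:C]).
Proof.
move: p; apply: mpoly_lin_ind => [a|p q hp hq|i p hp].
- have := converges_cst (grow_cst _ a : grow (fun _ : V => a)).
  by congr (converges _ _); [apply/funext => M|]; apply/funext => x; rewrite mevalC.
- have := convergesD hp hq.
  by congr (converges _ _); [apply/funext => M|]; apply/funext => x; rewrite mevalD.
have := convergesM (converges_lz (v0 i 0) (delta_mx 0 i)) hp.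
by congr (converges _ _); [apply/funext => M|]; apply/funext => x; rewrite mevalM mevalXU ?ev_delta.
Qed.
End PolyEval.

Section MuPos.
Variables (R : realType) (n : nat) (A : finType) (u : A -> 'cV[R]_n).
Notation C := R[i].
Notation V := 'cV[R]_n.
Notation mu := (mu u).
Notation P := {mpoly C[n]}.
Notation toC := (real_complex R).
Definition rpt (x : V) : 'I_n -> C := fun i => (x i 0)%:C.

Lemma rptE (x : V) : rpt x = zpt 0 0 x.
Proof. by apply/funext => i; apply: eqC => /=; rewrite ?ev_delta ?mul0r. Qed.

Lemma tame_rpt (p : P) : tame u (fun x => p.@[rpt x]) (fun a x => (pd (map_mx toC (u a)) p).@[rpt x]).
Proof. by apply: (eq_tame (tame_poly u 0 0 p)) => [x|a x]; rewrite rptE. Qed.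

Lemma grow_rpt (p : P) : grow (fun x : V => p.@[rpt x]).
Proof. exact: tame_grow (tame_rpt p). Qed.

Lemma conjD (a b : C) : conjc (a + b) = conjc a + conjc b.
Proof. by case: a b => [a1 a2] [b1 b2]; apply: eqC => /=; ring. Qed.
Lemma conjM (a b : C) : conjc (a * b) = conjc a * conjc b.
Proof. by case: a b => [a1 a2] [b1 b2]; apply: eqC => /=; ring. Qed.

Lemma cj_ex (p : P) : exists q : P, forall x, q.@[rpt x] = conjc (p.@[rpt x]).
Proof.
move: p; apply: mpoly_lin_ind => [a|p q [p' hp] [q' hq]|i p [p' hp]].
- by exists (conjc a)%:MP => x; rewrite !mevalC.
- by exists (p' + q') => x; rewrite !mevalD hp hq conjD.
exists ('X_i * p') => x; rewrite !mevalM !mevalXU hp conjM; congr (_ * _).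
by apply: eqC => //=; rewrite oppr0.
Qed.
Definition cj (p : P) : P := sval (cid (cj_ex p)).

Lemma cjE (p : P) x : (cj p).@[rpt x] = conjc (p.@[rpt x]).
Proof. by rewrite /cj; case: cid. Qed.

Lemma affine_ge0 (b z : C) : (forall t : R, 0 <= b + t%:C * z) -> z = 0.
Proof.
move=> h; case: z h => z1 z2; case: b => b1 b2 h.
have hh t : (b2 + t * z2 = 0) /\ 0 <= b1 + t * z1.
  have := h t; rewrite lecE /= => /andP[/eqP e l]; split.
    by rewrite -[RHS]e; ring.
  by apply: le_trans l _; rewrite le_eqVlt; apply/orP; left; apply/eqP; ring.
have z20 : z2 = 0 by have [a _] := hh 0; have [b _] := hh 1; lra.
suff z10 : z1 = 0 by rewrite z10 z20.
apply/eqP; case: eqVneq => // nz; exfalso.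
have [_] := hh (- (b1 + 1) / z1); rewrite divfK // => ?; lra.
Qed.

(** The degenerate case of Cauchy-Schwarz. With zero quadratic term, the nonnegative form at
    [cj h + s g] is affine in the real and imaginary parts of [s], so its slopes along both axes
    vanish. *)
Lemma mu_cauchy (g h : P) : mu (fun x => (g * cj g).@[rpt x]) = 0 -> mu (fun x => (g * h).@[rpt x]) = 0.
Proof.
move=> g0.
set H := mu _; set H' := mu (fun x => (cj g * cj h).@[rpt x]).
have key (s : C) : 0 <= mu (fun x => (h * cj h).@[rpt x]) + (s * H + conjc s * H').
  have gr p := grow_rpt p.
  have E (x : V) : (cj h + s *: g).@[rpt x] * conjc ((cj h + s *: g).@[rpt x]) =
    (h * cj h).@[rpt x] + (s * (g * h).@[rpt x] + (conjc s * (cj g * cj h).@[rpt x] + (s * conjc s) * (g * cj g).@[rpt x])).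
    rewrite mevalD mevalZ !mevalM !cjE conjD conjM conjcK.
    move: (conjc (h.@[rpt x])) (conjc s) (conjc (g.@[rpt x])) (h.@[rpt x]) (g.@[rpt x]) => a b c' d d'.
    by ring.
  have -> : mu (fun x => (h * cj h).@[rpt x]) + (s * H + conjc s * H') =
     mu (fun x => (cj h + s *: g).@[rpt x] * conjc ((cj h + s *: g).@[rpt x])).
    rewrite (eq_mu u E) (muD u (gr _) (growD (growM (grow_cst _ s) (gr _)) (growD (growM (grow_cst _ _) (gr _)) (growM (grow_cst _ _) (gr _))))).
    rewrite (muD u (growM (grow_cst _ s) (gr _)) (growD (growM (grow_cst _ _) (gr _)) (growM (grow_cst _ _) (gr _)))).
    rewrite (muD u (growM (grow_cst _ _) (gr _)) (growM (grow_cst _ _) (gr _))).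
    congr (_ + _).
    transitivity (s * H + (conjc s * H' + (s * conjc s) * mu (fun x => (g * cj g).@[rpt x]))).
      exact: (congr1 (fun z => s * H + z) (esym (etrans (congr1 (fun z => conjc s * H' + (s * conjc s) * z) g0) (etrans (congr1 (fun z => conjc s * H' + z) (mulr0 (s * conjc s))) (addr0 (conjc s * H')))))).
    exact: (congr2 +%R (esym (muZ u s (gr (g * h)))) (congr2 +%R (esym (muZ u _ (gr (cj g * cj h)))) (esym (muZ u _ (gr (g * cj g)))))).
  apply: mu_ge0 => [|x]; last by rewrite mul_conjC_ge0.
  have e : (fun x => (cj h + s *: g).@[rpt x] * conjc ((cj h + s *: g).@[rpt x])) =
     (fun x => ((cj h + s *: g) * cj (cj h + s *: g)).@[rpt x]).
    by apply/funext => x; rewrite mevalM cjE.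
  by rewrite e.
have h1 : H + H' = 0.
  apply: (affine_ge0 (b := mu (fun x => (h * cj h).@[rpt x]))) => t.
  by have := key t%:C; rewrite (_ : conjc t%:C = t%:C) ?mulrDr //; apply: eqC => /=; rewrite ?oppr0.
have h2 : 'i%C * (H - H') = 0.
  apply: (affine_ge0 (b := mu (fun x => (h * cj h).@[rpt x]))) => t.
  have := key (t%:C * 'i%C); rewrite (_ : conjc (t%:C * 'i%C) = - (t%:C * 'i%C)).
    by rewrite mulNr -mulrBr mulrA.
  by apply: eqC => /=; ring.
have h3 : H - H' = 0.
  move/eqP: h2; rewrite mulf_eq0 => /orP[/eqP /(congr1 (@complex.Im R)) /= /eqP|/eqP //].
  by rewrite oner_eq0.
have : H + H = 0 by rewrite -[RHS](addr0 0) -{1}h1 -h3; ring.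
by rewrite -mulr2n => /eqP; rewrite mulrn_eq0 /= => /eqP.
Qed.

Lemma mu_lin (l : 'rV[R]_n) (p : P) :
  mu (fun x => (lin (map_mx toC l) * p).@[rpt x]) =
  mu (fun x => (pd (map_mx toC (\sum_a Mu.ev l (u a) *: u a)) p).@[rpt x]).
Proof.
have gr q := grow_rpt q.
have -> : mu (fun x => (lin (map_mx toC l) * p).@[rpt x]) = mu (fun x => (Mu.ev l x)%:C * p.@[rpt x]).
  apply: eq_mu => x; rewrite mevalM rptE zpt_lin -rptE; congr (_ * _).
  by apply: eqC => /=; rewrite ?mul0r.
rewrite (ibp l (tame_rpt p)); symmetry.
transitivity (mu (fun x => \sum_a (Mu.ev l (u a))%:C * (pd (map_mx toC (u a)) p).@[rpt x])).
  apply: eq_mu => x; rewrite map_mx_sum.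
  elim: (index_enum A) => [|a r IH]; first by rewrite !big_nil /pd big1 ?meval0 // => i _; rewrite mxE scale0r.
  by rewrite !big_cons pdD mevalD IH (map_mxZ toC) pdZ mevalZ.
rewrite (mu_sum u _ (fun a _ => growM (grow_cst _ _) (gr _))).
by apply: eq_bigr => a _; rewrite (muZ u _ (gr _)).
Qed.

Hypothesis uspan : forall i : 'I_n, exists l : 'rV[R]_n, \sum_a Mu.ev l (u a) *: u a = delta_mx i 0.

(** By Cauchy-Schwarz [g] is orthogonal to all polynomials. Integration by parts shows that partial
    derivatives inherit this, so by induction on the size they vanish; and [mu] of a constant is
    that constant. *)
Lemma mu_pos (g : P) : mu (fun x => (g * cj g).@[rpt x]) = 0 -> g = 0.
Proof.
move=> /mu_cauchy g0.
suff H k p : (msize p <= k)%N -> (forall h, mu (fun x => (p * h).@[rpt x]) = 0) -> p = 0.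
  exact: (H (msize g) g (leqnn _) g0).
elim: k p => [|k IH] p; first by rewrite leqn0 msize_poly_eq0 => /eqP.
move=> sp hp; have dp i : p^`M(i) = 0.
  have [l hl] := uspan i.
  have pdE q : pd (map_mx toC (delta_mx i 0 : V)) q = q^`M(i).
    rewrite /pd (bigD1 i) //= big1 ?addr0 => [|j ji]; last by rewrite !mxE (negbTE ji) scale0r.
    by rewrite !mxE !eqxx scale1r.
  apply: IH => [|h]; first by rewrite -pdE; exact: msize_pd.
  have := mu_lin l (p * h); rewrite hl pdE mderivM.
  have -> : mu (fun x => (lin (map_mx toC l) * (p * h)).@[rpt x]) = 0.
    by rewrite -[RHS](hp (lin (map_mx toC l) * h)); apply: eq_mu => x; rewrite mulrCA.
  have -> : mu (fun x => (p^`M(i) * h + p * h^`M(i)).@[rpt x]) =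
     mu (fun x => (p^`M(i) * h).@[rpt x] + (p * h^`M(i)).@[rpt x]) by apply: eq_mu => x; rewrite mevalD.
  by rewrite (muD u (grow_rpt _) (grow_rpt _)) hp addr0.
have pc := mderiv0_const dp.
have := hp 1; rewrite mulr1 pc.
have -> : mu (fun x => (p@_0%MM)%:MP.@[rpt x]) = p@_0%MM.
  by rewrite -[RHS](mu_cst u); apply: eq_mu => x; rewrite mevalC.
by move=> ->; rewrite mpolyC0.
Qed.
End MuPos.
End AB.

(** * The symmetrised weighted functional turns coordinates into Dunkl operators *)

Module AB2.
From HB Require Import structures.
From mathcomp Require Import boolp reals complex mpoly.
From mathcomp Require Import exp trigo.
From mathcomp Require Import ring lra.
Set Implicit Arguments.
Unset Strict Implicit.
Unset Printing Implicit Defensive.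
Import Order.TTheory GRing.Theory Num.Theory ComplexField.
Local Open Scope ring_scope.
Local Open Scope complex_scope.
Require Import Defs.
Import Cpow Cpow2 Ulim Mu Mu2 Mu3 Tame PosSeries Pos2 Pos3 Weight Bd.
Import PolyAct Root Cox Cox2 Cox3 Delta Hilb Chev1 Chev2 Dunkl AB.

Lemma scale_sum (K : comPzRingType) (W : lmodType K) (f : W -> K) (I : Type) (r : seq I) (l : I -> K) (y : I -> W) :
  (forall u w, f (u + w) = f u + f w) -> (forall b u, f (b *: u) = b * f u) ->
  f (\sum_(j <- r) l j *: y j) = \sum_(j <- r) l j * f (y j).
Proof.
move=> fD fZ; elim: r => [|j r IH]; last by rewrite !big_cons fD IH fZ.
by rewrite !big_nil -(scale0r (0 : W)) fZ mul0r.
Qed.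

Section AB2.
Variables (R : realType) (gT : finGroupType) (n : nat).
Variable rho : mx_representation R [set: gT] n.
Hypothesis faith : mx_faithful rho.
Variables (al : gT -> 'rV[R]_n) (v0 : 'cV[R]_n).
Local Notation refl := (is_reflection rho).
Local Notation sp := (sp rho).
Local Notation gram := (gram rho).
Local Notation coroot := (coroot rho).
Hypothesis hal : forall s, refl s ->
  [/\ rho s = 1%:M - coroot (al s) *m al s, sp (al s) (al s) = 2 & 0 < (al s *m v0) 0 0].
Local Notation C := R[i].
Local Notation V := 'cV[R]_n.
Local Notation A := {mpoly C[n]}.
Implicit Types p q : A.
Local Notation wact := (wact rho).
Local Notation TH := (TH rho).
Local Notation nab := (nab rho al).
Local Notation rowC := (rowC al).
Local Notation corC := (corC rho al).
Local Notation alC := (alC al).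
Local Notation root := (root al).
Local Notation toC := (real_complex R).

(** Multiplication by the group permutes the columns of all the [rho g], so [mu] is invariant; their
    covariance is [gram]. *)
Definition uu (a : gT * 'I_n) : V := col a.2 (rho a.1).
Local Notation mu := (mu uu).

Lemma uu_sum l : \sum_a Mu.ev l (uu a) *: uu a = coroot l.
Proof.
have -> : coroot l = \sum_g rho g *m (l *m rho g)^T.
  rewrite /Root.coroot /Root.gram mulmx_suml; apply: eq_bigr => g _.
  by rewrite trmx_mul mulmxA.
apply/matrixP => i k; rewrite !summxE.
rewrite -(pair_bigA _ (fun g j => (Mu.ev l (uu (g, j)) *: uu (g, j)) i k)) /=.
apply: eq_bigr => g _; rewrite mxE; apply: eq_bigr => j _.
rewrite !mxE ord1 mulrC; congr (_ * _).
by rewrite /Mu.ev /uu mxE; apply: eq_bigr => k' _; rewrite !mxE.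
Qed.

Lemma uu_sp l m : \sum_a Mu.ev m (uu a) * Mu.ev l (uu a) = sp m l.
Proof.
rewrite (Root.spC rho m l) -coroot_pair -uu_sum -[RHS]/(Mu.ev l _) ev_sum.
by apply: eq_bigr => a _; rewrite evZ.
Qed.

Lemma uu_span (i : 'I_n) : exists l : 'rV[R]_n, \sum_a Mu.ev l (uu a) *: uu a = delta_mx i 0.
Proof.
exists (invmx gram *m delta_mx i 0)^T; rewrite uu_sum /Root.coroot trmxK mulmxA mulmxV ?mul1mx //.
exact: gram_unit.
Qed.

Definition lam0 : 'rV[R]_n := (invmx gram *m v0)^T.
Lemma lam0E : coroot lam0 = v0.
Proof. by rewrite /Root.coroot /lam0 trmxK mulmxA mulmxV ?mul1mx //; exact: gram_unit. Qed.

(** The value 1 off reflections is a default that keeps the shift positive for every index. *)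
Definition tt s : R := if refl s then Mu.ev (al s) v0 else 1.
Lemma tt_gt0 s : 0 < tt s.
Proof. by rewrite /tt; case: ifP => // /hal[]. Qed.

Lemma wact_lin_real g (m : 'rV[R]_n) : wact g (lin (map_mx toC m)) = lin (map_mx toC (m *m rho g^-1%g)).
Proof. by rewrite wact_lin (map_mxM toC). Qed.

Lemma wact_pd g (m : 'rV[R]_n) p :
  pd (map_mx toC (coroot (m *m rho g^-1%g))) (wact g p) = wact g (pd (map_mx toC (coroot m)) p).
Proof.
rewrite !wactE pd_act -(map_mxM toC).
have -> : rho g^-1%g *m coroot (m *m rho g^-1%g) = coroot m; last by [].
by rewrite /Root.coroot trmx_mul !mulmxA gram_inv.
Qed.

Section Group.
Variable G : {group gT}.
Notation dunkl := (dunkl rho al G).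

Lemma sum_roots (W : nmodType) (F : gT -> W) : \sum_(s <- roots rho G) F s = \sum_(s | TH G s) F s.
Proof. by rewrite /roots big_filter big_enum_cond. Qed.

(** A divided difference has numerator [F g - F (g s)] over the transported root. Replacing [g] by
    [g s] flips the sign of the denominator, so the two halves add up to a simple pole with a factor
    2; conjugating [s] by [g] makes the root fixed. *)
Lemma nab_sum (m : 'rV[R]_n) p (z : 'I_n -> C) : (forall s, TH G s -> (alC s).@[z] != 0) ->
  \sum_(g in G) \sum_(s | TH G s) toC (sp m (al s)) * (wact g (nab s p)).@[z] =
  \sum_(g in G) \sum_(s | TH G s) (2 * toC (sp (m *m rho g^-1%g) (al s))) * ((alC s).@[z]^-1 * (wact g p).@[z]).
Proof.
move=> z0; pose a g s := (wact g (alC s)).@[z]; pose F g := (wact g p).@[z].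
have conj g s : TH G s -> g \in G -> exists2 b : bool, a g s = (-1) ^+ b * (alC (s ^ g^-1)%g).@[z] &
   sp m (al s) = (-1) ^+ b * sp (m *m rho g^-1%g) (al (s ^ g^-1)%g).
  move=> /andP[hs sG] gG; have e := al_conj hal g^-1%g hs.
  rewrite -(sp_rho rho g^-1%g m) e /a /Delta.alC wact_lin_real e.
  case: ifP => _; first by exists false; rewrite !expr0 !mul1r.
  by exists true; rewrite !expr1 !mulN1r ?spNr // map_mxN -scaleN1r /lin; rewrite !meval_lin -sumrN; apply: eq_bigr => j _; rewrite !mxE mulN1r mulNr.
have THc g s : TH G s -> g \in G -> TH G (s ^ g^-1)%g.
  by move=> hs gG; apply: TH_conj; rewrite ?groupV.
have a0 g s : TH G s -> g \in G -> a g s != 0.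
  move=> hs gG; have [b -> _] := conj g s hs gG; rewrite mulf_neq0 ?z0 ?THc //.
  by rewrite signr_eq0.
have N g s : TH G s -> g \in G -> (wact g (nab s p)).@[z] = (a g s)^-1 * (F g - F (g * s)%g).
  move=> hs gG; have /andP[hs' _] := hs; rewrite /F wactM -mevalB -(raddfB (wact g)) /=.
  rewrite (nabP faith hal p hs') (rmorphM (wact g)) /= mevalM mulKf //; exact: a0.
have aS g s : TH G s -> a (g * s)%g s = - a g s.
  move=> /andP[hs _]; rewrite /a wactM {1}/Delta.alC wact_lin_real (reflV faith hs) (al_self hal hs).
  have -> : lin (map_mx toC (- al s)) = - alC s.
    by rewrite map_mxN /Delta.alC /lin -sumrN; apply: eq_bigr => j _; rewrite mxE scaleNr.
  by rewrite (raddfN (wact g)) /= mevalN.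
transitivity (\sum_(s | TH G s) \sum_(g in G) (2 * toC (sp m (al s))) * ((a g s)^-1 * F g)).
  rewrite exchange_big; apply: eq_bigr => s hs; have /andP[hs' sG] := hs.
  rewrite (eq_bigr (fun g => toC (sp m (al s)) * ((a g s)^-1 * F g) - toC (sp m (al s)) * ((a g s)^-1 * F (g * s)%g))); last first.
    by move=> g gG; rewrite (N _ _ hs gG) mulrBr mulrBr.
  rewrite sumrB [X in _ - X](reindex_inj (mulIg s)) /=.
  rewrite [X in _ - X](eq_big (mem G) (fun g => - (toC (sp m (al s)) * ((a g s)^-1 * F g)))).
  - rewrite sumrN opprK -big_split; apply: eq_bigr => g _ /=.
    by move: (_ * F g) => X; ring.
  - by move=> g; rewrite groupMr.
  move=> g _; rewrite (aS _ _ hs) -mulgA (reflK faith hs') mulg1 invrN mulNr mulrN.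
  by [].
transitivity (\sum_(g in G) \sum_(s | TH G s) (2 * toC (sp m (al s))) * ((a g s)^-1 * F g)).
  exact: exchange_big.
apply: eq_bigr => g gG.
rewrite [RHS](reindex_inj (conjg_inj g^-1%g)) /=.
apply: eq_big => [s|s hs].
  apply/idP/idP => [hs|hs]; first exact: THc.
  have := TH_conj gG hs; by rewrite conjgKV.
have [b -> ->] := conj g s hs gG; rewrite invfM invr_sign.
have -> : toC ((-1) ^+ b * sp (m *m rho g^-1%g) (al (s ^ g^-1)%g)) = (-1) ^+ b * toC (sp (m *m rho g^-1%g) (al (s ^ g^-1)%g)).
  by case: b; rewrite ?expr0 ?expr1 ?mul1r ?mulN1r //; exact: rcN.
rewrite /F; move: ((alC (s ^ g^-1)%g).@[z]) (toC (sp (m *m rho g^-1%g) (al (s ^ g^-1)%g))) ((wact g p).@[z]) => X Y Z.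
have sq : (-1) ^+ b * (-1) ^+ b = 1 :> C by rewrite -expr2 sqrr_sign.
transitivity (((-1) ^+ b * (-1) ^+ b) * (2 * Y * (X^-1 * Z))); first by ring.
by rewrite sq mul1r.
Qed.

Section Weighted.
Variables (c e : R).
Hypothesis e0 : 0 < e.
Definition wgt x : C := weight (roots rho G) c (fun s => e * tt s) al (e *: lam0) x.
Definition E p : C := mu (fun x => p.@[zpt v0 e x] * wgt x).
(** The weight singles out the chamber of [v0]; symmetrising the argument over [G] makes the
    functional invariant. *)
Definition EA p : C := \sum_(g in G) E (wact g p).

Lemma et_gt0 s : 0 < e * tt s. Proof. by rewrite mulr_gt0 ?tt_gt0. Qed.
Lemma grow_wgt : grow wgt. Proof. exact: (grow_weight uu _ _ _ _ et_gt0). Qed.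
Lemma grow_E p : grow (fun x => p.@[zpt v0 e x] * wgt x).
Proof. exact: growM (grow_poly uu v0 e p) grow_wgt. Qed.
Lemma ED p q : E (p + q) = E p + E q.
Proof.
rewrite /E -(muD uu (grow_E p) (grow_E q)); apply: eq_mu => x.
by rewrite mevalD mulrDl.
Qed.
Lemma EZ a p : E (a *: p) = a * E p.
Proof.
rewrite /E -(muZ uu a (grow_E p)); apply: eq_mu => x.
by rewrite mevalZ -mulrA.
Qed.
Lemma EAD p q : EA (p + q) = EA p + EA q.
Proof. by rewrite /EA -big_split; apply: eq_bigr => g _; rewrite (raddfD (wact g)) /= ED. Qed.
Lemma EAZ a p : EA (a *: p) = a * EA p.
Proof. by rewrite /EA mulr_sumr; apply: eq_bigr => g _; rewrite linearZ /= EZ. Qed.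
Lemma EAW g p : g \in G -> EA (wact g p) = EA p.
Proof.
move=> gG; rewrite /EA [RHS](reindex_inj (mulIg g)) /=.
apply: eq_big => [h|h _]; first by rewrite groupMr.
by rewrite wactM.
Qed.

Lemma alC_zpt s x : TH G s -> (alC s).@[zpt v0 e x] = lz (e * tt s) (al s) x.
Proof. by move=> /andP[hs _]; rewrite /Delta.alC zpt_lin /tt hs. Qed.

Definition D s p : C := mu (fun x => (lz (e * tt s) (al s) x)^-1 * p.@[zpt v0 e x] * wgt x).
Lemma grow_D s p : grow (fun x => (lz (e * tt s) (al s) x)^-1 * p.@[zpt v0 e x] * wgt x).
Proof. exact: growM (growM (grow_lzV _ (et_gt0 s)) (grow_poly uu v0 e p)) grow_wgt. Qed.

Lemma E_lin (m : 'rV[R]_n) p : E (lin (map_mx toC m) * p) = E (pd (map_mx toC (coroot m)) p)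
  - \sum_(s | TH G s) (2 * c)%:C * toC (sp m (al s)) * D s p.
Proof.
have hv : e *: v0 = \sum_a Mu.ev (e *: lam0) (uu a) *: uu a by rewrite uu_sum corootZ lam0E.
have H := @weight_ibp R n _ uu _ (roots rho G) c (fun s => e * tt s) al (e *: lam0) et_gt0
   _ _ m _ (tame_poly uu v0 e p) hv.
have H1 : E (lin (map_mx toC m) * p) = mu (fun x => lz (Mu.ev m (e *: v0)) m x * p.@[zpt v0 e x] * wgt x).
  by apply: eq_mu => x; rewrite mevalM zpt_lin Mu.evZ.
rewrite H1 H sum_roots; congr (_ - _); last first.
  by apply: eq_bigr => s _; rewrite uu_sp.
rewrite -uu_sum /E; symmetry.
transitivity (mu (fun x => \sum_a (Mu.ev m (uu a))%:C * ((pd (map_mx toC (uu a)) p).@[zpt v0 e x] * wgt x))).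
  apply: eq_mu => x; rewrite map_mx_sum; move: (wgt x) => w.
  elim: (index_enum _) => [|a r IH]; first by rewrite !big_nil /pd big1 ?meval0 ?mul0r // => i _; rewrite mxE scale0r.
  by rewrite !big_cons pdD mevalD mulrDl IH (map_mxZ toC) pdZ mevalZ -mulrA.
rewrite (mu_sum uu _ (fun a _ => growM (grow_cst _ _) (grow_E _))).
by apply: eq_bigr => a _; rewrite (muZ uu _ (grow_E _)).
Qed.

Lemma E_sum (I : Type) (r : seq I) (Q : pred I) (f : I -> A) : E (\sum_(i <- r | Q i) f i) = \sum_(i <- r | Q i) E (f i).
Proof.
elim/big_rec2: _ => [|i x y _ <-]; last by rewrite ED.
by rewrite -(scale0r 0) EZ mul0r.
Qed.

(** Summed over the group, the pole terms of [E_lin] become by [nab_sum] the divided differences in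
    the Dunkl operator. The exponent [2c] of the weight accounts for the factor 2 there. *)
Lemma EA_lin_real (m : 'rV[R]_n) p :
  EA (lin (map_mx toC m) * p) = EA (dunkl c%:C (map_mx toC (coroot m)) p).
Proof.
have S0 : \sum_(g in G) \sum_(s | TH G s) (2 * c)%:C * toC (sp (m *m rho g^-1%g) (al s)) * D s (wact g p) =
  c%:C * \sum_(s | TH G s) toC (sp (al s) m) * EA (nab s p).
  rewrite exchange_big.
  transitivity (mu (fun x => c%:C * \sum_(g in G) \sum_(s | TH G s) toC (sp m (al s)) * ((wact g (nab s p)).@[zpt v0 e x] * wgt x))).
    have gg s g : grow (fun x => (2 * c)%:C * toC (sp (m *m rho g^-1%g) (al s)) * ((lz (e * tt s) (al s) x)^-1 * (wact g p).@[zpt v0 e x] * wgt x)).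
      exact: growM (grow_cst _ _) (grow_D _ _).
    transitivity (mu (fun x => \sum_(s | TH G s) \sum_(g in G) (2 * c)%:C * toC (sp (m *m rho g^-1%g) (al s)) * ((lz (e * tt s) (al s) x)^-1 * (wact g p).@[zpt v0 e x] * wgt x))).
      rewrite (mu_sum uu _ (fun s _ => grow_sum _ (fun g _ => gg s g))); apply: eq_bigr => s _.
      rewrite (mu_sum uu _ (fun g _ => gg s g)); apply: eq_bigr => g _.
      by rewrite (muZ uu _ (grow_D _ _)).
    apply: eq_mu => x; rewrite exchange_big /=.
    have zn s : TH G s -> (alC s).@[zpt v0 e x] != 0.
      by move=> hs; rewrite (alC_zpt _ hs) lz_neq0 ?gt_eqF ?et_gt0.
    have NS := nab_sum m p zn.
    transitivity (c%:C * (\sum_(g in G) \sum_(s | TH G s) toC (sp m (al s)) * (wact g (nab s p)).@[zpt v0 e x]) * wgt x); last first.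
      rewrite -mulrA mulr_suml; congr (_ * _); apply: eq_bigr => g _; rewrite mulr_suml.
      by apply: eq_bigr => s _; exact: (esym (mulrA _ _ _)).
    rewrite NS mulr_sumr mulr_suml; apply: eq_bigr => g _; rewrite mulr_sumr mulr_suml.
    apply: eq_bigr => s hs; rewrite (alC_zpt _ hs) rcM.
    have -> : (2 : R)%:C = 2 by rewrite -[LHS]/(toC 2) rmorph_nat.
    by move: (lz _ _ _)^-1 (toC _) (wgt x) (_.@[_]) => X Y Z T; ring.
  have gs s : grow (fun x => toC (sp m (al s)) * \sum_(g in G) ((wact g (nab s p)).@[zpt v0 e x] * wgt x)).
    exact: (growM (grow_cst _ _) (grow_sum _ (fun g _ => grow_E _))).
  transitivity (c%:C * mu (fun x => \sum_(s | TH G s) toC (sp m (al s)) * \sum_(g in G) ((wact g (nab s p)).@[zpt v0 e x] * wgt x))).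
    rewrite -(muZ uu _ (grow_sum _ (fun s _ => gs s))); apply: eq_mu => x; congr (_ * _).
    by rewrite exchange_big; apply: eq_bigr => s _; rewrite mulr_sumr.
  congr (_ * _); rewrite (mu_sum uu _ (fun s _ => gs s)); apply: eq_bigr => s _.
  rewrite (muZ uu _ (grow_sum _ (fun g _ => grow_E _))) (Root.spC rho m); congr (_ * _).
  by rewrite (mu_sum uu _ (fun g _ => grow_E _)).
rewrite {1}/EA.
transitivity (\sum_(g in G) (E (wact g (pd (map_mx toC (coroot m)) p)) - \sum_(s | TH G s) (2 * c)%:C * toC (sp (m *m rho g^-1%g) (al s)) * D s (wact g p))).
  apply: eq_bigr => g _; rewrite (rmorphM (wact g)) /= wact_lin_real E_lin wact_pd.
  by [].
rewrite sumrB S0 /Dunkl.dunkl.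
have EAB a b : EA (a - b) = EA a - EA b by rewrite EAD -scaleN1r EAZ mulN1r.
rewrite EAB EAZ; congr (_ - _ * _).
have EA_sum : forall (f : gT -> A), EA (\sum_(s | TH G s) f s) = \sum_(s | TH G s) EA (f s).
  move=> f; elim/big_rec2: _ => [|i x y _ <-]; last by rewrite EAD.
  by rewrite -(scale0r 0) EAZ mul0r.
rewrite EA_sum; apply: eq_bigr => s _; rewrite EAZ; congr (_ * _).
by rewrite /Delta.rowC -(map_mxM toC) mxE coroot_pair.
Qed.

Definition ly (l : 'rV[C]_n) : 'cV[C]_n := map_mx toC gram *m l^T.
Lemma ly_surj y : exists l, ly l = y.
Proof.
exists (invmx (map_mx toC gram) *m y)^T; rewrite /ly trmxK mulmxA mulmxV ?mul1mx //.
by rewrite map_unitmx gram_unit.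
Qed.

Lemma EA_lin l p : EA (lin l * p) = EA (dunkl c%:C (ly l) p).
Proof.
have dE j : map_mx toC (delta_mx 0 j : 'rV[R]_n) = delta_mx 0 j by exact: map_delta_mx.
have E1 : EA (lin l * p) = \sum_j l 0 j * EA (lin (delta_mx 0 j) * p).
  rewrite {1}/lin mulr_suml; elim: (index_enum _) => [|j r IH].
    by rewrite !big_nil -(scale0r 0) EAZ mul0r.
  by rewrite !big_cons EAD IH -scalerAl EAZ lin_delta.
rewrite E1.
have -> : ly l = \sum_j l 0 j *: ly (delta_mx 0 j).
  apply/matrixP => i k; rewrite summxE mxE; apply: eq_bigr => j _.
  by rewrite [RHS]mxE /ly trmx_delta -colE !mxE ord1 mulrC.
rewrite (@scale_sum _ _ (fun y => EA (dunkl c%:C y p))); last 2 first.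
- by move=> y y'; rewrite dunklD; exact: EAD.
- by move=> b y; rewrite dunklZ; exact: EAZ.
apply: eq_bigr => j _.
have e1 : ly (delta_mx 0 j) = map_mx toC (coroot (delta_mx 0 j)).
  by rewrite /ly /Root.coroot (map_mxM toC) -map_trmx dE.
rewrite e1; have := EA_lin_real (delta_mx 0 j) p; rewrite dE => ->.
by [].
Qed.
End Weighted.
End Group.
End AB2.
End AB2.

(** * The limit of the functional and the dichotomy decided by the length polynomial at [zeta] *)

Module AB3.
From HB Require Import structures.
From mathcomp Require Import boolp reals complex mpoly.
From mathcomp Require Import exp trigo.
From mathcomp Require Import ring lra.
Set Implicit Arguments.
Unset Strict Implicit.
Unset Printing Implicit Defensive.
Import Order.TTheory GRing.Theory Num.Theory ComplexField.
Local Open Scope ring_scope.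
Local Open Scope complex_scope.
Require Import Defs.
Import Cpow Cpow2 Ulim Mu Mu2 Mu3 Tame PosSeries Pos2 Pos3 Weight Bd.
Import PolyAct Root Cox Cox2 Cox3 Delta Hilb Chev1 Chev2 Dunkl AB AB2.
Import AB AB2.
Lemma sum_same (K : numFieldType) (T : finType) (B : {set T}) (F : T -> K) x :
  (forall g, g \in B -> F g = x) -> \sum_(g in B) F g = #|B|%:R * x.
Proof. by move=> h; rewrite (eq_bigr (fun=> x)) // sumr_const mulr_natl. Qed.

Lemma div_bound (R : realType) (x y D k N : R) : 0 < k -> k * x <= y * (D / N) -> x <= y * D / k / N.
Proof.
move=> k0 h; rewrite -(ler_pM2l k0); apply: le_trans h _.
have -> : k * (y * D / k / N) = (k / k) * (y * (D / N)) by ring.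
by rewrite divff ?gt_eqF // mul1r.
Qed.

Lemma complex_quad (R : realType) (X Y : R[i]) (N : R) : 0 < N -> 0 <= X ->
  (2 * N)%:C * X <= (N ^+ 2)%:C * Y -> Normc.normc X <= Normc.normc Y * N.
Proof.
move=> N0; case: X => x1 x2; case: Y => y1 y2.
have ly : y1 <= Normc.normc (y1 +i* y2) := le_trans (ler_norm _) (Re_le_normc (y1 +i* y2)).
have nx : 0 <= x1 -> x2 = 0 -> Normc.normc (x1 +i* x2) = x1.
  by move=> h ->; rewrite normcE2 /= expr0n addr0 sqrtr_sqr ger0_norm.
move: (Normc.normc (y1 +i* y2)) (Normc.normc (x1 +i* x2)) ly nx => nY nX ly nx.
rewrite !lecE /= => /andP[/eqP e1 l1] /andP[_ l2].
rewrite (nx l1 e1); have h1 : N * (2 * x1) <= N * (N * y1) by lra.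
rewrite ler_pM2l // in h1; have h2 : N * y1 <= N * nY by rewrite ler_pM2l.
by rewrite [nY * N]mulrC; lra.
Qed.

Lemma mul_diff (K : comPzRingType) (g k x y : K) : g * (k * x) - k * (g * y) = k * g * (x - y).
Proof. by ring. Qed.

Lemma grow_norm (R : realType) n (f g : 'cV[R]_n -> R[i]) : grow f ->
  (forall x, Normc.normc (g x) = Normc.normc (f x)) -> grow g.
Proof. by move=> [B [k [B0 h]]] e; exists B, k; split=> // x; rewrite e. Qed.

Lemma cpowX (R : realType) (z : R[i]) s k : z != 0 -> cpow z s ^+ k = cpow z (k%:R * s).
Proof.
move=> z0; elim: k => [|k IH]; first by rewrite mul0r cpow0 expr0.
by rewrite exprS IH -(cpowD _ _ z0) -natr1 mulrDl mul1r addrC.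
Qed.

(** Replaces division by [Q] with the tangent bound [2k - k^2 Q <= 1/Q], which stays polynomial when
    [Q] is. *)
Lemma quad_bound (R : realType) (D Q P k : R) : 0 < Q -> 0 <= P -> P <= D * Q -> P * (2 * k - k ^+ 2 * Q) <= D.
Proof.
move=> Q0 P0 h; rewrite -(ler_pM2r Q0); apply: le_trans h.
have -> : P * (2 * k - k ^+ 2 * Q) * Q = P - P * (1 - k * Q) ^+ 2 by ring.
by rewrite lerBlDr lerDl mulr_ge0 // sqr_ge0.
Qed.

Lemma pow_bound (R : realType) (y a : R) m : 1 <= a <= m%:R ->
  y ^+ (2 * m) <= (`|y| `^ a) ^+ 2 * (1 + y ^+ 2) ^+ m.
Proof.
move=> /andP[a1 am]; have -> : y ^+ (2 * m) = (`|y| ^+ m) ^+ 2.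
  by rewrite -exprM [(m * 2)%N]mulnC -normrX ger0_norm // exprM exprn_ge0 // sqr_ge0.
have [y1|y1] := leP `|y| 1.
  apply: (@le_trans _ _ ((`|y| `^ a) ^+ 2)).
    apply: lerXn2r; rewrite ?nnegrE ?powR_ge0 ?exprn_ge0 //.
    rewrite -powR_mulrn //; have [->|y0] := eqVneq y 0.
      by rewrite normr0 !powR0 //; apply/eqP; lra.
    apply: ger_powR => //; by rewrite normr_gt0 y0.
  by rewrite ler_peMr ?sqr_ge0 // exprn_ege1 // lerDl sqr_ge0.
apply: (@le_trans _ _ ((1 + y ^+ 2) ^+ m)).
  rewrite -exprM mulnC exprM; apply: lerXn2r; rewrite ?nnegrE ?addr_ge0 ?sqr_ge0 //.
  by rewrite -normrX ger0_norm ?sqr_ge0 // lerDr.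
rewrite ler_peMl ?exprn_ge0 ?addr_ge0 ?sqr_ge0 // exprn_ege1 //.
apply: (@le_trans _ _ (1 `^ a)); first by rewrite powR1.
apply: ge0_ler_powR; rewrite ?nnegrE //; last exact: ltW.
by lra.
Qed.

Section AB3.
Variables (R : realType) (gT : finGroupType) (n : nat).
Variable rho : mx_representation R [set: gT] n.
Hypothesis faith : mx_faithful rho.
Variables (al : gT -> 'rV[R]_n) (v0 : 'cV[R]_n).
Local Notation refl := (is_reflection rho).
Local Notation sp := (sp rho).
Local Notation coroot := (coroot rho).
Hypothesis hal : forall s, refl s ->
  [/\ rho s = 1%:M - coroot (al s) *m al s, sp (al s) (al s) = 2 & 0 < (al s *m v0) 0 0].
Local Notation C := R[i].
Local Notation V := 'cV[R]_n.
Local Notation A := {mpoly C[n]}.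
Implicit Types p q : A.
Local Notation wact := (wact rho).
Local Notation TH := (TH rho).
Local Notation alC := (alC al).
Local Notation root := (Cox.root al).
Local Notation toC := (real_complex R).
Local Notation normc := (@Normc.normc R).
Local Notation uu := (uu rho).
Local Notation mu := (mu uu).
Variable G : {group gT}.
Local Notation inv := (inv rho G).
Local Notation avg := (avg rho G).
Local Notation delta := (delta rho al G).
Local Notation neg := (neg rho al G).
Local Notation poincare := (poincare rho al v0 C G).
Local Notation tt := (tt rho al v0).
Variable c : R.
Hypothesis c0 : 0 < c.
(** The extra 1 makes [a = m - c] at least 1, the range in which the powers converge up to the
    walls. *)
Let m := (Num.bound c).+1.
Let a := m%:R - c.
Let dm := delta ^+ (2 * m).
Let zeta : C := cis (2 * (a * pi)).
Notation EA := (EA rho al v0 G).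
Notation E := (E rho al v0 G).
Notation wgt := (wgt rho al v0 G).
Notation ee M := (M.+1%:R^-1 : R).

Let ee0 M : 0 < ee M. Proof. by rewrite invr_gt0. Qed.
Let a1 : 1 <= a.
Proof.
have := archi_boundP (ltW c0); rewrite /a /m -natr1 => h; lra.
Qed.
Let am : 1 <= a <= m%:R. Proof. by rewrite a1 /a gerBl ltW. Qed.

Lemma delta_zpt e x : delta.@[zpt v0 e x] = \prod_(s <- roots rho G) lz (e * tt s) (al s) x.
Proof.
rewrite /Delta.delta; have : {subset roots rho G <= [pred s | TH G s]} by move=> s; rewrite mem_roots.
elim: (roots rho G) => [|s r IH] h; first by rewrite !big_nil meval1.
rewrite !big_cons mevalM IH; last by move=> t tr; apply: h; rewrite inE tr orbT.
have -> : (alC s).@[zpt v0 e x] = lz (e * tt s) (al s) x; last by [].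
by apply: (@alC_zpt _ _ _ _ _ _ G); exact: (h s (mem_head _ _)).
Qed.

Let kap : C := (\prod_(s <- roots rho G) 'i%C) ^+ (2 * m).
Let kap0 : kap != 0.
Proof.
rewrite expf_neq0 //; elim: (roots rho G) => [|s r IH]; first by rewrite big_nil oner_eq0.
rewrite big_cons mulf_neq0 //; apply/eqP => /(congr1 (@complex.Im R)) /= /eqP; by rewrite oner_eq0.
Qed.

(** The even power of [delta] is absorbed into the weight by [weight_shift]; [kap] collects the
    constants [i] between [lz] and [wl]. *)
Lemma E_delta e q : 0 < e -> E c e (dm * q) = kap * E (c - m%:R) e q.
Proof.
move=> e0; rewrite /AB2.E -(muZ uu kap (grow_E hal G (c - m%:R) e0 q)); apply: eq_mu => x.
rewrite mevalM /dm; have -> : (delta ^+ (2 * m)).@[zpt v0 e x] = delta.@[zpt v0 e x] ^+ (2 * m) by exact: (rmorphXn (meval _)).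
rewrite delta_zpt /AB2.wgt -(weight_shift _ c al (e *: lam0 rho v0) m x (et_gt0 hal e0)).
have -> : \prod_(s <- roots rho G) lz (e * tt s) (al s) x =
  (\prod_(s <- roots rho G) 'i%C) * \prod_(s <- roots rho G) wl (e * tt s) (al s) x.
  by rewrite -big_split; apply: eq_bigr => s _; exact: lz_wl.
have -> : \prod_(s <- roots rho G) wl (e * tt s) (al s) x ^+ 2 = (\prod_(s <- roots rho G) wl (e * tt s) (al s) x) ^+ 2.
  by rewrite prodrXl.
rewrite exprMn -/kap -exprM.
by move: kap (_ ^+ (2 * m)) (_.@[_]) (weight _ _ _ _ _ _) => X Y Z T; rewrite -!mulrA; congr (_ * _); rewrite mulrCA.
Qed.

Lemma dm_inv g : g \in G -> wact g dm = dm.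
Proof.
move=> gG; rewrite /dm (rmorphXn (wact g)) /= (wact_delta hal gG) exprZn mulnC mulnC exprM.
by rewrite sgn_sqr expr1n scale1r.
Qed.

Lemma EA_inv c' e q : inv q -> EA c' e q = #|G|%:R * E c' e q.
Proof.
move=> iq; rewrite /AB2.EA; apply: sum_same => g gG.
by rewrite iq.
Qed.

Lemma inv_dm q : inv q -> inv (dm * q).
Proof. by move=> iq g gG; rewrite (rmorphM (wact g)) /= dm_inv // iq. Qed.

Definition W (x : V) : C := \prod_(s <- roots rho G) cpow (wl 0 (al s) x) a ^+ 2.
Definition Dx (x : V) : R := \prod_(s <- roots rho G) (`|Mu.ev (al s) x| `^ a) ^+ 2.

Lemma Dx_ge0 x : 0 <= Dx x.
Proof. by apply: prodr_ge0 => s _; exact: sqr_ge0. Qed.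

Let kap' : C := \prod_(s <- roots rho G) cis (- (a * pi)).
Let kap'0 : kap' != 0.
Proof.
rewrite /kap'; elim: (roots rho G) => [|s r IH]; first by rewrite big_nil oner_eq0.
by rewrite big_cons mulf_neq0 // -normc_gt0 normc_cis.
Qed.

(** The limit weight has modulus [Dx = |delta|^(2a)]; apart from a common phase, every root negative
    at [x] contributes one factor [zeta]. *)
Lemma W_E x : W x = (Dx x)%:C * (kap' * zeta ^+ #|neg x|).
Proof.
have -> : W x = (Dx x)%:C * (kap' * \prod_(s <- roots rho G) (if Mu.ev (al s) x < 0 then zeta else 1)).
  rewrite /W /Dx /kap'; elim: (roots rho G) => [|s r IH]; first by rewrite !big_nil !mulr1.
  rewrite !big_cons IH (cpow_wl0 _ _ a1) rcM -/zeta.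
  by rewrite [LHS]mulrACA; congr (_ * _); exact: mulrACA.
congr (_ * (_ * _)); rewrite -big_mkcond /= big_const_seq iter_mulr_1; congr (_ ^+ _).
rewrite /Cox.neg cardsE -sum1_count /roots big_filter_cond -sum1_card big_enum_cond /=.
by apply: eq_bigl => s.
Qed.

Lemma W_conv q : converges (fun M x => q.@[zpt v0 (ee M) x] * wgt (c - m%:R) (ee M) x)
   (fun x : V => q.@[rpt x] * W x).
Proof.
have H := convergesM (converges_poly v0 q) (convergesM (converges_prod (roots rho G)
   (fun s => convergesM (converges_cpow (al s) (tt_gt0 hal s) a1) (converges_cpow (al s) (tt_gt0 hal s) a1)))
   (converges_cis (- lam0 rho v0))).
have e1 : (fun M x => q.@[zpt v0 (ee M) x] * wgt (c - m%:R) (ee M) x) =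
  (fun M x => q.@[zpt v0 (ee M) x] * ((\prod_(s <- roots rho G) (cpow (wl (ee M * tt s) (al s) x) a * cpow (wl (ee M * tt s) (al s) x) a)) * cis (Mu.ev (ee M *: - lam0 rho v0) x))).
  apply/funext => M; apply/funext => x; congr (_ * _); rewrite /AB2.wgt /weight scalerN.
  congr (_ * _); apply: eq_bigr => s _; by rewrite opprB expr2.
have e2 : (fun x : V => q.@[rpt x] * W x) = (fun x => q.@[fun i => (x i 0)%:C] * ((\prod_(s <- roots rho G) (cpow (wl 0 (al s) x) a * cpow (wl 0 (al s) x) a)) * 1)).
  by apply/funext => x; rewrite mulr1.
by rewrite e1 e2.
Qed.

Lemma grow_qW q : grow (fun x : V => q.@[rpt x] * W x). Proof. by have [] := W_conv q. Qed.

Lemma grow_Dx q : grow (fun x : V => q.@[rpt x] * (Dx x)%:C).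
Proof.
apply: (grow_norm (grow_qW q)) => x; rewrite W_E !normcM.
have -> : normc (zeta ^+ #|neg x|) = 1 by rewrite normcX normc_cis expr1n.
have -> : normc kap' = 1; last by rewrite !mulr1.
rewrite /kap'; elim: (roots rho G) => [|s r IH]; first by rewrite big_nil Normc.normc1.
by rewrite big_cons normcM IH normc_cis mulr1.
Qed.

Lemma rpt_act g q (x : V) : (wact g^-1%g q).@[rpt x] = q.@[rpt (rho g *m x)].
Proof.
rewrite wactE invgK.
have -> : rpt x = (fun i => (map_mx toC x) i 0) by apply/funext => i; rewrite mxE.
rewrite meval_act -(map_mxM toC); congr (meval _ _); apply/funext => i; by rewrite mxE.
Qed.

Lemma mu_act g (f : V -> C) : mu (fun x => f (rho g *m x)) = mu f.
Proof.
apply: (mu_invariant (s := fun b => ((g * b.1)%g, b.2))).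
  by move=> [h i] [h' i'] /= [/mulgI -> ->].
move=> [h i]; apply/matrixP => j k; rewrite /AB2.uu /= rhoM !mxE; apply: eq_bigr => t _; by rewrite !mxE.
Qed.

Lemma Dx_act g x : g \in G -> Dx (rho g *m x) = Dx x.
Proof.
move=> gG; rewrite /Dx /roots !big_filter !big_enum_cond [RHS](reindex_inj (conjg_inj g)) /=.
apply: eq_big => [s|s /andP[hs _]].
  apply/idP/idP => h; first exact: TH_conj.
  by have := TH_conj (groupVr gG) h; rewrite conjgK.
have := root_act hal g x hs; rewrite -[Cox.root _ _ _]/(Mu.ev (al s) (rho g *m x)) => ->.
by case: ifP => // _; rewrite normrN.
Qed.

(** Off the walls, carrying [x] into the chamber identifies the numbers of negative roots along its
    orbit with the lengths of the group elements. On a wall both sides vanish with [Dx]. *)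
Lemma sum_zeta x : (Dx x)%:C * (\sum_(g in G) zeta ^+ #|neg (rho g *m x)|) = (Dx x)%:C * poincare.[zeta].
Proof.
have [/hasP[s sr /eqP e]|/hasPn reg] := boolP (has (fun s => Mu.ev (al s) x == 0) (roots rho G)).
  have -> : Dx x = 0; last by rewrite !mul0r.
  rewrite /Dx (big_rem s) //= e normr0 powR0 ?expr0n ?mul0r //; apply/eqP; move: a1; lra.
congr (_ * _); have [h hG hd] := dom_ex hal G x; set x0 := rho h *m x.
have rx t w : TH G t -> w \in G -> root t (rho w *m x) != 0.
  move=> ht wG; have /andP[ht' _] := ht; have := reg (t ^ w)%g.
  rewrite mem_roots TH_conj // => /(_ isT) nz; rewrite (root_act hal _ _ ht').
  by case: ifP => _; rewrite ?oppr_eq0.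
rewrite /Cox3.poincare horner_sum.
rewrite [RHS](eq_bigr (fun w => zeta ^+ #|neg (rho w *m x0)|)).
  rewrite [LHS](reindex_inj (mulIg h)) /=; apply: eq_big => [g|g _]; first by rewrite groupMr.
  by rewrite rhoM -mulmxA.
move=> w wG; rewrite hornerXn /ninv; congr (_ ^+ _); apply: eq_card => s; rewrite !inE.
case hs : (TH G s) => //=; have /andP[hs' _] := hs.
have p0 : 0 < root (s ^ w)%g x0.
  rewrite lt_def hd ?TH_conj // andbT; apply: rx => //; exact: TH_conj.
rewrite (root_act hal w x0 hs'); have := root_neq0 hal w hs'.
case: (ltgtP (root s (rho w *m v0)) 0) => //= _ _; first by rewrite oppr_lt0 p0.
by rewrite ltNge (ltW p0).
Qed.

(** Invariance of [q], [Dx] and [mu] lets the limit integral be averaged over [G]; the phases then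
    sum to the length polynomial at [zeta]. *)
Lemma phi_lim q : inv q -> exists2 D, 0 <= D & forall M,
  normc (EA c (ee M) (dm * q) - kap * (kap' * poincare.[zeta]) * mu (fun x => q.@[rpt x] * (Dx x)%:C)) <= D / M.+1%:R.
Proof.
move=> iq; have cv := W_conv q.
have [D D0 hD] := @converges_lim R n _ uu _ _ (fun M => grow_E hal G (c - m%:R) (ee0 M) q) cv.
exists (normc (kap * #|G|%:R) * D) => [|M]; first by rewrite mulr_ge0 ?normc_ge0.
rewrite (EA_inv _ _ (inv_dm iq)) (E_delta _ (ee0 M)).
have S : #|G|%:R * mu (fun x => q.@[rpt x] * W x) = kap' * poincare.[zeta] * mu (fun x => q.@[rpt x] * (Dx x)%:C).
  transitivity (mu (fun x => \sum_(g in G) q.@[rpt (rho g *m x)] * W (rho g *m x))).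
    have gg g : g \in G -> grow (fun x : V => q.@[rpt (rho g *m x)] * W (rho g *m x)).
      move=> gG; apply: (grow_norm (grow_Dx q)) => x.
      rewrite -rpt_act iq ?groupV // W_E Dx_act // !normcM.
      have -> : normc (zeta ^+ #|neg (rho g *m x)|) = 1 by rewrite normcX normc_cis expr1n.
      have -> : normc kap' = 1; last by rewrite !mulr1.
      rewrite /kap'; elim: (roots rho G) => [|s r IH]; first by rewrite big_nil Normc.normc1.
      by rewrite big_cons normcM IH normc_cis mulr1.
    rewrite (mu_sum uu _ gg); symmetry; apply: sum_same => g gG.
    exact: (mu_act g (fun x => q.@[rpt x] * W x)).
  rewrite -(muZ uu _ (grow_Dx q)); apply: eq_mu => x.
  transitivity (q.@[rpt x] * (kap' * ((Dx x)%:C * \sum_(g in G) zeta ^+ #|neg (rho g *m x)|))).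
    rewrite !mulr_sumr; apply: eq_bigr => g gG; rewrite -rpt_act iq ?groupV // W_E Dx_act //.
    by congr (_ * _); rewrite mulrCA.
  rewrite sum_zeta; move: (_.@[_]) (_%:C) (_.[_]) => X Y Z; ring.
rewrite -[kap * (kap' * poincare.[zeta]) * _]mulrA -S mul_diff [normc (kap * #|G|%:R * _)]normcM.
apply: (@le_trans _ _ (normc (kap * #|G|%:R) * (D / M.+1%:R))).
  by apply: ler_wpM2l; [exact: normc_ge0|exact: hD].
by rewrite le_eqVlt; apply/orP; left; apply/eqP; exact: mulrA.
Qed.

Lemma wact1p g : wact g 1 = 1. Proof. exact: (rmorph1 (wact g)). Qed.
Lemma inv1 : inv 1. Proof. by move=> g _; exact: wact1p. Qed.

(** Positivity was proved for exponents strictly between 0 and 1, so [2c] is split into [k] equal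
    parts [s] and each root is repeated [k] times. The constant is uniform in the contour shift. *)
Lemma phi_low : exists2 k, 0 < k & forall M, k <= normc (EA c (ee M) 1).
Proof.
pose k := (Num.bound (2 * c)).+1; pose s := 2 * c / k%:R.
have k0 : 0 < k%:R :> R by rewrite ltr0n.
have s01 : 0 < s < 1.
  rewrite divr_gt0 ?mulr_gt0 //= ltr_pdivrMr // mul1r.
  by apply: lt_trans (archi_boundP _) _; rewrite ?mulr_ge0 ?(ltW c0) // ltr_nat.
pose ls := flatten [seq nseq k (al t) | t <- roots rho G].
pose T := \sum_t tt t.
have [b b0 hb] := @cpow_prod_positive R n _ uu s s01 ls T (enorm (lam0 rho v0)).
have tT t : tt t <= T.
  rewrite /T (bigD1 t) //= lerDl sumr_ge0 // => j _; exact: (ltW (tt_gt0 hal j)).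
exists b => // M; rewrite (EA_inv _ _ inv1) normcM.
have G1 : 1 <= normc #|G|%:R.
  have -> : (#|G|%:R : C) = (#|G|%:R)%:C by rewrite (rmorph_nat toC).
  by rewrite normc_real ger0_norm // ler1n cardG_gt0.
suff H : b%:C <= E c (ee M) 1.
  have h2 : b <= normc (E c (ee M) 1).
    apply: le_trans (Re_le_normc _); move: H; rewrite lecE /= => /andP[_ h].
    exact: le_trans h (ler_norm _).
  apply: le_trans h2 _; rewrite ler_peMl ?normc_ge0 //.
have N1 : ee M <= 1 by rewrite invf_le1 // ler1n.
have := hb (fun l => ee M * Mu.ev l v0) (ee M *: - lam0 rho v0).
have inls l : l \in ls -> exists2 t, TH G t & l = al t.
  by move=> /flattenP[? /mapP[t tr ->]]; rewrite mem_nseq => /andP[_ /eqP ->]; exists t => //; rewrite -mem_roots.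
have ttE t : TH G t -> Mu.ev (al t) v0 = tt t by move=> /andP[ht _]; rewrite /AB2.tt ht.
have h1 : forall l, l \in ls -> 0 < ee M * Mu.ev l v0 <= T.
  move=> l /inls[t ht ->]; rewrite (ttE t ht) mulr_gt0 ?(tt_gt0 hal) ?ee0 //=.
  apply: le_trans (tT t); rewrite ger_pMl ?(tt_gt0 hal) //.
have h2 : enorm (ee M *: - lam0 rho v0) <= enorm (lam0 rho v0).
  rewrite -scaleN1r !enormZ normrN1 mul1r ger0_norm ?(ltW (ee0 M)) //.
  by rewrite ler_piMl // enorm_ge0.
move=> /(_ h1 h2); congr (_ <= _); apply: eq_mu => x.
rewrite meval1 mul1r /AB2.wgt /weight scalerN; congr (_ * _).
rewrite /ls big_flatten big_map big_seq [RHS]big_seq; apply: eq_bigr => t tr.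
have ht : TH G t by rewrite -mem_roots.
rewrite big_nseq iter_mulr_1 (ttE t ht).
have wn : wl (ee M * tt t) (al t) x != 0 by rewrite wl_neq0 // gt_eqF // mulr_gt0 ?(tt_gt0 hal).
rewrite !cpowX //; congr (cpow _ _); rewrite /s mulrN mulrCA mulfV ?mulr1 ?mulrN //.
by rewrite gt_eqF.
Qed.

Notation stable := (stable rho al G c%:C).
Notation L := (EA c (ee 0)).

Lemma EA_avg c' e p : 0 < e -> EA c' e (avg p) = EA c' e p.
Proof.
move=> e0; rewrite /Delta.avg (EAZ hal) //.
have -> : EA c' e (\sum_(g in G) wact g p) = \sum_(g in G) EA c' e p.
  transitivity (\sum_(g in G) EA c' e (wact g p)); last by apply: eq_bigr => g gG; exact: EAW.
  elim/big_rec2: _ => [|i x y _ <-]; last by rewrite (EAD hal).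
  by rewrite -(scale0r 0) (EAZ hal) // mul0r.
rewrite (sum_same (x := EA c' e p)) // mulrA mulVf ?mul1r //; exact: (cardC_neq0 R G).
Qed.

(** The ideal is the radical of the functional at shift 1, and [delta^(2m)] is its nonzero element.
    Proportionality of the functionals, [EA_eps(1) L(p) = L(1) EA_eps(p)], and the lower bound on
    [EA_eps(1)] turn the limit 0 into exact vanishing of [L]. *)
Theorem stable_ideal_ex : poincare.[zeta] = 0 -> exists K, [/\ stable K, ~ K 1 & exists2 f, f != 0 & K f].
Proof.
move=> P0; have [k k0 hk] := phi_low.
have LD M := EAD hal G c (ee0 M); have LZ M := EAZ hal G c (ee0 M).
have LL M := EA_lin faith hal G c (ee0 M).
exists (rad L); split.
- apply: (rad_stable faith hal (LD 0%N) (LZ 0%N) _ (LL 0%N)); last exact: ly_surj.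
  by move=> g p gG; exact: EAW.
- move=> /(_ 1); rewrite mulr1 => L1; have := hk 0%N; rewrite L1 Normc.normc0 leNgt k0.
  by [].
exists dm; first by rewrite expf_neq0 // (delta_neq0 hal).
have key q : inv q -> L (dm * q) = 0.
  move=> iq; have [D D0 hD] := phi_lim iq; apply: normc_zero.
  apply: (archi_zero (D := normc (L 1) * D / k)); first exact: normc_ge0.
  move=> M; have U := functional_unique hal (LD 0%N) (LZ 0%N) (LD M) (LZ M) (LL 0%N) (LL M) (dm * q).
  have := hD M; rewrite P0 !mulr0 mul0r subr0 => h.
  apply: (div_bound k0).
  apply: (@le_trans _ _ (normc (EA c (ee M) 1) * normc (L (dm * q)))).
    by apply: ler_wpM2r; rewrite ?normc_ge0.
  apply: (@le_trans _ _ (normc (L 1 * EA c (ee M) (dm * q)))).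
    by rewrite U normcM; exact: lexx.
  rewrite normcM; apply: ler_wpM2l; [exact: normc_ge0|exact: h].
move=> q; rewrite -(EA_avg _ _ (ee0 0)) mulrC avgM; last exact: dm_inv.
rewrite mulrC; apply: key; exact: avg_inv.
Qed.

Lemma meval_prodR (x : V) : (delta ^+ m * cj (delta ^+ m)).@[rpt x] = (\prod_(s <- roots rho G) Mu.ev (al s) x ^+ (2 * m))%:C.
Proof.
have e : (delta ^+ m).@[rpt x] = (\prod_(s <- roots rho G) Mu.ev (al s) x ^+ m)%:C.
  have -> : (delta ^+ m).@[rpt x] = delta.@[rpt x] ^+ m by exact: (rmorphXn (meval _)).
  rewrite rptE /Delta.delta; elim: (roots rho G) => [|s r IH]; first by rewrite !big_nil meval1 expr1n.
  rewrite !big_cons mevalM exprMn IH rcM /Delta.alC zpt_lin; congr (_ * _).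
  have -> : lz (0 * Mu.ev (al s) (0 : V)) (al s) x = toC (Mu.ev (al s) x) by apply: eqC => /=; rewrite ?mul0r.
  by rewrite -(rmorphXn toC).
rewrite mevalM cjE e.
have -> : conjc (\prod_(s <- roots rho G) Mu.ev (al s) x ^+ m)%:C = (\prod_(s <- roots rho G) Mu.ev (al s) x ^+ m)%:C.
  by apply: eqC => //=; rewrite oppr0.
rewrite -rcM -big_split; congr (_%:C); apply: eq_bigr => s _; by rewrite /= -exprD mul2n addnn.
Qed.

(** Vanishing of all shifted functionals on [K] gives [mu (f h |delta|^(2a)) = 0] for every [h]. To
    apply [mu_pos], let [X] be [mu] of [|f delta^m|^2]: the bound [|delta|^(2m) <= |delta|^(2a) Q],
    with [Q] polynomial, yields [2k X <= k^2 Y] for every [k], and small [k] forces [X = 0]. *)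
Theorem stable_ideal_zero K f : poincare.[zeta] != 0 -> stable K -> ~ K 1 -> K f -> f = 0.
Proof.
move=> P0 sK K1 Kf.
have LD M := EAD hal G c (ee0 M); have LZ M := EAZ hal G c (ee0 M).
have LL M := EA_lin faith hal G c (ee0 M).
have z1 h : mu (fun x => (f * h).@[rpt x] * (Dx x)%:C) = 0.
  have Kq : K (avg (f * h)) by apply: (stable_avg sK); rewrite mulrC; exact: (stableM sK).
  have ia : inv (avg (f * h)) by exact: avg_inv.
  have [D D0 hD] := phi_lim ia.
  have z2 : kap * (kap' * poincare.[zeta]) * mu (fun x => (avg (f * h)).@[rpt x] * (Dx x)%:C) = 0.
    apply: normc_zero; apply: (archi_zero (D := D)); first exact: normc_ge0.
    move=> M; have := hD M.
    have -> : EA c (ee M) (dm * avg (f * h)) = 0.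
      apply: (functional_stable faith hal (LD M) (LZ M) _ (LL M) sK K1); last exact: (stableM sK).
      by move=> g p gG; exact: EAW.
    by rewrite sub0r normcN.
  have nz : kap * (kap' * poincare.[zeta]) != 0 by exact: (mulf_neq0 kap0 (mulf_neq0 kap'0 P0)).
  have z3 : mu (fun x => (avg (f * h)).@[rpt x] * (Dx x)%:C) = 0.
    by move/eqP: z2; rewrite mulf_eq0 (negbTE nz) /= => /eqP.
  transitivity (mu (fun x => (avg (f * h)).@[rpt x] * (Dx x)%:C)); last exact: z3.
  have gg g : grow (fun x : V => (wact g (f * h)).@[rpt x] * (Dx x)%:C) by exact: grow_Dx.
  transitivity (#|G|%:R^-1 * mu (fun x => \sum_(g in G) (wact g (f * h)).@[rpt x] * (Dx x)%:C)); last first.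
    rewrite -(muZ uu _ (grow_sum _ (fun g _ => gg g))); apply: eq_mu => x.
    rewrite /Delta.avg mevalZ -mulrA; congr (_ * _); rewrite -mulr_suml; congr (_ * _).
    exact: (esym (raddf_sum (meval _) _ _ _)).
  rewrite (mu_sum uu _ (fun g _ => gg g)) (sum_same (x := mu (fun x => (f * h).@[rpt x] * (Dx x)%:C))).
    by rewrite mulrA mulVf ?mul1r //; exact: (cardC_neq0 R G).
  move=> g gG; rewrite -(mu_act g); apply: eq_mu => x.
  by rewrite -rpt_act -wactM mulVg wact1 Dx_act.
set g := f * delta ^+ m.
suff : g = 0.
  move/eqP; rewrite /g mulf_eq0 => /orP[/eqP //|]; by rewrite expf_eq0 (negbTE (delta_neq0 hal G)) andbF.
apply: (mu_pos (uu_span rho)).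
pose Qx (x : V) : R := \prod_(s <- roots rho G) (1 + Mu.ev (al s) x ^+ 2) ^+ m.
have gQ0 : grow (fun x : V => (Qx x)%:C).
  rewrite /Qx; elim: (roots rho G) => [|s r IH].
    by have := grow_cst n (1 : C); congr grow; apply/funext => x; rewrite big_nil.
  have g2 : grow (fun x : V => ((1 + Mu.ev (al s) x ^+ 2) ^+ m)%:C).
    elim: m => [|j IHj]; first by have := grow_cst n (1 : C); congr grow; apply/funext => x; rewrite expr0.
    have := growM (growD (grow_cst n (1 : C)) (growM (grow_ev (al s)) (grow_ev (al s)))) IHj.
    by congr grow; apply/funext => x; rewrite [_ ^+ j.+1]exprS rcM rcD expr2 rcM.
  by have := growM g2 IH; congr grow; apply/funext => x; rewrite big_cons rcM.
have gQ : grow (fun x : V => (g * cj g).@[rpt x] * (Qx x)%:C) by exact: (growM (grow_rpt uu (g * cj g)) gQ0).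
set X := mu _; set Y := mu (fun x => (g * cj g).@[rpt x] * (Qx x)%:C).
have gE x : (g * cj g).@[rpt x] = (f * cj f).@[rpt x] * (delta ^+ m * cj (delta ^+ m)).@[rpt x].
  by rewrite !mevalM !cjE /g mevalM conjM mulrACA.
have F0 (p : A) (x : V) : 0 <= (p * cj p).@[rpt x] by rewrite mevalM cjE mul_conjC_ge0.
have X0 : 0 <= X by apply: mu_ge0 => [|x]; [exact: (grow_rpt uu (g * cj g))|exact: F0].
have bound (k : R) : (2 * k)%:C * X <= (k ^+ 2)%:C * Y.
  rewrite -(muZ uu _ (grow_rpt uu (g * cj g))) -(muZ uu _ gQ) -subr_le0.
  have gA : grow (fun x : V => (2 * k)%:C * (g * cj g).@[rpt x]) by exact: growM (grow_cst _ _) (grow_rpt uu _).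
  have gB : grow (fun x : V => (k ^+ 2)%:C * ((g * cj g).@[rpt x] * (Qx x)%:C)) by exact: growM (grow_cst _ _) gQ.
  rewrite -[X in _ + X]mulN1r -(muZ uu _ gB) -(muD uu gA (growM (grow_cst _ _) gB)) -(z1 (cj f)).
  apply: mu_le => [||x]; [exact: growD gA (growM (grow_cst _ _) gB)|exact: grow_Dx|].
  rewrite gE meval_prodR.
  have -> : (2 * k)%:C * ((f * cj f).@[rpt x] * (\prod_(s <- roots rho G) Mu.ev (al s) x ^+ (2 * m))%:C) +
     -1 * ((k ^+ 2)%:C * ((f * cj f).@[rpt x] * (\prod_(s <- roots rho G) Mu.ev (al s) x ^+ (2 * m))%:C * (Qx x)%:C)) =
     (f * cj f).@[rpt x] * ((\prod_(s <- roots rho G) Mu.ev (al s) x ^+ (2 * m)) * (2 * k - k ^+ 2 * Qx x))%:C.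
    rewrite (rcM _ (_ - _)) rcD rcN (rcM (k ^+ 2)); move: (_.@[_]) (_%:C) (_%:C) (_%:C) (_%:C) => Z1 Z2 Z3 Z4 Z5; ring.
  apply: ler_wpM2l; first exact: F0.
  rewrite lecR; apply: quad_bound.
  - by apply: prodr_gt0 => s _; rewrite exprn_gt0 // ltr_wpDr // sqr_ge0.
  - by apply: prodr_ge0 => s _; rewrite exprM exprn_ge0 // sqr_ge0.
  rewrite /Dx /Qx -big_split; apply: ler_prod => s _; rewrite exprM exprn_ge0 ?sqr_ge0 //= -exprM.
  exact: pow_bound.
apply: normc_zero; apply: (archi_zero (D := normc Y)); first exact: normc_ge0.
by move=> M; exact: (complex_quad (ee0 M) X0 (bound (ee M))).
Qed.
End AB3.
End AB3.

(** * Localisation at roots, and nilpotency of the coordinates *)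

Module Loc.
From HB Require Import structures.
From mathcomp Require Import boolp reals complex mpoly.
From mathcomp Require Import ring.
Set Implicit Arguments.
Unset Strict Implicit.
Unset Printing Implicit Defensive.
Import Order.TTheory GRing.Theory Num.Theory ComplexField.
Local Open Scope ring_scope.
From mathcomp Require Import lra zify.
Require Import Defs.
Import PolyAct Root Cox Cox2 Cox3 Delta Hilb Chev1 Chev2 Dunkl.

Section Nil.
Variables (A : comPzRingType) (I : A -> Prop).
Hypotheses (ID : forall p q, I p -> I q -> I (p + q)) (IM : forall a p, I p -> I (a * p)).
Definition nilp p := exists k, I (p ^+ k).
Lemma nilpM a p : nilp p -> nilp (a * p).
Proof. by move=> [k h]; exists k; rewrite exprMn; exact: IM. Qed.
Lemma nilp_leq p k l : (k <= l)%N -> I (p ^+ k) -> I (p ^+ l).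
Proof. by move=> kl h; rewrite -(subnK kl) exprD; exact: IM. Qed.
Lemma nilpD p q : nilp p -> nilp q -> nilp (p + q).
Proof.
move=> [k hk] [l hl]; exists (k + l)%N; rewrite exprDn.
have I0 : I 0 by rewrite -(mul0r (p ^+ k)); exact: IM.
apply: (big_ind I) => // i _; rewrite -mulr_natl; apply: IM.
have [ki|ik] := leqP k (k + l - i); first by rewrite mulrC; apply: IM; exact: nilp_leq ki hk.
apply: IM; apply: nilp_leq hl; lia.
Qed.
Lemma nilp_sum (T : Type) (r : seq T) (P : pred T) (F : T -> A) : I 0 ->
  (forall i, P i -> nilp (F i)) -> nilp (\sum_(i <- r | P i) F i).
Proof.
move=> I0 h; apply: (big_ind nilp) => //; last exact: nilpD.
by exists 1%N; rewrite expr1.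
Qed.
End Nil.

Lemma dunkl_ring_identity (W : comPzRingType) (p pk dpk f df q g b e p1 dg dt hh sb : W) : p * dpk = e * pk ->
  p1 = p * pk -> dg = df - q * g -> dt = dpk * f + pk * df - q * (b + pk * g) -> hh = pk * f ->
  sb = p * (q * b) -> p1 * dg = p * dt - e * hh + sb.
Proof.
move=> h -> -> -> -> ->.
have -> : p * (dpk * f + pk * df - q * (b + pk * g)) - e * (pk * f) + p * (q * b) =
  (p * dpk - e * pk) * f + p * pk * (df - q * g) by ring.
by rewrite h subrr mul0r add0r.
Qed.

Lemma sum_splitB (W : zmodType) (T : finType) (P Q : pred T) (B : {set T}) (F : T -> W) :
  (forall s, s \in B -> P s) -> (forall s, Q s = P s && (s \notin B)) ->
  \sum_(s | P s) F s = \sum_(s in B) F s + \sum_(s | Q s) F s.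
Proof.
move=> BP QE; rewrite (bigID (mem B)) /=; congr (_ + _); apply: eq_bigl => s; last by rewrite QE.
by case sB : (s \in B); rewrite ?andbF // BP.
Qed.

Section Loc.
Variables (R : realType) (gT : finGroupType) (n : nat).
Variable rho : mx_representation R [set: gT] n.
Hypothesis faith : mx_faithful rho.
Variables (al : gT -> 'rV[R]_n) (v0 : 'cV[R]_n).
Local Notation refl := (is_reflection rho).
Local Notation sp := (sp rho).
Local Notation coroot := (coroot rho).
Hypothesis hal : forall s, refl s ->
  [/\ rho s = 1%:M - coroot (al s) *m al s, sp (al s) (al s) = 2 & 0 < (al s *m v0) 0 0].
Local Notation C := R[i].
Local Notation A := {mpoly C[n]}.
Implicit Types p q f : A.
Local Notation wact := (wact rho).
Local Notation TH := (TH rho).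
Local Notation nab := (nab rho al).
Local Notation rowC := (rowC al).
Local Notation corC := (corC rho al).
Local Notation alC := (alC al).
Local Notation root := (Cox.root al).
Local Notation toC := (real_complex R).
Variable c : C.
Notation stable G := (stable rho al G c).
Notation dunkl G := (dunkl rho al G c).

Definition root_mx (S : pred gT) : 'M[R]_(#|{: gT}|, n) := \matrix_(i, j) (if S (enum_val i) then al (enum_val i) 0 j else 0).

Lemma root_mx_act (S : pred gT) (v : 'cV[R]_n) : root_mx S *m v = 0 <-> (forall s, S s -> root s v = 0).
Proof.
have E i : (root_mx S *m v) i 0 = if S (enum_val i) then root (enum_val i) v else 0.
  rewrite mxE; case: ifP => h.
    by rewrite /Cox.root mxE; apply: eq_bigr => j _; rewrite mxE h.
  by rewrite big1 // => j _; rewrite mxE h mul0r.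
split=> [h s Ss|h]; last by apply/matrixP => i j; rewrite ord1 E mxE; case: ifP => // /h.
by have := E (enum_rank s); rewrite h enum_rankK Ss mxE.
Qed.

Lemma lin_root_span (S : pred gT) (l : 'rV[R]_n) (I : A -> Prop) : (forall p q, I p -> I q -> I (p + q)) ->
  (forall a p, I p -> I (a * p)) -> I 0 -> (forall s, S s -> nilp I (alC s)) ->
  l *m cokermx (root_mx S) = 0 -> nilp I (lin (map_mx toC l)).
Proof.
move=> ID IM I0 hS /eqP; rewrite -submxE => /submxP[D ->].
have -> : lin (map_mx toC (D *m root_mx S)) = \sum_(i | S (enum_val i)) toC (D 0 i) *: alC (enum_val i).
  rewrite /lin; transitivity (\sum_j \sum_(i | S (enum_val i)) (toC (D 0 i) * toC (al (enum_val i) 0 j)) *: 'X_j : A).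
    apply: eq_bigr => j _; rewrite mxE -scaler_suml; congr (_ *: _).
    rewrite mxE rmorph_sum [RHS]big_mkcond; apply: eq_bigr => i _; rewrite mxE rmorphM.
    by case: ifP => // _; rewrite rmorph0 mulr0.
  rewrite exchange_big; apply: eq_bigr => i _; rewrite /Delta.alC /lin scaler_sumr.
  by apply: eq_bigr => j _; rewrite scalerA !mxE.
apply: nilp_sum => // i Si; rewrite -mul_mpolyC; apply: nilpM => //; exact: hS.
Qed.


Section Main.
Variable J : A -> Prop.
Hypothesis sJ : stable [set: gT]%G J.
Hypothesis J1 : ~ J 1.
Let JD := stableD sJ.
Let JM := stableM sJ.

Definition prodB (B : {set gT}) : A := \prod_(s in B) alC s.
Definition goodB (B : {set gT}) := (B \subset [set s | refl s]) /\ forall k, ~ J (prodB B ^+ k).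

Lemma goodB0 : goodB set0.
Proof. by split; [exact: sub0set|move=> k; rewrite /prodB big_set0 expr1n]. Qed.

Lemma maxB : exists B, goodB B /\ forall s, refl s -> s \notin B -> exists k, J ((alC s * prodB B) ^+ k).
Proof.
pose Pb : pred {set gT} := fun B => `[< goodB B >].
have g0 : Pb set0 by apply/asboolP; exact: goodB0.
case: (arg_maxnP (P := Pb) (fun B : {set gT} => #|B|) g0) => B /asboolP gB mB.
exists B; split=> // s hs sB; apply: contrapT => hn.
have : goodB (s |: B).
  split; first by apply/subsetP => t; rewrite !inE => /orP[/eqP ->//|tB]; have /subsetP/(_ _ tB) := gB.1; rewrite inE.
  move=> k hk; apply: hn; exists k; move: hk; by rewrite /prodB big_setU1.
by move=> /asboolP /mB; rewrite /geq /= cardsU1 sB add1n ltnn.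
Qed.

Hypothesis J0 : exists2 f, f != 0 & J f.
Hypothesis zeroB : forall (G : {group gT}) (x : 'cV[R]_n), refl_group rho G ->
  (forall g, (g \in G) = (rho g *m x == x)) -> G != [set: gT] :> {set gT} ->
  forall K f, stable G K -> ~ K 1 -> K f -> f = 0.
Hypothesis rT : refl_group rho [set: gT]%G.

(** Why a parabolic subgroup appears: the roots outside a maximal [B] are nilpotent modulo the
    localised ideal, hence so is every combination of them. No root of [B] can then lie in their
    span, and some point [x] is killed by exactly the roots outside [B]; its stabiliser is proper
    once [B] is nonempty. *)
Lemma root_nilp s1 : refl s1 -> nilp J (alC s1).
Proof.
move=> hs0; have [B [[Bsub Bn] Bmax]] := maxB.
have J00 : J 0 by have [f _ Jf] := J0; exact: stable0 sJ Jf.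
(* For empty [B] the product is 1, and maximality is the claim itself. *)
have [B0|[t0 t0B]] := set_0Vmem B.
  have [|k] := Bmax s1 hs0; first by rewrite B0 inE.
  by rewrite B0 /prodB big_set0 mulr1 => hk; exists k.
exfalso.
pose pi := prodB B; pose JB f := exists k, J (pi ^+ k * f).
have Brefl s : s \in B -> refl s by move=> sB; have /subsetP/(_ _ sB) := Bsub; rewrite inE.
have JBup k l f : (k <= l)%N -> J (pi ^+ k * f) -> J (pi ^+ l * f).
  by move=> kl h; rewrite -(subnK kl) exprD -mulrA; exact: JM.
have JBD p q : JB p -> JB q -> JB (p + q).
  move=> [k hk] [l hl]; exists (maxn k l); rewrite mulrDr; apply: JD.
    exact: JBup (leq_maxl _ _) hk.
  exact: JBup (leq_maxr _ _) hl.
have JBM a p : JB p -> JB (a * p) by move=> [k hk]; exists k; rewrite mulrCA; exact: JM.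
have JB0 : JB 0 by exists 0%N; rewrite mulr0.
have JB1 : ~ JB 1 by move=> [k]; rewrite mulr1; exact: Bn.
pose S : pred gT := fun s => refl s && (s \notin B).
have nS s : S s -> nilp JB (alC s).
  move=> /andP[hs sB]; have [k hk] := Bmax s hs sB; exists k, k.
  by rewrite mulrC -exprMn.
(* The columns of [K] span the common kernel of the roots in [S]; [x] will be a generic point of
   it. *)
have [K [hK1 hK2]] : exists K : 'M[R]_n, root_mx S *m K = 0 /\ (forall l : 'rV[R]_n, l *m K = 0 -> l *m cokermx (root_mx S) = 0).
  by exists (cokermx (root_mx S)); split; [exact: mulmx_coker|move=> l].
have [w hw] : exists w : 'cV[R]_n, forall s, s \in B -> root s (K *m w) != 0.
  have [|w hw] := avoid_hyperplanes (ls := [seq al s *m K | s <- enum B]).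
    move=> l /mapP[s]; rewrite mem_enum => sB ->; apply/eqP => e0.
    have [k [j hk]] := lin_root_span JBD JBM JB0 nS (hK2 _ e0).
    apply: (Bn (j + k)%N); rewrite exprD.
    have [Q e] : exists Q : A, prodB B = Q * alC s.
      by exists (\prod_(i in B | i != s) alC i); rewrite /prodB (bigD1 s sB) mulrC.
    rewrite {2}e exprMn mulrCA; apply: JM; exact: hk.
  exists w => s sB; rewrite /Cox.root mulmxA; apply: hw.
  by apply/mapP; exists s; [rewrite mem_enum|reflexivity].
pose x := K *m w.
have xS s : S s -> root s x = 0.
  move=> Ss; have [h _] := root_mx_act S x; apply: (h _ s Ss).
  by rewrite /x mulmxA hK1 mul0mx.
pose G : {group gT} := <<[set s | TH [set: gT]%G s & root s x == 0]>>%G.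
have GE g : (g \in G) = (rho g *m x == x).
  apply/idP/eqP => [gG|e]; last by apply: (stab_gen faith hal rT) => //; rewrite inE.
  have fixg : group_set [set h : gT | rho h *m x == x].
    apply/group_setP; split=> [|g1 g2]; first by rewrite inE rho1 mul1mx.
    by rewrite !inE rhoM -mulmxA => /eqP h1 /eqP ->; rewrite h1.
  have /subsetP/(_ g gG) : G \subset mk_group fixg; last by rewrite inE => /eqP.
  rewrite gen_subG; apply/subsetP => s; rewrite !inE => /andP[/andP[hs _] /eqP r0].
  by rewrite (refl_act hal x hs) r0 scale0r subr0.
have rG : refl_group rho G.
  apply: genS; apply/subsetP => s hs; rewrite inE; have := hs; rewrite inE => /andP[/andP[hs' _] _].
  by rewrite /Cox.TH hs' /=; exact: mem_gen.
have THG s : TH G s = S s.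
  rewrite /Cox.TH /S; case hs : (refl s); last by [].
  rewrite !andTb GE (refl_act hal x hs).
  have [sB|sB] := boolP (s \in B); last first.
    by rewrite (xS s); [rewrite scale0r subr0 eq_refl|rewrite /S hs sB].
  apply/negbTE; apply/eqP => e; have := hw s sB; rewrite -/x => /eqP; apply.
  have : root s (x - root s x *: coroot (al s)) = root s x by rewrite e.
  have := root_self hal x hs; rewrite (refl_act hal x hs) e; lra.
have GT : G != [set: gT] :> {set gT}.
  apply/eqP => e; have h : t0 \in (G : {set gT}) by rewrite e inE.
  by have := THG t0; rewrite /Cox.TH /S t0B (Brefl _ t0B) /= h.
have conjB g s : g \in G -> s \in B -> (s ^ g)%g \in B.
  move=> gG sB; have hs := Brefl s sB; have := hw s sB; rewrite -/x.
  have /eqP {1}<- : rho g *m x == x by rewrite -GE.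
  rewrite (root_act hal g x hs) => h; apply: contraT => nB.
  have : root (s ^ g)%g x = 0 by apply: xS; rewrite /S (refl_conj _ hs).
  by move=> r0; move: h; rewrite r0 oppr0 if_same eqxx.
have pi_act g : g \in G -> exists2 e : C, e ^+ 2 = 1 & wact g pi = e *: pi.
  move=> gG; have gV : g^-1%g \in G by rewrite groupV.
  pose e s : C := if 0 < root s (rho g^-1%g *m v0) then 1 else -1.
  exists (\prod_(s in B) e s).
    rewrite -prodrXl; apply: big1 => s _; rewrite /e.
    by case: (0 < _); [exact: expr1n|rewrite sqrrN; exact: expr1n].
  rewrite /pi /prodB (rmorph_prod (wact g)) /=.
  rewrite (eq_bigr (fun s => e s *: alC (s ^ g^-1)%g)); last first.
    move=> s sB; rewrite (wact_alC hal g (Brefl s sB)) /e.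
    by case: (0 < _); rewrite ?scale1r ?scaleN1r.
  rewrite scaler_prod; congr (_ *: _).
  rewrite [RHS](reindex_inj (conjg_inj g^-1%g)) /=; apply: eq_bigl => s.
  apply/idP/idP => h; first exact: conjB.
  by have := conjB g _ gG h; rewrite conjgKV.
(* The group [G] permutes the roots of [B] up to sign, so even powers of [pi] are invariant. *)
have piE g k : g \in G -> wact g (pi ^+ (2 * k)) = pi ^+ (2 * k).
  move=> gG; have [e e2 h] := pi_act g gG.
  by rewrite (rmorphXn (wact g)) /= h exprZn (exprM e) e2 expr1n scale1r.
have JB2 f : JB f -> exists k, J (pi ^+ (2 * k) * f).
  by move=> [k hk]; exists k; apply: JBup hk; rewrite leq_pmull.
have stJB : stable G JB.
  split; [exact: JBD|exact: JBM| |].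
    move=> g f gG /JB2[k hk]; exists (2 * k)%N.
    by rewrite -(piE g k gG) -(rmorphM (wact g)) /=; apply: (stableW sJ) => //; rewrite inE.
  move=> y f /JB2[k hk]; exists (2 * k).+1.
  set h := pi ^+ (2 * k) * f in hk.
  have nabS s : S s -> nab s h = pi ^+ (2 * k) * nab s f.
    move=> Ss; have /andP[hs _] := Ss; rewrite /Delta.nab ddiffM; last exact: (rowC_neq0 hal).
    have fx : act (1%:M - corC s *m rowC s) (pi ^+ (2 * k)) = pi ^+ (2 * k).
      have sG : s \in G by have : TH G s; [rewrite THG|move=> /andP[]].
      have w1 : wact s (pi ^+ (2 * k)) = pi ^+ (2 * k) by exact: piE.
      have hs2 : refl s by exact: hs.
      exact: (etrans (esym (wact_refl faith hal (pi ^+ (2 * k)) hs2)) w1).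
    have d0 : ddiff (corC s) (rowC s) (pi ^+ (2 * k)) = 0 by exact: (ddiff_fix (rowC_neq0 hal hs) fx).
    exact: (etrans (congr2 (fun a b => a * f + b * ddiff (corC s) (rowC s) f) d0 fx) (etrans (congr1 (fun z => z + _) (mul0r f)) (add0r _))).
  have nabB s : s \in B -> J (pi * nab s h).
    move=> sB; have hs := Brefl s sB; have [Q e] : exists Q : A, pi = Q * alC s.
      by exists (\prod_(i in B | i != s) alC i); rewrite /pi /prodB (bigD1 s sB) mulrC.
    rewrite e -mulrA; apply: JM; rewrite -(nabP faith hal h hs).
    by apply: (stableB sJ); [exact: hk|apply: (stableW sJ); [rewrite inE|exact: hk]].
  (* The Dunkl operators of [G] and of the whole group differ by the terms of [B], whose
     denominators divide [pi]; differentiating the power of [pi] adds another error. One extra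
     factor [pi] clears both. *)
  have key : pi ^+ (2 * k).+1 * dunkl G y f = pi * dunkl [set: gT]%G y h
     - (2 * k)%:R * (pd y pi) * h + c *: \sum_(s in B) (rowC s *m y) 0 0 *: (pi * nab s h).
    have pdX j : pi * pd y (pi ^+ j) = j%:R * pd y pi * pi ^+ j.
      elim: j => [|j IH]; first by rewrite expr0 -[1]/(1%:MP) pdC mulr0 !mul0r.
      rewrite exprS pdM mulrDr mulrCA [pi * (pi * _)]mulrA -[pi * pi * _]mulrA IH -natr1.
      by move: (pd y pi) (pi ^+ j) => X Y; ring.
    have e1 : \sum_(s | TH [set: gT]%G s) (rowC s *m y) 0 0 *: nab s h =
       \sum_(s in B) (rowC s *m y) 0 0 *: nab s h + pi ^+ (2 * k) * \sum_(s | TH G s) (rowC s *m y) 0 0 *: nab s f.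
      have E : \sum_(s | TH G s) (rowC s *m y) 0 0 *: nab s h = pi ^+ (2 * k) * \sum_(s | TH G s) (rowC s *m y) 0 0 *: nab s f.
        rewrite mulr_sumr; apply: eq_bigr => s; rewrite THG => Ss; rewrite (nabS s Ss).
        exact: scalerAr.
      rewrite -E; apply: sum_splitB => s.
        by move=> /Brefl hs; rewrite /Cox.TH hs inE.
      by rewrite THG /S /Cox.TH inE andbT.
    have e2 : c *: (\sum_(s in B) (rowC s *m y) 0 0 *: (pi * nab s h)) = pi * (c *: \sum_(s in B) (rowC s *m y) 0 0 *: nab s h).
      rewrite -scalerAr mulr_sumr; congr (_ *: _); apply: eq_bigr => s _; exact: scalerAr.
    have pdh : pd y h = pd y (pi ^+ (2 * k)) * f + pi ^+ (2 * k) * pd y f by exact: pdM.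
    apply: (dunkl_ring_identity (pdX (2 * k)%N) (exprS pi (2 * k)%N) (q := c%:MP)
      (g := \sum_(s | TH G s) (rowC s *m y) 0 0 *: nab s f) (b := \sum_(s in B) (rowC s *m y) 0 0 *: nab s h)
      (df := pd y f) (f := f)).
    - exact: (congr1 (fun z => pd y f - z) (esym (mul_mpolyC _ _))).
    - exact: (congr2 (fun a b => a - b) pdh (etrans (esym (mul_mpolyC _ _)) (congr1 (fun z => c%:MP * z) e1))).
    - exact: erefl.
    exact: (etrans e2 (congr1 (fun z => pi * z) (esym (mul_mpolyC _ _)))).
  rewrite key; apply: JD; last first.
    apply: (stableZ _ sJ); apply: (big_ind J); [exact: J00|exact: JD|].
    by move=> s sB; apply: (stableZ _ sJ); exact: nabB.
  apply: (stableB sJ); last exact: JM.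
  by apply: JM; exact: (stableY sJ).
have [f f0 Jf] := J0.
have JBf : JB f by exists 0%N; rewrite expr0 mul1r.
by have := zeroB rG GE GT stJB JB1 JBf; move/eqP; rewrite (negbTE f0).
Qed.

Hypothesis nofix : forall v : 'cV[R]_n, (forall g, rho g *m v = v) -> v = 0.

(** Without fixed vectors the roots have no common zero, so every coordinate is a combination of
    nilpotent roots. *)
Lemma var_nilp : exists N, forall i, J ('X_i ^+ N).
Proof.
have J00 : J 0 by have [f _ Jf] := J0; exact: stable0 sJ Jf.
have co0 : cokermx (root_mx refl) = 0.
  apply/matrixP => i j; have : col j (cokermx (root_mx refl)) = 0; last by move/matrixP/(_ i 0); rewrite !mxE.
  apply: nofix => g; set v := col _ _.
  have rv s : refl s -> root s v = 0.
    move=> hs; have [h _] := root_mx_act refl v; apply: h => //.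
    by rewrite /v colE mulmxA mulmx_coker mul0mx.
  have fixg : group_set [set h : gT | rho h *m v == v].
    apply/group_setP; split=> [|g1 g2]; first by rewrite inE rho1 mul1mx.
    by rewrite !inE rhoM -mulmxA => /eqP h1 /eqP ->; rewrite h1.
  have : g \in mk_group fixg; last by rewrite inE => /eqP.
  apply: (subsetP _ g (subsetP rT g (in_setT g))); rewrite gen_subG; apply/subsetP => s; rewrite !inE => /andP[hs _].
  by rewrite (refl_act hal v hs) rv // scale0r subr0.
have h i : exists k, J ('X_i ^+ k).
  rewrite -lin_delta -(map_delta_mx toC).
  by apply: (lin_root_span (S := refl) JD JM J00 root_nilp); rewrite co0 mulmx0.
have [k hk] := choice h.
exists (\sum_i k i)%N => i; apply: (nilp_leq JM _ (hk i)).
by rewrite (bigD1 i) //= leq_addr.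
Qed.
End Main.
End Loc.
End Loc.

(** * The order of [zeta] and the roots of the length polynomial *)

Module Fin1.
From HB Require Import structures.
From mathcomp Require Import boolp reals complex mpoly.
From mathcomp Require Import exp trigo.
From mathcomp Require Import ring lra zify.
Set Implicit Arguments.
Unset Strict Implicit.
Unset Printing Implicit Defensive.
Import Order.TTheory GRing.Theory Num.Theory ComplexField.
Local Open Scope ring_scope.
Local Open Scope complex_scope.
Require Import Defs.
Import Cpow Cpow2 Ulim Mu Mu2 Mu3 Tame PosSeries Pos2.
Import PolyAct Root Cox Cox2 Cox3 Delta Hilb Chev1 Chev2 Dunkl PartM.

Section Zeta.
Variable R : realType.
Notation C := R[i].
Lemma cis_nat (N : nat) : cis (2 * (N%:R * pi)) = 1 :> C.
Proof.
elim: N => [|N IH]; first by rewrite mul0r mulr0 cis0.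
have -> : 2 * (N.+1%:R * pi) = 2 * (N%:R * pi) + (pi + pi) :> R by rewrite -natr1; ring.
have cpi : cis (pi + pi) = 1 :> C.
  by rewrite /cis cosD sinD cospi sinpi; apply: eqC => /=; ring.
by rewrite cisD IH cpi mulr1.
Qed.

(** Subtract the integer part; a remainder [r] in []0, 1[] would give
    [cos(2 r pi) = 1 - 2 sin(r pi)^2 < 1]. *)
Lemma cis_eq1 (t : R) : 0 <= t -> cis (2 * (t * pi)) = 1 :> C -> exists N : nat, t = N%:R.
Proof.
move=> t0 h; pose N := Num.truncn t; exists N.
have /andP[tN tN1] : N%:R <= t < N.+1%:R by exact: truncn_itv.
have h2 : cis (2 * ((t - N%:R) * pi)) = 1 :> C.
  have e : 2 * (t * pi) = 2 * ((t - N%:R) * pi) + 2 * (N%:R * pi) by ring.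
  by move: h; rewrite e cisD cis_nat mulr1.
have [|r0] := eqVneq (t - N%:R) 0; first by move/eqP; rewrite subr_eq0 => /eqP.
exfalso; set r := t - N%:R in h2 r0.
have rp : 0 < r by rewrite lt_def r0 subr_ge0.
have r1 : r < 1 by rewrite /r ltrBlDl -natr1 addrC in tN1 *; lra.
have p0 := pi_gt0 R.
have s0 : 0 < sin (r * pi) by apply: sin_gt0_pi; rewrite mulr_gt0 //= -[ltRHS]mul1r ltr_pM2r.
have c1 : cos (2 * (r * pi)) = 1 by have := congr1 (@complex.Re R) h2.
have : cos (2 * (r * pi)) = 1 - 2 * sin (r * pi) ^+ 2.
  have -> : 2 * (r * pi) = r * pi + r * pi by ring.
  by rewrite cosD -!expr2 cos2sin2; ring.
rewrite c1; move: s0; set s := sin _ => s0; have : 0 < s ^+ 2 by rewrite exprn_gt0.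
lra.
Qed.

Variables (c : rat) (m : nat).
Hypothesis mc : c <= m%:R.
Let a : R := m%:R - ratr c.
Lemma zeta_pow k : ((cis (2 * (a * pi)) : C) ^+ k == 1) = (`|denq c| %| k)%N.
Proof.
rewrite cisX; have -> : k%:R * (2 * (a * pi)) = 2 * ((k%:R * a) * pi) by ring.
have a0 : 0 <= a by rewrite /a subr_ge0 -(ratr_nat R m) ler_rat.
have cE : c * (denq c)%:~R = (numq c)%:~R by rewrite -[X in X * _]divq_num_den divfK // intr_eq0 denq_neq0.
have dE : (denq c) = (`|denq c|%N : int) by rewrite gez0_abs // ltW // denq_gt0.
apply/eqP/idP => [|/dvdnP[q ->]].
  move=> /(cis_eq1 (mulr_ge0 (ler0n _ _) a0))[N hN].
  have e1 : k%:R * (m%:R - c) = N%:R :> rat.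
    apply: (fmorph_inj (ratr : {rmorphism rat -> R})).
    rewrite (rmorphM (ratr : {rmorphism rat -> R})) (rmorphB (ratr : {rmorphism rat -> R})) /= !ratr_nat.
    exact: hN.
  have e2 : ((k%:Z * (m%:Z * denq c - numq c))%:~R : rat) = (N%:Z * denq c)%:~R.
    rewrite rmorphM rmorphB rmorphM /= rmorphM /= -cE.
    by rewrite -[N%:~R]/(N%:R : rat) -[k%:~R]/(k%:R : rat) -[m%:~R]/(m%:R : rat) -e1; ring.
  have {}e2 := intr_inj e2.
  have : (denq c %| k%:Z * numq c)%Z.
    apply/dvdzP; exists (k%:Z * m%:Z - N%:Z); rewrite mulrBl -e2; ring.
  rewrite Gauss_dvdzl; first by rewrite dvdzE absz_nat.
  by rewrite coprimezE coprime_sym; exact: coprime_num_den.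
have E : (q * `|denq c|)%:R * a = ((q * `|denq c| * m)%N%:Z - q%:Z * numq c)%:~R.
  have cR : ratr c * `|denq c|%:R = (numq c)%:~R :> R.
    have := congr1 (ratr : {rmorphism rat -> R}) cE.
    by rewrite (rmorphM (ratr : {rmorphism rat -> R})) /= !ratr_int {1}dE.
  have e3 : (((q * `|denq c| * m)%N%:Z - q%:Z * numq c)%:~R : R) = (q * `|denq c| * m)%:R - q%:R * (numq c)%:~R.
    by first [rewrite intrB intrM | rewrite rmorphB rmorphM].
  by rewrite e3 -cR /a !natrM; ring.
have : 0 <= ((q * `|denq c| * m)%N%:Z - q%:Z * numq c).
  by rewrite -(ler0z R) -E mulr_ge0 ?ler0n.
rewrite E; move=> /gez0_abs <-; rewrite -pmulrn; exact: cis_nat.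
Qed.
End Zeta.

(** Since [k > 1], the point [z] differs from 1 and the factor [(1 - X)^n] does not vanish there. *)
Lemma poly_prod_root (F : fieldType) (P : {poly F}) n (I : finType) (d : I -> nat) (z : F) k :
  P * (1 - 'X) ^+ n = \prod_i (1 - 'X^(d i)) -> (1 < k)%N -> (forall j, (z ^+ j == 1) = (k %| j)%N) ->
  (P.[z] == 0) = [exists i, (k %| d i)%N].
Proof.
move=> e k1 hz; have z1 : 1 - z != 0.
  by rewrite subr_eq0 eq_sym -[z]expr1 hz dvdn1 gtn_eqF.
have h1 : (1 - 'X : {poly F}).[z] = 1 - z by rewrite -polyC1 hornerD hornerN hornerC hornerX.
have h2 j : (1 - 'X^j : {poly F}).[z] = 1 - z ^+ j by rewrite -polyC1 hornerD hornerN hornerC hornerXn.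
have := congr1 (fun p => p.[z]) e; rewrite hornerM horner_exp h1 horner_prod => h.
have -> : (P.[z] == 0) = (\prod_i (1 - 'X^(d i)).[z] == 0).
  by rewrite -h mulf_eq0 expf_eq0 (negbTE z1) andbF orbF.
apply/idP/idP.
  rewrite prodf_seq_eq0 => /hasP[i _ /=]; rewrite h2 subr_eq0 eq_sym hz => hi.
  by apply/existsP; exists i.
move=> /existsP[i hi]; rewrite prodf_seq_eq0; apply/hasP; exists i; first exact: mem_index_enum.
by rewrite /= h2 subr_eq0 eq_sym hz.
Qed.

Section Deg.
Variables (R : realType) (gT : finGroupType) (n : nat).
Variable rho : mx_representation R [set: gT] n.
Hypothesis faith : mx_faithful rho.
Variables (al : gT -> 'rV[R]_n) (v0 : 'cV[R]_n).
Local Notation refl := (is_reflection rho).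
Local Notation sp := (sp rho).
Local Notation coroot := (coroot rho).
Hypothesis hal : forall s, refl s ->
  [/\ rho s = 1%:M - coroot (al s) *m al s, sp (al s) (al s) = 2 & 0 < (al s *m v0) 0 0].
Local Notation C := R[i].

Lemma poincare_root (G : {group gT}) m (f : m.-tuple {mpoly C[n]}) d (z : C) k : free_gens rho G f d ->
  refl_group rho G -> (1 < k)%N -> (forall j, (z ^+ j == 1) = (k %| j)%N) ->
  ((poincare rho al v0 C G).[z] == 0) = [exists i, (k %| d i)%N].
Proof.
by move=> hf rG; exact: (poly_prod_root (poincare_degrees faith hal hf rG)).
Qed.

(** Failure of [Div] carries information only once free generators exist; Chevalley's theorem
    supplies them. *)
Lemma Div_gens (P : {set gT}) (G : {group gT}) k : P = G -> refl_group rho G -> (0 < k)%N ->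
  exists f : n.-tuple {mpoly C[n]}, exists d, free_gens rho G f d /\ ([exists i, (k %| d i)%N] -> Div rho P k).
Proof.
move=> PG rG k0; have [m [f [d hf]]] := chevalley faith hal rG.
have mn := gens_card faith hal hf rG; subst m.
exists f, d; split=> // /existsP[i hi]; split=> //; exists f, d; split; last by exists i.
case: hf => h1 h2 h3 h4; split; [exact: h1| | |exact: h4].
  by move=> j; exact: (proj2 (invariantE rho _ PG) (h2 j)).
by move=> p hp; exact: (h3 p (proj1 (invariantE rho p PG) hp)).
Qed.

Lemma Div_free (P : {set gT}) (G : {group gT}) k : P = G -> Div rho P k ->
  exists f : n.-tuple {mpoly C[n]}, exists d, free_gens rho G f d /\ [exists i, (k %| d i)%N].
Proof.
move=> PG [_ [f [d [[h1 h2 h3 h4] [i hi]]]]]; exists f, d; split; last by apply/existsP; exists i.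
split; [exact: h1| | |exact: h4].
  by move=> j; exact: (proj1 (invariantE rho _ PG) (h2 j)).
by move=> p hp; exact: (h3 p (proj2 (invariantE rho p PG) hp)).
Qed.
End Deg.
End Fin1.

(** * Assembling the theorem *)

Module Fin2.
From HB Require Import structures.
From mathcomp Require Import boolp reals complex mpoly.
From mathcomp Require Import exp trigo.
From mathcomp Require Import ring lra.
Set Implicit Arguments.
Unset Strict Implicit.
Unset Printing Implicit Defensive.
Import Order.TTheory GRing.Theory Num.Theory ComplexField.
Local Open Scope ring_scope.
Local Open Scope complex_scope.
Require Import Defs.
Import Cpow Cpow2 Ulim Mu Mu2 Mu3 Tame PosSeries Pos2 Pos3 Weight Bd.
Import Cpow PolyAct Root Cox Cox2 Cox3 Delta Hilb Chev1 Chev2 Dunkl AB AB2 AB3 Loc PartM Fin1.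

Theorem main (R : realType) (gT : finGroupType) (n : nat)
    (rho : mx_representation R [set: gT] n)
    (hW : real_reflection_group rho)
    (alpha : gT -> 'rV[R[i]]_n) (alphav : gT -> 'cV[R[i]]_n)
    (halpha : root_vectors rho alpha alphav)
    (c : rat) (hc : 0 < c) (hcusp : cuspidal rho `|denq c|%N)
    (L : lmodType (cherednik rho (ratr c) alpha alphav))
    (hL : irreducible_quotient (polyrep rho (ratr c) alpha alphav) L) :
  finite_dimensional_over (cherednik_scalar rho (ratr c) alpha alphav) L.
Proof.
have [faith gen nofix] := hW.
have [al [v0 hal]] := root_system rho.
have rT : refl_group rho [set: gT]%G.
  rewrite /refl_group.
  have -> : [set s | TH rho [set: gT]%G s] = [set s | is_reflection rho s].
    by apply/setP => s; rewrite !inE /TH inE andbT.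
  by rewrite gen.
pose d := `|denq c|%N.
have d0 : (0 < d)%N by rewrite absz_gt0 denq_neq0.
pose cR : R := ratr c.
have c0 : 0 < cR by rewrite ltr0q.
have cC : ratr c = cR%:C :> R[i] by exact: (esym (fmorph_rat (real_complex R) c)).
pose m := (Num.bound cR).+1; pose z : R[i] := cis (2 * ((m%:R - cR) * pi)).
have mc : c <= m%:R.
  rewrite -(ler_rat R) ratr_nat; apply: ltW.
  by apply: lt_trans (archi_boundP (ltW c0)) _; rewrite ltr_nat.
have zp k : (z ^+ k == 1) = (d %| k)%N by exact: (zeta_pow R mc k).
have [hT hpar] := hcusp.
(* Cuspidality speaks of complex points; a real point keeps its stabiliser after
   complexification. *)
have par (G : {group gT}) (x : 'cV[R]_n) : refl_group rho G ->
    (forall g, (g \in G) = (rho g *m x == x)) -> G != [set: gT] :> {set gT} ->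
    exists f : n.-tuple {mpoly R[i][n]}, exists dg, free_gens rho G f dg /\ ~~ [exists i, (d %| dg i)%N].
  move=> rG GE GT; pose y := map_mx (real_complex R) x.
  have PG : stab rho y = G.
    apply/setP => g; rewrite inE GE /act_h /y.
    have -> : rhoC rho g *m map_mx (real_complex R) x = map_mx (real_complex R) (rho g *m x).
      by rewrite (map_mxM (real_complex R)).
    apply/eqP/eqP => [/matrixP h|-> //]; apply/matrixP => i j.
    by have := h i j; rewrite [LHS]mxE [RHS]mxE => /complexI.
  have [f [dg [hf hD]]] := Div_gens faith hal PG rG d0.
  exists f, dg; split; first exact: hf.
  apply/negP => /hD; apply: hpar; first by exists y.
  by rewrite PG properT.
(* The number 1 divides every degree, and the trivial group is the stabiliser of the generic point
   [v0]. It is a proper subgroup because there are no fixed vectors and a degree index shows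
   [n > 0]. So 1 is not cuspidal. *)
have d1 : (1 < d)%N.
  rewrite ltn_neqAle d0 andbT; apply/eqP => e1.
  have [_ [_ [_ [_ [i _]]]]] := hT.
  have GE g : (g \in (1%G : {group gT})) = (rho g *m v0 == v0).
    apply/idP/eqP => [/set1P ->|e]; first by rewrite rho1 mul1mx.
    have := stab_gen faith hal rT (in_setT g) e.
    have -> : [set s | TH rho [set: gT]%G s & root al s v0 == 0] = set0.
      apply/setP => s; rewrite !inE; apply/negbTE; apply/negP => /andP[/andP[hs _] /eqP r0].
      by have := root_v0 hal hs; rewrite r0 ltxx.
    move=> h; have h2 : g \in <<(set0 : {set gT})>>%g by exact: h.
    by move: h2; rewrite gen0.
  have GT : (1%G : {group gT}) != [set: gT] :> {set gT}.
    apply/eqP => e; have : delta_mx i 0 = 0 :> 'cV[R]_n.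
      apply: nofix => g; have g1 : g = 1%g.
        have h : g \in [set: gT] by rewrite inE.
        by move: h; rewrite -e => /set1P.
      by rewrite g1 rho1 mul1mx.
    by move/matrixP/(_ i 0); rewrite !mxE !eqxx /= => /eqP; rewrite oner_eq0.
  have [f' [dg' [_ /negP H]]] := par 1%G v0 (sub1G _) GE GT.
  by apply: H; apply/existsP; exists i; rewrite -e1 dvd1n.
have pT : (poincare rho al v0 R[i] [set: gT]%G).[z] = 0.
  have [f [dg [hf hd]]] := Div_free (G := [set: gT]%G) (erefl _) hT.
  by apply/eqP; rewrite (poincare_root faith hal hf rT d1 zp).
have pG (G : {group gT}) (x : 'cV[R]_n) : refl_group rho G ->
    (forall g, (g \in G) = (rho g *m x == x)) -> G != [set: gT] :> {set gT} ->
    (poincare rho al v0 R[i] G).[z] != 0.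
  move=> rG GE GT; have [f [dg [hf hd]]] := par G x rG GE GT.
  by rewrite (poincare_root faith hal hf rG d1 zp).
have [v [v0' vW vY]] := vacuum_ex hL.
have [irr _] := hL.
pose io := PartM.iota rho alpha alphav (ratr c).
pose px := PX rho alpha alphav (ratr c).
have sJ : stable rho al [set: gT]%G (ratr c) (J io px v).
  apply: (J_stable faith hal (PW := PW rho alpha alphav (ratr c)) (PY := PY rho alpha alphav (ratr c)));
  [exact: iota_comm|exact: iotaD|exact: iotaM|exact: iota0|exact: iota1|exact: PXlin|exact: PWX|exact: PXX|
   exact: (PYX faith hal _ halpha)|exact: vW|exact: vY].
have J1 : ~ J io px v 1.
  by apply: J_proper; [exact: iota0|exact: iota1|exact: v0'].
have Jmax K p : stable rho al [set: gT]%G (ratr c) K -> ~ K 1 -> K p -> J io px v p.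
  move=> sK K1 Kp.
  apply: (J_max faith hal (PW := PW rho alpha alphav (ratr c)) (PY := PY rho alpha alphav (ratr c)) _ _ _ _ _ _ _ _ _ _ _ _ _ _ sK K1 Kp);
  [exact: iota_comm|exact: iotaD|exact: iotaM|exact: iota0|exact: iota1|exact: PXlin|exact: PWX|exact: PXX|
   exact: (PYX faith hal _ halpha)|move=> Q; exact: gen_ind|exact: vW|exact: vY|exact: irr|exact: v0'].
(* The kernel contains every proper stable ideal, in particular the nonzero one produced by the
   vanishing of the length polynomial. *)
have J0 : exists2 f, f != 0 & J io px v f.
  have [K [sK K1 [f f0 Kf]]] := stable_ideal_ex faith hal c0 pT.
  by exists f => //; apply: (Jmax K) => //; rewrite cC.
have zeroB (G : {group gT}) (x : 'cV[R]_n) : refl_group rho G ->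
    (forall g, (g \in G) = (rho g *m x == x)) -> G != [set: gT] :> {set gT} ->
    forall K f, stable rho al G (ratr c) K -> ~ K 1 -> K f -> f = 0.
  move=> rG GE GT K f sK K1 Kf; rewrite cC in sK.
  exact: (stable_ideal_zero faith hal c0 (pG G x rG GE GT) sK K1 Kf).
have [N hN] := var_nilp faith hal sJ J1 J0 zeroB rT nofix.
suff : exists k (e : 'I_k -> L), forall w, exists a : 'I_k -> R[i], w = \sum_(i < k) io (a i) *: e i by [].
apply: (finite_dim faith hal (PW := PW rho alpha alphav (ratr c)) (PY := PY rho alpha alphav (ratr c)) _ _ _ _ _ _ _ _ _ _ _ _ _ _ hN);
  [exact: iota_comm|exact: iotaD|exact: iotaM|exact: iota0|exact: iota1|exact: PXlin|exact: PWX|exact: PXX|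
   exact: (PYX faith hal _ halpha)|move=> Q; exact: gen_ind|exact: vW|exact: vY|exact: irr|exact: v0'].
Qed.
End Fin2.

Theorem corollary3p27 (R : realType) (gT : finGroupType) (n : nat)
    (rho : mx_representation R [set: gT] n)
    (hW : real_reflection_group rho)
    (alpha : gT -> 'rV[R[i]]_n) (alphav : gT -> 'cV[R[i]]_n)
    (halpha : root_vectors rho alpha alphav)
    (c : rat) (hc : 0 < c) (hcusp : cuspidal rho `|denq c|%N)
    (L : lmodType (cherednik rho (ratr c) alpha alphav))
    (hL : irreducible_quotient (polyrep rho (ratr c) alpha alphav) L) :
  finite_dimensional_over (cherednik_scalar rho (ratr c) alpha alphav) L.
Proof. exact: (Fin2.main hW halpha hc hcusp hL). Qed.
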